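(* There is an FPTAS for the number of proper $q$-vertex-colourings of any finite subgraph of each of the following lattice graphs: the $\mathbb{Z}^2$ lattice if $q\geq 6$; the $\mathbb{Z}^3$ lattice if $q\geq 10$; the triangular lattice if $q\geq 10$; the honeycomb lattice if $q\geq 5$; the Kagome lattice if $q\geq 5$.
   Context: A proper $q$-colouring of a graph assigns colours from $[q]$ to vertices so that adjacent vertices receive distinct colours. An FPTAS is a deterministic algorithm which, given a finite graph with $n$ vertices and $\varepsilon\in(0,1)$, outputs a number within a factor $1\pm\varepsilon$ of the count in time polynomial in $n$ and $1/\varepsilon$. *)

(* Defs.v *)
From HB Require Import structures.
From mathcomp Require Import all_boot all_order all_algebra.

Set Implicit Arguments.
Unset Strict Implicit.
Unset Printing Implicit Defensive.

Import Order.TTheory GRing.Theory Num.Theory.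

Record graph := Graph {
  order : nat;
  adj : rel 'I_order;
  adj_sym : symmetric adj;
  adj_irr : irreflexive adj }.

Definition proper_colouring (q : nat) (G : graph)
    (c : {ffun 'I_(order G) -> 'I_q}) : bool :=
  [forall x, forall y, adj x y ==> (c x != c y)].

Definition num_colourings (q : nat) (G : graph) : nat :=
  #|[set c : {ffun 'I_(order G) -> 'I_q} | proper_colouring c]|.

(* G is isomorphic to a (not necessarily induced) subgraph of L. *)
Definition subgraph_of (T : Type) (L : rel T) (G : graph) : Prop :=
  exists2 f : 'I_(order G) -> T,
    injective f & forall x y, adj x y -> L (f x) (f y).

Section Lattices.
Local Open Scope ring_scope.

Definition Z2_lattice : rel (int * int) := fun u v =>
  `|u.1 - v.1| + `|u.2 - v.2| == 1.

Definition Z3_lattice : rel (int * int * int) := fun u v =>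
  `|u.1.1 - v.1.1| + `|u.1.2 - v.1.2| + `|u.2 - v.2| == 1.

(* (x, y) stands for the point x * (1, 0) + y * (1/2, sqrt 3 / 2): the six
   shortest vectors are +-(1, 0), +-(0, 1) and +-(1, -1). *)
Definition triangular_lattice : rel (int * int) := fun u v =>
  (v.1 - u.1, v.2 - u.2) \in
    [:: (1, 0); (-1, 0); (0, 1); (0, -1); (1, -1); (-1, 1)].

(* (x, y, b) is the vertex of class b in the cell (x, y); a vertex of class
   false is joined to the vertices of class true in three cells. *)
Definition honeycomb_lattice : rel (int * int * bool) := fun u v =>
  let nbr (a b : int * int * bool) :=
    [&& ~~ a.2, b.2 &
        (a.1.1 - b.1.1, a.1.2 - b.1.2) \in [:: (0, 0); (1, 0); (0, 1)]] in
  nbr u v || nbr v u.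

(* The triangular lattice with the points having two even coordinates
   deleted. *)
Definition kagome_vertex : Type :=
  {u : int * int | ~~ ((2 %| u.1)%Z && (2 %| u.2)%Z)}.

Definition kagome_lattice : rel kagome_vertex := fun u v =>
  triangular_lattice (sval u) (sval v).

End Lattices.

(* Model of computation: the WHILE language of N. D. Jones, "Computability and
   Complexity: From a Programming Perspective" (MIT Press, 1997). Data are
   binary trees, and each elementary operation costs one time unit. Subtrees
   can be shared and only the test against Leaf is available, so this time
   measure is polynomially related to that of Turing machines. *)
Inductive tree := Leaf | Node of tree & tree.

Inductive expr :=
  | EVar of nat
  | ELeaf
  | ENode of expr & expr
  | EFst of expr
  | ESnd of expr.

Inductive cmd :=
  | Assign of nat & expr
  | Seq of cmd & cmd
  | If of expr & cmd & cmd
  | While of expr & cmd.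

Definition store := nat -> tree.

Definition update (s : store) (x : nat) (t : tree) : store :=
  fun y => if y == x then t else s y.

Fixpoint eval (s : store) (E : expr) : tree :=
  match E with
  | EVar x => s x
  | ELeaf => Leaf
  | ENode E1 E2 => Node (eval s E1) (eval s E2)
  | EFst E1 => if eval s E1 is Node t _ then t else Leaf
  | ESnd E1 => if eval s E1 is Node _ t then t else Leaf
  end.

Fixpoint cost (E : expr) : nat :=
  match E with
  | EVar _ | ELeaf => 1
  | ENode E1 E2 => (cost E1 + cost E2).+1
  | EFst E1 | ESnd E1 => (cost E1).+1
  end.

Definition truthy (t : tree) : bool := if t is Node _ _ then true else false.

(* exec c s k s': started in the store s, c halts after k time units in s'. *)
Inductive exec : cmd -> store -> nat -> store -> Prop :=
  | exec_assign s x E :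
      exec (Assign x E) s (cost E).+1 (update s x (eval s E))
  | exec_seq s1 s2 s3 c1 c2 k1 k2 :
      exec c1 s1 k1 s2 -> exec c2 s2 k2 s3 ->
      exec (Seq c1 c2) s1 (k1 + k2).+1 s3
  | exec_if s s' E c1 c2 k :
      exec (if truthy (eval s E) then c1 else c2) s k s' ->
      exec (If E c1 c2) s (cost E + k).+1 s'
  | exec_while_done s E c :
      ~~ truthy (eval s E) -> exec (While E c) s (cost E).+1 s
  | exec_while_step s1 s2 s3 E c k1 k2 :
      truthy (eval s1 E) -> exec c s1 k1 s2 -> exec (While E c) s2 k2 s3 ->
      exec (While E c) s1 (cost E + k1 + k2).+1 s3.

Definition computes (p : cmd) (input : tree) (k : nat) (output : tree) : Prop :=
  exists2 s, exec p (update (fun=> Leaf) 0 input) k s & s 0 = output.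

Definition tree_of_bool (b : bool) : tree := if b then Node Leaf Leaf else Leaf.

Definition tree_of_seq : seq tree -> tree := foldr Node Leaf.

Definition tree_of_graph (G : graph) : tree :=
  tree_of_seq [seq tree_of_seq [seq tree_of_bool (adj x y)
    | y <- enum 'I_(order G)] | x <- enum 'I_(order G)].

Definition binary_digit (a i : nat) : bool := odd (a %/ 2 ^ i).

(* The fraction a / b, with both numbers in binary, most significant digit
   first, and padded to a common length: the list of the pairs (digit of a,
   digit of b). With this aligned layout log(1 / (a / b)) steps suffice to read
   off a lower bound for a / b up to a constant factor, however long a and b
   are, so that a running time polynomial in 1 / (a / b) only is meaningful. *)
Definition tree_of_fraction (a b : nat) : tree :=
  tree_of_seq
    [seq Node (tree_of_bool (binary_digit a i)) (tree_of_bool (binary_digit b i))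
    | i <- rev (iota 0 (up_log 2 (maxn a b).+1))].

Definition represents (t : tree) (x : rat) : Prop :=
  exists a b : nat,
    [/\ 0 < b, x = (a%:R / b%:R)%R & t = tree_of_fraction a b].

(* As 1 / eps > 1, the bounds K * (n + 1 / eps) ^ d dominate all polynomials in n
   and 1 / eps. *)
Definition has_FPTAS (C : graph -> Prop) (Z : graph -> nat) : Prop :=
  exists (p : cmd) (K d : nat),
    forall (G : graph) (eps : rat) (t : tree),
      C G -> (0 < eps < 1)%R -> represents t eps ->
      exists (k : nat) (out : tree) (x : rat),
        [/\ computes p (Node (tree_of_graph G) t) k out,
            (k%:R <= K%:R * ((order G)%:R + eps^-1) ^+ d :> rat)%R,
            represents out x
          & ((1 - eps) * (Z G)%:R <= x <= (1 + eps) * (Z G)%:R)%R].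

(* Main.v *)
Require Import Defs.
From mathcomp Require Import all_boot all_order all_algebra.
From mathcomp Require Import zify ring lra.

(** Counting reduces to marginals: the number of colourings is the product, over
    the vertices taken in turn, of the inverse probability that a vertex receives
    a chosen colour given the colours already pinned.  Such a marginal is a ratio
    of sums, over the colourings of a sphere of constant radius r, of weights
    that depend on the enclosed ball only and of the marginal of the sphere
    colouring itself; revealing the sphere vertex by vertex expresses the latter
    through marginals of the same kind.  Strong spatial mixing makes each
    evaluation halve the error of its inputs, so that a logarithmic depth
    suffices and the tree of recursive calls has polynomial size.

    Strong spatial mixing is shown by induction on the graph: the influence of
    recolouring s on a distant vertex is bounded by a potential which sums over
    the neighbours of s weights depending on the size of their colour lists, and
    exposing the neighbours one at a time contracts this potential.  For Kagome
    subgraphs the potential is taken per triangle, that is, jointly over the two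
    other corners of a triangle at s.

    Programs are obtained by showing that the functions on trees computable in
    time polynomial in a unary clock are closed under the constructions needed;
    the clock is a power of (n + 2) 2^j, where 2^-j is the leading digit of the
    accuracy. *)

Set Implicit Arguments.
Unset Strict Implicit.
Unset Printing Implicit Defensive.

Module Colourings.
Import Order.TTheory GRing.Theory Num.Theory.
Local Open Scope ring_scope.

Section ListColourings.
Variables (V C : finType) (c0 : C) (e : rel V).
Hypotheses (e_sym : symmetric e) (e_irr : irreflexive e).
Implicit Types (H A B Q : {set V}) (L M : V -> {set C}) (c : {ffun V -> C}).
Implicit Types (f g : {ffun V -> C} -> rat).

(* A colouring of the subgraph induced by H is represented by the function on V
   with the value c0 outside H. *)
Definition list_colouring H L c : bool :=
  [forall v, if v \in H then c v \in L v else c v == c0] &&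
  [forall v in H, forall w in H, e v w ==> (c v != c w)].

Lemma list_colouringP H L c :
  reflect [/\ forall v, v \in H -> c v \in L v,
              forall v, v \notin H -> c v = c0
            & forall v w, v \in H -> w \in H -> e v w -> c v != c w]
    (list_colouring H L c).
Proof.
apply: (iffP andP) => [[/forallP lists /forall_inP proper]|[in_list outside proper]].
  split=> [v vH|v vH|v w vH wH evw].
  - by have := lists v; rewrite vH.
  - by have := lists v; rewrite (negPf vH) => /eqP.
  - by have /forall_inP/(_ w wH)/implyP/(_ evw) := proper v vH.
split; first by apply/forallP=> v; case: ifP => [/in_list|/negbT/outside/eqP].
apply/forall_inP=> v vH; apply/forall_inP=> w wH; apply/implyP; exact: proper.
Qed.

Definition colouring_sum H L f : rat := \sum_(c | list_colouring H L c) f c.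
Local Notation csum := colouring_sum.

Definition num_list_colourings H L : rat := csum H L (fun=> 1).
Local Notation ncol := num_list_colourings.

Definition recolour c v a : {ffun V -> C} := [ffun w => if w == v then a else c w].

Lemma recolourE c v a : recolour c v a v = a.
Proof. by rewrite ffunE eqxx. Qed.

Lemma recolour_neq c v a w : w != v -> recolour c v a w = c w.
Proof. by rewrite ffunE => /negPf->. Qed.

Lemma recolourK c v a b : recolour (recolour c v a) v b = recolour c v b.
Proof. by apply/ffunP=> w; rewrite !ffunE; case: eqP. Qed.

Lemma recolour_id c v : recolour c v (c v) = c.
Proof. by apply/ffunP=> w; rewrite ffunE; case: eqP => // ->. Qed.

Definition forbid L Q (a : C) : V -> {set C} :=
  fun w => if w \in Q then L w :\ a else L w.

Lemma forbid_in L Q a w : w \in Q -> forbid L Q a w = L w :\ a.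
Proof. by rewrite /forbid => ->. Qed.

Lemma forbid_notin L Q a w : w \notin Q -> forbid L Q a w = L w.
Proof. by rewrite /forbid => /negPf->. Qed.

Lemma card_forbid L Q a w : (#|L w| <= #|forbid L Q a w| + (w \in Q))%N.
Proof.
rewrite /forbid; case: (w \in Q); last by rewrite addn0.
by rewrite (cardsD1 a (L w)) addnC leq_add2l leq_b1.
Qed.

Lemma forbid_sub L Q a w : forbid L Q a w \subset L w.
Proof. by rewrite /forbid; case: ifP => // _; rewrite subD1set. Qed.

Lemma forbid_comm L Q Q' a a' w :
  forbid (forbid L Q a) Q' a' w = forbid (forbid L Q' a') Q a w.
Proof.
rewrite /forbid; case: (w \in Q'); case: (w \in Q) => //.
by rewrite !setDDl setUC.
Qed.

Definition neighbours (v : V) : {set V} := [set w | e v w].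
Local Notation nbr := neighbours.

Lemma list_colouringD1 H L c v : v \in H ->
  list_colouring H L c =
  (c v \in L v) &&
    list_colouring (H :\ v) (forbid L (nbr v) (c v)) (recolour c v c0).
Proof.
move=> vH; apply/list_colouringP/andP => [[in_list outside proper]|].
  split; first exact: in_list.
  apply/list_colouringP; split=> [w /setD1P[wv wH]|w|w w'].
  - rewrite recolour_neq // /forbid inE; case: ifP => [evw|_]; last exact: in_list.
    by rewrite !inE in_list // eq_sym proper.
  - rewrite !inE ffunE; case: eqVneq => //= _; exact: outside.
  - by move=> /setD1P[wv wH] /setD1P[w'v w'H]; rewrite !recolour_neq //; exact: proper.
case=> cvL /list_colouringP[in_list outside proper].
have colour_ok w : w != v -> w \in H -> (c w \in L w) && (e v w ==> (c w != c v)).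
  move=> wv wH; have := in_list w; rewrite recolour_neq // !inE wv => /(_ wH).
  by rewrite /forbid inE; case: ifP => _; [rewrite !inE => /andP[-> ->]|move=> ->].
split=> [w wH|w wH|w w' wH w'H ew].
- by have [->//|wv] := eqVneq w v; case/andP: (colour_ok w wv wH).
- have wv : w != v by apply: contraNneq wH => ->.
  by have := outside w; rewrite recolour_neq // !inE wv; apply.
have [wv|wv] := eqVneq w v; have [w'v|w'v] := eqVneq w' v.
- by rewrite wv w'v e_irr in ew.
- by have /andP[_ /implyP] := colour_ok w' w'v w'H; rewrite wv eq_sym -wv; apply.
- by have /andP[_ /implyP] := colour_ok w wv wH; rewrite w'v -w'v e_sym; apply.
- by have := proper w w'; rewrite !recolour_neq // !inE wv w'v; apply.
Qed.

Lemma eq_csum H L M f g :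
  (forall v, v \in H -> L v = M v) ->
  (forall c, list_colouring H L c -> f c = g c) -> csum H L f = csum H M g.
Proof.
move=> eqL eqf; have eq_good : list_colouring H L =1 list_colouring H M.
  move=> c; congr (_ && _).
  by apply: eq_forallb => v; case: ifP => // vH; rewrite eqL.
by rewrite /csum -(eq_bigl _ _ eq_good); apply: eq_bigr.
Qed.

Lemma eq_csum_lists H L M f :
  (forall v, v \in H -> L v = M v) -> csum H L f = csum H M f.
Proof. by move=> eqL; apply: eq_csum. Qed.

Lemma eq_csum_fun H L f g : f =1 g -> csum H L f = csum H L g.
Proof. by move=> eqf; apply: eq_csum. Qed.

Lemma eq_ncol H L M : (forall v, v \in H -> L v = M v) -> ncol H L = ncol H M.
Proof. exact: eq_csum_lists. Qed.

Lemma csumD1 H L f v : v \in H ->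
  csum H L f =
  \sum_(a in L v) csum (H :\ v) (forbid L (nbr v) a) (fun c => f (recolour c v a)).
Proof.
move=> vH; rewrite /csum.
rewrite (partition_big (fun c : {ffun V -> C} => c v) (mem (L v))) /=; last first.
  by move=> c /list_colouringP[in_list _ _]; exact: in_list.
apply: eq_bigr => a aL.
rewrite (reindex_onto (fun c => recolour c v a) (fun c => recolour c v c0)) /=.
  apply: eq_bigl => c; rewrite (list_colouringD1 _ _ vH) recolourE recolourK eqxx.
  rewrite aL andbT; apply/andP/idP => [[+ /eqP rec_c]|cH]; first by rewrite rec_c.
  suff rec_c : recolour c v c0 = c by rewrite rec_c.
  have /list_colouringP[_ outside _] := cH.
  by rewrite -[RHS](recolour_id _ v) outside // !inE eqxx.
by move=> c /andP[_ /eqP <-]; rewrite recolourK recolour_id.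
Qed.

Lemma ncolD1 H L v : v \in H ->
  ncol H L = \sum_(a in L v) ncol (H :\ v) (forbid L (nbr v) a).
Proof. exact: csumD1. Qed.

Lemma csum_set0 L f : csum set0 L f = f [ffun => c0].
Proof.
rewrite /csum (big_pred1 [ffun=> c0]) // => c /=.
apply/list_colouringP/eqP => [[_ outside _]|->].
  by apply/ffunP=> v; rewrite ffunE outside ?inE.
by split=> [v|v _|v w]; rewrite ?inE ?ffunE.
Qed.

Lemma ncol_set0 L : ncol set0 L = 1.
Proof. exact: csum_set0. Qed.

Lemma csum_set1 v L f :
  csum [set v] L f = \sum_(a in L v) f (recolour [ffun=> c0] v a).
Proof.
by rewrite (csumD1 _ _ (set11 v)) setDv; apply: eq_bigr => a _; rewrite csum_set0.
Qed.

Lemma ncol_set1 v L : ncol [set v] L = #|L v|%:R.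
Proof. by rewrite /ncol csum_set1 sumr_const. Qed.

Lemma csumD H L f g : csum H L (fun c => f c + g c) = csum H L f + csum H L g.
Proof. by rewrite /csum big_split. Qed.

Lemma csumZ H L k f : csum H L (fun c => k * f c) = k * csum H L f.
Proof. by rewrite /csum big_distrr. Qed.

Lemma csumN H L f : csum H L (fun c => - f c) = - csum H L f.
Proof. by rewrite /csum sumrN. Qed.

Lemma csumB H L f g : csum H L (fun c => f c - g c) = csum H L f - csum H L g.
Proof. by rewrite csumD csumN. Qed.

Lemma csum_const H L (k : rat) : csum H L (fun=> k) = k * ncol H L.
Proof. by rewrite -csumZ; apply: eq_csum_fun => c; rewrite mulr1. Qed.

Lemma exchange_csum (J : finType) (P : pred J) (F : J -> {ffun V -> C} -> rat) H L :
  csum H L (fun c => \sum_(j | P j) F j c) = \sum_(j | P j) csum H L (F j).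
Proof. by rewrite /csum exchange_big. Qed.

Lemma csum_ge0 H L f : (forall c, 0 <= f c) -> 0 <= csum H L f.
Proof. by move=> f_ge0; apply: sumr_ge0. Qed.

Lemma ler_csum H L f g : (forall c, list_colouring H L c -> f c <= g c) ->
  csum H L f <= csum H L g.
Proof. by move=> le_fg; apply: ler_sum. Qed.

Lemma ncol_ge0 H L : 0 <= ncol H L.
Proof. by apply: csum_ge0 => ?; apply: ler01. Qed.

Definition degree_in H v := #|[set w in H | e v w]|.
Local Notation edeg := degree_in.

Lemma degree_inD1 H v w : v \in H -> edeg H w = (e w v + edeg (H :\ v) w)%N.
Proof.
move=> vH; rewrite /edeg (cardsD1 v) !inE vH /=; congr (_ + _)%N.
by apply: eq_card => x; rewrite !inE andbA.
Qed.

Lemma degree_inS A H v : A \subset H -> (edeg A v <= edeg H v)%N.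
Proof.
move=> /subsetP AH; apply: subset_leq_card; apply/subsetP=> w.
by rewrite !inE => /andP[/AH-> ->].
Qed.

Lemma card_neighbours_in H v : #|H :&: nbr v| = edeg H v.
Proof. by apply: eq_card => w; rewrite !inE. Qed.

Lemma forbid_neighbours_slack H L v a w : v \in H ->
  (#|L w| + edeg (H :\ v) w <= #|forbid L (nbr v) a w| + edeg H w)%N.
Proof.
move=> vH; rewrite (degree_inD1 w vH); have := card_forbid L (nbr v) a w.
by rewrite inE (e_sym v w); lia.
Qed.

Lemma ncol_gt0 H L : (forall v, v \in H -> (edeg H v < #|L v|)%N) -> 0 < ncol H L.
Proof.
have [n] := ubnP #|H|; elim: n => // n IHn in H L * => ltHn deg_lt.
have [->|/set0Pn[v vH]] := eqVneq H set0; first by rewrite ncol_set0.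
have /card_gt0P[a aL] : (0 < #|L v|)%N by apply: leq_ltn_trans (deg_lt v vH).
rewrite (ncolD1 _ vH) (bigD1 a) //=; apply: ltr_wpDr.
  by apply: sumr_ge0 => b _; exact: ncol_ge0.
apply: IHn => [|w /setD1P[_ wH]]; first by move: ltHn; rewrite (cardsD1 v) vH.
by have := deg_lt w wH; have := forbid_neighbours_slack L a w vH; lia.
Qed.

Definition depends_on A f :=
  forall c c' : {ffun V -> C}, {in A, c =1 c'} -> f c = f c'.

Lemma depends_on_recolour A f c v a :
  depends_on A f -> v \notin A -> f (recolour c v a) = f c.
Proof.
move=> f_on vA; apply: f_on => w wA; rewrite recolour_neq //.
by apply: contraNneq vA => <-.
Qed.

(* Colouring H outside A removes from the list of a vertex of A at most as many
   colours as it has neighbours there. *)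
Lemma csum_restrict_ge0 H L A f : A \subset H -> depends_on A f ->
  (forall M, (forall w, w \in A -> M w \subset L w /\
      (#|L w| <= #|M w| + edeg (H :\: A) w)%N) -> 0 <= csum A M f) ->
  0 <= csum H L f.
Proof.
have [n] := ubnP #|H :\: A|; elim: n => // n IHn in H L * => ltn AH f_on ge0_on_A.
have [/eqP|/set0Pn[v]] := eqVneq (H :\: A) set0.
  rewrite setD_eq0 => HA; have -> : H = A by apply/eqP; rewrite eqEsubset HA.
  by apply: ge0_on_A => w wA; split=> //; rewrite leq_addr.
move=> vHA; have /setDP[vH vA] := vHA.
rewrite (csumD1 _ _ vH); apply: sumr_ge0 => a aL.
rewrite (eq_csum_fun _ _ (g := f)) => [|c]; last exact: (depends_on_recolour _ _ f_on vA).
have swapD : (H :\ v) :\: A = (H :\: A) :\ v by rewrite !setDDl setUC.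
apply: IHn => [||//|M M_large].
- by move: ltn; rewrite swapD (cardsD1 v (H :\: A)) vHA.
- by rewrite subsetD1 AH.
apply: ge0_on_A => w wA; have [MwL cardMw] := M_large w wA; split.
  exact: subset_trans MwL (forbid_sub _ _ _ _).
have := forbid_neighbours_slack L a w vHA; move: cardMw; rewrite swapD; lia.
Qed.

Lemma csum_restrict_eq0 H L A f : A \subset H -> depends_on A f ->
  (forall w y, w \in A -> y \in H -> y \notin A -> ~~ e w y) ->
  csum A L f = 0 -> csum H L f = 0.
Proof.
move=> AH f_on separated f_eq0; apply/eqP; rewrite eq_le -oppr_ge0 -csumN.
have restrict_ge0 g : depends_on A g -> csum A L g = 0 -> 0 <= csum H L g.
  move=> g_on g_eq0; apply: (csum_restrict_ge0 AH g_on) => M M_large.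
  rewrite (eq_csum_lists _ (M := L)) ?g_eq0 // => w wA.
  have [MwL] := M_large w wA; rewrite (_ : edeg _ _ = 0%N) ?addn0.
    by move=> ?; apply/eqP; rewrite eqEcard MwL.
  apply/eqP; rewrite cards_eq0 -subset0; apply/subsetP=> y.
  by rewrite !inE -andbA => /and3P[yA yH]; apply/contraLR => _; exact: separated.
rewrite !restrict_ge0 //; last by rewrite csumN f_eq0 oppr0.
by move=> c c' eq_cc'; rewrite (f_on _ _ eq_cc').
Qed.

Definition avoid A (k : C) c : bool := [forall w in A, c w != k].

Definition avoidr A k c : rat := (avoid A k c)%:R.

Lemma avoid_set0 k c : avoid set0 k c.
Proof. by apply/forall_inP=> w; rewrite inE. Qed.

Lemma avoidU1 A v k c : avoid (v |: A) k c = (c v != k) && avoid A k c.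
Proof.
apply/forall_inP/andP => [av|[cv /forall_inP av] w].
  split; first by apply: av; rewrite setU11.
  by apply/forall_inP=> w wA; apply: av; rewrite setU1r.
by case/setU1P=> [->|/av].
Qed.

Lemma avoidS A B k c : A \subset B -> avoid B k c -> avoid A k c.
Proof.
by move=> /subsetP AB /forall_inP av; apply/forall_inP=> w /AB; exact: av.
Qed.

Lemma avoid_recolour A v k c a : avoid A k (recolour c v a) =
  ((v \in A) ==> (a != k)) && avoid (A :\ v) k c.
Proof.
apply/forall_inP/andP => [av|[/implyP av_v /forall_inP av] w wA].
  split; first by apply/implyP=> /av; rewrite recolourE.
  apply/forall_inP=> w /setD1P[wv wA].
  by have := av w wA; rewrite recolour_neq.
have [wv|wv] := eqVneq w v; first by rewrite wv recolourE av_v -?wv.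
by rewrite recolour_neq // av // !inE wv.
Qed.

Lemma avoidr_ge0 A k c : 0 <= avoidr A k c.
Proof. exact: ler0n. Qed.

Lemma avoidr_le1 A k c : avoidr A k c <= 1.
Proof. by rewrite /avoidr; case: avoid. Qed.

Lemma depends_on_avoidr A k : depends_on A (avoidr A k).
Proof.
move=> c c' eq_cc'; congr (nat_of_bool _)%:R.
by apply: eq_forallb => w; case wA: (w \in A) => //=; rewrite eq_cc'.
Qed.

Lemma csum_forbid H L Q k f :
  csum H (forbid L Q k) f = csum H L (fun c => f c * avoidr (H :&: Q) k c).
Proof.
rewrite /csum /avoidr.
rewrite (bigID (avoid (H :&: Q) k) (list_colouring H L)) /= [X in _ + X]big1; last first.
  by move=> c /andP[_ /negbTE ->]; rewrite mulr0.
rewrite addr0 (eq_bigl (fun c => list_colouring H L c && avoid (H :&: Q) k c)).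
  by apply: eq_bigr => c /andP[_ ->]; rewrite mulr1.
move=> c; apply/list_colouringP/andP => [[in_list outside proper]|].
  split; last first.
    apply/forall_inP=> w /setIP[wH wQ].
    by have := in_list w wH; rewrite forbid_in // => /setD1P[].
  apply/list_colouringP; split=> // v vH.
  exact: subsetP (forbid_sub L Q k v) _ (in_list v vH).
case=> /list_colouringP[in_list outside proper] /forall_inP av.
split=> // v vH; rewrite /forbid; case: ifP => vQ; last exact: in_list.
by rewrite !inE in_list // av // inE vH.
Qed.

Lemma ncol_forbid H L Q k : ncol H (forbid L Q k) = csum H L (avoidr (H :&: Q) k).
Proof. by rewrite /ncol csum_forbid; apply: eq_csum_fun => c; rewrite mul1r. Qed.

Lemma ncol_forbid_sub H L A k : A \subset H ->
  ncol H (forbid L A k) = csum H L (avoidr A k).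
Proof. by move=> /setIidPr {2}<-; exact: ncol_forbid. Qed.

Lemma csum_avoidr_ge0 H L A k : 0 <= csum H L (avoidr A k).
Proof. by apply: csum_ge0 => c; exact: avoidr_ge0. Qed.

Lemma csum_avoidr_le H L A k : csum H L (avoidr A k) <= ncol H L.
Proof. by apply: ler_csum => c _; exact: avoidr_le1. Qed.

Lemma csum_avoidr_set0 H L k : csum H L (avoidr set0 k) = ncol H L.
Proof. by apply: eq_csum_fun => c; rewrite /avoidr avoid_set0. Qed.

Definition has_colour (w : V) (z : C) : {ffun V -> C} -> rat := fun c => (c w == z)%:R.

Lemma has_colour_ge0 w z c : 0 <= has_colour w z c.
Proof. exact: ler0n. Qed.

Lemma has_colour_le1 w z c : has_colour w z c <= 1.
Proof. by rewrite /has_colour; case: eqP. Qed.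

Lemma has_colour_recolourE w z c a : has_colour w z (recolour c w a) = (a == z)%:R.
Proof. by rewrite /has_colour recolourE. Qed.

Lemma has_colour_recolour w z c v a : w != v ->
  has_colour w z (recolour c v a) = has_colour w z c.
Proof. by move=> wv; rewrite /has_colour recolour_neq. Qed.

Lemma csum_has_colour H L w z : w \in H -> csum H L (has_colour w z) =
  if z \in L w then ncol (H :\ w) (forbid L (nbr w) z) else 0.
Proof.
move=> wH; rewrite (csumD1 _ _ wH).
under eq_bigr do rewrite (eq_csum_fun _ _ (has_colour_recolourE _ _ ^~ _)) csum_const.
case: ifP => zL.
  rewrite (bigD1 z) //= eqxx mul1r big1 ?addr0 // => a /andP[_ /negPf->].
  by rewrite mul0r.
rewrite big1 // => a aL; case: eqP => [az|_]; last by rewrite mul0r.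
by rewrite -az aL in zL.
Qed.

Lemma csum_avoidr_D1 H L A v z : v \in A -> A \subset H ->
  csum H L (avoidr A z) = csum H L (avoidr (A :\ v) z) -
    csum H (forbid L (A :\ v) z) (has_colour v z).
Proof.
move=> vA AH; rewrite csum_forbid (setIidPr (subset_trans (subD1set _ _) AH)) -csumB.
apply: eq_csum_fun => c; rewrite -{1}(setD1K vA) /avoidr avoidU1 /has_colour.
by case: (_ == z); case: avoid => /=; rewrite ?mul0r ?mulr0 ?mulr1 ?subrr ?subr0.
Qed.

End ListColourings.

Definition independent (V : finType) (e : rel V) (I : {set V}) : bool :=
  [forall v in I, forall w in I, ~~ e v w].

Lemma independentP (V : finType) (e : rel V) (I : {set V}) :
  reflect {in I &, forall v w, ~~ e v w} (independent e I).
Proof.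
apply: (iffP forall_inP) => [indep v w vI wI|indep v vI].
  exact: (forall_inP (indep v vI)).
by apply/forall_inP=> w wI; exact: indep.
Qed.

Lemma sub_independent (V : finType) (e e' : rel V) (I J : {set V}) :
  subrel e e' -> I \subset J -> independent e' J -> independent e I.
Proof.
move=> ee' /subsetP IJ /independentP indep; apply/independentP=> v w /IJ vJ /IJ wJ.
by apply: contra (indep v w vJ wJ); exact: ee'.
Qed.

Lemma independent_card_le1 (V : finType) (e : rel V) (I : {set V}) :
  irreflexive e -> (#|I| <= 1)%N -> independent e I.
Proof.
move=> e_irr I1; apply/independentP=> v w vI wI.
by rewrite (card_le1_eqP I1 _ _ vI wI) e_irr.
Qed.

Lemma multiaffine_ge_vertices (R : realFieldType) (T : finType) (J : {set T})
    (p : T -> R) (b A0 B P X : R) :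
  (forall i, i \in J -> 0 <= p i <= b) ->
  (forall n, (n <= #|J|)%N -> A0 <= P * (1 - b) ^+ n + B * (X + n%:R * b)) ->
  A0 <= P * \prod_(i in J) (1 - p i) + B * (X + \sum_(i in J) p i).
Proof.
have [n] := ubnP #|J|; elim: n => // n IHn in J P X * => ltJn p_range ge_vertices.
have [->|/set0Pn[v vJ]] := eqVneq J set0.
  by rewrite !big_set0; have := ge_vertices 0%N isT; rewrite expr0 mul0r.
have cardJ := cardsD1 v J; rewrite vJ in cardJ.
have ltJv : (#|J :\ v| < n)%N by move: ltJn; rewrite cardJ.
have p_range' i : i \in J :\ v -> 0 <= p i <= b by case/setD1P=> _ /p_range.
have at0 := IHn (J :\ v) P X ltJv p_range'
  (fun k kJ => ge_vertices k (leq_trans kJ (subset_leq_card (subD1set _ _)))).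
have at_b : A0 <= P * (1 - b) * \prod_(i in J :\ v) (1 - p i) +
    B * (X + b + \sum_(i in J :\ v) p i).
  apply: IHn => // k kJ; have := ge_vertices k.+1; rewrite cardJ ltnS => /(_ kJ).
  by rewrite exprS -natr1 !mulrA mulrDl mul1r [k%:R * b + b]addrC [X + (b + _)]addrA.
rewrite (big_setD1 v vJ) /= [\sum_(i in J) _](big_setD1 v vJ) /=.
move: at0 at_b; set Pi := \prod_(i in _) _; set S := \sum_(i in _) _ => at0 at_b.
have /andP[pv_ge0 pv_le] := p_range v vJ.
(* An affine function of p v on [0, b] is minimal at an end point. *)
have -> : P * ((1 - p v) * Pi) + B * (X + (p v + S)) =
    P * Pi + B * (X + S) + p v * (B - P * Pi) by ring.
have [slope_ge0|slope_lt0] := lerP 0 (B - P * Pi).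
  by apply: le_trans at0 _; rewrite lerDl mulr_ge0.
apply: le_trans at_b _.
have -> : P * (1 - b) * Pi + B * (X + b + S) =
    P * Pi + B * (X + S) + b * (B - P * Pi) by ring.
by rewrite lerD2l ler_wnM2r // ltW.
Qed.

End Colourings.

Module ListBounds.
Import Colourings.
Import Order.TTheory GRing.Theory Num.Theory.
Local Open Scope ring_scope.

(* The line A0 - B0 t lies below (1 - 1/m)^(m t) at the points t = n / m. *)
Definition power_minorant (m i : nat) (A0 B0 : rat) :=
  [/\ 0 <= A0, 0 <= B0 &
      forall n, (n <= i)%N -> A0 <= (1 - m%:R^-1) ^+ n + B0 * (n%:R / m%:R)].

Lemma power_minorant0 m A0 B0 : 0 <= A0 <= 1 -> 0 <= B0 -> power_minorant m 0 A0 B0.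
Proof.
case/andP=> A0_ge0 A0_le1 B0_ge0; split=> // n.
by rewrite leqn0 => /eqP->; rewrite mul0r mulr0 addr0.
Qed.

Lemma power_minorantS m i A0 B0 : power_minorant m i A0 B0 ->
  A0 <= (1 - m%:R^-1) ^+ i.+1 + B0 * (i.+1%:R / m%:R) ->
  power_minorant m i.+1 A0 B0.
Proof.
move=> [A0_ge0 B0_ge0 minorant] A0_le; split=> // n.
by rewrite leq_eqVlt => /orP[/eqP-> //|]; rewrite ltnS; exact: minorant.
Qed.

Lemma power_minorantW m i j A0 B0 :
  (i <= j)%N -> power_minorant m j A0 B0 -> power_minorant m i A0 B0.
Proof.
move=> ij [A0_ge0 B0_ge0 minorant]; split=> // n /leq_trans/(_ ij); exact: minorant.
Qed.

Lemma power_minorant_2_1 : power_minorant 2 1 (1/2) 0.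
Proof. by apply/power_minorantS; first (apply: power_minorant0; [apply/andP; split|]); lra. Qed.

Lemma power_minorant_3_1 : power_minorant 3 1 (2/3) 0.
Proof. by apply/power_minorantS; first (apply: power_minorant0; [apply/andP; split|]); lra. Qed.

Lemma power_minorant_3_2 : power_minorant 3 2 (4/9) 0.
Proof.
by do 2!(apply/power_minorantS; last lra); apply: power_minorant0; [apply/andP; split|]; lra.
Qed.

Section Bounds.
Variables (V C : finType) (c0 : C) (e : rel V).
Hypotheses (e_sym : symmetric e) (e_irr : irreflexive e).
Implicit Types (H A I J : {set V}) (L M : V -> {set C}) (K : {set C}).
Local Notation csum := (colouring_sum c0 e).
Local Notation ncol := (num_list_colourings c0 e).
Local Notation nbr := (neighbours e).
Local Notation edeg := (degree_in e).

Lemma ncol_independent I L :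
  independent e I -> ncol I L = \prod_(w in I) #|L w|%:R.
Proof.
have [n] := ubnP #|I|; elim: n => // n IHn in I * => ltIn indep.
have [->|/set0Pn[v vI]] := eqVneq I set0; first by rewrite big_set0 ncol_set0.
rewrite (ncolD1 c0 e_sym e_irr _ vI) (big_setD1 v vI) /= -IHn; last 2 first.
- by move: ltIn; rewrite (cardsD1 v) vI.
- by apply: sub_independent indep => //; exact: subD1set.
rewrite (eq_bigr (fun=> ncol (I :\ v) L)) ?sumr_const ?mulr_natl // => a _.
apply: eq_ncol => w /setD1P[_ wI]; rewrite forbid_notin // inE.
exact: (independentP _ _ indep).
Qed.

Lemma csum_avoidr_independent I L k :
  independent e I -> {in I, forall w, (0 < #|L w|)%N} ->
  csum I L (avoidr I k) =
    ncol I L * \prod_(w in I) (1 - (k \in L w)%:R / #|L w|%:R).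
Proof.
move=> indep L_gt0; rewrite -ncol_forbid_sub // !ncol_independent // -big_split /=.
apply: eq_bigr => w wI; have Lw0 : #|L w|%:R != 0 :> rat.
  by rewrite pnatr_eq0 -lt0n L_gt0.
rewrite forbid_in // mulrBr mulr1 mulrCA divff // mulr1.
by rewrite (cardsD1 k (L w)) natrD addrAC subrr add0r.
Qed.

Lemma sum_list_density_le1 K (L : {set C}) :
  \sum_(k in K) (k \in L)%:R / #|L|%:R <= 1 :> rat.
Proof.
have [->|L_gt0] := posnP #|L|.
  by rewrite big1 ?ler01 // => k _; rewrite invr0 mulr0.
rewrite -mulr_suml ler_pdivrMr ?ltr0n // mul1r -natr_sum ler_nat -sum1_card.
rewrite big_mkcond [leqRHS]big_mkcond /=.
by apply: leq_sum => k _; case: (k \in K); case: (k \in L).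
Qed.

Lemma sum_avoidr_ge_independent I L K (m kap : nat) (A0 B0 : rat) :
  independent e I -> {in I, forall w, (m <= #|L w|)%N} -> (0 < m)%N ->
  power_minorant m #|I| A0 B0 -> (kap <= #|K|)%N ->
  (kap%:R * A0 - #|I|%:R * B0) * ncol I L <= \sum_(k in K) csum I L (avoidr I k).
Proof.
move=> indep L_large m_gt0 [A0_ge0 B0_ge0 minorant] kap_le.
have L_gt0 w : w \in I -> (0 < #|L w|)%N by move=> /L_large; exact: leq_trans.
pose density w k : rat := (k \in L w)%:R / #|L w|%:R.
have density_range w k : w \in I -> 0 <= density w k <= m%:R^-1.
  move=> wI; rewrite divr_ge0 //= /density.
  case: (k \in L w); last by rewrite mul0r invr_ge0.
  by rewrite mul1r lef_pV2 ?posrE ?ltr0n ?ler_nat ?L_gt0 ?L_large.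
have prod_ge k : A0 - B0 * \sum_(w in I) density w k <=
    \prod_(w in I) (1 - density w k).
  rewrite lerBlDr -[X in X + _]mul1r -[X in B0 * X]add0r.
  apply: multiaffine_ge_vertices => [w wI|n nI]; first exact: density_range.
  by rewrite mul1r add0r; exact: minorant.
under [leRHS]eq_bigr do rewrite csum_avoidr_independent //.
rewrite -mulr_sumr mulrC ler_wpM2l ?ncol_ge0 //.
apply: le_trans (ler_sum _ (fun k _ => prod_ge k)).
rewrite sumrB sumr_const -(mulr_natl A0) -mulr_sumr exchange_big /=.
apply: lerB; first by rewrite ler_wpM2r // ler_nat.
rewrite mulrC ler_wpM2r // -sumr_const; apply: ler_sum => w _.
exact: sum_list_density_le1.
Qed.

(* Exposing the vertices outside I one by one, each vertex of A outside I uses up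
   at most one colour of K. *)
Lemma sum_avoidr_ge H L A I K (m kap : nat) (A0 B0 : rat) :
  I \subset A -> A \subset H -> independent e I -> (0 < m)%N ->
  {in I, forall w, (m + edeg (H :\: I) w <= #|L w|)%N} ->
  (kap + #|A :\: I| <= #|K|)%N -> power_minorant m #|I| A0 B0 ->
  (kap%:R * A0 - #|I|%:R * B0) * ncol H L <= \sum_(k in K) csum H L (avoidr A k).
Proof.
move=> IA AH indep m_gt0 L_large kap_le minorant.
have [n] := ubnP #|H :\: I|.
elim: n => // n IHn in H L A K IA AH L_large kap_le * => ltn.
have [/eqP|/set0Pn[v vHI]] := eqVneq (H :\: I) set0.
  rewrite setD_eq0 => HI; have AI : A = I.
    by apply/eqP; rewrite eqEsubset IA (subset_trans AH).
  have HI_eq : H = I by apply/eqP; rewrite eqEsubset HI -AI.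
  subst H A; rewrite setDv cards0 addn0 in kap_le.
  apply: (sum_avoidr_ge_independent (m := m)) => // w wI.
  by apply: leq_trans (L_large w wI); rewrite leq_addr.
have /setDP[vH vI] := vHI; pose K' a := if v \in A then K :\ a else K.
rewrite (ncolD1 c0 e_sym e_irr _ vH).
under [leRHS]eq_bigr do rewrite (csumD1 c0 e_sym e_irr _ _ vH).
rewrite exchange_big /= mulr_sumr; apply: ler_sum => a _.
have swapD (B : {set V}) : (B :\ v) :\: I = (B :\: I) :\ v by rewrite !setDDl setUC.
apply: le_trans (_ : \sum_(k in K' a)
    csum (H :\ v) (forbid L (nbr v) a) (avoidr (A :\ v) k) <= _).
  apply: IHn => [||w wI||].
  - by rewrite subsetD1 IA.
  - exact: setSD.
  - have := forbid_neighbours_slack e_sym L a w vHI.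
    by have := L_large w wI; rewrite swapD; lia.
  - rewrite swapD /K'; move: kap_le; rewrite (cardsD1 v (A :\: I)) inE vI /=.
    by case: (v \in A); have := cardsD1 a K; case: (a \in K); lia.
  - by move: ltn; rewrite swapD (cardsD1 v (H :\: I)) vHI.
rewrite [leLHS]big_mkcond [leRHS]big_mkcond; apply: ler_sum => k _.
rewrite /K'; case: ifPn => [kK'|_]; last first.
  by case: ifP => // _; apply: csum_ge0 => c; exact: avoidr_ge0.
have -> : k \in K by move: kK'; case: ifP => // _ /setD1P[].
apply: ler_csum => c _; rewrite /avoidr avoid_recolour.
by move: kK'; case: (v \in A) => // /setD1P[ka _]; rewrite eq_sym ka.
Qed.

Lemma sum_avoidr_ge_free H L A K (kap : nat) : A \subset H ->
  (kap + #|A| <= #|K|)%N ->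
  kap%:R * ncol H L <= \sum_(k in K) csum H L (avoidr A k).
Proof.
move=> AH kap_le; have := @sum_avoidr_ge H L A set0 K 1 kap 1 0.
rewrite !setD0 cards0 mul0r mulr1 subr0; apply=> //; rewrite ?sub0set //.
- by apply/independentP=> v w; rewrite inE.
- by move=> w; rewrite inE.
exact: power_minorant0.
Qed.

Lemma csum_has_colour_le H L w z (m : nat) : w \in H -> (m + edeg H w <= #|L w|)%N ->
  m%:R * csum H L (has_colour w z) <= ncol H L.
Proof.
move=> wH L_large; rewrite -subr_ge0 -csumZ -csumB.
have w_sub : [set w] \subset H by rewrite sub1set.
apply: (csum_restrict_ge0 e_sym e_irr w_sub) => [c c' eq_cc'|M /(_ w (set11 w))[_]].
  by rewrite /has_colour eq_cc' // set11.
have := degree_inS e w (subsetDl H [set w]) => deg_le M_large.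
rewrite csum_set1 // sumrB sumr_const subr_ge0 -mulr_sumr.
under eq_bigr do rewrite has_colour_recolourE.
apply: le_trans (_ : m%:R * 1 <= _); last by rewrite mulr1 ler_nat; lia.
rewrite ler_wpM2l // -natr_sum (ler_nat _ _ 1) -big_mkcondr /=.
by rewrite sum1_card; apply: leq_trans (subset_leq_card _) (eq_leq (card1 z));
   apply/subsetP=> a; rewrite !inE => /andP[].
Qed.

Lemma csum_avoidr_ge H L A z (m : nat) : (0 < m)%N -> A \subset H ->
  (forall w, w \in A -> z \in L w -> (m + edeg H w <= #|L w|)%N) ->
  (1 - m%:R^-1) ^+ #|A| * ncol H L <= csum H L (avoidr A z).
Proof.
move=> m_gt0; have [n] := ubnP #|A|; elim: n => // n IHn in A * => ltAn AH L_large.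
have [->|/set0Pn[v vA]] := eqVneq A set0.
  by rewrite cards0 expr0 mul1r csum_avoidr_set0.
have m_gt0r : 0 < m%:R :> rat by rewrite ltr0n.
have invm_le1 : m%:R^-1 <= 1 :> rat by rewrite invf_le1 // ler1n.
have vH := subsetP AH v vA; have AvH := subset_trans (subD1set A v) AH.
rewrite (cardsD1 v A) vA exprS -mulrA.
apply: le_trans (_ : (1 - m%:R^-1) * csum H L (avoidr (A :\ v) z) <= _).
  rewrite ler_wpM2l ?subr_ge0 //; apply: IHn => // [|w /setD1P[_ wA]].
    by move: ltAn; rewrite (cardsD1 v) vA.
  exact: L_large.
rewrite (csum_avoidr_D1 _ _ _ _ vA AH) -ncol_forbid_sub // mulrBl mul1r.
rewrite lerD2l lerN2 ler_pdivlMl //.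
have [zL|zL] := boolP (z \in L v).
  apply: csum_has_colour_le => //; have := L_large v vA zL.
  by rewrite forbid_notin // !inE eqxx.
rewrite (csum_has_colour c0 e_sym e_irr) // forbid_notin ?inE ?eqxx //.
by rewrite (negPf zL) mulr0 ncol_ge0.
Qed.

Lemma csum_has_colour_avoidr H L w z : w \in H -> z \in L w ->
  csum H L (has_colour w z) = csum (H :\ w) L (avoidr ((H :\ w) :&: nbr w) z).
Proof. by move=> wH zL; rewrite (csum_has_colour c0 e_sym e_irr) // zL ncol_forbid. Qed.

Lemma ncol_avoidr H L w : w \in H ->
  ncol H L = \sum_(k in L w) csum (H :\ w) L (avoidr ((H :\ w) :&: nbr w) k).
Proof.
move=> wH; rewrite (ncolD1 c0 e_sym e_irr _ wH).
by apply: eq_bigr => k _; rewrite ncol_forbid.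
Qed.

Lemma csum_has_colour_ge H L w z (m d : nat) : (0 < m)%N -> w \in H -> z \in L w ->
  (forall y, y \in H :\ w -> e w y -> z \in L y -> (m + edeg (H :\ w) y <= #|L y|)%N) ->
  (edeg H w <= d)%N ->
  (1 - m%:R^-1) ^+ d / #|C|%:R * ncol H L <= csum H L (has_colour w z).
Proof.
move=> m_gt0 wH zL L_large deg_le.
have invm_le1 : m%:R^-1 <= 1 :> rat by rewrite invf_le1 ?ltr0n // ler1n.
have pow_base_ge0 : 0 <= 1 - m%:R^-1 :> rat by rewrite subr_ge0.
have C_gt0 : 0 < #|C|%:R :> rat by rewrite ltr0n; apply/card_gt0P; exists z.
have ncol_le : ncol H L <= #|C|%:R * ncol (H :\ w) L.
  rewrite (ncol_avoidr _ wH); apply: le_trans (_ : \sum_(k in L w) ncol (H :\ w) L <= _).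
    by apply: ler_sum => k _; exact: csum_avoidr_le.
  by rewrite sumr_const -(mulr_natl (ncol _ _)) ler_wpM2r ?ncol_ge0 // ler_nat max_card.
rewrite csum_has_colour_avoidr //.
apply: le_trans (_ : (1 - m%:R^-1) ^+ d * ncol (H :\ w) L <= _).
  by rewrite -mulrA ler_wpM2l ?exprn_ge0 // mulrC ler_pdivrMr // mulrC.
apply: le_trans (csum_avoidr_ge m_gt0 (subsetIl _ (nbr w)) _); last first.
  by move=> y /setIP[yH]; rewrite inE; exact: L_large.
rewrite ler_wpM2r ?ncol_ge0 // ler_wiXn2l //; first by rewrite gerBl invr_ge0.
by rewrite card_neighbours_in (leq_trans _ deg_le) // degree_inS // subD1set.
Qed.

Lemma csum_avoidr_le_pow H L A (z : C) (al : rat) : A \subset H -> 0 <= al <= 1 ->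
  (forall w (B : {set V}), w \in A -> B \subset A :\ w ->
     al * ncol H (forbid L B z) <= csum H (forbid L B z) (has_colour w z)) ->
  csum H L (avoidr A z) <= (1 - al) ^+ #|A| * ncol H L.
Proof.
have [n] := ubnP #|A|; elim: n => // n IHn in A * => ltAn AH al_range colour_ge.
have [->|/set0Pn[v vA]] := eqVneq A set0.
  by rewrite cards0 expr0 mul1r csum_avoidr_le.
have AvH := subset_trans (subD1set A v) AH; have /andP[_ al_le1] := al_range.
rewrite (cardsD1 v A) vA exprS -mulrA (csum_avoidr_D1 _ _ _ _ vA AH).
apply: le_trans (_ : (1 - al) * csum H L (avoidr (A :\ v) z) <= _).
  by rewrite mulrBl mul1r lerD2l lerN2 -ncol_forbid_sub // colour_ge.
rewrite ler_wpM2l ?subr_ge0 // IHn // => [|w B /setD1P[_ wA] BA].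
  by move: ltAn; rewrite (cardsD1 v) vA.
by apply: colour_ge wA (subset_trans BA _); rewrite setSD // subD1set.
Qed.

Lemma csum_avoidr_antimono H L A J z :
  J \subset A -> csum H L (avoidr A z) <= csum H L (avoidr J z).
Proof.
move=> JA; apply: ler_csum => c _; rewrite ler_nat.
by case: (boolP (avoid A z c)) => // /(avoidS JA)->.
Qed.

End Bounds.
End ListBounds.

Module SpatialMixing.
Import Colourings ListBounds.
Import Order.TTheory GRing.Theory Num.Theory.
Local Open Scope ring_scope.

Section WeightedMeans.
Variables (R : realFieldType) (T : finType).
Implicit Types (K : {set T}) (W F : T -> R).

Definition weighted_mean W F K : R :=
  (\sum_(a in K) W a * F a) / \sum_(a in K) W a.

Lemma dist_weighted_mean W F K (x B : R) :
  (forall a, a \in K -> 0 <= W a) -> 0 < \sum_(a in K) W a ->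
  (forall a, a \in K -> `|F a - x| <= B) -> `|weighted_mean W F K - x| <= B.
Proof.
move=> W_ge0 sumW_gt0 F_near.
have -> : weighted_mean W F K - x =
    (\sum_(a in K) W a * (F a - x)) / (\sum_(a in K) W a).
  under [in RHS]eq_bigr do rewrite mulrBr.
  by rewrite sumrB -mulr_suml mulrBl [_ * x / _]mulrAC divff ?mul1r // gt_eqF.
rewrite normrM normfV (gtr0_norm sumW_gt0) ler_pdivrMr // mulr_sumr.
apply: le_trans (ler_norm_sum _ _ _) _; apply: ler_sum => a aK.
by rewrite normrM (ger0_norm (W_ge0 a aK)) mulrC ler_wpM2r ?W_ge0 ?F_near.
Qed.

Lemma sum_setD1_split K (f : T -> R) u z : u != z ->
  \sum_(a in K :\ u) f a =
  \sum_(a in K :\ u :\ z) f a + (if z \in K then f z else 0).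
Proof.
move=> uz; case: ifPn => zK.
  by rewrite (big_setD1 z) 1?addrC // !inE zK eq_sym uz.
by rewrite addr0 [K :\ u :\ z](setDidPl _) // disjoint_sym disjoints1 !inE negb_and zK orbT.
Qed.

(* The means (P + Wy Ey) / (A + Wy) = E1 and (P + Wx Ex) / (A + Wx) = E2 share the
   part of weight A. *)
Lemma dist_means_common_part (A P Wx Wy Ex Ey E1 E2 B : R) :
  0 <= Wy -> Wy <= Wx -> 0 <= A + Wx ->
  E1 * (A + Wy) = P + Wy * Ey -> E2 * (A + Wx) = P + Wx * Ex ->
  `|Ey - Ex| <= B -> `|E1 - Ex| <= B -> `|E1 - E2| * (A + Wx) <= B * Wx.
Proof.
move=> Wy_ge0 le_Wyx AWx_ge0 E1E E2E dist_Ey dist_E1.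
rewrite -{1}(ger0_norm AWx_ge0) -normrM.
have -> : (E1 - E2) * (A + Wx) = Wy * (Ey - Ex) + (Wx - Wy) * (E1 - Ex).
  by rewrite mulrBl E2E (_ : A + Wx = A + Wy + (Wx - Wy)); [rewrite mulrDr E1E|]; ring.
have Wxy_ge0 : 0 <= Wx - Wy by rewrite subr_ge0.
apply: le_trans (ler_normD _ _) _.
rewrite !normrM (ger0_norm Wy_ge0) (ger0_norm Wxy_ge0).
by rewrite -[Wx in leRHS](subrKC Wy) mulrDr ![B * _]mulrC lerD // ler_wpM2l.
Qed.

Lemma dist_weighted_mean_remove W F K (x y : T) (B rho : R) :
  (forall a, 0 < W a) -> (forall a b, a \in K -> b \in K -> `|F a - F b| <= B) ->
  (forall z, (0 < #|K :\ z|)%N) -> x != y -> 0 <= rho -> 0 <= B ->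
  (forall z, z \in [set x; y] -> z \in K ->
     W z * B <= rho * (W z + \sum_(a in K :\ x :\ y) W a)) ->
  `|weighted_mean W F (K :\ x) - weighted_mean W F (K :\ y)| <= rho.
Proof.
move=> W_gt0 F_near K_large xy rho_ge0 B_ge0 share_le.
pose W0 z := if z \in K then W z else 0.
have W0_ge0 z : 0 <= W0 z by rewrite /W0; case: ifP => // _; rewrite ltW.
wlog le_yx : x y xy share_le / W0 y <= W0 x.
  move=> main; have [|/ltW] := leP (W0 y) (W0 x); first exact: main.
  rewrite distrC; apply: main => [|z]; first by rewrite eq_sym.
  by rewrite (setUC [set y]) setDDl (setUC [set y]) -setDDl; exact: share_le.
have yKx : y \in K -> x \in K.
  move=> yK; apply: contraTT le_yx => xK.
  by rewrite -ltNge /W0 (negPf xK) yK.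
have [xK|xK] := boolP (x \in K); last first.
  have yK : y \notin K by apply: contra xK.
  by rewrite !(setDidPl _) ?subrr ?normr0 // disjoint_sym disjoints1.
set A := \sum_(a in K :\ x :\ y) W a in share_le *.
have sumW_gt0 z : 0 < \sum_(a in K :\ z) W a.
  have /card_gt0P[a aK] := K_large z; rewrite (bigD1 a) //=.
  by apply: ltr_wpDr => //; apply: sumr_ge0 => b _; exact: ltW.
have sum_remove_x (f : T -> R) : \sum_(a in K :\ x) f a =
    \sum_(a in K :\ x :\ y) f a + (if y \in K then f y else 0) by exact: sum_setD1_split.
have sum_remove_y (f : T -> R) :
    \sum_(a in K :\ y) f a = \sum_(a in K :\ x :\ y) f a + f x.
  by rewrite (@sum_setD1_split _ f y x) 1?eq_sym // xK setDDl setUC -setDDl.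
have AWx_gt0 : 0 < A + W x by have := sumW_gt0 y; rewrite sum_remove_y.
rewrite -(ler_pM2r AWx_gt0).
apply: le_trans (_ : B * W x <= _); last first.
  by rewrite mulrC [A + _]addrC share_le // set21.
pose Fy := if y \in K then F y else F x.
apply: (@dist_means_common_part A (\sum_(a in K :\ x :\ y) W a * F a)
  (W x) (W0 y) (F x) Fy) => //.
- by move: le_yx; rewrite /W0 xK.
- exact: ltW.
- rewrite -[A + W0 y](sum_remove_x W) mulfVK ?gt_eqF // sum_remove_x.
  by rewrite /W0 /Fy; case: ifP => // _; rewrite mul0r.
- by rewrite -[A + W x](sum_remove_y W) mulfVK ?gt_eqF // sum_remove_y.
- by rewrite /Fy; case: ifP => yK; [exact: F_near|rewrite subrr normr0].
- by apply: dist_weighted_mean => // a; [rewrite ltW|case/setD1P=> _ /F_near; apply].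
Qed.

End WeightedMeans.

Section Mixing.
Variables (V C : finType) (c0 : C) (e lat : rel V) (Delta : nat).
Hypotheses (e_sym : symmetric e) (e_irr : irreflexive e) (lat_sym : symmetric lat).
Hypothesis e_lat : subrel e lat.
Hypothesis Delta_lt : (Delta < #|C|)%N.
Implicit Types (H A Q : {set V}) (L M : V -> {set C}) (c : {ffun V -> C}).
Local Notation csum := (colouring_sum c0 e).
Local Notation ncol := (num_list_colourings c0 e).
Local Notation nbr := (neighbours e).
Local Notation edeg := (degree_in e).
Local Notation ldeg := (degree_in lat).

Definition ball t r : {set V} :=
  iter r (fun B : {set V} => B :|: [set w | [exists x in B, e x w]]) [set t].

Lemma ballS t r : ball t r \subset ball t r.+1.
Proof. by rewrite /ball iterS subsetUl. Qed.

Lemma ball_center t r : t \in ball t r.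
Proof. by elim: r => [|r IHr]; [rewrite inE|exact: subsetP (ballS t r) _ IHr]. Qed.

Lemma ball_edge t r v w : v \in ball t r -> e v w -> w \in ball t r.+1.
Proof.
move=> vb evw; rewrite /ball iterS; apply/setUP; right; rewrite inE.
by apply/exists_inP; exists v.
Qed.

Lemma notin_ball_edge t r v w : e v w -> v \notin ball t r.+1 -> w \notin ball t r.
Proof. by move=> evw; apply: contra => wb; apply: ball_edge wb _; rewrite e_sym. Qed.

Lemma notin_ball_neq t r v : v \notin ball t r -> v != t.
Proof. by apply: contraNneq => ->; exact: ball_center. Qed.

Lemma degree_in_sub H v : (edeg H v <= ldeg H v)%N.
Proof.
apply: subset_leq_card; apply/subsetP=> w; rewrite !inE => /andP[->] /=.
exact: e_lat.
Qed.

(* Lists of this size arise by colouring lattice neighbours outside H with the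
   full palette C available: Delta bounds the degree in the lattice. *)
Definition ample_lists H L :=
  forall v, v \in H -> (#|C| + ldeg H v <= #|L v| + Delta)%N.
Local Notation ample := ample_lists.

Definition surplus_list H L v := (#|C| + ldeg H v < #|L v| + Delta)%N.
Local Notation surplus := surplus_list.

Lemma ampleS A H L : A \subset H -> ample H L -> ample A L.
Proof.
move=> AH L_ample v vA; apply: leq_trans (L_ample v (subsetP AH v vA)).
by rewrite leq_add2l degree_inS.
Qed.

Lemma ampleD1 H L v : ample H L -> ample (H :\ v) L.
Proof. exact/ampleS/subD1set. Qed.

Lemma surplusD1 H L v w : surplus H L w -> surplus (H :\ v) L w.
Proof. by apply: leq_ltn_trans; rewrite leq_add2l degree_inS // subD1set. Qed.

Lemma surplusD1_neighbour H L v w :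
  ample H L -> v \in H -> w \in H -> lat v w -> surplus (H :\ v) L w.
Proof.
move=> L_ample vH wH lvw; have := L_ample w wH.
by rewrite (degree_inD1 lat w vH) lat_sym lvw /surplus; lia.
Qed.

Lemma eq_surplus H L M w : L w = M w -> surplus H L w -> surplus H M w.
Proof. by rewrite /surplus => ->. Qed.

Lemma surplus_forbid H L Q a w : w \notin Q -> surplus H L w -> surplus H (forbid L Q a) w.
Proof. by move=> wQ; apply: eq_surplus; rewrite forbid_notin. Qed.

Lemma surplus_card_gt0 H L v : surplus H L v -> forall x, (0 < #|L v :\ x|)%N.
Proof.
move=> Lv_surplus x; have := cardsD1 x (L v); have := Delta_lt; move: Lv_surplus.
by rewrite /surplus; case: (x \in L v); lia.
Qed.

Lemma ample_forbid H L Q a : ample H L ->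
  (forall w, w \in H -> w \in Q -> surplus H L w) -> ample H (forbid L Q a).
Proof.
move=> L_ample Q_surplus v vH; have := card_forbid L Q a v; have := L_ample v vH.
by have := Q_surplus v vH; rewrite /surplus; case: (v \in Q) => [/(_ isT)|_]; lia.
Qed.

Lemma ample_forbid1 H L v a : ample H L -> surplus H L v -> ample H (forbid L [set v] a).
Proof. by move=> L_ample ?; apply: ample_forbid => // w _ /set1P->. Qed.

Lemma ample_expose H L v a : ample H L -> v \in H -> ample (H :\ v) (forbid L (nbr v) a).
Proof.
move=> L_ample vH; apply: ample_forbid => [|w /setD1P[_ wH]]; first exact: ampleD1.
by rewrite inE => /e_lat; exact: surplusD1_neighbour.
Qed.

Lemma ample_ncol_gt0 H L : ample H L -> 0 < ncol H L.
Proof.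
move=> L_ample; apply: (ncol_gt0 c0 e_sym e_irr) => v vH.
by have := L_ample v vH; have := degree_in_sub H v; move: Delta_lt; lia.
Qed.

Definition marginal H L t k : rat := csum H L (has_colour t k) / ncol H L.
Local Notation prob := marginal.

Lemma eq_marginal H L M t k :
  (forall v, v \in H -> L v = M v) -> prob H L t k = prob H M t k.
Proof. by move=> eqL; rewrite /prob (eq_ncol _ _ eqL) (eq_csum_lists _ _ _ eqL). Qed.

Lemma marginal_ge0 H L t k : 0 <= prob H L t k.
Proof. by rewrite divr_ge0 ?ncol_ge0 ?csum_ge0 // => c; exact: has_colour_ge0. Qed.

Lemma csum_has_colour_marginal H L t k :
  ample H L -> csum H L (has_colour t k) = ncol H L * prob H L t k.
Proof.
by move=> L_ample; rewrite /prob mulrCA divff ?mulr1 // gt_eqF // ample_ncol_gt0.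
Qed.

Lemma marginal_le1 H L t k : ample H L -> prob H L t k <= 1.
Proof.
move=> L_ample; rewrite /prob ler_pdivrMr ?ample_ncol_gt0 // mul1r.
by apply: ler_csum => c _; exact: has_colour_le1.
Qed.

Lemma marginal_dist_le1 H L M t k :
  ample H L -> ample H M -> `|prob H L t k - prob H M t k| <= 1.
Proof.
move=> /marginal_le1 L_le1 /marginal_le1 M_le1.
rewrite ler_norml; have := marginal_ge0 H L t k; have := marginal_ge0 H M t k.
by have := L_le1 t k; have := M_le1 t k; move=> *; apply/andP; split; lra.
Qed.

Lemma marginal_sum1 H L v : v \in H -> 0 < ncol H L -> \sum_(a in L v) prob H L v a = 1.
Proof.
move=> vH ncol_pos; rewrite /prob -mulr_suml.
under eq_bigr => a aL do rewrite (csum_has_colour c0 e_sym e_irr) // aL.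
by rewrite -(ncolD1 c0 e_sym e_irr _ vH) divff // gt_eqF.
Qed.

Lemma marginal_forbid_set0 H L a t k : prob H (forbid L set0 a) t k = prob H L t k.
Proof. by apply: eq_marginal => w _; rewrite forbid_notin ?inE. Qed.

Section ExposeVertex.
Variables (H : {set V}) (L : V -> {set C}) (v t : V) (k : C).
Hypotheses (vH : v \in H) (vt : v != t) (L_ample : ample H L).
Hypothesis Lv_surplus : surplus H L v.
Let weight a := ncol (H :\ v) (forbid L (nbr v) a).
Let cond_marginal a := prob (H :\ v) (forbid L (nbr v) a) t k.

Lemma csum_forbid1 x (f : {ffun V -> C} -> rat) :
  (forall c a, f (recolour c v a) = f c) ->
  csum H (forbid L [set v] x) f =
  \sum_(a in L v :\ x) csum (H :\ v) (forbid L (nbr v) a) f.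
Proof.
move=> f_indep; rewrite (csumD1 c0 e_sym e_irr _ _ vH) forbid_in ?set11 //.
apply: eq_bigr => a _; apply: eq_csum => [w /setD1P[wv _]|c _ //].
by rewrite forbid_comm [LHS]forbid_notin // in_set1.
Qed.

Lemma marginal_forbid1 x :
  prob H (forbid L [set v] x) t k = weighted_mean weight cond_marginal (L v :\ x).
Proof.
rewrite /prob /weighted_mean {1}/num_list_colourings !csum_forbid1 //; last first.
  by move=> c a; rewrite has_colour_recolour // eq_sym.
congr (_ / _); apply: eq_bigr => a _; rewrite csum_has_colour_marginal //.
exact: ample_expose.
Qed.

Lemma marginal_forbid1_dist x y (B rho : rat) :
  (forall a b, `|cond_marginal a - cond_marginal b| <= B) ->
  x != y -> 0 <= rho -> 0 <= B ->
  (forall z, z \in [set x; y] -> z \in L v ->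
     weight z * B <= rho * (weight z + \sum_(a in L v :\ x :\ y) weight a)) ->
  `|prob H (forbid L [set v] x) t k - prob H (forbid L [set v] y) t k| <= rho.
Proof.
move=> dist_B xy rho_ge0 B_ge0 share_le; rewrite !marginal_forbid1.
apply: dist_weighted_mean_remove share_le => // a.
- exact/ample_ncol_gt0/ample_expose.
- exact: surplus_card_gt0 Lv_surplus a.
Qed.

(* ga bounds the expected number of colours of L v, other than x and y, that the
   neighbours of v leave unused. *)
Lemma marginal_forbid1_dist_unused x y (B ga : rat) :
  (forall a b, `|cond_marginal a - cond_marginal b| <= B) -> x != y -> 0 <= ga ->
  ga * ncol (H :\ v) L <=
    \sum_(a in L v :\ x :\ y) csum (H :\ v) L (avoidr ((H :\ v) :&: nbr v) a) ->
  `|prob H (forbid L [set v] x) t k - prob H (forbid L [set v] y) t k| <= B / (1 + ga).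
Proof.
move=> dist_B xy ga_ge0 unused_ge; have B_ge0 := le_trans (normr_ge0 _) (dist_B x x).
have ga1_gt0 : 0 < 1 + ga by rewrite ltr_pwDl.
apply: (marginal_forbid1_dist dist_B xy _ B_ge0) => [|z _ _]; first by rewrite divr_ge0 // ltW.
rewrite mulrAC ler_pdivlMr // mulrAC [leRHS]mulrC ler_wpM2r // mulrDr mulr1.
rewrite lerD2l mulrC; apply: le_trans (_ : ga * ncol (H :\ v) L <= _).
  by rewrite ler_wpM2l // /weight ncol_forbid csum_avoidr_le.
by rewrite (eq_bigr (fun a => csum (H :\ v) L (avoidr ((H :\ v) :&: nbr v) a))) // => a _;
  rewrite /weight ncol_forbid.
Qed.

End ExposeVertex.

(* The vertices of s are switched from a to b one at a time. *)
Lemma marginal_forbid_telescope H L t k (s : seq V) a b (B : V -> rat) :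
  ample H L -> uniq s -> {in s, forall w, w \in H /\ surplus H L w} ->
  (forall w M, w \in s -> ample H M -> surplus H M w ->
    `|prob H (forbid M [set w] a) t k - prob H (forbid M [set w] b) t k| <= B w) ->
  `|prob H (forbid L [set w in s] a) t k - prob H (forbid L [set w in s] b) t k|
    <= \sum_(w <- s) B w.
Proof.
elim: s L => [|w s IHs] L L_ample; first by rewrite set_nil !marginal_forbid_set0 subrr normr0 big_nil.
rewrite cons_uniq => /andP[ws uniq_s] s_surplus switch_le; rewrite big_cons.
have w_notin : w \notin [set u in s] by rewrite inE.
have forbid_cons d d' : prob H (forbid (forbid L [set u in s] d) [set w] d') t k =
    prob H (forbid (forbid L [set w] d') [set u in s] d) t k.
  by apply: eq_marginal => u _; exact: forbid_comm.
have forbid_set_cons d : prob H (forbid L [set u in w :: s] d) t k =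
    prob H (forbid (forbid L [set u in s] d) [set w] d) t k.
  apply: eq_marginal => u _; rewrite set_cons /forbid in_setU1 in_set1.
  by case: eqP => [->|_]; rewrite ?(negPf w_notin).
have [wH Lw_surplus] := s_surplus w (mem_head w s).
have s_surplus' u : u \in s -> u \in H /\ surplus H L u.
  by move=> us; apply: s_surplus; rewrite inE us orbT.
rewrite !forbid_set_cons.
rewrite -(subrKA (prob H (forbid (forbid L [set u in s] a) [set w] b) t k)).
apply: le_trans (ler_normD _ _) _; apply: lerD.
  apply: switch_le; [exact: mem_head| |exact: surplus_forbid].
  by apply: ample_forbid => // u _; rewrite inE => /s_surplus'[].
rewrite !forbid_cons; apply: IHs => // [|u us|u M us].
- exact: ample_forbid1.
- have [uH Lu_surplus] := s_surplus' u us; split=> //; apply: surplus_forbid => //.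
  by rewrite inE; apply: contraNneq ws => <-.
- by apply: switch_le; rewrite inE us orbT.
Qed.

(* Recolouring s outside the ball of radius r + 1 around t moves the marginal at
   t by at most K lam^r, whatever the lists. *)
Definition spatial_mixing (K lam : rat) :=
  forall H L s t k a b r, ample H L -> s \in H -> s \notin ball t r.+1 ->
  `|prob (H :\ s) (forbid L (nbr s) a) t k -
    prob (H :\ s) (forbid L (nbr s) b) t k| <= K * lam ^+ r.

Section Contraction.
Variables (Phi : {set V} -> V -> rat) (lam K0 : rat).
Hypotheses (Phi_ge : forall H v, 1 <= K0 * Phi H v) (Phi_le1 : forall H v, Phi H v <= 1).
Hypotheses (lam_ge0 : 0 <= lam) (K0_gt0 : 0 < K0).
Hypothesis ldeg_le : forall v, (ldeg setT v <= Delta)%N.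
Hypothesis Phi_contracts : forall H L v x y z,
  ample H L -> v \in H -> surplus H L v -> x != y -> z \in [set x; y] -> z \in L v ->
  let weight a := ncol (H :\ v) (forbid L (nbr v) a) in
  weight z * \sum_(w in (H :\ v) :&: nbr v) Phi (H :\ v) w <=
  lam * Phi H v * (weight z + \sum_(a in L v :\ x :\ y) weight a).

Lemma potential_ge0 H v : 0 <= Phi H v.
Proof. by rewrite -(pmulr_rge0 _ K0_gt0) (le_trans ler01). Qed.

Lemma marginal_expose_dist H L v t k a b r : v \in H -> ample H L ->
  (forall w M, w \in H :\ v -> e v w -> ample (H :\ v) M -> surplus (H :\ v) M w ->
   `|prob (H :\ v) (forbid M [set w] a) t k - prob (H :\ v) (forbid M [set w] b) t k|
     <= K0 * lam ^+ r * Phi (H :\ v) w) ->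
  `|prob (H :\ v) (forbid L (nbr v) a) t k - prob (H :\ v) (forbid L (nbr v) b) t k|
  <= K0 * lam ^+ r * \sum_(w in (H :\ v) :&: nbr v) Phi (H :\ v) w.
Proof.
move=> vH L_ample switch_le; set N := (H :\ v) :&: nbr v.
have only_N d : prob (H :\ v) (forbid L (nbr v) d) t k =
    prob (H :\ v) (forbid L [set w in enum N] d) t k.
  by apply: eq_marginal => w wHv; rewrite /forbid !inE mem_enum in_setI wHv inE.
rewrite !only_N mulr_sumr -big_enum.
apply: marginal_forbid_telescope => [||w|w M].
- exact: ampleD1.
- exact: enum_uniq.
- rewrite mem_enum => /setIP[wHv]; rewrite inE => evw; split=> //.
  by have /setD1P[_ wH] := wHv; apply: surplusD1_neighbour => //; exact: e_lat.
- by rewrite mem_enum => /setIP[wHv]; rewrite inE => evw; exact: switch_le.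
Qed.

Lemma marginal_forbid1_decay r H L v x y t k :
  ample H L -> v \in H -> surplus H L v -> v \notin ball t r ->
  `|prob H (forbid L [set v] x) t k - prob H (forbid L [set v] y) t k| <=
    K0 * lam ^+ r * Phi H v.
Proof.
elim: r H L v x y => [|r IHr] H L v x y L_ample vH Lv_surplus v_far.
  rewrite expr0 mulr1; apply: le_trans (Phi_ge H v).
  by apply: marginal_dist_le1; apply: ample_forbid1.
have scale_ge0 : 0 <= K0 * lam ^+ r by rewrite mulr_ge0 ?exprn_ge0 // ltW.
have bound_ge0 : 0 <= K0 * lam ^+ r.+1 * Phi H v.
  by rewrite !mulr_ge0 ?exprn_ge0 ?potential_ge0 // ltW.
have [->|xy] := eqVneq x y; first by rewrite subrr normr0.
apply: (@marginal_forbid1_dist H L v t k vH (notin_ball_neq v_far) L_ample Lv_surplus x y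
  (K0 * lam ^+ r * \sum_(w in (H :\ v) :&: nbr v) Phi (H :\ v) w)) => //.
- move=> a b; apply: marginal_expose_dist => // w M wH evw M_ample Mw_surplus.
  by apply: IHr => //; exact: notin_ball_edge v_far.
- by rewrite mulr_ge0 // sumr_ge0 // => w _; exact: potential_ge0.
move=> z zxy zL; have := Phi_contracts L_ample vH Lv_surplus xy zxy zL => /= contracts.
rewrite mulrCA exprSr; apply: le_trans (ler_wpM2l scale_ge0 contracts) _.
by rewrite !mulrA.
Qed.

Lemma spatial_mixing_of_contraction : spatial_mixing (K0 * Delta%:R) lam.
Proof.
move=> H L s t k a b r L_ample sH s_far.
apply: le_trans (marginal_expose_dist (r := r) sH L_ample _) _.
  move=> w M wH esw M_ample Mw_surplus; apply: marginal_forbid1_decay => //.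
  exact: notin_ball_edge s_far.
rewrite -mulrA [lam ^+ r * _]mulrC mulrA ler_wpM2r ?exprn_ge0 // ler_wpM2l ?(ltW K0_gt0) //.
apply: le_trans (_ : \sum_(w in (H :\ s) :&: nbr s) 1 <= _); first exact: ler_sum.
rewrite sumr_const ler_nat card_neighbours_in; apply: leq_trans (ldeg_le s).
by apply: leq_trans (degree_in_sub _ _) (degree_inS _ _ _); exact: subsetT.
Qed.

End Contraction.
End Mixing.
End SpatialMixing.

Module LocalContraction.
Import Colourings ListBounds SpatialMixing.
Import Order.TTheory GRing.Theory Num.Theory.
Local Open Scope ring_scope.

Lemma le_scaled_sum (R : realFieldType) (W X Y T n P ga : R) :
  0 <= W -> 0 <= Y -> 0 <= n -> 0 <= T -> W <= P * n -> ga * n <= T ->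
  P * (X - Y) <= Y * ga -> W * X <= Y * (W + T).
Proof.
move=> W_ge0 Y_ge0 n_ge0 T_ge0 W_le T_ge numeric.
have YT_ge0 : 0 <= Y * T by exact: mulr_ge0.
have YT_ge : Y * (ga * n) <= Y * T by exact: ler_wpM2l.
have [XY|YX] := lerP X Y.
  have WX_le : W * X <= W * Y by exact: ler_wpM2l.
  by lra.
have WXY_le : W * (X - Y) <= P * n * (X - Y) by rewrite ler_wpM2r // subr_ge0 ltW.
have nPXY_le : n * (P * (X - Y)) <= n * (Y * ga) by exact: ler_wpM2l.
by lra.
Qed.

Section Local.
Variables (V C : finType) (c0 : C) (e lat : rel V) (Delta : nat).
Hypotheses (e_sym : symmetric e) (e_irr : irreflexive e) (lat_sym : symmetric lat).
Hypothesis e_lat : subrel e lat.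
Hypothesis Delta_lt : (Delta < #|C|)%N.
Hypothesis ldeg_le : forall v, (degree_in lat setT v <= Delta)%N.
Implicit Types (H I : {set V}) (L M : V -> {set C}) (K : {set C}).
Local Notation csum := (colouring_sum c0 e).
Local Notation ncol := (num_list_colourings c0 e).
Local Notation nbr := (neighbours e).
Local Notation edeg := (degree_in e).
Local Notation ldeg := (degree_in lat).
Local Notation ample := (ample_lists lat Delta).
Local Notation surplus := (surplus_list lat Delta).
Local Notation excess := (#|C| - Delta)%N.

(* Vertices of the largest degree possible next to an exposed vertex have weight 1,
   the others a weight phi <= 1. *)
Definition vertex_weight (phi : rat) H v : rat :=
  if ldeg H v == Delta.-1 then 1 else phi.

Definition full_neighbours H v : {set V} :=
  [set w in (H :\ v) :&: nbr v | ldeg (H :\ v) w == Delta.-1].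

Section Vertex.
Variables (H : {set V}) (L : V -> {set C}) (v : V).
Hypotheses (vH : v \in H) (L_ample : ample H L) (Lv_surplus : surplus H L v).
Local Notation H' := (H :\ v).
Local Notation N := ((H :\ v) :&: nbr v).
Local Notation full := (full_neighbours H v).

Lemma mem_exposed_neighbours w : w \in N -> [/\ w \in H, w != v, e v w & lat v w].
Proof. by rewrite !inE => /andP[/andP[-> ->] evw]; split=> //; exact: e_lat. Qed.

Lemma card_exposed_neighbours_le : (#|N| <= ldeg H v)%N.
Proof.
rewrite card_neighbours_in; apply: leq_trans (degree_inS _ _ (subD1set _ _)) _.
exact: degree_in_sub.
Qed.

Lemma surplus_degree_lt : (ldeg H v < Delta)%N.
Proof.
move: Lv_surplus; have := subset_leq_card (subsetT (L v)).
by rewrite /surplus_list cardsT; clear; lia.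
Qed.

Lemma card_listD2_ge x y : (excess + ldeg H v <= #|L v :\ x :\ y|.+1)%N.
Proof.
move: Delta_lt Lv_surplus; rewrite /surplus_list.
have := cardsD1 x (L v); have := cardsD1 y (L v :\ x).
by case: (x \in _); case: (y \in _); clear; lia.
Qed.

Lemma exposed_neighbour_list_large w I :
  w \in N -> (excess.+1 + edeg (H' :\: I) w <= #|L w|)%N.
Proof.
move=> wN; have [wH _ _ lvw] := mem_exposed_neighbours wN.
have := L_ample wH; rewrite (degree_inD1 lat w vH) lat_sym lvw.
have := leq_trans (degree_inS e w (subsetDl H' I)) (degree_in_sub e_lat H' w).
by move: Delta_lt; clear; lia.
Qed.

Lemma full_neighbour_list w : w \in full -> L w = setT.
Proof.
rewrite inE => /andP[wN /eqP full_degree].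
have [wH _ _ lvw] := mem_exposed_neighbours wN.
apply/eqP; rewrite eqEcard subsetT cardsT.
have := L_ample wH; rewrite (degree_inD1 lat w vH) lat_sym lvw full_degree.
by have := surplus_degree_lt; lia.
Qed.

Lemma full_sub : full \subset N.
Proof. by apply/subsetP=> w; rewrite inE => /andP[]. Qed.

Lemma csum_avoidr_full_le z (al : rat) : 0 <= al <= 1 ->
  (forall w M, w \in full -> z \in M w ->
     (forall y, y \in H' :\ w -> e w y -> (z \in M y) || (y \notin N) ->
       (excess.+1 + edeg (H' :\ w) y <= #|M y|)%N) ->
     al * ncol H' M <= csum H' M (has_colour w z)) ->
  csum H' L (avoidr N z) <= (1 - al) ^+ #|full| * ncol H' L.
Proof.
move=> al_range colour_ge; apply: le_trans (csum_avoidr_antimono _ _ _ _ _ full_sub) _.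
apply: csum_avoidr_le_pow => // [|w B w_full B_full].
  exact: subset_trans full_sub (subsetIl _ _).
have [wH _ _ _] := mem_exposed_neighbours (subsetP full_sub w w_full).
have wB : w \notin B by apply/negP=> /(subsetP B_full w); rewrite !inE eqxx.
apply: colour_ge => // [|y /setD1P[yw /setD1P[yv yH]] ewy].
  by rewrite forbid_notin // full_neighbour_list // inE.
have [yB|yB] := boolP (y \in B).
  have /setD1P[_ /(subsetP full_sub) yN] := subsetP B_full y yB.
  by rewrite yN orbF forbid_in // !inE eqxx.
rewrite forbid_notin // => _.
have := L_ample yH; rewrite (degree_inD1 lat y wH) lat_sym (e_lat ewy).
have : (edeg (H' :\ w) y <= ldeg (H :\ w) y)%N.
  apply: leq_trans (degree_in_sub e_lat _ _) (degree_inS _ _ _).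
  by rewrite setSD // subD1set.
move: (edeg _ _) (ldeg _ _) #|L y| #|C| Delta_lt; clear; lia.
Qed.

Lemma csum_avoidr_full_le_pow z (al := (1 - excess.+1%:R^-1) ^+ Delta.-1 / #|C|%:R) :
  csum H' L (avoidr N z) <= (1 - al) ^+ #|full| * ncol H' L.
Proof.
have C_gt0 : (0 < #|C|)%N by exact: leq_trans Delta_lt.
apply: csum_avoidr_full_le => [|w M w_full zM M_large].
  have inv_ge0 : 0 <= excess.+1%:R^-1 :> rat by rewrite invr_ge0.
  have inv_le1 : excess.+1%:R^-1 <= 1 :> rat by rewrite invf_le1 ?ler1n ?ltr0n.
  rewrite divr_ge0 ?ler0n ?exprn_ge0 ?subr_ge0 //=.
  rewrite ler_pdivrMr ?ltr0n // mul1r; apply: le_trans (_ : 1 <= _); last by rewrite ler1n.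
  by rewrite exprn_ile1 ?subr_ge0 // gerBl.
have wN := subsetP full_sub w w_full.
apply: (csum_has_colour_ge c0 e_sym e_irr (m := excess.+1)) => //.
- by case/setIP: wN.
- by move=> y yH ewy zMy; apply: M_large => //; rewrite zMy.
by move: w_full; rewrite inE => /andP[_ /eqP <-]; exact: degree_in_sub.
Qed.

Lemma sum_vertex_weight phi :
  \sum_(w in N) vertex_weight phi H' w = #|full|%:R + (#|N| - #|full|)%:R * phi.
Proof.
rewrite (big_setID full) /= (setIidPr full_sub).
rewrite (eq_bigr (fun=> 1)) => [|w]; last first.
  by rewrite inE /vertex_weight => /andP[_ ->].
rewrite sumr_const [X in _ + X](eq_bigr (fun=> phi)) => [|w /setDP[wN]]; last first.
  by rewrite inE wN /= /vertex_weight => /negPf->.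
by rewrite sumr_const mulr_natl cardsD (setIidPr full_sub).
Qed.

Definition contracts (phi lam : rat) (x y z : C) :=
  csum H' L (avoidr N z) * \sum_(w in N) vertex_weight phi H' w <=
  lam * vertex_weight phi H v *
    (csum H' L (avoidr N z) + \sum_(k in L v :\ x :\ y) csum H' L (avoidr N k)).

Section Conditions.
Variables (phi lam : rat) (x y z : C).
Hypotheses (phi_range : 0 <= phi <= 1) (lam_ge0 : 0 <= lam).
Local Notation K := (L v :\ x :\ y).
Local Notation Y := (lam * vertex_weight phi H v).

Lemma scaled_weight_ge0 : 0 <= Y.
Proof.
case/andP: phi_range => phi_ge0 _; apply: mulr_ge0 => //.
by rewrite /vertex_weight; case: ifP.
Qed.

(* P bounds the probability that no neighbour of v uses the colour z, and ga the
   expected number of colours of K that they leave unused. *)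
Lemma contracts_of_bounds (P ga : rat) :
  csum H' L (avoidr N z) <= P * ncol H' L ->
  ga * ncol H' L <= \sum_(k in K) csum H' L (avoidr N k) ->
  P * (#|full|%:R + (#|N| - #|full|)%:R * phi - Y) <= Y * ga ->
  contracts phi lam x y z.
Proof.
move=> avoid_z_le unused_ge numeric; rewrite /contracts sum_vertex_weight.
apply: le_scaled_sum avoid_z_le unused_ge numeric => //.
- exact: csum_avoidr_ge0.
- exact: scaled_weight_ge0.
- exact: ncol_ge0.
by apply: sumr_ge0 => k _; exact: csum_avoidr_ge0.
Qed.

Lemma contracts_avoidr (P : rat) (I : {set V}) (i m kap : nat) (A0 B0 : rat) :
  I \subset N -> independent e I -> #|I| = i -> (0 < m <= excess.+1)%N ->
  (kap + #|N| <= #|K| + i)%N -> power_minorant m i A0 B0 ->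
  csum H' L (avoidr N z) <= P * ncol H' L ->
  P * (#|full|%:R + (#|N| - #|full|)%:R * phi - Y) <= Y * (kap%:R * A0 - i%:R * B0) ->
  contracts phi lam x y z.
Proof.
move=> IN indep <- /andP[m_gt0 m_le] kap_le minorant avoid_z_le.
apply: contracts_of_bounds => //.
apply: (sum_avoidr_ge c0 e_sym e_irr (m := m)) => //; first exact: subsetIl.
  move=> w /(subsetP IN) /(exposed_neighbour_list_large I); apply: leq_trans.
  by rewrite leq_add2r.
by rewrite cardsD (setIidPr IN) addnBA ?subset_leq_card // leq_subLR [leqRHS]addnC.
Qed.

Lemma vertex_weight_ge : phi <= vertex_weight phi H v.
Proof. by case/andP: phi_range => _ phi_le1; rewrite /vertex_weight; case: ifP. Qed.

Lemma trivial_numeric_bound (ga : rat) : 0 <= ga -> #|N|%:R <= lam * phi * (ga + 1) ->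
  1 * (#|full|%:R + (#|N| - #|full|)%:R * phi - Y) <= Y * ga.
Proof.
move=> ga_ge0 numeric; have full_le := subset_leq_card full_sub.
have [_ phi_le1] := andP phi_range; rewrite mul1r lerBlDr -{2}[Y]mulr1 -mulrDr.
apply: le_trans (_ : #|N|%:R <= _).
  by rewrite -{2}(subnKC full_le) natrD lerD2l ler_piMr.
apply: le_trans numeric _; rewrite ler_wpM2r ?addr_ge0 // ler_wpM2l //.
exact: vertex_weight_ge.
Qed.

Lemma contracts_independent (I : {set V}) (i m kap : nat) (A0 B0 : rat) :
  I \subset N -> independent e I -> #|I| = i -> (0 < m <= excess.+1)%N ->
  (kap + #|N| <= #|K| + i)%N -> power_minorant m i A0 B0 ->
  0 <= kap%:R * A0 - i%:R * B0 ->
  #|N|%:R <= lam * phi * (kap%:R * A0 - i%:R * B0 + 1) -> contracts phi lam x y z.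
Proof.
move=> IN indep cardI m_range kap_le minorant ga_ge0 numeric.
apply: (contracts_avoidr (P := 1) IN indep cardI m_range kap_le minorant).
  by rewrite mul1r csum_avoidr_le.
exact: trivial_numeric_bound.
Qed.

Lemma contracts_free (kap : nat) :
  (kap + #|N| <= #|K|)%N -> #|N|%:R <= lam * phi * (kap%:R + 1) -> contracts phi lam x y z.
Proof.
move=> kap_le numeric; apply: (contracts_of_bounds (P := 1) (ga := kap%:R)).
- by rewrite mul1r csum_avoidr_le.
- exact: (sum_avoidr_ge_free c0 e_sym e_irr L (subsetIl _ _) kap_le).
exact: trivial_numeric_bound (ler0n _ kap) numeric.
Qed.

End Conditions.
End Vertex.

Lemma spatial_mixing_of_contracts (phi lam : rat) :
  1 / 2 <= phi <= 1 -> 0 <= lam ->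
  (forall H L v x y z, v \in H -> ample H L -> surplus H L v ->
     contracts H L v phi lam x y z) ->
  spatial_mixing c0 e lat Delta (2 * Delta%:R) lam.
Proof.
case/andP=> phi_ge phi_le lam_ge0 all_contract.
apply: (@spatial_mixing_of_contraction _ _ c0 e lat Delta e_sym e_irr lat_sym e_lat
  Delta_lt (vertex_weight phi)) => //.
- by move=> H v; rewrite /vertex_weight; case: ifP => _; lra.
- by move=> H v; rewrite /vertex_weight; case: ifP => _; lra.
move=> H L v x y z L_ample vH Lv_surplus _ _ _ /=.
under [X in _ * (_ + X)]eq_bigr do rewrite ncol_forbid.
by rewrite ncol_forbid; exact: all_contract.
Qed.

End Local.
End LocalContraction.

Module DegreeMixing.
Import Colourings ListBounds SpatialMixing LocalContraction.
Import Order.TTheory GRing.Theory Num.Theory.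
Local Open Scope ring_scope.

Definition neighbourhoods_independent (V : finType) (lat : rel V) (n i : nat) :=
  forall v (A : {set V}), A \subset neighbours lat v -> #|A| = n ->
  exists I : {set V}, [/\ I \subset A, #|I| = i & independent lat I].

Lemma subset_of_card (T : finType) (A : {set T}) (i : nat) :
  (i <= #|A|)%N -> exists2 I : {set T}, I \subset A & #|I| = i.
Proof.
move=> iA; exists [set u in take i (enum A)].
  by apply/subsetP=> u; rewrite inE => /mem_take; rewrite mem_enum.
by rewrite cardsE (card_uniqP (take_uniq _ (enum_uniq _))) size_takel // -cardE.
Qed.

Definition triangle_free (T : Type) (lat : rel T) :=
  forall u v w, lat u v -> lat u w -> ~~ lat v w.

Lemma neighbourhoods_independent_triangle_free (V : finType) (lat : rel V) n i :
  triangle_free lat -> (i <= n)%N -> neighbourhoods_independent lat n i.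
Proof.
move=> no_triangle i_le v A /subsetP A_nbr cardA.
have [|I IA cardI] := @subset_of_card _ A i; first by rewrite cardA.
exists I; split=> //; apply/independentP=> u w /(subsetP IA)/A_nbr + /(subsetP IA)/A_nbr.
by rewrite !inE; exact: no_triangle.
Qed.

Lemma power_minorant_3_3 : power_minorant 3 3 (8/9) (2/3).
Proof. by do 3!(apply/power_minorantS; last lra); apply: power_minorant0; [apply/andP; split|]; lra. Qed.

Lemma power_minorant_3_3_small : power_minorant 3 3 (20/27) (4/9).
Proof. by do 3!(apply/power_minorantS; last lra); apply: power_minorant0; [apply/andP; split|]; lra. Qed.

Lemma power_minorant_5_3 : power_minorant 5 3 (112/125) (16/25).
Proof. by do 3!(apply/power_minorantS; last lra); apply: power_minorant0; [apply/andP; split|]; lra. Qed.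

Lemma power_minorant_5_2 : power_minorant 5 2 (24/25) (4/5).
Proof. by do 2!(apply/power_minorantS; last lra); apply: power_minorant0; [apply/andP; split|]; lra. Qed.

Section Degree.
Variables (V C : finType) (c0 : C) (e lat : rel V).
Hypotheses (e_sym : symmetric e) (e_irr : irreflexive e) (lat_sym : symmetric lat).
Hypothesis e_lat : subrel e lat.
Implicit Types (H A I : {set V}) (L M : V -> {set C}) (c : {ffun V -> C}).
Local Notation csum := (colouring_sum c0 e).
Local Notation ncol := (num_list_colourings c0 e).
Local Notation nbr := (neighbours e).
Local Notation edeg := (degree_in e).
Local Notation ldeg := (degree_in lat).

Lemma exposed_independent H v n i :
  neighbourhoods_independent lat n i -> #|(H :\ v) :&: nbr v| = n ->
  exists I, [/\ I \subset (H :\ v) :&: nbr v, #|I| = i & independent e I].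
Proof.
move=> lat_indep cardN; have [|I [IN cardI indep]] := lat_indep v _ _ cardN.
  by apply/subsetP=> w; rewrite !inE => /andP[_ /e_lat].
by exists I; split=> //; apply: sub_independent indep.
Qed.

Lemma spatial_mixing_equal_weights (n i m kap kap' : nat) (A0 B0 lam : rat)
    (Delta := n.+2) :
  (forall v, ldeg setT v <= Delta)%N -> neighbourhoods_independent lat n.+1 i ->
  (0 < m <= (#|C| - Delta).+1)%N -> power_minorant m i A0 B0 ->
  0 <= kap%:R * A0 - i%:R * B0 -> (kap < #|C| - Delta + i)%N -> (kap' < #|C| - Delta)%N ->
  0 <= lam -> n.+1%:R <= lam * (kap%:R * A0 - i%:R * B0 + 1) ->
  n%:R <= lam * (kap'%:R + 1) ->
  spatial_mixing c0 e lat Delta (2 * Delta%:R) lam.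
Proof.
move=> ldeg_le indep m_range minorant ga_ge0 kap_lt kap'_lt lam_ge0.
move=> bound_max bound_small; have Delta_lt : (Delta < #|C|)%N by move: kap'_lt; rewrite /Delta; clear; lia.
have phi_range : 0 <= (1 : rat) <= 1 by [].
apply: (spatial_mixing_of_contracts e_sym e_irr lat_sym e_lat Delta_lt ldeg_le
  (phi := 1) _ lam_ge0); first by apply/andP; split; lra.
move=> H L v x y z vH L_ample Lv_surplus.
have N_le := card_exposed_neighbours_le e_lat H v.
have deg_lt := surplus_degree_lt Lv_surplus.
have K_ge := card_listD2_ge Delta_lt Lv_surplus x y.
have [N_max|N_small] := eqVneq #|(H :\ v) :&: nbr v| n.+1.
  have [I [IN cardI I_indep]] := exposed_independent indep N_max.
  apply: (contracts_independent c0 e_sym e_irr lat_sym e_lat Delta_lt vH L_ample z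
    phi_range lam_ge0 IN I_indep cardI m_range _ minorant ga_ge0).
    by move: N_max N_le deg_lt K_ge kap_lt; rewrite /Delta; clear; lia.
  by rewrite N_max mulr1.
apply: (contracts_free c0 lat Delta e_sym e_irr z phi_range lam_ge0 (kap := kap')); first by move: N_le K_ge kap'_lt; rewrite /Delta; clear; lia.
rewrite mulr1; apply: le_trans bound_small; rewrite ler_nat.
by move: N_small N_le deg_lt; rewrite /Delta; clear; lia.
Qed.

Lemma spatial_mixing_degree3 :
  (forall v, ldeg setT v <= 3)%N -> triangle_free lat -> (5 <= #|C|)%N ->
  spatial_mixing c0 e lat 3 (2 * 3%:R) (9/10).
Proof.
move=> ldeg_le no_triangle C5.
apply: (spatial_mixing_equal_weights (kap := 3) (kap' := 1) ldeg_le
  (neighbourhoods_independent_triangle_free no_triangle (leqnn 2)) _ power_minorant_3_2) ;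
  by [lra|move: C5; clear; lia].
Qed.

Section DegreeFour.
Hypothesis ldeg_le : forall v, (ldeg setT v <= 4)%N.
Hypothesis no_triangle : triangle_free lat.

Lemma spatial_mixing_degree4_q7 :
  (7 <= #|C|)%N -> spatial_mixing c0 e lat 4 (2 * 4%:R) (499/500).
Proof.
move=> C7.
apply: (spatial_mixing_equal_weights (kap := 5) (kap' := 2) ldeg_le
  (neighbourhoods_independent_triangle_free no_triangle (leqnn 3)) _ power_minorant_3_3) ;
  by [lra|move: C7; clear; lia].
Qed.

Lemma csum_same_colour_le H L y1 y2 (m : nat) : y1 \in H -> y2 \in H -> y1 != y2 ->
  (m + edeg H y1 <= #|L y1|)%N ->
  m%:R * csum H L (fun c => (c y1 == c y2)%:R) <= ncol H L.
Proof.
move=> y1H y2H y12 L_large.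
rewrite (ncolD1 c0 e_sym e_irr _ y2H) (csumD1 c0 e_sym e_irr _ _ y2H) mulr_sumr.
apply: ler_sum => a _; rewrite (eq_csum_fun _ _ _ _ (g := has_colour y1 a)) => [|c].
  apply: (csum_has_colour_le c0 e_sym e_irr); first by rewrite !inE y12.
  by have := forbid_neighbours_slack e_sym L a y1 y2H; move: L_large; clear; lia.
by rewrite recolourE recolour_neq.
Qed.

(* Given the colours of y1 and y2, at most #|C| - 2 colours remain for w unless
   these two colours agree. *)
Lemma ncol_le_two_neighbours H L w y1 y2 : w \in H -> y1 != y2 ->
  y1 \in (H :\ w) :&: nbr w -> y2 \in (H :\ w) :&: nbr w ->
  ncol H L <= (#|C| - 2)%:R * ncol (H :\ w) L +
    csum (H :\ w) L (fun c => (c y1 == c y2)%:R).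
Proof.
move=> wH y12 y1N y2N; set N := (H :\ w) :&: nbr w in y1N y2N *.
apply: le_trans (_ : \sum_k csum (H :\ w) L (avoidr N k) <= _).
  rewrite (ncol_avoidr c0 e_sym e_irr _ wH) [leLHS]big_mkcond; apply: ler_sum => k _.
  by case: ifP => // _; exact: csum_avoidr_ge0.
rewrite -exchange_csum -csum_const -csumD; apply: ler_csum => c _.
apply: le_trans (_ : \sum_k (k \in ~: [set c y1; c y2])%:R <= _).
  apply: ler_sum => k _; rewrite ler_nat; case: (boolP (avoid N k c)) => // /forall_inP av.
  by rewrite !inE negb_or ![k == _]eq_sym !av.
rewrite -natr_sum -natrD ler_nat -big_mkcond sum1_card.
have := cardsC [set c y1; c y2]; rewrite cards2.
by case: (c y1 == c y2) => /=; lia.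
Qed.

Lemma csum_has_colour_ge_q6 H L w z : #|C| = 6%N -> w \in H -> z \in L w ->
  (forall y, y \in H :\ w -> e w y -> (3 + edeg (H :\ w) y <= #|L y|)%N) ->
  (edeg H w <= 3)%N -> 8/117 * ncol H L <= csum H L (has_colour w z).
Proof.
move=> C6 wH zL L_large deg_le; rewrite (csum_has_colour_avoidr c0 e_sym e_irr wH zL).
set N := (H :\ w) :&: nbr w; set n := ncol (H :\ w) L.
have n_ge0 : 0 <= n by exact: ncol_ge0.
have avoid_ge : (1 - 3%:R^-1) ^+ #|N| * n <= csum (H :\ w) L (avoidr N z).
  apply: (csum_avoidr_ge c0 e_sym e_irr (m := 3)) => [//||y]; first exact: subsetIl.
  by move=> /setIP[yH]; rewrite inE => ewy _; exact: L_large.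
have N_le : (#|N| <= 3)%N.
  by rewrite card_neighbours_in (leq_trans (degree_inS _ _ (subD1set _ _))).
have [N_le1|N_gt1] := leqP #|N| 1.
  have ncol_le : ncol H L <= #|C|%:R * n.
    rewrite (ncol_avoidr c0 e_sym e_irr _ wH) -/N.
    apply: le_trans (_ : \sum_(k in L w) n <= _).
      by apply: ler_sum => k _; exact: csum_avoidr_le.
    by rewrite sumr_const -(mulr_natl n) ler_wpM2r // ler_nat max_card.
  rewrite C6 in ncol_le.
  case: #|N| N_le1 avoid_ge => [|[|m]] m_le; last by discriminate m_le.
    by rewrite expr0; lra.
  by rewrite expr1; lra.
have /card_gt1P[y1 [y2 [y1N y2N y12]]] := N_gt1.
have ncol_le := ncol_le_two_neighbours L wH y12 y1N y2N; rewrite C6 -/n in ncol_le.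
have same_le : 3%:R * csum (H :\ w) L (fun c => (c y1 == c y2)%:R) <= n.
  have /setIP[y1H] := y1N; have /setIP[y2H _] := y2N; rewrite inE => ewy1.
  by apply: csum_same_colour_le => //; exact: L_large.
rewrite (_ : 6 - 2 = 4)%N // in ncol_le.
case: #|N| N_gt1 N_le avoid_ge => [|[|[|[|m]]]] m_gt1 m_le avoid_ge.
- by discriminate m_gt1.
- by discriminate m_gt1.
- by lra.
- by lra.
- by discriminate m_le.
Qed.

Lemma csum_avoidr_full_le_q6 H L v z : #|C| = 6%N ->
  v \in H -> ample_lists lat 4 H L -> surplus_list lat 4 H L v ->
  csum (H :\ v) L (avoidr ((H :\ v) :&: nbr v) z) <=
    (1 - 8/117) ^+ #|full_neighbours e lat 4 H v| * ncol (H :\ v) L.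
Proof.
move=> C6 vH L_ample Lv_surplus; have Delta_lt : (4 < #|C|)%N by rewrite C6.
apply: (csum_avoidr_full_le lat_sym e_lat Delta_lt vH L_ample Lv_surplus).
  by apply/andP; split; lra.
move=> w M w_full zM M_large; have wN := subsetP (full_sub _ _ _ _ _) w w_full.
have [wH wv evw lvw] := mem_exposed_neighbours e_lat wN.
apply: csum_has_colour_ge_q6 => //; first by rewrite !inE wv.
  move=> y yH ewy; have := M_large y yH ewy; rewrite C6; apply.
  rewrite !inE; apply/orP; right; apply: contraL (e_lat ewy) => /andP[_ /e_lat lvy].
  exact: no_triangle lvw lvy.
have /setIdP[_ /eqP full_degree] := w_full.
by have := degree_in_sub e_lat (H :\ v) w; rewrite full_degree.
Qed.

Lemma degree4_numeric (R : realFieldType) (j : nat) : (j <= 3)%N ->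
  (1 - 8/117) ^+ j * (j%:R + (3 - j)%:R * (31/36) - 499/500) <=
  499/500 * (4 * (20/27) - 3 * (4/9)) :> R.
Proof.
by case: j => [|[|[|[|j]]]] j_le; [..|discriminate j_le]; rewrite ?subSS ?subn0; lra.
Qed.

Lemma spatial_mixing_degree4_q6 :
  #|C| = 6%N -> spatial_mixing c0 e lat 4 (2 * 4%:R) (499/500).
Proof.
move=> C6; have Delta_lt : (4 < #|C|)%N by rewrite C6.
have phi_range : 0 <= (31/36 : rat) <= 1 by apply/andP; split; lra.
have lam_ge0 : 0 <= 499/500 :> rat by lra.
apply: (spatial_mixing_of_contracts e_sym e_irr lat_sym e_lat Delta_lt ldeg_le
  (phi := 31/36) _ lam_ge0); first by apply/andP; split; lra.
move=> H L v x y z vH L_ample Lv_surplus; set N := (H :\ v) :&: nbr v.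
have N_le := card_exposed_neighbours_le e_lat H v; rewrite -/N in N_le.
have deg_lt := surplus_degree_lt Lv_surplus.
have K_ge := card_listD2_ge Delta_lt Lv_surplus x y; rewrite C6 in K_ge.
have free := contracts_free (H := H) (L := L) (v := v) (x := x) (y := y) c0 lat 4 e_sym e_irr z
  phi_range lam_ge0.
have indep n : (n <= 3)%N -> #|N| = n ->
    exists I, [/\ I \subset N, #|I| = n & independent e I].
  by move=> _; apply/exposed_independent/neighbourhoods_independent_triangle_free.
have [N_le1|N_gt1] := leqP #|N| 1.
  apply: (free 1%N); rewrite -/N; first by move: K_ge N_le N_le1; clear; lia.
  have : #|N|%:R <= 1 :> rat by rewrite (ler_nat _ _ 1).
  by move=> /le_trans; apply; lra.
have [cardN|N_neq2] := eqVneq #|N| 2.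
  have [I [IN cardI I_indep]] := indep 2%N isT cardN.
  apply: (contracts_independent (kap := 3) c0 e_sym e_irr lat_sym e_lat Delta_lt vH
    L_ample z phi_range lam_ge0 IN I_indep cardI _ _ power_minorant_3_2);
    rewrite ?C6 -/N ?cardN; [by []| |lra|lra].
  by move: K_ge N_le; rewrite cardN; clear; lia.
have cardN : #|N| = 3%N by move: N_le N_gt1 N_neq2 deg_lt; clear; lia.
have [I [IN cardI I_indep]] := indep 3%N isT cardN.
apply: (contracts_avoidr (kap := 4) e_sym e_irr lat_sym e_lat Delta_lt vH L_ample
    phi_range lam_ge0 IN I_indep cardI _ _ power_minorant_3_3_small
    (csum_avoidr_full_le_q6 z C6 vH L_ample Lv_surplus));
  rewrite ?C6 -/N ?cardN; [by []| |].
  by move: K_ge N_le; rewrite cardN; clear; lia.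
have full_degree : ldeg H v == 4.-1 by rewrite eqn_leq -ltnS deg_lt -cardN.
have full_le := subset_leq_card (full_sub e lat 4 H v); rewrite -/N cardN in full_le.
by rewrite /vertex_weight full_degree mulr1; exact: (degree4_numeric rat full_le).
Qed.

Lemma spatial_mixing_degree4 :
  (6 <= #|C|)%N -> spatial_mixing c0 e lat 4 (2 * 4%:R) (499/500).
Proof.
rewrite leq_eqVlt => /orP[/eqP/esym|]; first exact: spatial_mixing_degree4_q6.
exact: spatial_mixing_degree4_q7.
Qed.

End DegreeFour.

Section DegreeSix.
Hypothesis ldeg_le : forall v, (ldeg setT v <= 6)%N.
Hypothesis indep5 : neighbourhoods_independent lat 5 3.
Hypothesis indep4 : neighbourhoods_independent lat 4 2.

Lemma spatial_mixing_degree6_q11 :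
  (11 <= #|C|)%N -> spatial_mixing c0 e lat 6 (2 * 6%:R) (99/100).
Proof.
move=> C11; apply: (spatial_mixing_equal_weights (kap := 7) (kap' := 4) ldeg_le indep5 _
  power_minorant_5_3) ;
  by [lra|move: C11; clear; lia].
Qed.

Lemma degree6_numeric5 (R : realFieldType) (j : nat) : (j <= 5)%N ->
  (1 - (1 - 5%:R^-1) ^+ 5 / 10%:R) ^+ j * (j%:R + (5 - j)%:R * (87/100) - 99/100) <=
  99/100 * (6 * (112/125) - 3 * (16/25)) :> R.
Proof.
by case: j => [|[|[|[|[|[|j]]]]]] j_le; [..|discriminate j_le]; rewrite ?subSS ?subn0; lra.
Qed.

Lemma degree6_numeric4 (R : realFieldType) (j : nat) : (j <= 4)%N ->
  (1 - (1 - 5%:R^-1) ^+ 5 / 10%:R) ^+ j *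
    (j%:R + (4 - j)%:R * (87/100) - 99/100 * (87/100)) <=
  99/100 * (87/100) * (5 * (24/25) - 2 * (4/5)) :> R.
Proof.
by case: j => [|[|[|[|[|j]]]]] j_le; [..|discriminate j_le]; rewrite ?subSS ?subn0; lra.
Qed.

Lemma spatial_mixing_degree6_q10 :
  #|C| = 10%N -> spatial_mixing c0 e lat 6 (2 * 6%:R) (99/100).
Proof.
move=> C10; have Delta_lt : (6 < #|C|)%N by rewrite C10.
have phi_range : 0 <= (87/100 : rat) <= 1 by apply/andP; split; lra.
have lam_ge0 : 0 <= 99/100 :> rat by lra.
apply: (spatial_mixing_of_contracts e_sym e_irr lat_sym e_lat Delta_lt ldeg_le
  (phi := 87/100) _ lam_ge0); first by apply/andP; split; lra.
move=> H L v x y z vH L_ample Lv_surplus; set N := (H :\ v) :&: nbr v.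
have N_le := card_exposed_neighbours_le e_lat H v; rewrite -/N in N_le.
have deg_lt := surplus_degree_lt Lv_surplus.
have K_ge := card_listD2_ge Delta_lt Lv_surplus x y; rewrite C10 in K_ge.
have free := contracts_free (H := H) (L := L) (v := v) (x := x) (y := y) c0 lat 6 e_sym e_irr z
  phi_range lam_ge0.
have avoid_le :=
  csum_avoidr_full_le_pow c0 e_sym e_irr lat_sym e_lat Delta_lt vH L_ample Lv_surplus z.
rewrite C10 in avoid_le.
have full_le := subset_leq_card (full_sub e lat 6 H v); rewrite -/N in full_le.
have [N_le3|N_gt3] := leqP #|N| 3.
  apply: (free 3%N); rewrite -/N; first by move: K_ge N_le N_le3; clear; lia.
  have : #|N|%:R <= 3 :> rat by rewrite (ler_nat _ _ 3).
  by move=> /le_trans; apply; lra.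
have [deg5|deg_neq5] := eqVneq (ldeg H v) 5.
  have weight1 : vertex_weight lat 6 (87/100) H v = 1 by rewrite /vertex_weight deg5.
  have [cardN|N_neq5] := eqVneq #|N| 5.
    have [I [IN cardI I_indep]] := exposed_independent indep5 cardN.
    apply: (contracts_avoidr (kap := 6) e_sym e_irr lat_sym e_lat Delta_lt vH L_ample
      phi_range lam_ge0 IN I_indep cardI _ _ power_minorant_5_3 avoid_le);
      rewrite ?C10 -/N ?cardN; [by []| |].
      by move: K_ge; rewrite deg5; clear; lia.
    rewrite cardN in full_le.
    by rewrite weight1 mulr1; exact: (degree6_numeric5 rat full_le).
  have cardN : #|N| = 4%N by move: N_le N_gt3 N_neq5; rewrite deg5; clear; lia.
  apply: (free 4%N); rewrite -/N cardN; last lra.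
  by move: K_ge; rewrite deg5; clear; lia.
have cardN : #|N| = 4%N by move: N_le N_gt3 deg_neq5 deg_lt; clear; lia.
have deg4 : ldeg H v = 4%N by move: N_le deg_lt deg_neq5; rewrite cardN; clear; lia.
have [I [IN cardI I_indep]] := exposed_independent indep4 cardN.
apply: (contracts_avoidr (kap := 5) e_sym e_irr lat_sym e_lat Delta_lt vH L_ample
  phi_range lam_ge0 IN I_indep cardI _ _ power_minorant_5_2 avoid_le);
  rewrite ?C10 -/N ?cardN; [by []| |].
  by move: K_ge; rewrite deg4; clear; lia.
by rewrite /vertex_weight deg4; rewrite cardN in full_le; exact: (degree6_numeric4 rat full_le).
Qed.

Lemma spatial_mixing_degree6 :
  (10 <= #|C|)%N -> spatial_mixing c0 e lat 6 (2 * 6%:R) (99/100).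
Proof.
rewrite leq_eqVlt => /orP[/eqP/esym|]; first exact: spatial_mixing_degree6_q10.
exact: spatial_mixing_degree6_q11.
Qed.

End DegreeSix.
End Degree.
End DegreeMixing.

Module PairProfiles.
Import Colourings ListBounds.
Import Order.TTheory GRing.Theory Num.Theory.
Local Open Scope ring_scope.

(* g k stands for the probability that the colour k is unused in a set of n <= 2
   vertices with lists of more than n colours. *)
Definition unused_profile (C : finType) (n : nat) (g : C -> rat) :=
  (forall k, n.+1%:R^-1 <= g k <= 1) /\ \sum_k (1 - g k) <= n%:R.

Section Profiles.
Variables (V C : finType) (c0 : C) (e : rel V).
Hypotheses (e_sym : symmetric e) (e_irr : irreflexive e).
Implicit Types (H A B : {set V}) (L M : V -> {set C}) (c : {ffun V -> C}).
Local Notation csum := (colouring_sum c0 e).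
Local Notation ncol := (num_list_colourings c0 e).
Local Notation nbr := (neighbours e).
Local Notation edeg := (degree_in e).

Definition separated A B := {in A & B, forall v w, ~~ e v w}.

Lemma separated_sym A B : separated A B -> separated B A.
Proof. by move=> sepAB v w vB wA; rewrite e_sym; exact: sepAB. Qed.

Lemma degree_in_setDU_separated H A B w : separated A B -> w \in A ->
  edeg (H :\: (A :|: B)) w = edeg (H :\: A) w.
Proof.
move=> sepAB wA; apply: eq_card => y; rewrite !inE.
by case yB: (y \in B); rewrite ?orbF //= (negPf (sepAB w y wA yB)) !andbF.
Qed.

Lemma csumM_separated L f g A B : [disjoint A & B] -> separated A B ->
  depends_on A f -> depends_on B g ->
  csum (A :|: B) L (fun c => f c * g c) = csum A L f * csum B L g.
Proof.
have [n] := ubnP #|B|; elim: n => // n IHn in L B g * => ltBn disAB sepAB f_on g_on.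
have [B0|/set0Pn[v vB]] := eqVneq B set0.
  rewrite B0 setU0 csum_set0 mulrC -csumZ; apply: eq_csum_fun => c.
  by rewrite mulrC; congr (_ * _); apply: g_on => w; rewrite B0 inE.
have vAB : v \in A :|: B by rewrite inE vB orbT.
have vA : v \notin A by rewrite (disjointFl disAB vB).
have ABv : (A :|: B) :\ v = A :|: (B :\ v).
  apply/setP=> w; rewrite !inE; case: eqVneq => [->|] //=; first by rewrite (negPf vA).
rewrite (csumD1 c0 e_sym e_irr _ _ vAB) (csumD1 c0 e_sym e_irr _ _ vB) mulr_sumr.
apply: eq_bigr => a _; rewrite ABv.
rewrite -(@eq_csum_lists _ _ c0 e A (forbid L (nbr v) a)) => [|w wA]; last first.
  by rewrite forbid_notin // inE e_sym sepAB.
rewrite -IHn //.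
- by apply: eq_csum_fun => c; rewrite (depends_on_recolour _ _ f_on vA).
- by move: ltBn; rewrite (cardsD1 v) vB.
- by apply: disjointWr disAB; exact: subD1set.
- by move=> x y xA /setD1P[_ yB]; exact: sepAB.
move=> c c' eq_cc'; apply: g_on => w wB; rewrite !ffunE; case: (eqVneq w v) => // wv.
by apply: eq_cc'; rewrite !inE wv.
Qed.

Lemma sum_unused_le A L :
  \sum_k (ncol A L - csum A L (avoidr A k)) <= #|A|%:R * ncol A L.
Proof.
rewrite sumrB sumr_const -(mulr_natl (ncol A L)).
have [A_le|A_gt] := leqP #|A| #|C|.
  have := @sum_avoidr_ge_free _ _ c0 e e_sym e_irr A L A setT (#|C| - #|A|) (subxx A).
  rewrite cardsT subnK // => /(_ (leqnn _)); rewrite natrB // mulrBl.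
  by rewrite (eq_bigl xpredT) => [|k]; rewrite ?inE //; lra.
apply: le_trans (_ : #|C|%:R * ncol A L <= _).
  by rewrite gerBl sumr_ge0 // => k _; exact: csum_avoidr_ge0.
by rewrite ler_wpM2r ?ncol_ge0 // ler_nat ltnW.
Qed.

Lemma ncol_set2 L v w : v != w -> ncol [set v; w] L =
  (#|L v| * #|L w|)%:R - (e v w * #|L v :&: L w|)%:R.
Proof.
move=> vw; rewrite (ncolD1 c0 e_sym e_irr _ (set21 v w)).
have -> : [set v; w] :\ v = [set w].
  by apply/setP=> u; rewrite !inE; case: eqVneq => [->|] //=; rewrite (negPf vw).
case: (boolP (e v w)) => evw; last first.
  rewrite mul0n subr0 natrM mulr_natl -sumr_const; apply: eq_bigr => a _.
  by rewrite ncol_set1 // forbid_notin // inE.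
rewrite (eq_bigr (fun a => #|L w|%:R - (a \in L w)%:R)) => [|a _]; last first.
  by rewrite ncol_set1 // forbid_in ?inE // (cardsD1 a (L w)) natrD addrAC subrr add0r.
rewrite sumrB sumr_const mul1n; congr (_ - _); first by rewrite natrM mulr_natl.
rewrite -natr_sum -big_mkcondr sum1_card; congr _%:R.
by apply: eq_card => a; rewrite inE.
Qed.

Lemma ncol_set2_le_avoid L v w k : v != w -> (2 < #|L v|)%N -> (2 < #|L w|)%N ->
  ncol [set v; w] L <= 3 * csum [set v; w] L (avoidr [set v; w] k).
Proof.
move=> vw Lv_large Lw_large; rewrite -ncol_forbid_sub // !ncol_set2 //.
rewrite !forbid_in ?set21 ?set22 // -setDIl.
rewrite mulrBr lerBlDr addrAC lerBrDr -!(natrM _ 3) -!natrD ler_nat.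
have := subset_leq_card (subsetIl (L v) (L w)).
have := subset_leq_card (subsetIr (L v) (L w)); move: Lv_large Lw_large.
rewrite (cardsD1 k (L v)) (cardsD1 k (L w)) (cardsD1 k (L v :&: L w)) inE.
set cv := #|L v :\ k|; set cw := #|L w :\ k|; set cvw := #|(L v :&: L w) :\ k|.
have product_ge : (2 <= cv -> 2 <= cw -> 2 * cv + 2 * cw <= cv * cw + 4)%N by clear; nia.
by case: (e v w); case: (k \in L v); case: (k \in L w) => /=; move: product_ge; clear; nia.
Qed.

Lemma ncol_le_avoid_pair H L A k : A \subset H -> #|A| = 2%N ->
  {in A, forall w, (2 + edeg (H :\: A) w < #|L w|)%N} ->
  ncol H L <= 3 * csum H L (avoidr A k).
Proof.
move=> AH card2 L_large; rewrite -subr_ge0 /num_list_colourings -csumZ -csumN -csumD.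
apply: (csum_restrict_ge0 e_sym e_irr AH) => [c c' eq_cc'|M M_large].
  by rewrite (depends_on_avoidr _ eq_cc').
rewrite csumD csumN csumZ subr_ge0.
have /cards2P[v [w [vw eqA]]] : #|A| == 2%N by rewrite card2.
have M_gt2 u : u \in A -> (2 < #|M u|)%N.
  by move=> uA; have [_] := M_large u uA; have := L_large u uA; clear; lia.
by rewrite eqA; apply: ncol_set2_le_avoid => //; apply: M_gt2; rewrite eqA !inE eqxx ?orbT.
Qed.

Lemma csum_avoidr_unused_profile A L (n : nat) : (#|A| <= n <= 2)%N ->
  0 < ncol A L -> {in A, forall w, (n < #|L w|)%N} ->
  unused_profile n (fun k => csum A L (avoidr A k) / ncol A L).
Proof.
case/andP=> A_le n_le2 ncol_pos L_large; have ncol_neq0 := lt0r_neq0 ncol_pos.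
split=> [k|]; last first.
  rewrite (eq_bigr (fun k => (ncol A L - csum A L (avoidr A k)) / ncol A L)) => [|k _].
    rewrite -mulr_suml ler_pdivrMr //; apply: le_trans (sum_unused_le A L) _.
    by rewrite ler_wpM2r ?ler_nat // ltW.
  by rewrite mulrBl divff.
apply/andP; split; last by rewrite ler_pdivrMr // mul1r csum_avoidr_le.
rewrite ler_pdivlMr // ler_pdivrMl ?ltr0n //.
case: (ltngtP #|A| 1%N) => [|A_gt1|/eqP/cards1P[v eqA]].
- rewrite ltnS leqn0 cards_eq0 => /eqP->; rewrite csum_avoidr_set0.
  by rewrite ler_peMl ?ncol_ge0 // ler1n.
- have card2 : #|A| = 2%N by move: A_le n_le2 A_gt1; clear; lia.
  have n2 : n = 2%N by move: A_le n_le2; rewrite card2; clear; lia.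
  have /cards2P[v [w [vw eqA]]] : #|A| == 2%N by rewrite card2.
  by rewrite n2 eqA; apply: ncol_set2_le_avoid; rewrite // -n2 L_large // eqA !inE eqxx ?orbT.
have Lv_large : (n < #|L v|)%N by apply: L_large; rewrite eqA set11.
rewrite eqA -ncol_forbid_sub // !ncol_set1 // forbid_in ?set11 // -natrM ler_nat.
rewrite eqA cards1 in A_le; move: A_le Lv_large; rewrite (cardsD1 k (L v)).
by case: (k \in L v) => /=; clear; nia.
Qed.

Section TwoBlocks.
Variables (A B : {set V}) (m n : nat) (coef : C -> C -> rat).
Hypotheses (disAB : [disjoint A & B]) (sepAB : separated A B).
Hypotheses (A_small : (#|A| <= m <= 2)%N) (B_small : (#|B| <= n <= 2)%N).
Hypothesis coef_ge0 : forall g h, unused_profile m g -> unused_profile n h ->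
  0 <= \sum_i \sum_j coef i j * (g i * h j).

Lemma ncol_small_gt0 (D : {set V}) (d : nat) L :
  (#|D| <= d)%N -> {in D, forall w, (d < #|L w|)%N} -> 0 < ncol D L.
Proof.
move=> D_le L_large; apply: (ncol_gt0 c0 e_sym e_irr) => v vD.
apply: leq_ltn_trans (L_large v vD); apply: leq_trans D_le.
by rewrite -(card_neighbours_in e) subset_leq_card // subsetIl.
Qed.

Lemma sum_csum_avoidr2_ge0_union L :
  {in A, forall w, (m < #|L w|)%N} -> {in B, forall w, (n < #|L w|)%N} ->
  0 <= \sum_i \sum_j coef i j * csum (A :|: B) L (fun c => avoidr A i c * avoidr B j c).
Proof.
move=> LA_large LB_large; have [A_le _] := andP A_small; have [B_le _] := andP B_small.
have ncolA_gt0 := ncol_small_gt0 A_le LA_large.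
have ncolB_gt0 := ncol_small_gt0 B_le LB_large.
have := coef_ge0 (csum_avoidr_unused_profile A_small ncolA_gt0 LA_large)
  (csum_avoidr_unused_profile B_small ncolB_gt0 LB_large).
rewrite -(pmulr_rge0 _ (mulr_gt0 ncolA_gt0 ncolB_gt0)) mulr_sumr => /le_trans; apply.
apply: ler_sum => i _; rewrite mulr_sumr; apply: ler_sum => j _.
rewrite csumM_separated //; try exact: depends_on_avoidr.
by rewrite le_eqVlt; apply/orP; left; apply/eqP; field; rewrite !gt_eqF.
Qed.

Lemma sum_csum_avoidr2_ge0 H L : A \subset H -> B \subset H ->
  {in A, forall w, (m + edeg (H :\: A) w < #|L w|)%N} ->
  {in B, forall w, (n + edeg (H :\: B) w < #|L w|)%N} ->
  0 <= \sum_i \sum_j coef i j * csum H L (fun c => avoidr A i c * avoidr B j c).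
Proof.
move=> AH BH LA_large LB_large; have ABH : A :|: B \subset H by rewrite subUset AH.
have csum_out (D : {set V}) M : \sum_i \sum_j coef i j *
      csum D M (fun c => avoidr A i c * avoidr B j c) =
    csum D M (fun c => \sum_i \sum_j coef i j * (avoidr A i c * avoidr B j c)).
  rewrite exchange_csum; apply: eq_bigr => i _; rewrite exchange_csum.
  by apply: eq_bigr => j _; rewrite csumZ.
rewrite csum_out; apply: (csum_restrict_ge0 e_sym e_irr ABH) => [c c' eq_cc'|M M_large].
  apply: eq_bigr => i _; apply: eq_bigr => j _; congr (_ * (_ * _)).
    by apply: depends_on_avoidr => w wA; apply: eq_cc'; rewrite inE wA.
  by apply: depends_on_avoidr => w wB; apply: eq_cc'; rewrite inE wB orbT.
rewrite -csum_out; apply: sum_csum_avoidr2_ge0_union => w wD.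
  have [|_] := M_large w; first by rewrite inE wD.
  by rewrite degree_in_setDU_separated //; have := LA_large w wD; clear; lia.
have [|_] := M_large w; first by rewrite inE wD orbT.
rewrite setUC degree_in_setDU_separated //; last exact: separated_sym.
by have := LB_large w wD; clear; lia.
Qed.

End TwoBlocks.

End Profiles.
End PairProfiles.

Module KagomeCosts.
Import Order.TTheory GRing.Theory Num.Theory.
Local Open Scope ring_scope.

Lemma mean3_range (R : realFieldType) (p q r f g h lo hi : R) :
  0 <= p -> 0 <= q -> 0 <= r -> lo <= f <= hi -> lo <= g <= hi -> lo <= h <= hi ->
  (p + q + r) * lo <= p * f + q * g + r * h <= (p + q + r) * hi.
Proof.
move=> p_ge0 q_ge0 r_ge0 /andP[lo_f f_hi] /andP[lo_g g_hi] /andP[lo_h h_hi].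
by rewrite !mulrDl; apply/andP; split; do 2?apply: lerD; exact: ler_wpM2l.
Qed.

Lemma mean_range (R : realFieldType) (I : finType) (K : {set I}) (W F : I -> R) (f lo hi : R) :
  (0 < #|K|)%N -> (forall i, 0 < W i) -> (forall i, lo * W i <= F i <= hi * W i) ->
  f * \sum_(i in K) W i = \sum_(i in K) F i -> lo <= f <= hi.
Proof.
move=> /card_gt0P[j jK] W_gt0 F_range f_mean.
have sum_gt0 : 0 < \sum_(i in K) W i.
  by rewrite (bigD1 j) //= ltr_pwDl // sumr_ge0 // => i _; exact: ltW.
rewrite -(ler_pM2r sum_gt0) -[f <= _](ler_pM2r sum_gt0) f_mean !mulr_sumr.
by apply/andP; split; apply: ler_sum => i _; have /andP[] := F_range i.
Qed.

Lemma dist_mean3 (R : realFieldType)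
    (s a b s' a' b' f g g' h h' lo hi Dg Dh ma mb : R) :
  s + a + b = 1 -> s' + a' + b' = 1 -> s <= s' -> 0 <= ma -> 0 <= mb ->
  ma <= a -> ma <= a' -> mb <= b -> mb <= b' ->
  lo <= f <= hi -> lo <= g <= hi -> lo <= g' <= hi -> lo <= h <= hi -> lo <= h' <= hi ->
  `|g - g'| <= Dg -> `|h - h'| <= Dh ->
  `|(s * f + a * g + b * h) - (s' * f + a' * g' + b' * h')| <=
  ma * Dg + mb * Dh + (1 - s - ma - mb) * (hi - lo).
Proof.
move=> sum1 sum1' ss' ma_ge0 mb_ge0 ma_a ma_a' mb_b mb_b' f_in g_in g_in' h_in h_in' Dg_ge Dh_ge.
have /andP[low high] : (1 - s - ma - mb) * lo <= 0 * f + (a - ma) * g + (b - mb) * h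
    <= (1 - s - ma - mb) * hi.
  have -> : 1 - s - ma - mb = 0 + (a - ma) + (b - mb) by rewrite -sum1; ring.
  by apply: mean3_range => //; rewrite subr_ge0.
have /andP[low' high'] : (1 - s - ma - mb) * lo <=
    (s' - s) * f + (a' - ma) * g' + (b' - mb) * h' <= (1 - s - ma - mb) * hi.
  have -> : 1 - s - ma - mb = (s' - s) + (a' - ma) + (b' - mb) by rewrite -sum1'; ring.
  by apply: mean3_range => //; rewrite subr_ge0.
have : `|ma * (g - g')| <= ma * Dg by rewrite normrM (ger0_norm ma_ge0) ler_wpM2l.
have : `|mb * (h - h')| <= mb * Dh by rewrite normrM (ger0_norm mb_ge0) ler_wpM2l.
rewrite !ler_norml => /andP[h_low h_high] /andP[g_low g_high].
by apply/andP; split; lra.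
Qed.

(* S is the weight of the pairs of colours that are possible whether x or y is
   forbidden, A and B that of the pairs which use the colour z in the first,
   respectively the second, vertex, and A' and B' that of those which use z'. *)
Definition linear5 (R : pzRingType) (k : R * R * R * R * R) (S A A' B B' : R) : R :=
  let: (k0, k1, k2, k3, k4) := k in k0 * S + k1 * A + k2 * A' + k3 * B + k4 * B'.

Definition weight_constraints (R : unitRingType) (m n : nat) : seq (R * R * R * R * R) :=
  match m, n with
  | 0, _ => [:: (5, -1, 0, -1, 0)]
  | 1, 1 => [:: (4, -1, 0, -1, 0)]
  | 1, _ => [:: (2, -1, 0, 0, 0); (3/2, 0, 0, -1, 0); (3/2, -1, 5/2, -1, 5/2);
                (77/80, -(5/8), 1, 0, 0)]
  | _, _ => [:: (3, -1, 0, -1, 0); (7, -8, 8, 0, 0); (7, 0, 0, -8, 8); (7, -8, 15, -8, 15)]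
  end.

Lemma weight_constraints_ge0 (R : realFieldType) (m n : nat) k :
  k \in weight_constraints R m n -> (0 <= k.1.1.2) && (0 <= k.2).
Proof.
apply/allP: k; rewrite /weight_constraints.
by case: m n => [|[|i]] [|[|j]]; rewrite /=; do ![apply/andP; split=> //]; lra.
Qed.

Definition mate_cost (R : unitRingType) (n : nat) : R :=
  match n with 0 => 0 | 1 => 61/100 | _ => 1 end.

Section Costs.
Variable R : realFieldType.
Implicit Types (m n : nat) (S A B a b s lo hi X : R).

Lemma mate_cost_ge0 n : 0 <= mate_cost R n.
Proof. by case: n => [|[|n]] /=; lra. Qed.

Lemma mate_cost_le1 n : mate_cost R n <= 1.
Proof. by case: n => [|[|n]] /=; lra. Qed.

Lemma normalized_cost_le m n s a a' b b' s' :
  (m <= n)%N -> (0 < n)%N -> (n <= 2)%N -> 0 <= a -> 0 <= a' -> 0 <= b -> 0 <= b' ->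
  s + a + b = 1 -> s' + a' + b' = 1 ->
  {in weight_constraints R m n, forall k, 0 <= linear5 k s a a' b b'} ->
  (m = 1%N -> n = 2%N -> 2 * s' <= 5 * s) -> (m = 2%N -> 8 * s' <= 15 * s) ->
  (1 - s - Num.min b b') * mate_cost R m + (1 - s - Num.min a a') * mate_cost R n <= 197/200.
Proof.
case: m => [|[|[|m]]]; case: n => [|[|[|n]]] //= _ _ _ a_ge0 a_ge0' b_ge0 b_ge0' sum1 sum1'
  /allP /=; rewrite ?andbT.
all: case: (lerP a a') => aa; case: (lerP b b') => bb; rewrite /linear5.
all: try (case/and4P=> c1 c2 c3 c4); try move=> c1; move=> ratio1 ratio2.
all: try have {}ratio1 := ratio1 erefl erefl; try have {}ratio2 := ratio2 erefl; lra.
Qed.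

Section Ratio.
Variables (m n : nat) (S A A' B B' : R).
Hypotheses (mn : (m <= n)%N) (n_gt0 : (0 < n)%N) (n_le2 : (n <= 2)%N).
Hypotheses (A_ge0 : 0 <= A) (A_ge0' : 0 <= A') (B_ge0 : 0 <= B) (B_ge0' : 0 <= B').
Hypothesis constraints : {in weight_constraints R m n, forall k, 0 <= linear5 k S A A' B B'}.

Lemma shared_weight_gt0 : 0 < S + A + B -> 0 < S.
Proof.
move=> total_gt0; move: constraints; rewrite /weight_constraints.
case: m n mn n_gt0 n_le2 => [|[|[|i]]] [|[|[|j]]] // _ _ _ /allP /=.
all: rewrite /linear5 ?andbT => con; try (case/and4P: con => c1 c2 c3 c4); lra.
Qed.

Hypotheses (S_gt0 : 0 < S) (total_le : S + A' + B' <= S + A + B).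
Local Notation Z := (S + A + B).
Local Notation Z' := (S + A' + B').

Lemma total_gt0 : 0 < Z. Proof. by rewrite -addrA ltr_wpDr // addr_ge0. Qed.
Lemma total_gt0' : 0 < Z'. Proof. by rewrite -addrA ltr_wpDr // addr_ge0. Qed.

Lemma normalize_le p q : p * Z <= q * Z' -> p * (S / Z') <= q * (S / Z).
Proof.
move=> pq; rewrite mulrCA [leRHS]mulrCA; apply: ler_wpM2l; first exact: ltW.
by rewrite ler_pdivrMr ?total_gt0' // mulrAC ler_pdivlMr ?total_gt0.
Qed.

Lemma normalized_constraints : {in weight_constraints R m n, forall k,
  0 <= linear5 k (S / Z) (A / Z) (A' / Z') (B / Z) (B' / Z')}.
Proof.
have inv_le : Z^-1 <= Z'^-1 by rewrite lef_pV2 ?posrE ?total_gt0 ?total_gt0'.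
have A_le : A' / Z <= A' / Z' by exact: ler_wpM2l.
have B_le : B' / Z <= B' / Z' by exact: ler_wpM2l.
move=> k k_in; have k_ge0 := constraints k_in.
have := weight_constraints_ge0 k_in; case: k k_ge0 {k_in} => [[[[k0 k1] k2] k3] k4].
rewrite /linear5 /= => k_ge0 /andP[k2_ge0 k4_ge0].
have := ler_wpM2l k2_ge0 A_le; have := ler_wpM2l k4_ge0 B_le.
have : 0 <= (k0 * S + k1 * A + k2 * A' + k3 * B + k4 * B') / Z.
  by rewrite divr_ge0 // ltW // total_gt0.
by rewrite !mulrDl -!mulrA; lra.
Qed.

(* The means of the marginals over the pairs of colours possible when z, respectively
   z', is allowed: f and f', g and g' are their means over the pairs counted in A, A',
   B and B'. *)
Lemma dist_pair_means X (F f f' g g' lo Df Dg : R) :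
  0 <= X -> lo * S <= F <= (lo + (Df + Dg)) * S ->
  lo <= f <= lo + (Df + Dg) -> lo <= f' <= lo + (Df + Dg) ->
  lo <= g <= lo + (Df + Dg) -> lo <= g' <= lo + (Df + Dg) ->
  `|f - f'| <= Df -> `|g - g'| <= Dg ->
  Df <= mate_cost R m * X -> Dg <= mate_cost R n * X ->
  `|(F + f * A + g * B) / Z - (F + f' * A' + g' * B') / Z'| <= 197/200 * X.
Proof.
move=> X_ge0 /andP[F_ge F_le] f_in f_in' g_in g_in' f_dist g_dist Df_le Dg_le.
have Z_gt0 := total_gt0; have Z_gt0' := total_gt0'.
set s := S / Z; set s' := S / Z'; set a := A / Z; set a' := A' / Z'.
set b := B / Z; set b' := B' / Z'; set ma := Num.min a a'; set mb := Num.min b b'.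
have sum1 : s + a + b = 1 by rewrite /s /a /b -!mulrDl divff // gt_eqF.
have sum1' : s' + a' + b' = 1 by rewrite /s' /a' /b' -!mulrDl divff // gt_eqF.
have div_ge0 : [/\ 0 <= a, 0 <= a', 0 <= b & 0 <= b'] by split; rewrite divr_ge0 // ltW.
have [a_ge0 a_ge0' b_ge0 b_ge0'] := div_ge0.
have ss' : s <= s' by rewrite /s /s' ler_pM2l // lef_pV2.
have mean_eq : (F + f * A + g * B) / Z = s * (F / S) + a * f + b * g.
  by rewrite /s /a /b; field; rewrite !gt_eqF.
have mean_eq' : (F + f' * A' + g' * B') / Z' = s' * (F / S) + a' * f' + b' * g'.
  by rewrite /s' /a' /b'; field; rewrite !gt_eqF.
have F_in : lo <= F / S <= lo + (Df + Dg) by rewrite ler_pdivlMr // ler_pdivrMr // F_ge.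
rewrite mean_eq mean_eq'.
apply: le_trans (dist_mean3 (ma := ma) (mb := mb) sum1 sum1' ss' _ _ _ _ _ _ F_in
  f_in f_in' g_in g_in' f_dist g_dist) _; rewrite ?le_min ?a_ge0 ?b_ge0 // ?ge_min ?lexx ?orbT //.
have cost_le : (1 - s - mb) * mate_cost R m + (1 - s - ma) * mate_cost R n <= 197/200.
  apply: (normalized_cost_le mn n_gt0 n_le2) sum1 sum1' normalized_constraints _ _ => //.
    move=> m1 n2; apply: normalize_le; move: constraints; rewrite m1 n2 => /allP /=.
    by rewrite /linear5 => /and4P[_ _ con _]; lra.
  move=> m2; apply: normalize_le; have n2 : n = 2%N.
    by apply/eqP; rewrite eqn_leq n_le2 -m2.
  move: constraints; rewrite m2 n2 => /allP /=.
  by rewrite /linear5 => /and5P[_ _ _ con _]; lra.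
have ma_le : ma <= a by rewrite /ma ge_min lexx.
have mb_le : mb <= b by rewrite /mb ge_min lexx.
have rest_b : 0 <= 1 - s - mb by lra.
have rest_a : 0 <= 1 - s - ma by lra.
have := ler_wpM2l rest_b Df_le; have := ler_wpM2l rest_a Dg_le.
by have := ler_wpM2r X_ge0 cost_le; lra.
Qed.

End Ratio.
End Costs.
End KagomeCosts.

Module KagomeWeights.
Import Colourings SpatialMixing PairProfiles KagomeCosts.
Import Order.TTheory GRing.Theory Num.Theory.
Local Open Scope ring_scope.

Section OneProfile.
Variables (C : finType) (n : nat) (g : C -> rat).
Hypothesis g_profile : unused_profile n g.
Implicit Types K L : {set C}.

Lemma unused_profileW m : (n <= m)%N -> unused_profile m g.
Proof.
have [g_range sum_le] := g_profile.
move=> nm; split=> [k|]; last by apply: le_trans sum_le _; rewrite ler_nat.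
have /andP[g_ge ->] := g_range k; rewrite andbT; apply: le_trans g_ge.
by rewrite lef_pV2 ?posrE ?ltr0n // ler_nat ltnS.
Qed.

Lemma unused_ge k : n.+1%:R^-1 <= g k.
Proof. by have [/(_ k)/andP[]] := g_profile. Qed.

Lemma unused_ge0 k : 0 <= g k.
Proof. by apply: le_trans (unused_ge k); rewrite invr_ge0. Qed.

Lemma unused_le1 k : g k <= 1.
Proof. by have [/(_ k)/andP[]] := g_profile. Qed.

Lemma sum_unused_ge0 K : 0 <= \sum_(k in K) g k.
Proof. by apply: sumr_ge0 => k _; exact: unused_ge0. Qed.

Lemma sum_unused_le K : \sum_(k in K) g k <= #|K|%:R.
Proof. by rewrite -sumr_const; apply: ler_sum => k _; exact: unused_le1. Qed.

Lemma sum_unused_ge_min K : #|K|%:R / n.+1%:R <= \sum_(k in K) g k.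
Proof. by rewrite mulr_natl -sumr_const; apply: ler_sum => k _; exact: unused_ge. Qed.

Lemma sum_unused_ge K : #|K|%:R - n%:R <= \sum_(k in K) g k.
Proof.
have [g_range sum_le] := g_profile; have : \sum_(k in K) (1 - g k) <= n%:R.
  apply: le_trans sum_le; rewrite [leLHS]big_mkcond; apply: ler_sum => k _.
  by case: ifP => // _; rewrite subr_ge0 unused_le1.
by rewrite sumrB sumr_const; lra.
Qed.

Lemma sum_unused_ge2 K x y : x != y -> x \notin K -> y \notin K ->
  #|K|%:R - n%:R + (1 - g x) + (1 - g y) <= \sum_(k in K) g k.
Proof.
move=> xy xK yK; have := sum_unused_ge (x |: (y |: K)).
by rewrite !big_setU1 ?inE ?negb_or ?xy //= !cardsU1 !inE negb_or xy xK yK /= !natrD; lra.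
Qed.

Lemma sum_neq_setD1 K (f : C -> rat) j : \sum_(k in K | k != j) f k = \sum_(k in K :\ j) f k.
Proof. by apply: eq_bigl => k; rewrite !inE andbC. Qed.

Definition value_in L (z : C) : rat := if z \in L then g z else 0.

Lemma value_in_ge0 L z : 0 <= value_in L z.
Proof. by rewrite /value_in; case: ifP => // _; exact: unused_ge0. Qed.

Lemma value_in_le1 L z : value_in L z <= 1.
Proof. by rewrite /value_in; case: ifP => // _; exact: unused_le1. Qed.

Lemma value_in_ge L z : z \in L -> n.+1%:R^-1 <= value_in L z.
Proof. by rewrite /value_in => ->; exact: unused_ge. Qed.

Section LargeList.
Variables (L : {set C}) (x y : C).
Hypotheses (xy : x != y) (L_large : (3 + n <= #|L|)%N).
Local Notation K := (L :\ x :\ y).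

Lemma card_listD2 : #|L| = ((x \in L) + (y \in L) + #|K|)%N.
Proof.
by rewrite (cardsD1 x) (cardsD1 y (L :\ x)) addnA !inE eq_sym xy.
Qed.

Lemma card_K_ge : (n < #|K|)%N.
Proof.
by move: card_listD2 L_large; case: (x \in L); case: (y \in L); clear; lia.
Qed.

Lemma sum_unused_other_ge j : n%:R / n.+1%:R <= \sum_(k in K | k != j) g k.
Proof.
rewrite sum_neq_setD1; apply: le_trans (sum_unused_ge_min _).
rewrite ler_wpM2r ?invr_ge0 // ler_nat.
by have := card_K_ge; rewrite (cardsD1 j K); case: (j \in K); clear; lia.
Qed.

Lemma sum_unused_other_ge1 z j : z \in [set x; y] -> z \notin L ->
  1 <= \sum_(k in K | k != j) g k.
Proof.
move=> z_xy zL; rewrite sum_neq_setD1; apply: le_trans (sum_unused_ge _).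
rewrite lerBrDr -(natrD _ 1 n) ler_nat; move: card_listD2 zL L_large; rewrite (cardsD1 j K).
by case/set2P: z_xy => ->; case: (j \in K); case: (x \in L); case: (y \in L) => //=; clear; lia.
Qed.

End LargeList.

Lemma sum_unused_full_ge x y z (K := [set: C] :\ x :\ y) : n = 2%N -> x != y ->
  z \in [set x; y] -> #|K|%:R - 1 - g z <= \sum_(k in K) g k.
Proof.
move=> n2 xy z_xy; have xK : x \notin K by rewrite !inE eqxx andbF.
have yK : y \notin K by rewrite !inE eqxx.
have := sum_unused_ge2 xy xK yK; rewrite n2; have := unused_le1 x; have := unused_le1 y.
by case/set2P: z_xy => ->; lra.
Qed.

End OneProfile.

Section WeightForms.
Variable C : finType.
Implicit Types (w : C -> C -> rat) (g h : C -> rat) (K L : {set C}) (form : (C -> C -> rat) -> rat).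

Definition off_diagonal K K' w := \sum_(i in K) \sum_(j in K' | j != i) w i j.

Definition row_in L K' z w := if z \in L then \sum_(j in K') w z j else 0.

Definition transpose w := fun i j => w j i.

Definition pair_total Lv Lw x y z w := let Kv := Lv :\ x :\ y in let Kw := Lw :\ x :\ y in
  off_diagonal Kv Kw w + row_in Lv Kw z w + row_in Lw Kv z (transpose w).

Lemma off_diagonal_transpose K K' w : off_diagonal K K' (transpose w) = off_diagonal K' K w.
Proof.
rewrite /off_diagonal (exchange_big_dep (mem K')) /=; last by move=> ? ? _ /andP[].
apply: eq_bigr => j jK'; apply: eq_bigl => i.
by rewrite jK' eq_sym.
Qed.

Lemma off_diagonal_range K K' w w' (lo hi : rat) :
  (forall i j, lo * w i j <= w' i j <= hi * w i j) ->
  lo * off_diagonal K K' w <= off_diagonal K K' w' <= hi * off_diagonal K K' w.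
Proof.
move=> w'_range; rewrite /off_diagonal !mulr_sumr.
by apply/andP; split; apply: ler_sum => i _; rewrite mulr_sumr; apply: ler_sum => j _;
  have /andP[] := w'_range i j.
Qed.

Lemma row_in_ge0 L K' z w : (forall i j, 0 <= w i j) -> 0 <= row_in L K' z w.
Proof. by move=> w_ge0; rewrite /row_in; case: ifP => // _; apply: sumr_ge0. Qed.

Lemma row_in_scale L K' z w w' (f : rat) :
  f * \sum_(j in K') w z j = \sum_(j in K') w' z j ->
  row_in L K' z w' = f * row_in L K' z w.
Proof. by move=> mean; rewrite /row_in; case: ifP => _; rewrite ?mulr0 ?mean. Qed.

Definition linear_form form := exists coef : C -> C -> rat,
  forall w, form w = \sum_i \sum_j coef i j * w i j.

Lemma linear_formD form form' : linear_form form -> linear_form form' ->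
  linear_form (fun w => form w + form' w).
Proof.
move=> [coef formE] [coef' formE']; exists (fun i j => coef i j + coef' i j) => w.
rewrite formE formE' -big_split; apply: eq_bigr => i _.
by rewrite -big_split; apply: eq_bigr => j _; rewrite mulrDl.
Qed.

Lemma linear_formZ (a : rat) form : linear_form form -> linear_form (fun w => a * form w).
Proof.
move=> [coef formE]; exists (fun i j => a * coef i j) => w; rewrite formE mulr_sumr.
by apply: eq_bigr => i _; rewrite mulr_sumr; apply: eq_bigr => j _; rewrite mulrA.
Qed.

Lemma linear_form_transpose form : linear_form form -> linear_form (form \o transpose).
Proof. by move=> [coef formE]; exists (transpose coef) => w; rewrite /= formE exchange_big. Qed.

Lemma linear_form_sum (P : C -> pred C) (K : pred C) :
  linear_form (fun w => \sum_(i | K i) \sum_(j | P i j) w i j).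
Proof.
exists (fun i j => (K i && P i j)%:R) => w; rewrite big_mkcond; apply: eq_bigr => i _.
case: (K i); last by rewrite big1 // => j _; rewrite mul0r.
by rewrite big_mkcond; apply: eq_bigr => j _; case: (P i j); rewrite ?mul1r ?mul0r.
Qed.

Lemma linear_form_off_diagonal K K' : linear_form (off_diagonal K K').
Proof. exact: linear_form_sum. Qed.

Lemma linear_form_row_in L K' z : linear_form (row_in L K' z).
Proof.
have [coef formE] := linear_form_sum (fun=> mem K') [pred i | (i == z) && (z \in L)].
exists coef => w; rewrite -formE /row_in; case: (z \in L); last by rewrite big1 => [|i]; rewrite /= ?andbF.
by rewrite [RHS](big_pred1 z) => [|i]; rewrite /= ?andbT.
Qed.

Lemma sum_pairs_split Lv Lw x y w : x != y ->
  \sum_(i in Lv :\ x) \sum_(j in Lw :\ x | j != i) w i j = pair_total Lv Lw x y y w.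
Proof.
move=> xy; rewrite /pair_total (sum_setD1_split Lv _ xy) sum_neq_setD1 addrAC; congr (_ + _).
rewrite (eq_bigr (fun i => \sum_(j in Lw :\ x :\ y | j != i) w i j +
    (if y \in Lw then w i y else 0))) => [|i /setD1P[iy _]]; last first.
  rewrite big_mkcondr (sum_setD1_split Lw _ xy) -big_mkcondr.
  by rewrite [y == i]eq_sym iy.
rewrite big_split /= /row_in /transpose; congr (_ + _).
by case: (y \in Lw); rewrite ?big1_eq.
Qed.

Lemma pair_totalC Lv Lw x y z w : pair_total Lv Lw x y z w = pair_total Lv Lw y x z w.
Proof. by rewrite /pair_total ![_ :\ x :\ y]setDDl ![_ :\ y :\ x]setDDl setUC. Qed.

(* The weights S, A, A', B and B' of KagomeCosts for the lists Lv and Lw of two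
   adjacent vertices, with z and z' ranging over the two forbidden colours x and y. *)
Definition pair_form (k : rat * rat * rat * rat * rat) (Lv Lw : {set C}) (x y z z' : C) w :=
  let Kv := Lv :\ x :\ y in let Kw := Lw :\ x :\ y in
  linear5 k (off_diagonal Kv Kw w) (row_in Lv Kw z w) (row_in Lv Kw z' w)
    (row_in Lw Kv z (transpose w)) (row_in Lw Kv z' (transpose w)).

Lemma linear_form_pair_form k Lv Lw x y z z' : linear_form (pair_form k Lv Lw x y z z').
Proof.
rewrite /pair_form /linear5; case: k => [[[[k0 k1] k2] k3] k4].
do !apply: linear_formD; apply: linear_formZ; [exact: linear_form_off_diagonal|..];
  by [exact: linear_form_row_in|exact/linear_form_transpose/linear_form_row_in].
Qed.

Lemma row_in_mul L K' z g h : row_in L K' z (fun i j => g i * h j) =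
  value_in g L z * \sum_(j in K') h j.
Proof. by rewrite /row_in /value_in; case: ifP => _; rewrite ?mul0r // mulr_sumr. Qed.

Lemma row_in_transpose_mul L K z g h : row_in L K z (transpose (fun i j => g i * h j)) =
  value_in h L z * \sum_(i in K) g i.
Proof.
rewrite -row_in_mul /row_in; case: ifP => // _.
by apply: eq_bigr => i _; rewrite /transpose mulrC.
Qed.

Lemma off_diagonal_mul_ge K K' g h (D : rat) : (forall i, 0 <= g i) ->
  (forall i, D <= \sum_(j in K' | j != i) h j) ->
  D * \sum_(i in K) g i <= off_diagonal K K' (fun i j => g i * h j).
Proof.
move=> g_ge0 D_le; rewrite mulrC mulr_suml; apply: ler_sum => i _.
by rewrite -mulr_sumr ler_wpM2l.
Qed.

Lemma off_diagonal_mulC K K' g h :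
  off_diagonal K K' (fun i j => g i * h j) = off_diagonal K' K (fun j i => h j * g i).
Proof.
rewrite -off_diagonal_transpose; apply: eq_bigr => j _; apply: eq_bigr => i _.
exact: mulrC.
Qed.

Lemma sum_sum_other_ge K K' g : (forall i, 0 <= g i) ->
  (#|K'|%:R - 1) * \sum_(i in K) g i <= \sum_(j in K') \sum_(i in K | i != j) g i.
Proof.
move=> g_ge0; rewrite mulrBl mul1r mulr_natl -sumr_const lerBlDr.
apply: le_trans (_ : \sum_(j in K') (\sum_(i in K | i != j) g i + (if j \in K then g j else 0)) <= _).
  apply: ler_sum => j _; case: ifP => jK; first by rewrite (bigD1 j) //= addrC.
  rewrite addr0 le_eqVlt; apply/orP; left; apply/eqP/eq_bigl => i.
  by case: (eqVneq i j) => [->|]; rewrite ?jK ?andbT.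
rewrite big_split lerD2l [leLHS]big_mkcond [leRHS]big_mkcond; apply: ler_sum => j _.
by case: ifP; case: ifP.
Qed.

(* Sum the products of the nonnegative h j - 1/3 and sum_(i != j) g i - 2/3. *)
Lemma off_diagonal_mul_ge_22 K K' g h : unused_profile 2 g -> unused_profile 2 h ->
  (2 < #|K|)%N -> (2 < #|K'|)%N ->
  2/3 * (\sum_(i in K) g i + \sum_(j in K') h j - 1) <= off_diagonal K K' (fun i j => g i * h j).
Proof.
move=> g_profile h_profile K_gt2 K'_gt2; rewrite off_diagonal_mulC.
set G := \sum_(i in K) g i; pose Gj j := \sum_(i in K | i != j) g i.
have Gj_ge j : 2/3 <= Gj j.
  rewrite /Gj sum_neq_setD1; apply: le_trans (sum_unused_ge_min g_profile _).
  rewrite ler_wpM2r // ler_nat; move: K_gt2; rewrite (cardsD1 j K).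
  by case: (j \in K); clear; lia.
have G_ge1 : 1 <= G.
  apply: le_trans (sum_unused_ge_min g_profile K).
  by rewrite ler_pdivlMr // mul1r ler_nat.
have K'_ge3 : 3 <= #|K'|%:R :> rat by rewrite (ler_nat _ 3).
have Gj_sum := sum_sum_other_ge K K' (unused_ge0 g_profile).
have : 0 <= \sum_(j in K') (h j - 3^-1) * (Gj j - 2/3).
  by apply: sumr_ge0 => j _; rewrite mulr_ge0 // subr_ge0 // (unused_ge h_profile).
have -> : \sum_(j in K') (h j - 3^-1) * (Gj j - 2/3) =
    off_diagonal K' K (fun j i => h j * g i) - 2/3 * (\sum_(j in K') h j) -
    3^-1 * (\sum_(j in K') Gj j) + #|K'|%:R * (2/9).
  rewrite !mulr_sumr -(sumr_const (mem K') (1 : rat)) mulr_suml -!sumrB -big_split /=.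
  by apply: eq_bigr => j _; rewrite -mulr_sumr -/(Gj j); field.
rewrite -/G in Gj_sum; have := mulr_ge0 (_ : 0 <= #|K'|%:R - 3) (_ : 0 <= G - 1).
by rewrite !subr_ge0 => /(_ K'_ge3 G_ge1); lra.
Qed.

End WeightForms.

Lemma two_two_gap (R : realFieldType) (S G H N q : R) :
  2/3 * (G + H - 1) <= S -> N - 1 - q <= G -> H <= N -> 3 <= N -> 1/3 <= q <= 1 -> 0 <= H ->
  8 * ((1 - q) * H) <= 7 * S.
Proof.
move=> S_ge G_ge H_le N_ge /andP[q_ge q_le] H_ge0.
have [q_small|q_large] := lerP q (5/12).
  by have : (1 - q) * H <= 2/3 * H; [apply: ler_wpM2r; lra|lra].
by have : (1 - q) * H <= 7/12 * H; [apply: ler_wpM2r; lra|lra].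
Qed.

Lemma two_two_ratio (R : realFieldType) (S G H N p q : R) :
  2/3 * (G + H - 1) <= S -> N - 1 - p <= G -> N - 1 - q <= H -> 3 <= N ->
  1/3 <= p <= 1 -> 1/3 <= q <= 1 -> 8 * (S + H + G) <= 15 * (S + p * H + q * G).
Proof.
move=> S_ge G_ge H_ge N_ge /andP[p_ge p_le] /andP[q_ge q_le].
have G_ge0 : 0 <= G by lra.
have H_ge0 : 0 <= H by lra.
have pH_ge (r : R) : r <= p -> r * H <= p * H by exact: ler_wpM2r.
have qG_ge (r : R) : r <= q -> r * G <= q * G by exact: ler_wpM2r.
have [p_small|/ltW/pH_ge p_large] := lerP p (8/15);
  have [q_small|/ltW/qG_ge q_large] := lerP q (8/15);
  by have := pH_ge _ p_ge; have := qG_ge _ q_ge; lra.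
Qed.

Section ProductWeights.
Variables (C : finType) (Lv Lw : {set C}) (x y z z' : C) (nv nw : nat) (g h : C -> rat).
Hypotheses (xy : x != y) (z_xy' : z' \in [set x; y]).
Hypotheses (g_profile : unused_profile nv g) (h_profile : unused_profile nw h).
Hypotheses (Lv_large : (3 + nv <= #|Lv|)%N) (Lw_large : (3 + nw <= #|Lw|)%N).
Local Notation Kv := (Lv :\ x :\ y).
Local Notation Kw := (Lw :\ x :\ y).
Local Notation G := (\sum_(i in Kv) g i).
Local Notation H := (\sum_(j in Kw) h j).
Local Notation S := (off_diagonal Kv Kw (fun i j => g i * h j)).
Local Notation gz := (value_in g Lv).
Local Notation hz := (value_in h Lw).

Let G_ge0 : 0 <= G := sum_unused_ge0 g_profile Kv.
Let H_ge0 : 0 <= H := sum_unused_ge0 h_profile Kw.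
Let gz_le1 u : gz u <= 1 := value_in_le1 g_profile Lv u.
Let hz_le1 u : hz u <= 1 := value_in_le1 h_profile Lw u.
Let gzH_le u : gz u * H <= H. Proof. by rewrite ler_piMl. Qed.
Let hzG_le u : hz u * G <= G. Proof. by rewrite ler_piMl. Qed.

Lemma off_diagonal_ge_first : nw%:R / nw.+1%:R * G <= S.
Proof.
apply: off_diagonal_mul_ge => [i|i]; first exact: (unused_ge0 g_profile).
exact: (sum_unused_other_ge h_profile xy Lw_large).
Qed.

Lemma off_diagonal_ge_second (D : rat) :
  (forall j, D <= \sum_(i in Kv | i != j) g i) -> D * H <= S.
Proof.
rewrite off_diagonal_mulC; apply: off_diagonal_mul_ge => j.
exact: (unused_ge0 h_profile).
Qed.

Lemma product_weights_0 : nv = 0%N -> (0 < nw)%N -> gz z * H + hz z * G <= 5 * S.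
Proof.
move=> nv0 nw_gt0; have nw_half : 1/2 <= nw%:R / nw.+1%:R :> rat.
  rewrite ler_pdivlMr // mulrAC mul1r ler_pdivrMr // -natrM ler_nat.
  by rewrite muln2 -addnn -addn1 leq_add2l.
have g1 i : g i = 1.
  apply/le_anti; rewrite (unused_le1 g_profile) /=.
  by apply: le_trans (unused_ge g_profile i); rewrite nv0 invr1.
have /card_gt0P[k kK] : (0 < #|Kv|)%N by apply: leq_ltn_trans (card_K_ge xy Lv_large).
have S_ge : \sum_(j in Kw | j != k) h j <= S.
  rewrite [leRHS](bigD1 k) //= -[leLHS]addr0 lerD //.
    by under [leRHS]eq_bigr do rewrite g1 mul1r.
  apply: sumr_ge0 => i _; apply: sumr_ge0 => j _.
  by rewrite mulr_ge0 ?(unused_ge0 g_profile) ?(unused_ge0 h_profile).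
have half_le := le_trans nw_half (sum_unused_other_ge h_profile xy Lw_large k).
have H_le : H <= \sum_(j in Kw | j != k) h j + 1.
  rewrite sum_neq_setD1; have [kKw|kKw] := boolP (k \in Kw).
    by rewrite (big_setD1 k kKw) /= addrC lerD2l (unused_le1 h_profile).
  have -> : Kw :\ k = Kw by apply/setDidPl; rewrite disjoint_sym disjoints1.
  by rewrite lerDl.
have G_le := le_trans (ler_wpM2r G_ge0 nw_half) off_diagonal_ge_first.
by have := gzH_le z; have := hzG_le z; lra.
Qed.

Lemma product_row_le : nv%:R / nv.+1%:R * (gz z * H) <= S.
Proof.
apply: le_trans (off_diagonal_ge_second (sum_unused_other_ge g_profile xy Lv_large)).
by rewrite ler_wpM2l ?divr_ge0.
Qed.

Lemma product_column_le : nw%:R / nw.+1%:R * (hz z * G) <= S.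
Proof. by apply: le_trans off_diagonal_ge_first; rewrite ler_wpM2l ?divr_ge0. Qed.

Section OneTwo.
Hypotheses (nv1 : nv = 1%N) (nw2 : nw = 2%N) (Lw_full : Lw = setT).

Lemma one_two_row : 1/2 * H <= gz z' * H \/ H <= S.
Proof.
have [zL|zL] := boolP (z' \in Lv); [left|right].
  by rewrite ler_wpM2r //; have := value_in_ge g_profile zL; rewrite nv1; lra.
rewrite -[H]mul1r; apply: off_diagonal_ge_second => j.
exact: (sum_unused_other_ge1 g_profile xy Lv_large _ z_xy' zL).
Qed.

Lemma product_weights_12_row : 5/8 * (gz z * H) <= 77/80 * S + gz z' * H.
Proof.
have S_ge := product_row_le; rewrite nv1 in S_ge; have := gzH_le z.
have row_ge0 : 0 <= gz z' * H by rewrite mulr_ge0 // (value_in_ge0 g_profile).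
have S_ge_H : 1/2 * H <= S.
  have := off_diagonal_ge_second (sum_unused_other_ge g_profile xy Lv_large).
  by rewrite nv1.
by case: one_two_row; lra.
Qed.

Lemma product_weights_12_total :
  2 * (S + gz z * H + hz z * G) <= 5 * (S + gz z' * H + hz z' * G).
Proof.
have S_ge_G := off_diagonal_ge_first; rewrite nw2 in S_ge_G.
have S_ge_H := off_diagonal_ge_second (sum_unused_other_ge g_profile xy Lv_large).
rewrite nv1 in S_ge_H; have := gzH_le z; have := hzG_le z.
have row_ge0 : 0 <= gz z' * H by rewrite mulr_ge0 // (value_in_ge0 g_profile).
have column_ge : 1/3 * G <= hz z' * G.
  rewrite ler_wpM2r //; have := @value_in_ge _ _ _ h_profile Lw z'.
  by rewrite nw2 Lw_full inE => /(_ isT); lra.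
by case: one_two_row; lra.
Qed.

End OneTwo.

Section TwoTwo.
Hypotheses (nv2 : nv = 2%N) (nw2 : nw = 2%N) (Lv_full : Lv = setT) (Lw_full : Lw = setT).
Local Notation N := (#|Kv|%:R : rat).

Let g2 : unused_profile 2 g. Proof. by rewrite -nv2. Qed.
Let h2 : unused_profile 2 h. Proof. by rewrite -nw2. Qed.

Lemma two_two_bounds : [/\ 2/3 * (G + H - 1) <= S, N - 1 - gz z' <= G,
  N - 1 - hz z' <= H & 3 <= N].
Proof.
have Kv_gt : (2 < #|Kv|)%N by have := card_K_ge xy Lv_large; rewrite nv2.
have Kw_gt : (2 < #|Kw|)%N by have := card_K_ge xy Lw_large; rewrite nw2.
split.
- exact: (off_diagonal_mul_ge_22 g2 h2).
- by rewrite /value_in Lv_full inE; exact: (sum_unused_full_ge g_profile nv2 xy).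
- rewrite /value_in Lv_full Lw_full inE; exact: (sum_unused_full_ge h_profile nw2 xy).
- by rewrite (ler_nat _ 3).
Qed.

Lemma two_two_value (f : C -> rat) L u : unused_profile 2 f -> L = setT ->
  1/3 <= value_in f L u <= 1.
Proof.
move=> f_profile ->; rewrite (value_in_le1 f_profile) andbT.
by have := @value_in_ge _ _ _ f_profile [set: C] u; rewrite inE => /(_ isT); lra.
Qed.

Lemma product_weights_22_total :
  8 * (S + gz z * H + hz z * G) <= 15 * (S + gz z' * H + hz z' * G).
Proof.
have [S_ge G_ge H_ge N_ge] := two_two_bounds.
have ratio := two_two_ratio S_ge G_ge H_ge N_ge (two_two_value z' g2 Lv_full)
  (two_two_value z' h2 Lw_full).
by have := gzH_le z; have := hzG_le z; lra.
Qed.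

Lemma product_weights_22_row : 8 * (gz z * H - gz z' * H) <= 7 * S.
Proof.
have [S_ge G_ge _ N_ge] := two_two_bounds.
have H_le : H <= N by have := sum_unused_le h_profile Kw; rewrite Lw_full Lv_full.
have gap := two_two_gap S_ge G_ge H_le N_ge (two_two_value z' g2 Lv_full) H_ge0.
by have := gzH_le z; lra.
Qed.

Lemma product_weights_22_column : 8 * (hz z * G - hz z' * G) <= 7 * S.
Proof.
have [S_ge _ H_ge N_ge] := two_two_bounds; rewrite [G + H]addrC in S_ge.
have G_le : G <= N := sum_unused_le g_profile Kv.
have gap := two_two_gap S_ge H_ge G_le N_ge (two_two_value z' h2 Lw_full) G_ge0.
by have := hzG_le z; lra.
Qed.

End TwoTwo.

Lemma pair_form_product_ge0 k : (nv <= nw)%N -> (0 < nw)%N -> (nw <= 2)%N ->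
  (nv = 2%N -> Lv = setT) -> (nw = 2%N -> Lw = setT) ->
  k \in weight_constraints rat nv nw ->
  0 <= pair_form k Lv Lw x y z z' (fun i j => g i * h j).
Proof.
move=> nvw nw_gt0 nw_le2 Lv_full Lw_full.
have weights_0 := @product_weights_0; have row_le := product_row_le.
have column_le := product_column_le.
rewrite /pair_form !row_in_mul !row_in_transpose_mul /linear5.
have [nv0|nv_neq0] := eqVneq nv 0%N.
  by rewrite nv0 inE => /eqP->; have := weights_0 nv0 nw_gt0; lra.
have [nw1|nw_neq1] := eqVneq nw 1%N.
  have nv1 : nv = 1%N by move: nvw nv_neq0; rewrite nw1; clear; lia.
  by rewrite nv1 nw1 in row_le column_le *; rewrite inE => /eqP->; lra.
have nw2 : nw = 2%N by move: nw_gt0 nw_le2 nw_neq1; clear; lia.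
have [nv1|nv_neq1] := eqVneq nv 1%N.
  have row := product_weights_12_row nv1; have total := product_weights_12_total nv1 nw2 (Lw_full nw2).
  by rewrite nv1 nw2 in row_le column_le *; rewrite !inE => /or4P[]/eqP->; lra.
have nv2 : nv = 2%N by move: nvw nv_neq0 nv_neq1; rewrite nw2; clear; lia.
have total := product_weights_22_total nv2 nw2 (Lv_full nv2) (Lw_full nw2).
have row := product_weights_22_row nv2 nw2 (Lv_full nv2) (Lw_full nw2).
have column := product_weights_22_column nv2 nw2 (Lv_full nv2) (Lw_full nw2).
by rewrite nv2 nw2 in row_le column_le *; rewrite !inE => /or4P[]/eqP->; lra.
Qed.

End ProductWeights.
End KagomeWeights.

Module KagomeMixing.
Import Colourings ListBounds SpatialMixing PairProfiles KagomeCosts KagomeWeights.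
Import Order.TTheory GRing.Theory Num.Theory.
Local Open Scope ring_scope.

(* Every vertex lies in two triangles: tri b v names the one of kind b. *)
Definition triangle_adj (V : finType) (T : eqType) (tri : bool -> V -> T) : rel V :=
  fun v w => (v != w) && ((tri true v == tri true w) || (tri false v == tri false w)).

Definition mates (V : finType) (T : eqType) (tri : bool -> V -> T) b (H : {set V}) v :=
  [set w in H | (w != v) && (tri b w == tri b v)].

Section Triangles.
Variables (V C : finType) (c0 : C) (e : rel V) (T : eqType) (tri : bool -> V -> T).
Hypotheses (e_sym : symmetric e) (e_irr : irreflexive e).
Hypothesis e_adj : subrel e (triangle_adj tri).
Hypothesis Delta_lt : (4 < #|C|)%N.
Hypothesis mates_le2 : forall b v, (#|mates tri b setT v| <= 2)%N.
Hypothesis tri_inj : forall b v w, tri b v = tri b w -> tri (~~ b) v = tri (~~ b) w -> v = w.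
Hypothesis no_square : forall b v w x y, tri b v = tri b w -> v != w ->
  tri (~~ b) x = tri (~~ b) v -> x != v -> tri (~~ b) y = tri (~~ b) w -> y != w ->
  tri b x != tri b y.
Implicit Types (H P Q : {set V}) (L M : V -> {set C}) (c : {ffun V -> C}).
Local Notation lat := (triangle_adj tri).
Local Notation mates := (mates tri).
Local Notation csum := (colouring_sum c0 e).
Local Notation ncol := (num_list_colourings c0 e).
Local Notation nbr := (neighbours e).
Local Notation edeg := (degree_in e).
Local Notation ldeg := (degree_in lat).
Local Notation ample := (ample_lists lat 4).
Local Notation surplus := (surplus_list lat 4).
Local Notation prob := (marginal c0 e).
Local Notation ball := (ball e).

Lemma triangle_adj_sym : symmetric lat.
Proof.
by move=> v w; rewrite /lat eq_sym [tri true v == _]eq_sym [tri false v == _]eq_sym.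
Qed.

Lemma triangle_adjE b v w :
  lat v w = (v != w) && ((tri b v == tri b w) || (tri (~~ b) v == tri (~~ b) w)).
Proof. by rewrite /lat; case: b => //=; rewrite orbC. Qed.

Lemma mate_adj b H v w : w \in mates b H v -> lat v w.
Proof.
by rewrite inE (triangle_adjE b) => /and3P[_ wv /eqP->]; rewrite eq_sym wv eqxx.
Qed.

Lemma mates_disjoint b H H' v w : w \in mates b H v -> w \notin mates (~~ b) H' v.
Proof.
rewrite !inE => /and3P[_ wv /eqP tri_b]; apply/negP=> /and3P[_ _ /eqP tri_nb].
by rewrite (tri_inj tri_b tri_nb) eqxx in wv.
Qed.

Lemma degree_in_mates b H v : ldeg H v = (#|mates b H v| + #|mates (~~ b) H v|)%N.
Proof.
rewrite -cardsUI (_ : mates b H v :&: mates (~~ b) H v = set0) ?cards0 ?addn0.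
  apply: eq_card => w; rewrite !inE (triangle_adjE b) ![w == v]eq_sym ![_ == tri _ v]eq_sym.
  by case: (w \in H) => //=; case: (v != w).
apply/setP=> w; rewrite in_set0 inE; apply/negbTE/nandP.
by case: (boolP (w \in mates b H v)) => [/(@mates_disjoint _ _ H)|]; [right|left].
Qed.

Lemma card_mates_le2 b H v : (#|mates b H v| <= 2)%N.
Proof.
apply: leq_trans (mates_le2 b v); apply: subset_leq_card; apply/subsetP=> w.
by rewrite !inE => /andP[_].
Qed.

Definition linked b H v := mates b H v :&: nbr v.

Lemma linked_sub b H v : linked b H v \subset mates b H v. Proof. exact: subsetIl. Qed.

Lemma mem_linked b H v w : w \in linked b H v -> w \in mates b H v.
Proof. exact: subsetP (linked_sub b H v) w. Qed.

Lemma card_linked_le b H v : (#|linked b H v| <= #|mates b H v|)%N.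
Proof. exact: subset_leq_card (linked_sub b H v). Qed.

Lemma card_linked_le2 b H v : (#|linked b H v| <= #|linked b H v| <= 2)%N.
Proof. by rewrite leqnn (leq_trans (card_linked_le _ _ _)) ?card_mates_le2. Qed.

Lemma linkedP b H v w : w \in linked b H v -> [/\ w \in H, w != v, tri b w = tri b v & e v w].
Proof. by rewrite !inE => /andP[/and3P[-> -> /eqP->] ->]. Qed.

Lemma linked_sub_exposed b H v : linked b H v \subset H :\ v.
Proof. by apply/subsetP=> u /linkedP[uH uv _ _]; rewrite !inE uv. Qed.

Lemma exposed_linked b H v : (H :\ v) :&: nbr v = linked b H v :|: linked (~~ b) H v.
Proof.
apply/setP=> w; rewrite !inE; case evw: (e v w); rewrite ?andbF ?andbT //=.
have := e_adj evw; rewrite (triangle_adjE b) eq_sym => /andP[-> tri_eq].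
by case: (w \in H) => //=; move: tri_eq; rewrite ![_ == tri _ w]eq_sym => ->.
Qed.

Lemma linked_card_list b H L v w : ample H L -> v \in H -> w \in linked b H v ->
  (#|linked b H v| + edeg ((H :\ v) :\: linked b H v) w < #|L w|)%N.
Proof.
move=> L_ample vH w_linked; have [wH wv tri_w evw] := linkedP w_linked.
set P := linked b H v in w_linked *.
suff : (#|P| + edeg ((H :\ v) :\: P) w <= ldeg H w)%N.
  by have := L_ample w wH; move: Delta_lt; clear; lia.
have -> : #|P| = #|v |: (P :\ w)|.
  by rewrite cardsU1 (cardsD1 w P) w_linked !inE eqxx !andbF.
rewrite -cardsUI [X in (_ + X)%N](_ : _ = 0)%N ?addn0.
  apply: subset_leq_card; apply/subsetP=> u /setUP[|]; last first.
    by rewrite !inE => /andP[/andP[_ /andP[_ ->]]] /e_adj ->.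
  case/setU1P => [->|]; first by rewrite !inE vH triangle_adj_sym e_adj.
  case/setD1P => uw /linkedP[uH _ tri_u _]; rewrite !inE uH (triangle_adjE b) eq_sym uw.
  by rewrite tri_u tri_w eqxx.
apply/eqP; rewrite cards_eq0; apply/eqP/setP=> u; rewrite in_set0; apply/negP.
case/setIP=> u_left; rewrite inE => /andP[/setDP[/setD1P[uv _] uP] _].
by case/setU1P: u_left => [/eqP|/setD1P[_]]; [rewrite (negPf uv)|rewrite (negPf uP)].
Qed.

Definition triangle_part b (tau : T) H := [set w in H | tri b w == tau].

Lemma triangle_part_D1 b H v : triangle_part b (tri b v) (H :\ v) = mates b H v.
Proof. by apply/setP=> w; rewrite !inE andbA; case: (w == v); rewrite ?andbF ?andbT. Qed.

Lemma mem_triangle_part b tau H v : v \in triangle_part b tau H ->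
  v \in H /\ mates b H v = triangle_part b tau H :\ v.
Proof.
rewrite inE => /andP[vH /eqP tri_v]; split=> //.
by apply/setP=> w; rewrite !inE tri_v; case: (w == v); rewrite ?andbF.
Qed.

Definition triangle_weight P Q : rat :=
  if (#|P| <= 1)%N then 61/100 else if (Q == P) && independent e P then 1 else 99/100.

Lemma triangle_weight_ge P Q : 61/100 <= triangle_weight P Q.
Proof. by rewrite /triangle_weight; case: ifP => _; [|case: ifP => _]; lra. Qed.

Lemma triangle_weight_le1 P Q : triangle_weight P Q <= 1.
Proof. by rewrite /triangle_weight; case: ifP => _; [|case: ifP => _]; lra. Qed.

Lemma triangle_weight_ge0 P Q : 0 <= triangle_weight P Q.
Proof. by have := triangle_weight_ge P Q; lra. Qed.

Lemma surplus_mates b H L v w :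
  ample H L -> v \in H -> w \in mates b H v -> surplus (H :\ v) L w.
Proof.
move=> L_ample vH w_mate; have lvw := mate_adj w_mate; move: w_mate; rewrite inE => /andP[wH _].
exact: (surplusD1_neighbour triangle_adj_sym Delta_lt L_ample vH wH lvw).
Qed.

Lemma card_listD2_mates b H L v x y : surplus H L v ->
  (#|mates b H v| + #|mates (~~ b) H v| <= #|L v :\ x :\ y|)%N.
Proof.
rewrite /surplus_list (degree_in_mates b) (cardsD1 x (L v)) (cardsD1 y (L v :\ x)).
by case: (x \in L v); case: (y \in L v :\ x); move: Delta_lt; clear; lia.
Qed.

Variables (t : V) (k : C).

Definition triangle_mixing (r : nat) (X : rat) := forall H L b tau Q x y,
  (#|triangle_part b tau H| <= 2)%N -> Q \subset triangle_part b tau H -> ample H L ->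
  {in triangle_part b tau H, forall w, surplus H L w} ->
  {in Q, forall w, w \notin ball t r} ->
  `|prob H (forbid L Q x) t k - prob H (forbid L Q y) t k| <=
    X * triangle_weight (triangle_part b tau H) Q.

Section Step.
Variables (r : nat) (X : rat).
Hypotheses (X_ge0 : 0 <= X) (mixing_r : triangle_mixing r X).

Definition mates_bound b H v : rat :=
  if linked b H v == set0 then 0 else X * triangle_weight (mates b H v) (linked b H v).

Lemma mates_bound_ge0 b H v : 0 <= mates_bound b H v.
Proof. by rewrite /mates_bound; case: ifP => // _; rewrite mulr_ge0 ?triangle_weight_ge0. Qed.

Lemma mates_bound_le b H v : mates_bound b H v <= mate_cost rat #|mates b H v| * X.
Proof.
rewrite /mates_bound; case: ifPn => [_|/set0Pn[w /mem_linked w_mate]].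
  by rewrite mulr_ge0 ?mate_cost_ge0.
rewrite mulrC ler_wpM2r // /triangle_weight.
have : (0 < #|mates b H v|)%N by apply/card_gt0P; exists w.
by case: #|mates b H v| => [|[|n]] //= _; case: ifP => _; lra.
Qed.

Lemma mates_bound_leX b H v : mates_bound b H v <= X.
Proof.
by apply: le_trans (mates_bound_le b H v) _; rewrite ler_piMl // mate_cost_le1.
Qed.

Lemma forbid_linked_dist b H H1 M v x y : v \notin ball t r.+1 ->
  triangle_part b (tri b v) H1 = mates b H v -> ample H1 M ->
  {in mates b H v, forall w, surplus H1 M w} ->
  `|prob H1 (forbid M (linked b H v) x) t k - prob H1 (forbid M (linked b H v) y) t k|
    <= mates_bound b H v.
Proof.
move=> v_far part_eq M_ample M_surplus; rewrite /mates_bound.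
case: ifPn => [/eqP->|_]; first by rewrite !marginal_forbid_set0 subrr normr0.
rewrite -part_eq; apply: mixing_r; rewrite ?part_eq ?card_mates_le2 ?linked_sub //.
by move=> w /linkedP[_ _ _ evw]; exact: (notin_ball_edge e_sym evw).
Qed.

Lemma expose_dist b H L v x y : v \in H -> v \notin ball t r.+1 -> ample H L ->
  `|prob (H :\ v) (forbid L (nbr v) x) t k - prob (H :\ v) (forbid L (nbr v) y) t k| <=
    mates_bound b H v + mates_bound (~~ b) H v.
Proof.
move=> vH v_far L_ample; pose P b := linked b H v.
have two_steps a : prob (H :\ v) (forbid L (nbr v) a) t k =
    prob (H :\ v) (forbid (forbid L (P b) a) (P (~~ b)) a) t k.
  apply: eq_marginal => u uH; have /setP/(_ u) := exposed_linked b H v.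
  rewrite in_setI uH in_setU /= -/(P b) -/(P (~~ b)) => nbr_u.
  rewrite /forbid nbr_u; case: (u \in P b); case: (u \in P (~~ b)) => //=.
  by rewrite setDDl setUid.
have P_ample d a : ample (H :\ v) (forbid L (P d) a).
  apply: (ample_forbid Delta_lt) => [|w _ /mem_linked]; first exact: ampleD1.
  exact: surplus_mates.
have P_dist d a : `|prob (H :\ v) (forbid (forbid L (P d) a) (P (~~ d)) x) t k -
    prob (H :\ v) (forbid (forbid L (P d) a) (P (~~ d)) y) t k| <= mates_bound (~~ d) H v.
  apply: forbid_linked_dist => // [|w w_mate]; first exact: triangle_part_D1.
  apply: surplus_forbid; last exact: surplus_mates w_mate.
  by apply: contra (mates_disjoint H w_mate) => /mem_linked; rewrite negbK.
have swap a a' : prob (H :\ v) (forbid (forbid L (P (~~ b)) a) (P b) a') t k =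
    prob (H :\ v) (forbid (forbid L (P b) a') (P (~~ b)) a) t k.
  by apply: eq_marginal => u _; exact: forbid_comm.
have := P_dist (~~ b) y; rewrite negbK (swap y x) (swap y y) !two_steps => dist_b.
by rewrite [leRHS]addrC; apply: le_trans (ler_distD _ _ _) (lerD (P_dist b x) dist_b).
Qed.

Lemma forbid1_dist b H L v x y (ga rho : rat) :
  v \in H -> v \notin ball t r.+1 -> ample H L -> surplus H L v -> x != y ->
  0 <= ga -> rho * (1 + ga) = 1 ->
  ga * ncol (H :\ v) L <=
    \sum_(a in L v :\ x :\ y) csum (H :\ v) L (avoidr ((H :\ v) :&: nbr v) a) ->
  `|prob H (forbid L [set v] x) t k - prob H (forbid L [set v] y) t k| <=
    rho * (mates_bound b H v + mates_bound (~~ b) H v).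
Proof.
move=> vH v_far L_ample Lv_surplus xy ga_ge0 rho_eq unused_ge.
have -> : rho = (1 + ga)^-1.
  by rewrite -[LHS](@mulfK _ (1 + ga)) ?rho_eq ?mul1r // gt_eqF // ltr_pwDl.
rewrite mulrC; have vt : v != t by exact: notin_ball_neq v_far.
apply: (marginal_forbid1_dist_unused e_sym e_irr triangle_adj_sym e_adj Delta_lt vH vt L_ample
  Lv_surplus _ xy ga_ge0 unused_ge) => a a'.
exact: expose_dist.
Qed.

Section Lone.
Variables (b : bool) (H : {set V}) (L : V -> {set C}) (v : V) (x y : C).
Hypotheses (vH : v \in H) (v_far : v \notin ball t r.+1) (xy : x != y).
Hypotheses (L_ample : ample H L) (Lv_surplus : surplus H L v).
Hypothesis lone : linked b H v = set0.
Local Notation K := (L v :\ x :\ y).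
Local Notation Q := (linked (~~ b) H v).
Local Notation Bd := (mates_bound (~~ b) H v).
Local Notation dist := `|prob H (forbid L [set v] x) t k - prob H (forbid L [set v] y) t k|.

Lemma lone_dist (ga rho : rat) : 0 <= ga -> rho * (1 + ga) = 1 ->
  ga * ncol (H :\ v) L <= \sum_(a in K) csum (H :\ v) L (avoidr Q a) -> dist <= rho * Bd.
Proof.
have Q_exposed : (H :\ v) :&: nbr v = Q by rewrite (exposed_linked b) lone set0U.
rewrite -Q_exposed => ga_ge0 rho_eq.
move=> /(forbid1_dist b vH v_far L_ample Lv_surplus xy ga_ge0 rho_eq).
by rewrite {1}/mates_bound lone eqxx add0r.
Qed.

Lemma lone_dist_trivial : dist <= Bd.
Proof.
rewrite -[leRHS]mul1r; apply: (lone_dist (ga := 0)) => //.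
by rewrite mul0r; apply: sumr_ge0 => a _; exact: csum_avoidr_ge0.
Qed.

Lemma lone_dist_spare : (#|mates (~~ b) H v| < #|K|)%N -> dist <= 1/2 * Bd.
Proof.
move=> K_gt; apply: (lone_dist (ga := 1)); [by []|by lra|].
apply: (sum_avoidr_ge_free c0 e_sym e_irr L (kap := 1)).
  exact: linked_sub_exposed.
by rewrite add1n; apply: leq_ltn_trans K_gt; exact: card_linked_le.
Qed.

Lemma lone_dist_independent :
  (2 < #|K|)%N -> #|Q| = 2%N -> independent e Q -> dist <= 3/7 * Bd.
Proof.
move=> K_gt2 cardQ Q_indep.
apply: (lone_dist (ga := 3%:R * (4/9) - 2%:R * 0)); [lra|lra|].
rewrite -[X in _ - X%:R * _]cardQ; apply: (sum_avoidr_ge c0 e_sym e_irr (m := 3)).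
- exact: subxx.
- exact: linked_sub_exposed.
- exact: Q_indep.
- by [].
- by move=> w /(linked_card_list L_ample vH); rewrite cardQ.
- by rewrite setDv cards0 addn0.
by rewrite cardQ; exact: power_minorant_3_2.
Qed.

Lemma lone_dist_two : (1 < #|K|)%N -> #|mates (~~ b) H v| = 2%N -> dist <= 3/5 * Bd.
Proof.
move=> K_gt1 card_mates; apply: (lone_dist (ga := 2/3)); [lra|lra|].
have ncol_pos : 0 <= ncol (H :\ v) L by exact: ncol_ge0.
have := card_linked_le (~~ b) H v; rewrite card_mates leq_eqVlt => /orP[/eqP cardQ|cardQ_lt].
  apply: le_trans (_ : \sum_(a in K) ncol (H :\ v) L / 3 <= _).
    rewrite sumr_const -mulr_natl.
    have : 2%:R * ncol (H :\ v) L <= #|K|%:R * ncol (H :\ v) L by rewrite ler_wpM2r ?ler_nat.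
    by lra.
  apply: ler_sum => a _; rewrite ler_pdivrMr // mulrC.
  apply: (ncol_le_avoid_pair c0 e_sym e_irr) => // [|w]; first exact: linked_sub_exposed.
  by move=> /(linked_card_list L_ample vH); rewrite cardQ.
apply: le_trans (_ : 1 * ncol (H :\ v) L <= _); first by apply: (ler_wpM2r ncol_pos); lra.
apply: (sum_avoidr_ge_free c0 e_sym e_irr L (kap := 1)); first exact: linked_sub_exposed.
by rewrite add1n; apply: leq_trans K_gt1.
Qed.

Lemma lone_dist_one : (0 < #|K|)%N -> (#|mates (~~ b) H v| <= 1)%N -> dist <= 2/3 * Bd.
Proof.
move=> K_gt0 mates_le1; have Q_le1 := leq_trans (card_linked_le (~~ b) H v) mates_le1.
apply: (lone_dist (ga := 1%:R * (1/2) - #|Q|%:R * 0)); [lra|lra|].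
apply: (sum_avoidr_ge c0 e_sym e_irr (m := 2)).
- exact: subxx.
- exact: linked_sub_exposed.
- exact: independent_card_le1.
- by [].
- move=> w wQ; have := linked_card_list L_ample vH wQ.
  have : (0 < #|Q|)%N by apply/card_gt0P; exists w.
  by move: Q_le1; clear; lia.
- by rewrite setDv cards0 addn0.
exact: power_minorantW Q_le1 power_minorant_2_1.
Qed.

End Lone.

Lemma single_vertex_dist b tau H L v x y :
  triangle_part b tau H = [set v] -> ample H L -> surplus H L v ->
  v \notin ball t r.+1 -> x != y ->
  `|prob H (forbid L [set v] x) t k - prob H (forbid L [set v] y) t k| <= 3/5 * X.
Proof.
move=> part_eq L_ample Lv_surplus v_far xy.
have [vH mates_eq] : v \in H /\ mates b H v = triangle_part b tau H :\ v.
  by apply: mem_triangle_part; rewrite part_eq set11.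
have mates0 : mates b H v = set0 by rewrite mates_eq part_eq setDv.
have lone : linked b H v = set0 by rewrite /linked mates0 set0I.
have K_ge := card_listD2_mates b x y Lv_surplus; rewrite mates0 cards0 add0n in K_ge.
have := mates_bound_le (~~ b) H v; have := card_mates_le2 (~~ b) H v; have X_nonneg := X_ge0.
case cardM: #|mates (~~ b) H v| => [|[|[|n]]] M_le2; last (by discriminate M_le2);
  rewrite /mate_cost => bound_le.
- by apply: le_trans (lone_dist_trivial vH v_far xy L_ample Lv_surplus lone) _; lra.
- rewrite cardM in K_ge; have M_le1 : (#|mates (~~ b) H v| <= 1)%N by rewrite cardM.
  by apply: le_trans (lone_dist_one vH v_far xy L_ample Lv_surplus lone K_ge M_le1) _; lra.
rewrite cardM in K_ge.
by apply: le_trans (lone_dist_two vH v_far xy L_ample Lv_surplus lone K_ge cardM) _; lra.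
Qed.

Section TwoVertices.
Variables (b : bool) (tau : T) (H : {set V}) (L : V -> {set C}) (v w : V) (x y : C).
Hypotheses (part_eq : triangle_part b tau H = [set v; w]) (vw : v != w) (xy : x != y).
Hypotheses (L_ample : ample H L) (Lv_surplus : surplus H L v).
Hypothesis v_far : v \notin ball t r.+1.
Local Notation dist := `|prob H (forbid L [set v] x) t k - prob H (forbid L [set v] y) t k|.

Lemma triangle_part2 : [/\ v \in H, w \in H & mates b H v = [set w]].
Proof.
have [|vH mates_eq] := @mem_triangle_part b tau H v; first by rewrite part_eq set21.
have [|wH _] := @mem_triangle_part b tau H w; first by rewrite part_eq set22.
split=> //; rewrite mates_eq part_eq; apply/setP=> u; rewrite !inE.
by case: (eqVneq u v) => [->|] //=; rewrite (negPf vw).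
Qed.

Lemma nonadjacent_vertex_dist : ~~ e v w -> dist <= 99/200 * X.
Proof.
move=> evw; have [vH _ mates1] := triangle_part2; have X_nonneg := X_ge0.
have lone : linked b H v = set0.
  apply/setP=> u; rewrite /linked mates1 in_set0 inE in_set1 inE.
  by case: eqP => // ->; exact: negbTE.
have K_ge := card_listD2_mates b x y Lv_surplus; rewrite mates1 cards1 add1n in K_ge.
have [|not_full] := boolP ((linked (~~ b) H v == mates (~~ b) H v) &&
    independent e (mates (~~ b) H v) && (#|mates (~~ b) H v| == 2%N)).
  case/andP=> /andP[/eqP linked_eq indep] /eqP cardM; rewrite cardM in K_ge.
  have := @lone_dist_independent _ _ _ _ _ _ vH v_far xy L_ample Lv_surplus lone K_ge.
  rewrite linked_eq => /(_ cardM indep) /le_trans; apply.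
  by have := mates_bound_leX (~~ b) H v; lra.
apply: le_trans (lone_dist_spare vH v_far xy L_ample Lv_surplus lone K_ge) _.
suff : mates_bound (~~ b) H v <= 99/100 * X by lra.
rewrite /mates_bound; case: ifP => _; first by lra.
rewrite [leRHS]mulrC; apply: (ler_wpM2l X_ge0); rewrite /triangle_weight.
case: ifPn => [_|M_gt1]; first by lra.
case: ifP => [full|_]; last by lra.
have cardM : #|mates (~~ b) H v| == 2%N by rewrite eqn_leq card_mates_le2 ltnNge.
by rewrite full cardM in not_full.
Qed.

Lemma adjacent_vertex_dist : e v w -> surplus H L w -> dist <= 966/1000 * X.
Proof.
move=> evw Lw_surplus; have [vH wH mates1] := triangle_part2; have X_nonneg := X_ge0.
have linked1 : linked b H v = [set w].
  apply/setP=> u; rewrite /linked mates1 inE inE in_set1.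
  by case: eqP => // ->; rewrite inE evw.
have bound_b : mates_bound b H v <= 61/100 * X.
  by have := mates_bound_le b H v; rewrite mates1 cards1.
have := mates_bound_leX (~~ b) H v; have w_exposed : w \in (H :\ v) :&: nbr v.
  by rewrite (exposed_linked b) linked1 !inE eqxx.
have := @forbid1_dist b H L v x y (1%:R * (2/3) - 1%:R * 0) (3/5) vH v_far L_ample Lv_surplus xy.
move=> dist_le bound_nb; apply: le_trans (dist_le _ _ _) _; [by lra|by lra| |by lra].
rewrite -[X in _ - X%:R * _](cards1 w).
apply: (sum_avoidr_ge c0 e_sym e_irr (m := 3)); first by rewrite sub1set.
- exact: subsetIl.
- by apply: independent_card_le1; rewrite // cards1.
- by [].
- move=> u /set1P->; have := Lw_surplus; rewrite /surplus_list.
  have := degree_in_sub e_adj ((H :\ v) :\: [set w]) w.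
  have := degree_inS lat w (subsetDl (H :\ v) [set w]).
  rewrite (degree_inD1 _ w vH) triangle_adj_sym e_adj //; move: Delta_lt; clear; lia.
- rewrite (exposed_linked b) linked1 setDUl setDv set0U.
  have := card_listD2_mates b x y Lv_surplus; rewrite mates1 cards1.
  have := card_linked_le (~~ b) H v.
  by have := subset_leq_card (subsetDl (linked (~~ b) H v) [set w]); clear; lia.
by rewrite cards1; exact: power_minorant_3_1.
Qed.

End TwoVertices.

Definition pair_rest H v w := H :\ v :\ w.

Lemma pair_restC H v w : pair_rest H v w = pair_rest H w v.
Proof. by rewrite /pair_rest !setDDl setUC. Qed.

Definition pair_lists b H L v w (i j : C) :=
  forbid (forbid L (linked b H v) i) (linked b H w) j.

Lemma csum_pair_listsC b H L v w i j f :
  csum (pair_rest H v w) (pair_lists b H L v w i j) f =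
  csum (pair_rest H w v) (pair_lists b H L w v j i) f.
Proof. by rewrite pair_restC; apply: eq_csum_lists => u _; exact: forbid_comm. Qed.

Section Side.
Variables (b : bool) (tau : T) (H : {set V}) (L : V -> {set C}) (v w : V).
Hypotheses (part_eq : triangle_part b tau H = [set v; w]) (vw : v != w).
Hypotheses (L_ample : ample H L) (Lv_surplus : surplus H L v).
Local Notation rest := (pair_rest H v w).
Local Notation Qv := (linked (~~ b) H v).
Local Notation Qw := (linked (~~ b) H w).

Lemma same_triangle : tri b v = tri b w.
Proof.
have /setP part := part_eq; have := part v; have := part w.
by rewrite !inE !eqxx orbT => /andP[_ /eqP->] /andP[_ /eqP->].
Qed.

Lemma other_triangle_neq : tri (~~ b) v != tri (~~ b) w.
Proof. by apply: (contraNneq _ vw) => other_eq; apply/eqP/(tri_inj same_triangle). Qed.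

Lemma other_mates_rest u : u \in mates (~~ b) H v -> u \in rest /\ u \notin mates (~~ b) H w.
Proof.
rewrite !inE => /and3P[-> -> /eqP tri_u]; rewrite tri_u (negPf other_triangle_neq) !andbF !andbT.
split=> //.
by apply: contraNneq other_triangle_neq => uw; rewrite -tri_u uw.
Qed.

Lemma linked_rest : Qv \subset rest.
Proof. by apply/subsetP=> u /mem_linked/other_mates_rest[]. Qed.

Lemma other_mates_unlinked u : u \in mates (~~ b) H v -> u \notin Qw.
Proof. by move=> /other_mates_rest[_]; apply: contra; exact: mem_linked. Qed.

Lemma neighbours_rest u : u \in rest -> (u \in nbr v) = (u \in Qv).
Proof.
have [vH _ mates1] := triangle_part2 part_eq vw.
rewrite !inE => /and3P[uw uv uH]; have /setP/(_ u) := exposed_linked b H v.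
rewrite in_setU /linked mates1 !inE uH uv (negPf uw) /= => ->.
by case: (_ == _).
Qed.

Lemma surplus_rest u : u \in mates (~~ b) H v -> surplus rest L u.
Proof.
have [vH _ _] := triangle_part2 part_eq vw.
by move=> u_mate; apply/surplusD1/(surplus_mates L_ample vH u_mate).
Qed.

Lemma triangle_part_rest : triangle_part (~~ b) (tri (~~ b) v) rest = mates (~~ b) H v.
Proof.
apply/setP=> u; have := @other_mates_rest u; rewrite !inE.
case: (u \in H) => /=; rewrite ?andbF //; case: (u == v); rewrite ?andbF //= ?andbT.
by case: (tri _ u == _); rewrite ?andbF // => /(_ isT)[-> _].
Qed.

Lemma ample_rest : ample rest L.
Proof. by do 2!apply: ampleD1. Qed.

Lemma ample_rest_forbid i : ample rest (forbid L Qv i).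
Proof.
apply: (ample_forbid Delta_lt) => [|u _ /mem_linked]; first exact: ample_rest.
exact: surplus_rest.
Qed.

Lemma card_list_ge : (3 + #|mates (~~ b) H v| <= #|L v|)%N.
Proof.
have [_ _ mates1] := triangle_part2 part_eq vw; move: Lv_surplus.
by rewrite /surplus_list (degree_in_mates b) mates1 cards1; move: Delta_lt; clear; lia.
Qed.

Lemma list_full : #|mates (~~ b) H v| = 2%N -> L v = setT.
Proof.
have [_ _ mates1] := triangle_part2 part_eq vw.
move=> cardM; apply/eqP; rewrite eqEcard subsetT cardsT; move: Lv_surplus.
by rewrite /surplus_list (degree_in_mates b) mates1 cards1 cardM; clear; lia.
Qed.

End Side.

Section AdjacentPair.
Variables (b : bool) (tau : T) (H : {set V}) (L : V -> {set C}) (v w : V) (x y : C).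
Hypotheses (part_eq : triangle_part b tau H = [set v; w]) (vw : v != w) (evw : e v w).
Hypotheses (L_ample : ample H L) (Lv_surplus : surplus H L v) (Lw_surplus : surplus H L w).
Hypotheses (v_far : v \notin ball t r.+1) (w_far : w \notin ball t r.+1) (xy : x != y).
Local Notation rest := (pair_rest H v w).
Local Notation Qv := (linked (~~ b) H v).
Local Notation Qw := (linked (~~ b) H w).
Local Notation lists := (pair_lists (~~ b) H L v w).
Local Notation Kw := (L w :\ x :\ y).

Let part_eq' : triangle_part b tau H = [set w; v]. Proof. by rewrite setUC. Qed.
Let wv : w != v. Proof. by rewrite eq_sym. Qed.

Lemma ample_pair_lists i j : ample rest (lists i j).
Proof.
apply: (ample_forbid Delta_lt) => [|u _ uQw].
  exact: ample_rest_forbid part_eq vw L_ample i.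
have u_mate := mem_linked uQw; apply: surplus_forbid.
  by apply: contraTN uQw => /mem_linked; exact: other_mates_unlinked part_eq vw _.
rewrite pair_restC; exact: surplus_rest part_eq' wv L_ample _ u_mate.
Qed.

Lemma csum_forbid_pair f z : (forall c a, f (recolour c v a) = f c) ->
  (forall c a, f (recolour c w a) = f c) ->
  csum H (forbid L [set v; w] z) f =
  \sum_(i in L v :\ z) \sum_(j in L w :\ z | j != i) csum rest (lists i j) f.
Proof.
move=> f_v f_w; have [vH wH _] := triangle_part2 part_eq vw.
have wHv : w \in H :\ v by rewrite !inE wv.
rewrite (csumD1 c0 e_sym e_irr _ _ vH) forbid_in ?set21 //; apply: eq_bigr => i _.
rewrite (eq_csum_fun c0 e _ _ (fun c => f_v c i)) (csumD1 c0 e_sym e_irr _ _ wHv).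
rewrite forbid_in ?inE // forbid_in ?set22 //.
rewrite (eq_bigl (fun j => (j \in L w :\ z) && (j != i))) => [|j]; last by rewrite !inE andbC.
apply: eq_bigr => j _; rewrite (eq_csum_fun c0 e _ _ (fun c => f_w c j)).
apply: eq_csum_lists => u u_rest; rewrite /pair_lists /forbid.
rewrite (neighbours_rest part_eq vw u_rest).
have u_rest' : u \in pair_rest H w v by rewrite pair_restC.
rewrite (neighbours_rest part_eq' wv u_rest').
by move: u_rest; rewrite !inE => /and3P[/negPf-> /negPf-> _].
Qed.

Lemma pair_lists_dist_first i i' j :
  `|prob rest (lists i j) t k - prob rest (lists i' j) t k| <= mates_bound (~~ b) H v.
Proof.
have swap a : prob rest (lists a j) t k = prob rest (forbid (forbid L Qw j) Qv a) t k.
  by apply: eq_marginal => u _; exact: forbid_comm.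
rewrite !swap; apply: forbid_linked_dist => // [||u u_mate].
- exact: triangle_part_rest part_eq vw.
- by rewrite pair_restC; exact: ample_rest_forbid part_eq' wv L_ample j.
apply: surplus_forbid; last exact: surplus_rest part_eq vw L_ample _ u_mate.
exact: other_mates_unlinked part_eq vw _ u_mate.
Qed.

(* The vertex w is coloured from its list without x and y. *)
Lemma side_marginal : exists F : C -> rat,
  (forall z z', `|F z - F z'| <= mates_bound (~~ b) H v) /\
  (forall z, F z * \sum_(j in Kw) ncol rest (lists z j) =
             \sum_(j in Kw) csum rest (lists z j) (has_colour t k)).
Proof.
have [vH wH _] := triangle_part2 part_eq vw; have wHv : w \in H :\ v by rewrite !inE wv.
pose M := forbid (forbid L [set w] x) [set w] y.
have wQv : w \notin Qv.
  by apply/negP=> /(subsetP (linked_rest part_eq vw)); rewrite !inE eqxx.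
have M_out u : u != w -> M u = L u by move=> uw; rewrite /M !forbid_notin // inE.
have M_ample : ample (H :\ v) M.
  move=> u uHv; have [->|uw] := eqVneq u w; last first.
    by rewrite M_out //; exact: (ampleD1 L_ample uHv).
  rewrite /M !forbid_in ?set11 //; have := Lw_surplus.
  rewrite /surplus_list (degree_inD1 _ w vH) triangle_adj_sym e_adj //.
  rewrite (cardsD1 x (L w)) (cardsD1 y (L w :\ x)).
  by case: (x \in _); case: (y \in _); clear; lia.
have M_surplus u : u \in mates (~~ b) H v -> surplus (H :\ v) M u.
  move=> u_mate; have [u_rest _] := other_mates_rest part_eq vw u_mate.
  have uw : u != w by move: u_rest; rewrite !inE => /andP[].
  apply: (eq_surplus (L := L)); first by rewrite M_out.
  exact: surplus_mates u_mate.
exists (fun z => prob (H :\ v) (forbid M Qv z) t k); split=> [z z'|z].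
  by apply: forbid_linked_dist => //; exact: triangle_part_D1.
have expose_w f : (forall c a, f (recolour c w a) = f c) ->
    csum (H :\ v) (forbid M Qv z) f = \sum_(j in Kw) csum rest (lists z j) f.
  move=> f_w; rewrite (csumD1 c0 e_sym e_irr _ _ wHv) forbid_notin //.
  rewrite /M !forbid_in ?set11 //; apply: eq_bigr => j _.
  rewrite (eq_csum_fun c0 e _ _ (fun c => f_w c j)); apply: eq_csum_lists => u u_rest.
  have u_rest' : u \in pair_rest H w v by rewrite pair_restC.
  rewrite /pair_lists /forbid (neighbours_rest part_eq' wv u_rest').
  by move: u_rest; rewrite !inE => /and3P[/negPf-> _ _].
rewrite -expose_w => [|c a]; last first.
  by rewrite has_colour_recolour // eq_sym; exact: notin_ball_neq w_far.
rewrite -(expose_w (fun=> 1)) // (csum_has_colour_marginal c0 e_sym e_irr e_adj Delta_lt) 1?mulrC //.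
by apply: (ample_forbid Delta_lt) => // u _ /mem_linked; exact: M_surplus.
Qed.

End AdjacentPair.

Section PairBound.
Variables (b : bool) (tau : T) (H : {set V}) (L : V -> {set C}) (v w : V) (x y : C).
Hypotheses (part_eq : triangle_part b tau H = [set v; w]) (vw : v != w) (evw : e v w).
Hypotheses (L_ample : ample H L) (Lv_surplus : surplus H L v) (Lw_surplus : surplus H L w).
Hypotheses (v_far : v \notin ball t r.+1) (w_far : w \notin ball t r.+1) (xy : x != y).
Local Notation rest := (pair_rest H v w).
Local Notation Qv := (linked (~~ b) H v).
Local Notation Qw := (linked (~~ b) H w).
Local Notation lists := (pair_lists (~~ b) H L v w).
Local Notation Kv := (L v :\ x :\ y).
Local Notation Kw := (L w :\ x :\ y).
Local Notation Bv := (mates_bound (~~ b) H v).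
Local Notation Bw := (mates_bound (~~ b) H w).
Local Notation weight := (fun i j => ncol rest (lists i j)).
Local Notation colour_weight := (fun i j => csum rest (lists i j) (has_colour t k)).
Local Notation p i j := (prob rest (lists i j) t k).
Local Notation total := (pair_total (L v) (L w) x y).

Let part_eq' : triangle_part b tau H = [set w; v]. Proof. by rewrite setUC. Qed.
Let wv : w != v. Proof. by rewrite eq_sym. Qed.
Let ewv : e w v. Proof. by rewrite e_sym. Qed.

Lemma pair_weight_gt0 i j : 0 < weight i j.
Proof.
exact: (ample_ncol_gt0 c0 e_sym e_irr e_adj Delta_lt (ample_pair_lists part_eq vw L_ample i j)).
Qed.

Lemma pair_lists_dist i j i' j' : `|p i j - p i' j'| <= Bv + Bw.
Proof.
apply: le_trans (ler_distD (p i' j) _ _) (lerD _ _).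
  exact: pair_lists_dist_first part_eq vw L_ample v_far _ _ _.
have swap a : p i' a = prob (pair_rest H w v) (pair_lists (~~ b) H L w v a i') t k.
  by congr (_ / _); exact: csum_pair_listsC.
by rewrite !swap; exact: pair_lists_dist_first part_eq' wv L_ample w_far _ _ _.
Qed.

Lemma forbid_pair_total z z' : (z, z') \in [:: (x, y); (y, x)] ->
  csum H (forbid L [set v; w] z) (has_colour t k) = total z' colour_weight /\
  ncol H (forbid L [set v; w] z) = total z' weight.
Proof.
move=> zz'; rewrite /num_list_colourings !(csum_forbid_pair L part_eq vw evw) //; last first.
- by move=> c a; rewrite has_colour_recolour // eq_sym; exact: notin_ball_neq w_far.
- by move=> c a; rewrite has_colour_recolour // eq_sym; exact: notin_ball_neq v_far.
case/or3P: zz' => // /eqP[-> ->]; first by rewrite !(sum_pairs_split _ _ _ xy).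
by have yx : y != x; rewrite 1?eq_sym // !(pair_totalC _ _ x y) !(sum_pairs_split _ _ _ yx).
Qed.

Lemma linked_separated : separated e Qv Qw.
Proof.
move=> u u' /linkedP[_ uv tri_u _] /linkedP[_ uw' tri_u' _]; apply/negP=> /e_adj.
rewrite (triangle_adjE b) tri_u tri_u' (negPf (other_triangle_neq part_eq vw)) orbF => /andP[_].
by apply/negP; exact: no_square (same_triangle part_eq) vw tri_u uv tri_u' uw'.
Qed.

Lemma linked_disjoint : [disjoint Qv & Qw].
Proof.
rewrite disjoint_subset; apply/subsetP=> u /mem_linked u_mate.
exact: other_mates_unlinked part_eq vw _ u_mate.
Qed.

Lemma linked_list_large u (D : {set V}) : u \in H -> D \subset H :\ u ->
  {in linked (~~ b) H u, forall u',
    (#|linked (~~ b) H u| + edeg (D :\: linked (~~ b) H u) u' < #|L u'|)%N}.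
Proof.
move=> uH D_sub u' u'Q; apply: leq_ltn_trans (linked_card_list L_ample uH u'Q).
by rewrite leq_add2l degree_inS // setSD.
Qed.

Lemma pair_form_weight_ge0 k0 z z' :
  (forall g h, unused_profile #|mates (~~ b) H v| g -> unused_profile #|mates (~~ b) H w| h ->
     0 <= pair_form k0 (L v) (L w) x y z z' (fun i j => g i * h j)) ->
  0 <= pair_form k0 (L v) (L w) x y z z' weight.
Proof.
have [coef formE] := linear_form_pair_form k0 (L v) (L w) x y z z'.
have [vH wH _] := triangle_part2 part_eq vw.
have Qv_rest := linked_rest part_eq vw.
have Qw_rest := linked_rest part_eq' wv; rewrite pair_restC in Qw_rest.
move=> product_ge0; rewrite formE.
apply: le_trans (_ : \sum_i \sum_j coef i j *
    csum rest L (fun c => avoidr Qv i c * avoidr Qw j c) <= _); last first.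
  apply: ler_sum => i _; apply: ler_sum => j _.
  rewrite /pair_lists ncol_forbid csum_forbid (setIidPr Qv_rest) (setIidPr Qw_rest).
  by rewrite (eq_csum_fun c0 e _ _ (fun c => mulrC _ _)).
apply: (sum_csum_avoidr2_ge0 c0 e_sym e_irr linked_disjoint linked_separated
  (card_linked_le2 _ _ _) (card_linked_le2 _ _ _)) => // [g h g_profile h_profile||].
- rewrite -formE; apply: product_ge0.
    exact: (unused_profileW g_profile (card_linked_le _ _ _)).
  exact: (unused_profileW h_profile (card_linked_le _ _ _)).
- exact: linked_list_large vH (subD1set _ _).
- by apply: linked_list_large wH _; rewrite pair_restC subD1set.
Qed.

Lemma pair_form_constraints z z' :
  (#|mates (~~ b) H v| <= #|mates (~~ b) H w|)%N -> (0 < #|mates (~~ b) H w|)%N ->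
  z' \in [set x; y] ->
  {in weight_constraints rat #|mates (~~ b) H v| #|mates (~~ b) H w|, forall k0,
    0 <= pair_form k0 (L v) (L w) x y z z' weight}.
Proof.
move=> mates_le mates_gt0 z_xy' k0 k0_in; apply: pair_form_weight_ge0 => g h g_profile h_profile.
apply: (pair_form_product_ge0 z xy z_xy' g_profile h_profile) => //.
- exact: card_list_ge part_eq vw Lv_surplus.
- exact: card_list_ge part_eq' wv Lw_surplus.
- exact: card_mates_le2.
- exact: list_full part_eq vw Lv_surplus.
- exact: list_full part_eq' wv Lw_surplus.
Qed.

Lemma pair_lists_range : exists lo, forall i j, lo <= p i j <= lo + (Bv + Bw).
Proof.
pose ij := [arg min_(ij < (x, x)) p ij.1 ij.2]%O; exists (p ij.1 ij.2) => i j.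
apply/andP; split; first by rewrite /ij; case: arg_minP => // ? _ /(_ (i, j) isT).
by have := pair_lists_dist i j ij.1 ij.2; rewrite ler_norml => /andP[_]; lra.
Qed.

Lemma colour_weight_range lo hi i j : lo <= p i j <= hi ->
  lo * weight i j <= colour_weight i j <= hi * weight i j.
Proof.
move=> /andP[lo_le le_hi] /=; rewrite (csum_has_colour_marginal c0 e_sym e_irr e_adj Delta_lt).
  by rewrite [_ * p i j]mulrC !ler_wpM2r // ltW // pair_weight_gt0.
exact: ample_pair_lists part_eq vw L_ample i j.
Qed.

Lemma forbid_pair_marginal_range lo hi z : (forall i j, lo <= p i j <= hi) ->
  lo <= prob H (forbid L [set v; w] z) t k <= hi.
Proof.
move=> p_range; have forbid_ample : ample H (forbid L [set v; w] z).
  by apply: (ample_forbid Delta_lt) => // u _ /set2P[]->.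
have ncol_pos := ample_ncol_gt0 c0 e_sym e_irr e_adj Delta_lt forbid_ample.
rewrite /marginal ler_pdivlMr // ler_pdivrMr // /num_list_colourings.
rewrite !(csum_forbid_pair L part_eq vw evw) //; last first.
- by move=> c a; rewrite has_colour_recolour // eq_sym; exact: notin_ball_neq w_far.
- by move=> c a; rewrite has_colour_recolour // eq_sym; exact: notin_ball_neq v_far.
rewrite !mulr_sumr; apply/andP; split; apply: ler_sum => i _; rewrite mulr_sumr;
  by apply: ler_sum => j _; have /andP[] := colour_weight_range (p_range i j).
Qed.

Lemma side_means lo hi : (forall i j, lo <= p i j <= hi) -> exists F G : C -> rat,
  [/\ forall z, row_in (L v) Kw z colour_weight = F z * row_in (L v) Kw z weight /\
        row_in (L w) Kv z (transpose colour_weight) = G z * row_in (L w) Kv z (transpose weight),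
      forall z, lo <= F z <= hi /\ lo <= G z <= hi &
      forall z z', `|F z - F z'| <= Bv /\ `|G z - G z'| <= Bw].
Proof.
move=> p_range; have Lv_large := card_list_ge part_eq vw Lv_surplus.
have Lw_large := card_list_ge part_eq' wv Lw_surplus.
have [F [F_dist F_mean]] := side_marginal x y part_eq vw evw L_ample Lw_surplus v_far w_far.
have [G [G_dist G_mean]] := side_marginal x y part_eq' wv ewv L_ample Lv_surplus w_far v_far.
have {}G_mean z : G z * \sum_(j in Kv) transpose weight z j =
    \sum_(j in Kv) transpose colour_weight z j.
  rewrite (eq_bigr (fun j => ncol (pair_rest H w v) (pair_lists (~~ b) H L w v z j))).
    by rewrite G_mean; apply: eq_bigr => j _; exact/esym/csum_pair_listsC.
  by move=> j _; exact: csum_pair_listsC.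
have K_gt0 u : (3 <= #|L u|)%N -> (0 < #|L u :\ x :\ y|)%N.
  rewrite (cardsD1 x (L u)) (cardsD1 y (L u :\ x)).
  by case: (x \in _); case: (y \in _); clear; lia.
exists F, G; split=> [z|z|z z'].
- by split; apply: row_in_scale; rewrite ?F_mean ?G_mean.
- split.
    apply: mean_range (F_mean z) => [|j|j]; [exact/K_gt0/(leq_trans _ Lw_large)| |].
      exact: pair_weight_gt0.
    exact: colour_weight_range (p_range z j).
  apply: mean_range (G_mean z) => [|j|j]; [exact/K_gt0/(leq_trans _ Lv_large)| |].
    exact: pair_weight_gt0.
  exact: colour_weight_range (p_range j z).
by split; [exact: F_dist|exact: G_dist].
Qed.

Lemma ordered_pair_dist : (#|mates (~~ b) H v| <= #|mates (~~ b) H w|)%N ->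
  `|prob H (forbid L [set v; w] x) t k - prob H (forbid L [set v; w] y) t k| <= 197/200 * X.
Proof.
move=> mates_le; have [lo p_range] := pair_lists_range.
have Bv_le := mates_bound_le (~~ b) H v; have Bw_le := mates_bound_le (~~ b) H w.
have [mates0|mates_gt0] := posnP #|mates (~~ b) H w|.
  move: mates_le Bv_le Bw_le; rewrite mates0 leqn0 => /eqP-> /=; rewrite mul0r => Bv_le Bw_le.
  have := forbid_pair_marginal_range x p_range; have := forbid_pair_marginal_range y p_range.
  have X_nonneg := X_ge0; rewrite ler_norml => /andP[y_ge y_le] /andP[x_ge x_le].
  by apply/andP; split; lra.
have [F [G [means ranges dists]]] := side_means p_range.
have total_pos z z' : (z, z') \in [:: (x, y); (y, x)] -> 0 < total z' weight.
  move=> zz'; have [_ <-] := forbid_pair_total zz'.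
  apply: (ample_ncol_gt0 c0 e_sym e_irr e_adj Delta_lt).
  by apply: (ample_forbid Delta_lt) => // u _ /set2P[]->.
have weight_ge0 i j : 0 <= weight i j by exact: ltW (pair_weight_gt0 i j).
have S_range := off_diagonal_range Kv Kw (fun i j => colour_weight_range (p_range i j)).
suff main z z' : (z', z) \in [:: (x, y); (y, x)] -> total z' weight <= total z weight ->
    `|total z colour_weight / total z weight - total z' colour_weight / total z' weight| <=
    197/200 * X.
  have xy_in : (x, y) \in [:: (x, y); (y, x)] by rewrite inE eqxx.
  have yx_in : (y, x) \in [:: (x, y); (y, x)] by rewrite !inE eqxx orbT.
  rewrite /marginal; have [-> ->] := forbid_pair_total xy_in.
  have [-> ->] := forbid_pair_total yx_in.
  have [/main|/ltW/main] := leP (total x weight) (total y weight); first by apply.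
  by rewrite distrC; apply.
move=> zz' total_le.
have z_xy' : z' \in [set x; y].
  by move: zz'; rewrite !inE => /orP[]/eqP[-> _]; rewrite eqxx ?orbT.
have constraints := pair_form_constraints z mates_le mates_gt0 z_xy'.
have mates_w_le2 := card_mates_le2 (~~ b) H w.
have [[F_row G_row] [F_row' G_row']] := (means z, means z').
have [[F_range G_range] [F_range' G_range']] := (ranges z, ranges z').
have [F_dist G_dist] := dists z z'.
have weightT_ge0 i j : 0 <= transpose weight i j by exact: weight_ge0.
have S_gt0 := shared_weight_gt0 mates_le mates_gt0 mates_w_le2 constraints (total_pos _ _ zz').
rewrite /pair_total F_row G_row F_row' G_row'.
exact: (dist_pair_means mates_le mates_gt0 mates_w_le2 (row_in_ge0 _ _ z weight_ge0)
  (row_in_ge0 _ _ z' weight_ge0) (row_in_ge0 _ _ z weightT_ge0) (row_in_ge0 _ _ z' weightT_ge0)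
  constraints S_gt0 total_le X_ge0 S_range F_range F_range' G_range G_range' F_dist G_dist
  Bv_le Bw_le).
Qed.

End PairBound.

Section WholePart.
Variables (b : bool) (tau : T) (H : {set V}) (L : V -> {set C}) (v w : V) (x y : C).
Hypotheses (part_eq : triangle_part b tau H = [set v; w]) (vw : v != w) (xy : x != y).
Hypotheses (L_ample : ample H L) (Lv_surplus : surplus H L v) (Lw_surplus : surplus H L w).
Hypotheses (v_far : v \notin ball t r.+1) (w_far : w \notin ball t r.+1).
Local Notation dist Q := `|prob H (forbid L Q x) t k - prob H (forbid L Q y) t k|.

Let part_eq' : triangle_part b tau H = [set w; v]. Proof. by rewrite setUC. Qed.
Let wv : w != v. Proof. by rewrite eq_sym. Qed.

Lemma adjacent_pair_dist : e v w -> dist [set v; w] <= 197/200 * X.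
Proof.
move=> evw; case/orP: (leq_total #|mates (~~ b) H v| #|mates (~~ b) H w|) => mates_le.
  exact: (ordered_pair_dist part_eq).
by rewrite setUC; apply: (ordered_pair_dist part_eq'); rewrite // e_sym.
Qed.

Lemma nonadjacent_pair_dist : ~~ e v w -> dist [set v; w] <= 99/100 * X.
Proof.
move=> evw; have -> : [set v; w] = [set u in [:: v; w]] by apply/setP=> u; rewrite !inE.
have ewv : ~~ e w v by rewrite e_sym.
apply: le_trans (marginal_forbid_telescope Delta_lt (B := fun=> 99/200 * X) L_ample _ _ _) _.
- by rewrite /= inE vw.
- have [vH wH _] := triangle_part2 part_eq vw.
  by move=> u; rewrite !inE => /orP[]/eqP->.
- move=> u M; rewrite !inE => /orP[]/eqP-> M_ample Mu_surplus.
    exact: (nonadjacent_vertex_dist part_eq vw xy M_ample Mu_surplus v_far evw).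
  exact: (nonadjacent_vertex_dist part_eq' wv xy M_ample Mu_surplus w_far ewv).
by rewrite !big_cons big_nil; have X_nonneg := X_ge0; lra.
Qed.

Lemma one_vertex_dist : dist [set v] <= 966/1000 * X.
Proof.
have X_nonneg := X_ge0; have [evw|evw] := boolP (e v w).
  exact: (adjacent_vertex_dist part_eq vw xy L_ample Lv_surplus v_far evw Lw_surplus).
by have := nonadjacent_vertex_dist part_eq vw xy L_ample Lv_surplus v_far evw; lra.
Qed.

Lemma whole_part_dist :
  dist [set v; w] <= 199/200 * (X * triangle_weight [set v; w] [set v; w]).
Proof.
have X_nonneg := X_ge0; rewrite /triangle_weight cards2 vw eqxx /=.
have [indep|dep] := boolP (independent e [set v; w]).
  have [evw|evw] := boolP (e v w); first by have := adjacent_pair_dist evw; lra.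
  by have := nonadjacent_pair_dist evw; lra.
have [evw|evw] := boolP (e v w); first by have := adjacent_pair_dist evw; lra.
case/negP: dep; apply/independentP=> u u' /set2P[]-> /set2P[]->; rewrite ?e_irr //.
by rewrite e_sym.
Qed.

End WholePart.

Lemma step_bound_ge0 P Q : 0 <= 199/200 * X * triangle_weight P Q.
Proof. by apply: mulr_ge0; [have X_nonneg := X_ge0; lra|exact: triangle_weight_ge0]. Qed.

Lemma triangle_mixing_step : triangle_mixing r.+1 (199/200 * X).
Proof.
move=> H L b tau Q x y part_le2 Q_part L_ample surplus_part Q_far.
set P := triangle_part b tau H in part_le2 Q_part surplus_part *.
have [->|xy] := eqVneq x y; first by rewrite subrr normr0; exact: step_bound_ge0.
have [->|Q_neq0] := eqVneq Q set0.
  by rewrite !marginal_forbid_set0 subrr normr0; exact: step_bound_ge0.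
have [P_le1|P_gt1] := leqP #|P| 1.
  have /cards1P[v eqQ] : #|Q| == 1%N.
    by rewrite eqn_leq (leq_trans (subset_leq_card Q_part) P_le1) card_gt0 Q_neq0.
  have vP : v \in P by rewrite (subsetP Q_part) // eqQ set11.
  have part_eq : P = [set v] by apply/esym/eqP; rewrite eqEcard sub1set vP cards1.
  have v_far : v \notin ball t r.+1 by rewrite Q_far // eqQ set11.
  have := single_vertex_dist part_eq L_ample (surplus_part v vP) v_far xy.
  by have X_nonneg := X_ge0; rewrite eqQ /triangle_weight P_le1; lra.
have /cards2P[v [w [vw part_eq]]] : #|P| == 2%N by rewrite eqn_leq part_le2.
have part_eq' : P = [set w; v] by rewrite setUC.
have wv : w != v by rewrite eq_sym.
have vP : v \in P by rewrite part_eq set21.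
have wP : w \in P by rewrite part_eq set22.
have [eqQ|Q_neqP] := eqVneq Q P.
  rewrite eqQ in Q_far *; have v_far := Q_far v vP; have w_far := Q_far w wP.
  have := whole_part_dist part_eq vw xy L_ample (surplus_part v vP) (surplus_part w wP) v_far w_far.
  by rewrite part_eq mulrA.
have /cards1P[u eqQ] : #|Q| == 1%N.
  rewrite eqn_leq card_gt0 Q_neq0 andbT -ltnS; apply: leq_trans part_le2.
  by apply: proper_card; rewrite properEneq Q_neqP.
have u_far : u \notin ball t r.+1 by rewrite Q_far // eqQ set11.
have uP : u \in [set v; w] by rewrite -part_eq (subsetP Q_part) // eqQ set11.
have weight_ge : 99/100 * X <= triangle_weight P Q * X.
  by apply: (ler_wpM2r X_ge0); rewrite /triangle_weight leqNgt P_gt1; case: ifP => _; lra.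
have [Lv_surplus Lw_surplus] := (surplus_part v vP, surplus_part w wP).
rewrite eqQ in weight_ge *; have X_nonneg := X_ge0.
case/set2P: uP u_far weight_ge => -> u_far weight_ge.
  by have := one_vertex_dist part_eq vw xy L_ample Lv_surplus Lw_surplus u_far; lra.
by have := one_vertex_dist part_eq' wv xy L_ample Lw_surplus Lv_surplus u_far; lra.
Qed.

End Step.

Lemma triangle_mixing_decay r : triangle_mixing r (2 * (199/200) ^+ r).
Proof.
elim: r => [|r mixing_r]; last first.
  rewrite exprS mulrCA; apply: triangle_mixing_step mixing_r; apply: mulr_ge0; first by lra.
  by apply: exprn_ge0; lra.
move=> H L b tau Q x y _ Q_part L_ample surplus_part _.
have forbid_ample a : ample H (forbid L Q a).
  by apply: (ample_forbid Delta_lt) => // w _ /(subsetP Q_part); exact: surplus_part.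
have := marginal_dist_le1 c0 e_sym e_irr e_adj Delta_lt t k (forbid_ample x) (forbid_ample y).
by have := triangle_weight_ge (triangle_part b tau H) Q; rewrite expr0; lra.
Qed.

End Triangles.

Lemma spatial_mixing_triangles (V C : finType) (c0 : C) (e : rel V) (T : eqType)
    (tri : bool -> V -> T) :
  symmetric e -> irreflexive e -> subrel e (triangle_adj tri) -> (4 < #|C|)%N ->
  (forall b v, (#|mates tri b setT v| <= 2)%N) ->
  (forall b v w, tri b v = tri b w -> tri (~~ b) v = tri (~~ b) w -> v = w) ->
  (forall b v w x y, tri b v = tri b w -> v != w ->
     tri (~~ b) x = tri (~~ b) v -> x != v -> tri (~~ b) y = tri (~~ b) w -> y != w ->
     tri b x != tri b y) ->
  spatial_mixing c0 e (triangle_adj tri) 4 4 (199/200).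
Proof.
move=> e_sym e_irr e_adj Delta_lt mates_le2 tri_inj no_square H L s t k x y r L_ample sH s_far.
have X_ge0 : 0 <= 2 * (199/200) ^+ r :> rat.
  by apply: mulr_ge0; [lra|apply: exprn_ge0; lra].
have mixing_r : triangle_mixing c0 e tri t k r (2 * (199/200) ^+ r).
  exact: (triangle_mixing_decay c0).
have := expose_dist e_sym e_adj Delta_lt mates_le2 tri_inj mixing_r true x y sH s_far L_ample.
have := mates_bound_leX e tri X_ge0 true H s; have := mates_bound_leX e tri X_ge0 false H s.
by rewrite /=; lra.
Qed.
End KagomeMixing.

Module Lattices.
Import Defs Colourings SpatialMixing DegreeMixing KagomeMixing.
Import Order.TTheory GRing.Theory Num.Theory.
Local Open Scope ring_scope.

Definition has_mixing_supergraph (q Delta : nat) (K lam : rat) (G : graph) :=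
  exists lat : rel 'I_(order G),
  [/\ symmetric lat, subrel (@adj G) lat, forall v, (degree_in lat setT v <= Delta)%N,
      forall c0 : 'I_q, spatial_mixing c0 (@adj G) lat Delta K lam
    & forall t r, (#|ball (@adj G) t r| <= 2 * (2 * r + 1) ^ 3)%N].

Lemma card_le_size (V : finType) (T : eqType) (f : V -> T) (s : seq T) (A : {set V}) :
  injective f -> {in A, forall w, f w \in s} -> (#|A| <= size s)%N.
Proof.
move=> f_inj A_s; rewrite cardE -(size_map f); apply: uniq_leq_size.
  by rewrite map_inj_uniq ?enum_uniq.
by move=> p /mapP[w]; rewrite mem_enum => /A_s fw ->.
Qed.

(* Up to three integer coordinates and a class. *)
Definition point := (int * int * int * bool)%type.

Definition unit_step (p p' : point) := [&& `|p.1.1.1 - p'.1.1.1| <= 1,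
  `|p.1.1.2 - p'.1.1.2| <= 1 & `|p.1.2 - p'.1.2| <= 1].

Section Growth.
Variables (V : finType) (e : rel V) (co : V -> point).
Hypotheses (co_inj : injective co) (co_step : forall v w, e v w -> unit_step (co v) (co w)).

Lemma ball_coord t r v : v \in ball e t r ->
  [&& `|(co v).1.1.1 - (co t).1.1.1| <= r%:Z, `|(co v).1.1.2 - (co t).1.1.2| <= r%:Z
    & `|(co v).1.2 - (co t).1.2| <= r%:Z].
Proof.
elim: r v => [|r IHr] v; first by move/set1P->; rewrite !subrr normr0.
case/setUP => [/IHr|]; first by case/and3P; clear; lia.
rewrite inE => /existsP[u /andP[/IHr/and3P[near1 near2 near3] /co_step/and3P[]]].
by move: near1 near2 near3; clear; lia.
Qed.

Lemma card_ball_le t r : (#|ball e t r| <= 2 * (2 * r + 1) ^ 3)%N.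
Proof.
pose offset (x y : int) : 'I_(2 * r).+1 := inord (absz (x - y + r%:Z)).
have offset_inj (x x' y : int) :
    `|x - y| <= r%:Z -> `|x' - y| <= r%:Z -> offset x y = offset x' y -> x = x'.
  move=> near near' /(congr1 val); rewrite /offset /= !inordK; move: near near'; clear; lia.
pose offsets v := (offset (co v).1.1.1 (co t).1.1.1, offset (co v).1.1.2 (co t).1.1.2,
  offset (co v).1.2 (co t).1.2, (co v).2).
rewrite -(card_in_imset (f := offsets)) => [|v w]; last first.
  move=> /ball_coord/and3P[v1 v2 v3] /ball_coord/and3P[w1 w2 w3] [eq1 eq2 eq3 eq4].
  apply: co_inj; move: (offset_inj _ _ _ v1 w1 eq1) (offset_inj _ _ _ v2 w2 eq2)
    (offset_inj _ _ _ v3 w3 eq3) eq4.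
  by case: (co v) => [[[? ?] ?] ?]; case: (co w) => [[[? ?] ?] ?] /= -> -> -> ->.
apply: leq_trans (max_card _) _; rewrite !card_prod card_bool !card_ord !expnS expn0.
by clear; lia.
Qed.

End Growth.

Section Pullback.
Variables (T : eqType) (L : rel T) (V : finType) (f : V -> T).
Hypothesis f_inj : injective f.

Definition pullback : rel V := fun v w => L (f v) (f w).

Lemma pullback_sym : symmetric L -> symmetric pullback.
Proof. by move=> L_sym v w; exact: L_sym. Qed.

Lemma degree_in_pullback_le (nbs : T -> seq T) v : (forall p p', L p p' -> p' \in nbs p) ->
  (degree_in pullback setT v <= size (nbs (f v)))%N.
Proof.
by move=> L_nbs; apply: (card_le_size f_inj) => w; rewrite inE => /andP[_ /L_nbs].
Qed.

Lemma triangle_free_pullback : triangle_free L -> triangle_free pullback.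
Proof. by move=> no_triangle u v w; exact: no_triangle. Qed.

Lemma neighbourhoods_independent_pullback (nbs nbs' : T -> seq T) n i :
  (forall p p', L p p' -> p' \in nbs p ++ nbs' p) ->
  (forall p, {in nbs p &, forall p' p'', ~~ L p' p''}) ->
  (forall p, {in nbs' p &, forall p' p'', ~~ L p' p''}) ->
  (i.-1 + i.-1 < n)%N -> neighbourhoods_independent pullback n i.
Proof.
move=> L_nbs nbs_indep nbs_indep' i_small v A /subsetP A_nbr cardA.
pose part (s : seq T) := A :&: [set w | f w \in s].
have pick s : {in s &, forall p' p'', ~~ L p' p''} -> (i <= #|part s|)%N ->
    exists I : {set V}, [/\ I \subset A, #|I| = i & independent pullback I].
  move=> s_indep /subset_of_card[I I_part cardI]; exists I; split=> //.
    exact: subset_trans I_part (subsetIl _ _).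
  apply/independentP=> u w /(subsetP I_part)/setIP[_ uI] /(subsetP I_part)/setIP[_ wI].
  by move: uI wI; rewrite !inE; exact: s_indep.
have [|part_small] := leqP i #|part (nbs (f v))|; first exact: pick.
have [|part_small'] := leqP i #|part (nbs' (f v))|; first exact: pick.
have : (#|A| <= #|part (nbs (f v))| + #|part (nbs' (f v))|)%N.
  rewrite -cardsUI; apply: leq_trans (leq_addr _ _); apply/subset_leq_card/subsetP=> w wA.
  have := A_nbr w wA; rewrite inE => /L_nbs; rewrite mem_cat !in_setU !in_setI wA !inE.
  by [].
by move: part_small part_small' i_small; rewrite cardA; clear; lia.
Qed.

End Pullback.

Lemma Z2_sym : symmetric Z2_lattice.
Proof. by move=> p p'; rewrite /Z2_lattice; clear; apply/idP/idP; lia. Qed.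

Definition Z2_neighbours (p : int * int) :=
  [:: (p.1 + 1, p.2); (p.1 - 1, p.2); (p.1, p.2 + 1); (p.1, p.2 - 1)].

Lemma Z2_mem_neighbours p p' : Z2_lattice p p' -> p' \in Z2_neighbours p.
Proof.
by rewrite !inE /Z2_lattice; case: p p' => [a b] [a' b'] /=; rewrite !xpair_eqE; clear; lia.
Qed.

Lemma Z2_triangle_free : triangle_free Z2_lattice.
Proof. by move=> p p' p''; rewrite /Z2_lattice; clear; lia. Qed.

Lemma Z3_sym : symmetric Z3_lattice.
Proof. by move=> p p'; rewrite /Z3_lattice; clear; apply/idP/idP; lia. Qed.

Definition Z3_neighbours (p : int * int * int) :=
  [:: (p.1.1 + 1, p.1.2, p.2); (p.1.1 - 1, p.1.2, p.2); (p.1.1, p.1.2 + 1, p.2);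
      (p.1.1, p.1.2 - 1, p.2); (p.1.1, p.1.2, p.2 + 1); (p.1.1, p.1.2, p.2 - 1)].

Lemma Z3_mem_neighbours p p' : Z3_lattice p p' -> p' \in Z3_neighbours p.
Proof.
rewrite !inE /Z3_lattice; case: p p' => [[a b] d] [[a' b'] d'] /=.
by rewrite !xpair_eqE; clear; lia.
Qed.

Lemma Z3_triangle_free : triangle_free Z3_lattice.
Proof.
move=> [[a b] d] p' p'' /Z3_mem_neighbours + /Z3_mem_neighbours.
rewrite !inE /Z3_lattice /=.
by do 5?[case/orP]; move/eqP=> ->; do 5?[case/orP]; move/eqP=> -> /=; clear; lia.
Qed.

Lemma honeycomb_sym : symmetric honeycomb_lattice.
Proof. by move=> p p'; rewrite /honeycomb_lattice orbC. Qed.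

Definition honeycomb_neighbours (p : int * int * bool) :=
  let s : int := if p.2 then 1 else -1 in
  [:: (p.1.1, p.1.2, ~~ p.2); (p.1.1 + s, p.1.2, ~~ p.2); (p.1.1, p.1.2 + s, ~~ p.2)].

Lemma honeycomb_mem_neighbours p p' : honeycomb_lattice p p' -> p' \in honeycomb_neighbours p.
Proof.
rewrite !inE /honeycomb_lattice; case: p p' => [[a b] d] [[a' b'] d'] /=.
by rewrite !inE !xpair_eqE; case: d; case: d' => //=; rewrite ?andbF ?andbT ?orbF /=; clear; lia.
Qed.

Lemma honeycomb_triangle_free : triangle_free honeycomb_lattice.
Proof. by move=> p p' p''; rewrite /honeycomb_lattice /=; case: p.2; case: p'.2; case: p''.2. Qed.

Lemma triangular_sym : symmetric triangular_lattice.
Proof.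
by move=> p p'; rewrite /triangular_lattice !inE !xpair_eqE; clear; apply/idP/idP; lia.
Qed.

(* Every other vertex of the hexagon around p. *)
Definition even_neighbours (p : int * int) :=
  [:: (p.1 + 1, p.2); (p.1 - 1, p.2 + 1); (p.1, p.2 - 1)].
Definition odd_neighbours (p : int * int) :=
  [:: (p.1, p.2 + 1); (p.1 - 1, p.2); (p.1 + 1, p.2 - 1)].

Lemma triangular_mem_neighbours p p' :
  triangular_lattice p p' -> p' \in even_neighbours p ++ odd_neighbours p.
Proof.
rewrite !inE /triangular_lattice; case: p p' => [a b] [a' b'] /=.
by rewrite !inE !xpair_eqE; clear; lia.
Qed.

Lemma even_neighbours_independent p :
  {in even_neighbours p &, forall p' p'', ~~ triangular_lattice p' p''}.
Proof.
case: p => a b [a1 b1] [a2 b2]; rewrite /triangular_lattice !inE !xpair_eqE /=.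
by clear; lia.
Qed.

Lemma odd_neighbours_independent p :
  {in odd_neighbours p &, forall p' p'', ~~ triangular_lattice p' p''}.
Proof.
case: p => a b [a1 b1] [a2 b2]; rewrite /triangular_lattice !inE !xpair_eqE /=.
by clear; lia.
Qed.

Section Embedded.
Variables (G : graph) (q : nat).
Local Notation V := 'I_(order G).

Lemma Z2_mixing : (6 <= q)%N -> subgraph_of Z2_lattice G ->
  has_mixing_supergraph q 4 (2 * 4%:R) (499/500) G.
Proof.
move=> q6 [f f_inj f_adj]; have lat_sym := pullback_sym f Z2_sym.
have deg_le v := degree_in_pullback_le f_inj v Z2_mem_neighbours.
have no_triangle := triangle_free_pullback (f := f) Z2_triangle_free.
exists (pullback Z2_lattice f); split=> // [c0|t r].
  apply: (spatial_mixing_degree4 c0 (@adj_sym G) (@adj_irr G) lat_sym f_adj deg_le no_triangle).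
  by rewrite card_ord.
apply: (card_ball_le (co := fun v => ((f v).1, (f v).2, 0, true))) => [v w [eq1 eq2]|v w /f_adj].
  by apply: f_inj; move: eq1 eq2; case: (f v) => a b; case: (f w) => a' b' /= -> ->.
by rewrite /Z2_lattice /unit_step /=; clear; lia.
Qed.

Lemma Z3_mixing : (10 <= q)%N -> subgraph_of Z3_lattice G ->
  has_mixing_supergraph q 6 (2 * 6%:R) (99/100) G.
Proof.
move=> q10 [f f_inj f_adj]; have lat_sym := pullback_sym f Z3_sym.
have deg_le v := degree_in_pullback_le f_inj v Z3_mem_neighbours.
have no_triangle := triangle_free_pullback (f := f) Z3_triangle_free.
exists (pullback Z3_lattice f); split=> // [c0|t r].
  apply: (spatial_mixing_degree6 c0 (@adj_sym G) (@adj_irr G) lat_sym f_adj deg_le).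
  - exact: neighbourhoods_independent_triangle_free.
  - exact: neighbourhoods_independent_triangle_free.
  by rewrite card_ord.
apply: (card_ball_le (co := fun v => (f v, true))) => [v w [/f_inj]//|v w /f_adj].
by rewrite /Z3_lattice /unit_step /=; clear; lia.
Qed.

Lemma honeycomb_mixing : (5 <= q)%N -> subgraph_of honeycomb_lattice G ->
  has_mixing_supergraph q 3 (2 * 3%:R) (9/10) G.
Proof.
move=> q5 [f f_inj f_adj]; have lat_sym := pullback_sym f honeycomb_sym.
have deg_le v := degree_in_pullback_le f_inj v honeycomb_mem_neighbours.
have no_triangle := triangle_free_pullback (f := f) honeycomb_triangle_free.
exists (pullback honeycomb_lattice f); split=> // [c0|t r].
  apply: (spatial_mixing_degree3 c0 (@adj_sym G) (@adj_irr G) lat_sym f_adj deg_le no_triangle).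
  by rewrite card_ord.
apply: (card_ball_le (co := fun v => ((f v).1.1, (f v).1.2, 0, (f v).2))).
  move=> v w [eq1 eq2 eq3]; apply: f_inj; move: eq1 eq2 eq3.
  by case: (f v) => [[a b] d]; case: (f w) => [[a' b'] d'] /= -> -> ->.
move=> v w /f_adj; rewrite /honeycomb_lattice /unit_step /= !inE !xpair_eqE.
by case: (f v).2; case: (f w).2 => //=; rewrite ?orbF; clear; lia.
Qed.

Lemma triangular_mixing : (10 <= q)%N -> subgraph_of triangular_lattice G ->
  has_mixing_supergraph q 6 (2 * 6%:R) (99/100) G.
Proof.
move=> q10 [f f_inj f_adj]; have lat_sym := pullback_sym f triangular_sym.
have deg_le v := degree_in_pullback_le f_inj v triangular_mem_neighbours.
have indep n i : (i.-1 + i.-1 < n)%N ->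
    neighbourhoods_independent (pullback triangular_lattice f) n i.
  exact: neighbourhoods_independent_pullback triangular_mem_neighbours
    even_neighbours_independent odd_neighbours_independent.
exists (pullback triangular_lattice f); split=> // [c0|t r].
  by apply: (spatial_mixing_degree6 c0 (@adj_sym G) (@adj_irr G) lat_sym f_adj deg_le);
    rewrite ?card_ord //; exact: indep.
apply: (card_ball_le (co := fun v => ((f v).1, (f v).2, 0, true))) => [v w [eq1 eq2]|v w /f_adj].
  by apply: f_inj; move: eq1 eq2; case: (f v) => a b; case: (f w) => a' b' /= -> ->.
by rewrite /triangular_lattice !inE !xpair_eqE /unit_step /=; clear; lia.
Qed.

End Embedded.

(* Kagome triangles, labelled by a deleted or even-parity corner of the cell:
   type true points up, type false points down. *)
Definition kagome_corner (b : bool) (p : int * int) : int * int :=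
  let s : int := if b then -1 else 1 in
  if (2 %| p.1)%Z then (p.1 + s, p.2)
  else if (2 %| p.2)%Z then (p.1, p.2 + s) else p.

Lemma kagome_cases (p : int * int) : ~~ ((2 %| p.1)%Z && (2 %| p.2)%Z) ->
  exists a c : int, [\/ p = (2 * a + 1, 2 * c + 1) /\ forall b, kagome_corner b p = p,
    p = (2 * a, 2 * c + 1) /\ forall b : bool, kagome_corner b p = (2 * a + (if b then -1 else 1), 2 * c + 1)
  | p = (2 * a + 1, 2 * c) /\ forall b : bool, kagome_corner b p = (2 * a + 1, 2 * c + (if b then -1 else 1))].
Proof.
case: p => x y /=; rewrite /kagome_corner /=.
have par (z : int) : {a | (2 %| z)%Z /\ z = 2 * a} + {a | ~~ (2 %| z)%Z /\ z = 2 * a + 1}.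
  case: (boolP (2 %| z)%Z) => h; [left|right]; exists (z %/ 2)%Z; split=> //.
    by have := divz_eq z 2; rewrite (dvdz_mod0P h) addr0 mulrC.
  have := divz_eq z 2; have := ltz_pmod z (isT : 0 < 2 :> int); have := modz_ge0 z (isT : 2 != 0 :> int).
  have : (z %% 2)%Z != 0 by apply: contraNneq h => h0; apply/dvdz_mod0P.
  by clear; lia.
case: (par x) => [[a [h1 E1]]|[a [h1 E1]]]; case: (par y) => [[c [h2 E2]]|[c [h2 E2]]]; rewrite ?h1 ?h2 ?(negPf h1) ?(negPf h2) // => _;
  exists a, c.
- by apply: Or32; rewrite E1 E2.
- by apply: Or33; rewrite E1 E2.
- by apply: Or31; rewrite E1 E2.
Qed.


Definition on_kagome (p : int * int) := ~~ ((2 %| p.1)%Z && (2 %| p.2)%Z).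

Lemma kagome_corner_inj b p p' : on_kagome p -> on_kagome p' ->
  kagome_corner b p = kagome_corner b p' -> kagome_corner (~~ b) p = kagome_corner (~~ b) p' ->
  p = p'.
Proof.
move=> /kagome_cases[a [c p_case]] /kagome_cases[a' [c' p_case']] /eqP + /eqP + ; move=> eq1 eq2.
apply/eqP; move: eq1 eq2.
case: p_case => -[-> corner]; case: p_case' => -[-> corner']; rewrite !corner !corner' !xpair_eqE;
  by case: b; clear; rewrite /=; lia.
Qed.

Lemma kagome_corner_mem b p k (s : int := if b then -1 else 1) : on_kagome p ->
  kagome_corner b p = k -> p \in [:: k; (k.1 - s, k.2); (k.1, k.2 - s)].
Proof.
move=> /kagome_cases[a [c p_case]] <-.
by case: p_case => -[-> ->]; rewrite !inE !xpair_eqE /= ?eqxx ?addrK ?eqxx ?orbT.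
Qed.

Lemma kagome_corner_no_square b p1 p2 p3 p4 :
  on_kagome p1 -> on_kagome p2 -> on_kagome p3 -> on_kagome p4 ->
  kagome_corner b p1 = kagome_corner b p2 -> p1 != p2 ->
  kagome_corner (~~ b) p3 = kagome_corner (~~ b) p1 -> p3 != p1 ->
  kagome_corner (~~ b) p4 = kagome_corner (~~ b) p2 -> p4 != p2 ->
  kagome_corner b p3 != kagome_corner b p4.
Proof.
move=> /kagome_cases[a1 [c1 case1]] /kagome_cases[a2 [c2 case2]].
move=> /kagome_cases[a3 [c3 case3]] /kagome_cases[a4 [c4 case4]].
move=> /eqP + + /eqP + + /eqP.
case: case1 => -[-> corner1]; case: case2 => -[-> corner2];
  rewrite !corner1 !corner2 !xpair_eqE => eq12 neq12;
  try (exfalso; move: eq12 neq12; case: b; clear; rewrite /=; lia);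
  case: case3 => -[-> corner3]; rewrite !corner3 !xpair_eqE => eq31 neq31;
  try (exfalso; move: eq12 neq12 eq31 neq31; case: b; clear; rewrite /=; lia);
  case: case4 => -[-> corner4]; rewrite !corner4 !xpair_eqE => eq42 neq42;
  by move: eq12 neq12 eq31 neq31 eq42 neq42; case: b; clear; rewrite /=; lia.
Qed.

Lemma kagome_adj_corner p p' : on_kagome p -> on_kagome p' -> triangular_lattice p p' ->
  (kagome_corner true p == kagome_corner true p') ||
  (kagome_corner false p == kagome_corner false p').
Proof.
move=> /kagome_cases[a [c p_case]] /kagome_cases[a' [c' p_case']].
rewrite /triangular_lattice !inE.
by case: p_case => -[-> corner]; case: p_case' => -[-> corner'];
  rewrite !corner !corner' !xpair_eqE; clear; rewrite /=; lia.
Qed.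

Lemma kagome_mixing (G : graph) (q : nat) : (5 <= q)%N -> subgraph_of kagome_lattice G ->
  has_mixing_supergraph q 4 4 (199/200) G.
Proof.
move=> q5 [f f_inj f_adj]; pose g v := sval (f v); pose tri b v := kagome_corner b (g v).
have g_inj : injective g by move=> v w /val_inj; exact: f_inj.
have g_kagome v : on_kagome (g v) := valP (f v).
have tri_inj b v w : tri b v = tri b w -> tri (~~ b) v = tri (~~ b) w -> v = w.
  by move=> eq_b eq_nb; exact/g_inj/(kagome_corner_inj (g_kagome v) (g_kagome w) eq_b).
have mates_le2 b v : (#|mates tri b setT v| <= 2)%N.
  suff : (#|v |: mates tri b setT v| <= 3)%N by rewrite cardsU1 !inE eqxx.
  pose s : int := if b then -1 else 1; pose k := tri b v.
  apply: (card_le_size (f := g) (s := [:: k; (k.1 - s, k.2); (k.1, k.2 - s)])) => // w w_part.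
  apply: kagome_corner_mem (g_kagome w) _; move: w_part; rewrite !inE.
  by case/orP=> [/eqP->|/and3P[_ _ /eqP tri_w]]; [|exact: tri_w].
have adj_tri : subrel (@adj G) (triangle_adj tri).
  move=> v w vw; rewrite /triangle_adj (kagome_adj_corner (g_kagome v) (g_kagome w) (f_adj v w vw)) andbT.
  by apply: contraTneq vw => ->; rewrite adj_irr.
exists (triangle_adj tri); split=> [||v|c0|t r] //; first exact: triangle_adj_sym.
- by rewrite (degree_in_mates tri_inj true) (leq_add (mates_le2 _ _) (mates_le2 _ _)).
- apply: (spatial_mixing_triangles c0 (@adj_sym G) (@adj_irr G) adj_tri) => //.
    by rewrite card_ord.
  move=> b v w v' w' tri_vw vw tri_v v'v tri_w w'w.
  by apply: kagome_corner_no_square tri_vw _ tri_v _ tri_w _; rewrite ?inj_eq.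
apply: (card_ball_le (co := fun v => ((g v).1, (g v).2, 0, true))) => [v w [eq1 eq2]|v w /f_adj].
  by apply: g_inj; move: eq1 eq2; case: (g v) => a b; case: (g w) => a' b' /= -> ->.
rewrite /kagome_lattice -/(g v) -/(g w) /triangular_lattice !inE !xpair_eqE /unit_step /=.
by clear; lia.
Qed.

End Lattices.

Module Estimator.
Import Colourings ListBounds SpatialMixing.
Import Order.TTheory GRing.Theory Num.Theory.
Local Open Scope ring_scope.

Lemma reciprocal_factor_bounds (R : realFieldType) (n tau P E Z X : R) :
  0 <= n -> 0 <= tau -> n * tau + tau <= 1 / 2 -> 0 < P -> 0 <= Z -> 0 < X ->
  P * (1 - tau) <= E <= P * (1 + tau) ->
  (1 - n * tau) * (P * Z) <= X -> (1 - n * tau) * X <= P * Z ->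
  [/\ 0 < E^-1 * X, (1 - (n * tau + tau)) * Z <= E^-1 * X
    & (1 - (n * tau + tau)) * (E^-1 * X) <= Z].
Proof.
move=> n_ge0 tau_ge0 tau_small P_gt0 Z_ge0 X_gt0 /andP[E_ge E_le] X_ge X_le.
have ntau_ge0 : 0 <= n * tau by exact: mulr_ge0.
have E_gt0 : 0 < E by apply: lt_le_trans E_ge; apply: mulr_gt0 => //; lra.
have PZ_ge0 : 0 <= P * Z by rewrite mulr_ge0 // ltW.
split; first by rewrite mulr_gt0 ?invr_gt0.
  rewrite ler_pdivlMl //.
  have EZ_le : E * Z <= P * (1 + tau) * Z by exact: ler_wpM2r.
  apply: le_trans (_ : (1 - (n * tau + tau)) * (P * (1 + tau) * Z) <= _).
    by rewrite mulrCA; apply: ler_wpM2l => //; lra.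
  have := mulr_ge0 PZ_ge0 (mulr_ge0 ntau_ge0 tau_ge0).
  by have := mulr_ge0 PZ_ge0 (mulr_ge0 tau_ge0 tau_ge0); lra.
rewrite [E^-1 * X]mulrC mulrA ler_pdivrMr // [Z * E]mulrC.
have EZ_ge : P * (1 - tau) * Z <= E * Z by exact: ler_wpM2r.
have := mulr_ge0 (ltW X_gt0) (mulr_ge0 ntau_ge0 tau_ge0).
have : (1 - tau) * ((1 - n * tau) * X) <= (1 - tau) * (P * Z) by apply: ler_wpM2l; lra.
by lra.
Qed.

Lemma approximation_of_bounds (R : realFieldType) (nu eps Z X : R) :
  0 < eps < 1 -> nu <= eps / 2 -> 0 <= Z -> 0 <= X ->
  (1 - nu) * Z <= X -> (1 - nu) * X <= Z -> (1 - eps) * Z <= X <= (1 + eps) * Z.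
Proof.
move=> /andP[eps_gt0 eps_lt1] nu_le Z_ge0 X_ge0 X_ge X_le.
have nuZ_le : nu * Z <= eps / 2 * Z by exact: ler_wpM2r.
have nuX_le : nu * X <= eps / 2 * X by exact: ler_wpM2r.
have epsZ_ge0 : 0 <= eps * Z by rewrite mulr_ge0 // ltW.
apply/andP; split; first by lra.
have : (1 + eps) * ((1 - eps / 2) * X) <= (1 + eps) * Z by apply: ler_wpM2l; lra.
have : 0 <= eps * (1 - eps) * X by rewrite !mulr_ge0 //; lra.
by lra.
Qed.

Section Pinnings.
Variables (V C : finType) (c0 : C) (e lat : rel V) (Delta : nat).
Hypotheses (e_sym : symmetric e) (e_irr : irreflexive e) (lat_sym : symmetric lat).
Hypothesis e_lat : subrel e lat.
Hypothesis Delta_lt : (Delta < #|C|)%N.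
Hypothesis ldeg_le : forall v, (degree_in lat setT v <= Delta)%N.
Local Notation csum := (colouring_sum c0 e).
Local Notation ncol := (num_list_colourings c0 e).
Local Notation nbr := (neighbours e).
Local Notation ample := (ample_lists lat Delta).

Definition pinning := {ffun V -> option C}.
Implicit Types (p : pinning) (v s w : V) (a b c : C) (H A : {set V}) (S : seq V).

Definition unpinned p := [set v | p v == None].

Definition allowed p v : {set C} := [set a | [forall w, e v w ==> (p w != Some a)]].

Definition pin p v a : pinning := [ffun w => if w == v then Some a else p w].

Lemma unpinned_pin p v a : unpinned (pin p v a) = unpinned p :\ v.
Proof. by apply/setP=> w; rewrite !inE ffunE; case: (w == v). Qed.

Lemma allowed_pin p v a w :
  v \in unpinned p -> allowed (pin p v a) w = forbid (allowed p) (nbr v) a w.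
Proof.
rewrite inE => /eqP pv; apply/setP=> b; rewrite /forbid [w \in nbr v]inE e_sym.
case: ifP => ewv; rewrite !inE.
  apply/forallP/andP => [b_ok|[ba /forallP b_ok] u].
    split; first by have := b_ok v; rewrite ewv ffunE eqxx /=; apply: contraNneq => ->.
    apply/forallP=> u; have := b_ok u; rewrite ffunE.
    by case: (eqVneq u v) => [-> _|//]; rewrite pv implybT.
  have := b_ok u; rewrite ffunE; case: (eqVneq u v) => [-> _|//]; apply/implyP=> _.
  by apply: contraNneq ba => -[->].
apply: eq_forallb => u; rewrite ffunE; case: (eqVneq u v) => [->|//].
by rewrite ewv.
Qed.

Lemma ample_allowed p : ample (unpinned p) (allowed p).
Proof.
move=> v v_unpinned; pose B := [set w in ~: unpinned p | lat v w].
have deg_split : (degree_in lat (unpinned p) v + #|B| <= Delta)%N.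
  apply: leq_trans (ldeg_le v); rewrite /degree_in /B -cardsUI.
  rewrite [X in (_ + X)%N](_ : _ = 0%N) ?addn0; last first.
    apply/eqP; rewrite cards_eq0; apply/eqP/setP=> w; rewrite !inE.
    by case: (_ == None); rewrite ?andbF.
  by apply: subset_leq_card; apply/subsetP=> w; rewrite !inE -andb_orl => /andP[_ ->].
have forbidden_le : (#|~: allowed p v| <= #|B|)%N.
  apply: leq_trans (leq_imset_card (fun w => odflt c0 (p w)) B).
  apply: subset_leq_card; apply/subsetP=> a.
  rewrite !inE negb_forall => /existsP[w]; rewrite negb_imply negbK => /andP[evw /eqP pw].
  by apply/imsetP; exists w; rewrite ?inE ?pw // e_lat.
by have := cardsC (allowed p v); move: deg_split forbidden_le; clear; lia.
Qed.

Lemma allowed_gt0 p v : v \in unpinned p -> (0 < #|allowed p v|)%N.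
Proof. by move=> v_unpinned; have := ample_allowed v_unpinned; move: Delta_lt; clear; lia. Qed.

Definition least_allowed p v := nth c0 [seq a <- enum C | a \in allowed p v] 0.

Lemma mem_least_allowed p v : v \in unpinned p -> least_allowed p v \in allowed p v.
Proof.
move=> v_unpinned; have : least_allowed p v \in [seq a <- enum C | a \in allowed p v].
  apply: mem_nth; rewrite size_filter -has_count.
  have /card_gt0P[a a_allowed] := allowed_gt0 v_unpinned.
  by apply/hasP; exists a; rewrite ?mem_enum.
by rewrite mem_filter => /andP[].
Qed.

Definition pin_marginal p v a : rat := marginal c0 e (unpinned p) (allowed p) v a.

Definition num_extensions p : rat := ncol (unpinned p) (allowed p).

Lemma num_extensions_gt0 p : 0 < num_extensions p.
Proof. exact: (ample_ncol_gt0 c0 e_sym e_irr e_lat Delta_lt (@ample_allowed p)). Qed.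

Lemma num_extensions_pinE p v a : v \in unpinned p ->
  num_extensions (pin p v a) = ncol (unpinned p :\ v) (forbid (allowed p) (nbr v) a).
Proof.
move=> v_unpinned; rewrite /num_extensions unpinned_pin.
by apply: eq_ncol => w _; exact: allowed_pin.
Qed.

Lemma num_extensions_pin p v a : v \in unpinned p -> a \in allowed p v ->
  num_extensions (pin p v a) = pin_marginal p v a * num_extensions p.
Proof.
move=> v_unpinned a_allowed; rewrite /pin_marginal /marginal.
rewrite (csum_has_colour c0 e_sym e_irr) // a_allowed -num_extensions_pinE //.
by rewrite mulfVK // gt_eqF // num_extensions_gt0.
Qed.

Lemma pin_marginal_pin p v s a c : s \in unpinned p ->
  pin_marginal (pin p s a) v c =
  marginal c0 e (unpinned p :\ s) (forbid (allowed p) (nbr s) a) v c.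
Proof.
move=> s_unpinned; rewrite /pin_marginal unpinned_pin.
by apply: eq_marginal => w _; exact: allowed_pin.
Qed.

Lemma pin_marginal_ge0 p v a : 0 <= pin_marginal p v a.
Proof. exact: marginal_ge0. Qed.

Lemma pin_marginal_le1 p v a : pin_marginal p v a <= 1.
Proof. exact: (marginal_le1 c0 e_sym e_irr e_lat Delta_lt v a (@ample_allowed p)). Qed.

Lemma pin_marginal_sum1 p v :
  v \in unpinned p -> \sum_(a in allowed p v) pin_marginal p v a = 1.
Proof. by move=> v_unpinned; rewrite marginal_sum1 // num_extensions_gt0. Qed.

Lemma pin_marginal_total p v s c : s \in unpinned p -> s != v ->
  pin_marginal p v c =
  \sum_(a in allowed p s) pin_marginal p s a * pin_marginal (pin p s a) v c.
Proof.
move=> s_unpinned sv; rewrite {1}/pin_marginal /marginal.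
rewrite (csumD1 c0 e_sym e_irr _ _ s_unpinned) mulr_suml; apply: eq_bigr => a a_allowed.
rewrite (eq_csum_fun c0 e _ _ (g := has_colour v c)) => [|d]; last first.
  by rewrite has_colour_recolour // eq_sym.
rewrite (pin_marginal_pin _ _ _ s_unpinned) /marginal -num_extensions_pinE //.
rewrite (num_extensions_pin s_unpinned a_allowed) -/(num_extensions p) invfM.
have := num_extensions_gt0 (pin p s a); rewrite (num_extensions_pin s_unpinned a_allowed).
have [->|marginal_neq0 _] := eqVneq (pin_marginal p s a) 0; first by rewrite mul0r ltxx.
by rewrite mulrCA mulVKf.
Qed.

Definition marginal_lb : rat := (1 - 2%:R^-1) ^+ Delta / #|C|%:R.

Lemma marginal_lb_gt0 : 0 < marginal_lb.
Proof.
apply: divr_gt0; first by apply: exprn_gt0; rewrite subr_gt0 invf_lt1 ?ltr1n ?ltr0n.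
by rewrite ltr0n; move: Delta_lt; clear; lia.
Qed.

Lemma pin_marginal_ge p v a :
  v \in unpinned p -> a \in allowed p v -> marginal_lb <= pin_marginal p v a.
Proof.
move=> v_unpinned a_allowed; rewrite /pin_marginal /marginal ler_pdivlMr.
  apply: (csum_has_colour_ge c0 e_sym e_irr) => // [y|].
    move=> /setD1P[yv y_unpinned] evy _; have := ample_allowed y_unpinned.
    rewrite (degree_inD1 lat y v_unpinned) lat_sym e_lat //.
    by have := degree_in_sub e_lat (unpinned p :\ v) y; move: Delta_lt; clear; lia.
  apply: leq_trans (degree_in_sub e_lat _ _) _; apply: leq_trans (ldeg_le v).
  exact/degree_inS/subsetT.
exact: num_extensions_gt0.
Qed.

(* [p'] pins all of [S] and agrees with [p] elsewhere. *)
Definition extends_on S p p' :=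
  (forall s, s \notin S -> p' s = p s) /\ (forall s, s \in S -> p' s != None).

Lemma extends_on_pin s S p b p' :
  s \notin S -> extends_on S (pin p s b) p' -> extends_on (s :: S) p p'.
Proof.
move=> sS [agree pinned]; split=> u; rewrite inE.
  by rewrite negb_or => /andP[us /agree->]; rewrite ffunE (negPf us).
by case/orP=> [/eqP->|/pinned//]; rewrite (agree s sS) ffunE eqxx.
Qed.

Lemma unpinned_pin_tail p s b S : s \notin S -> {subset s :: S <= unpinned p} ->
  {subset S <= unpinned (pin p s b)}.
Proof.
move=> sS S_unpinned u uS; rewrite unpinned_pin in_setD1 S_unpinned ?inE ?uS ?orbT // andbT.
by apply: contraNneq sS => <-.
Qed.

(* [E] prescribes the probabilities with which the vertices of [S] are pinned. *)
Fixpoint reveal (E : pinning -> V -> C -> rat) S (g : pinning -> rat) p : rat :=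
  if S is s :: S' then \sum_(b in allowed p s) E p s b * reveal E S' g (pin p s b)
  else g p.

Lemma reveal_sum1 (E : pinning -> V -> C -> rat) S (K : {set C}) (g : C -> pinning -> rat) p :
  (forall p' s, s \in unpinned p' -> \sum_(b in allowed p' s) E p' s b = 1) ->
  uniq S -> {subset S <= unpinned p} ->
  (forall p', extends_on S p p' -> \sum_(a in K) g a p' = 1) ->
  \sum_(a in K) reveal E S (g a) p = 1.
Proof.
move=> E_sum1; elim: S p => [|s S IHS] p /= uniq_S S_unpinned g_sum1.
  by apply: g_sum1; split.
case/andP: uniq_S => sS uniq_S; rewrite exchange_big /=.
rewrite -[RHS](E_sum1 p s) ?S_unpinned ?mem_head //.
apply: eq_bigr => b _; rewrite -mulr_sumr IHS ?mulr1 //.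
  exact: unpinned_pin_tail sS S_unpinned.
by move=> p' /(extends_on_pin sS); exact: g_sum1.
Qed.

Lemma reveal_ge0 (E : pinning -> V -> C -> rat) S (g : pinning -> rat) p :
  (forall p' s b, 0 <= E p' s b) -> (forall p', 0 <= g p') -> 0 <= reveal E S g p.
Proof.
move=> E_ge0 g_ge0; elim: S p => [|s S IHS] p //=.
by apply: sumr_ge0 => b _; apply: mulr_ge0.
Qed.

Section Estimate.
Variable r : nat.

Definition sphere p v :=
  [seq s <- enum V | (s \in ball e v r.+2) && (s \notin ball e v r.+1) && (p s == None)].

Definition inner_ball p v := [set s in unpinned p | s \in ball e v r.+1].

Definition local_marginal p v a := marginal c0 e (inner_ball p v) (allowed p) v a.

Fixpoint estimate k p v a : rat :=
  if k is k'.+1 then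
    reveal (estimate k') (sphere p v) (fun p' => local_marginal p' v a) p
  else (a == least_allowed p v)%:R.

Lemma sphereP p v s : s \in sphere p v ->
  [/\ s \in ball e v r.+2, s \notin ball e v r.+1 & s \in unpinned p].
Proof.
rewrite mem_filter => /andP[/andP[/andP[s_ball s_far] ps] _].
by split; rewrite // inE ps.
Qed.

Lemma uniq_sphere p v : uniq (sphere p v).
Proof. exact/filter_uniq/enum_uniq. Qed.

Lemma sphere_unpinned p v : {subset sphere p v <= unpinned p}.
Proof. by move=> s /sphereP[]. Qed.

Lemma extends_on_sphere p v p' : v \in unpinned p -> extends_on (sphere p v) p p' ->
  v \in unpinned p' /\ allowed p v = allowed p' v.
Proof.
move=> v_unpinned [agree _].
have agree_ball w : w \in ball e v r.+1 -> p' w = p w.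
  by move=> w_ball; apply: agree; apply/negP=> /sphereP[_ /negP].
split; first by move: v_unpinned; rewrite !inE agree_ball ?ball_center.
apply/setP=> a; rewrite !inE; apply: eq_forallb => w; case evw: (e v w) => //=.
by rewrite agree_ball //; apply: ball_edge evw; exact: ball_center.
Qed.

Lemma ample_inner_ball p v : ample (inner_ball p v) (allowed p).
Proof. by apply: ampleS (@ample_allowed p); apply/subsetP=> w; rewrite inE => /andP[]. Qed.

Lemma estimate_sum1 k p v :
  v \in unpinned p -> \sum_(a in allowed p v) estimate k p v a = 1.
Proof.
elim: k p v => [|k IHk] p v v_unpinned /=.
  rewrite (bigD1 (least_allowed p v)) ?mem_least_allowed //= eqxx big1 ?addr0 // => a.
  by case/andP=> _ /negbTE->.
apply: reveal_sum1 => // [| |p' /(extends_on_sphere v_unpinned)[v_unpinned' ->]].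
- exact: uniq_sphere.
- exact: sphere_unpinned.
apply: marginal_sum1 => //; first by rewrite inE v_unpinned' ball_center.
exact: (ample_ncol_gt0 c0 e_sym e_irr e_lat Delta_lt (@ample_inner_ball p' v)).
Qed.

Lemma estimate_ge0 k p v a : 0 <= estimate k p v a.
Proof.
elim: k p v a => [|k IHk] p v a /=; first exact: ler0n.
by apply: reveal_ge0 => // p'; exact: marginal_ge0.
Qed.

(* Without unpinned vertices on the sphere the inner ball is cut off from the rest. *)
Lemma local_marginalE p v a : v \in unpinned p ->
  (forall s, s \in unpinned p -> s \in ball e v r.+2 -> s \in ball e v r.+1) ->
  local_marginal p v a = pin_marginal p v a.
Proof.
move=> v_unpinned sphere_pinned; set A := inner_ball p v.
have A_unpinned : A \subset unpinned p by apply/subsetP=> w; rewrite inE => /andP[].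
have vA : v \in A by rewrite inE v_unpinned ball_center.
have ncolA_gt0 := ample_ncol_gt0 c0 e_sym e_irr e_lat Delta_lt (@ample_inner_ball p v).
pose f (d : {ffun V -> C}) : rat := has_colour v a d - local_marginal p v a.
have csum_f H : csum H (allowed p) f =
    csum H (allowed p) (has_colour v a) - local_marginal p v a * ncol H (allowed p).
  by rewrite -csum_const -csumB.
have : csum (unpinned p) (allowed p) f = 0.
  apply: (csum_restrict_eq0 e_sym e_irr A_unpinned) => //.
  - by move=> d d' eq_dd'; rewrite /f /has_colour eq_dd'.
  - move=> w y /setIdP[w_unpinned w_ball] y_unpinned; rewrite in_set y_unpinned /=.
    by apply: contra => ewy; apply: sphere_pinned => //; exact: ball_edge w_ball ewy.
  by rewrite csum_f /local_marginal /marginal -/A mulfVK ?subrr // gt_eqF.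
rewrite csum_f => /eqP; rewrite subr_eq0 => /eqP eq_csum.
by rewrite /pin_marginal /marginal eq_csum mulfK // gt_eqF // num_extensions_gt0.
Qed.

Lemma extends_on_sphere_local_marginalE p v p' a :
  v \in unpinned p -> extends_on (sphere p v) p p' ->
  local_marginal p' v a = pin_marginal p' v a.
Proof.
move=> v_unpinned p'_ext; have [v_unpinned' _] := extends_on_sphere v_unpinned p'_ext.
apply: local_marginalE => // s; rewrite inE => p's s_ball; apply/negPn/negP=> s_out.
case: p'_ext => agree pinned; have [/pinned|s_sphere] := boolP (s \in sphere p v).
  by rewrite p's.
have p's_ps := agree s s_sphere; move: s_sphere.
by rewrite mem_filter s_ball s_out mem_enum -p's_ps p's.
Qed.

Section Error.
Variables (K lam : rat).
Hypothesis mixing : spatial_mixing c0 e lat Delta K lam.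
Let eta := K * lam ^+ r.
Hypothesis eta_ge0 : 0 <= eta.

Lemma reveal1_error (E f : C -> rat) p v s c b0 :
  s \in unpinned p -> s != v -> \sum_(b in allowed p s) E b = 1 ->
  \sum_(b in allowed p s) E b * f b - pin_marginal p v c =
  \sum_(b in allowed p s) E b * (f b - pin_marginal (pin p s b) v c) +
  \sum_(b in allowed p s) (E b - pin_marginal p s b) *
    (pin_marginal (pin p s b) v c - pin_marginal (pin p s b0) v c).
Proof.
move=> s_unpinned sv E_sum1; rewrite (pin_marginal_total c s_unpinned sv).
have cancel : \sum_(b in allowed p s)
    (E b - pin_marginal p s b) * pin_marginal (pin p s b0) v c = 0.
  by rewrite -mulr_suml sumrB E_sum1 pin_marginal_sum1 // subrr mul0r.
under [X in _ = _ + X]eq_bigr => b _ do rewrite mulrBr.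
rewrite [X in _ = _ + X]sumrB cancel subr0 -sumrB -big_split /=.
by apply: eq_bigr => b _; ring.
Qed.

Lemma reveal_error (E : pinning -> V -> C -> rat) (delta : rat) S (g : pinning -> rat) p v c :
  (forall p' s b, 0 <= E p' s b) ->
  (forall p' s, s \in unpinned p' -> \sum_(b in allowed p' s) E p' s b = 1) ->
  (forall p' s b, s \in unpinned p' -> `|E p' s b - pin_marginal p' s b| <= delta) ->
  0 <= delta -> uniq S -> {subset S <= unpinned p} ->
  (forall s, s \in S -> s \notin ball e v r.+1) ->
  (forall p', extends_on S p p' -> g p' = pin_marginal p' v c) ->
  `|reveal E S g p - pin_marginal p v c| <= (size S)%:R * (#|C|%:R * (delta * eta)).
Proof.
move=> E_ge0 E_sum1 E_near delta_ge0.
elim: S p => [|s S IHS] p /= uniq_S S_unpinned S_far g_exact.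
  by rewrite g_exact ?subrr ?normr0 ?mul0r //; split.
case/andP: uniq_S => sS uniq_S.
have s_unpinned : s \in unpinned p by rewrite S_unpinned ?mem_head.
have s_far : s \notin ball e v r.+1 by rewrite S_far ?mem_head.
set X := #|C|%:R * (delta * eta).
have {}IHS b : `|reveal E S g (pin p s b) - pin_marginal (pin p s b) v c| <= (size S)%:R * X.
  apply: IHS => //; first exact: unpinned_pin_tail sS S_unpinned.
  - by move=> u uS; apply: S_far; rewrite inE uS orbT.
  - by move=> p' /(extends_on_pin sS); exact: g_exact.
rewrite (reveal1_error _ c (least_allowed p s)) ?E_sum1 ?(notin_ball_neq s_far) //.
apply: le_trans (ler_normD _ _) _; rewrite mulrSr mulrDl mul1r; apply: lerD.
  apply: le_trans (ler_norm_sum _ _ _) _.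
  apply: le_trans (_ : \sum_(b in allowed p s) E p s b * ((size S)%:R * X) <= _); last first.
    by rewrite -mulr_suml E_sum1 // mul1r.
  by apply: ler_sum => b _; rewrite normrM (ger0_norm (E_ge0 _ _ _)); exact: ler_wpM2l.
apply: le_trans (ler_norm_sum _ _ _) _.
apply: le_trans (_ : \sum_(b in allowed p s) delta * eta <= _).
  apply: ler_sum => b _; rewrite normrM; apply: ler_pM => //; first exact: E_near.
  by rewrite !(pin_marginal_pin _ _ _ s_unpinned); apply: mixing => //; exact: ample_allowed.
rewrite sumr_const -[_ *+ _]mulr_natl; apply: ler_wpM2r; first exact: mulr_ge0.
by rewrite ler_nat; exact: max_card.
Qed.

Variable Smax : nat.
Hypothesis sphere_le : forall p v, (size (sphere p v) <= Smax)%N.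
Hypothesis eta_small : Smax%:R * (#|C|%:R * eta) <= 1 / 2.

Lemma estimate_error k p v a :
  v \in unpinned p -> `|estimate k p v a - pin_marginal p v a| <= (1 / 2) ^+ k.
Proof.
elim: k p v a => [|k IHk] p v a v_unpinned.
  rewrite expr0 /= ler_norml; have := pin_marginal_ge0 p v a; have := pin_marginal_le1 p v a.
  by case: (a == _) => /=; lra.
have half_ge0 : 0 <= (1 / 2 : rat) ^+ k by apply: exprn_ge0; lra.
apply: le_trans (reveal_error (delta := (1 / 2) ^+ k) _ _ _ half_ge0 _ _ _ _) _.
- exact: estimate_ge0.
- by move=> p' s; exact: estimate_sum1.
- by move=> p' s b; exact: IHk.
- exact: uniq_sphere.
- exact: sphere_unpinned.
- by move=> s /sphereP[].
- by move=> p'; exact: extends_on_sphere_local_marginalE.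
rewrite exprS; apply: le_trans (_ : Smax%:R * (#|C|%:R * eta) * (1 / 2) ^+ k <= _).
  rewrite [_ ^+ k * eta]mulrC [#|C|%:R * (eta * _)]mulrA [leLHS]mulrA.
  apply: (ler_wpM2r half_ge0); apply: ler_wpM2r; last by rewrite ler_nat.
  exact: (mulr_ge0 (ler0n _ _) eta_ge0).
exact: ler_wpM2r.
Qed.

Fixpoint count_estimate k (vs : seq V) p : rat :=
  if vs is v :: vs' then
    (estimate k p v (least_allowed p v))^-1 * count_estimate k vs' (pin p v (least_allowed p v))
  else 1.

Lemma count_estimate_bounds k (tau : rat) vs p : uniq vs -> unpinned p = [set v in vs] ->
  0 <= tau -> (size vs)%:R * tau <= 1 / 2 -> (1 / 2) ^+ k <= marginal_lb * tau ->
  [/\ 0 < count_estimate k vs p,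
      (1 - (size vs)%:R * tau) * num_extensions p <= count_estimate k vs p
    & (1 - (size vs)%:R * tau) * count_estimate k vs p <= num_extensions p].
Proof.
elim: vs p => [|v vs IHvs] p /=.
  move=> _ no_unpinned _ _ _; rewrite /num_extensions no_unpinned set_nil ncol_set0.
  by rewrite mul0r subr0 !mul1r; split; [exact: ltr01|exact: lexx|exact: lexx].
move=> /andP[v_vs uniq_vs] unpinned_vs tau_ge0 tau_small k_large.
have v_unpinned : v \in unpinned p by rewrite unpinned_vs !inE eqxx.
set a := least_allowed p v; have a_allowed : a \in allowed p v by exact: mem_least_allowed.
have unpinned_vs' : unpinned (pin p v a) = [set w in vs].
  rewrite unpinned_pin unpinned_vs; apply/setP=> w; rewrite !inE.
  by case: (eqVneq w v) => [->|//]; rewrite (negPf v_vs).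
rewrite -natr1 mulrDl mul1r in tau_small *.
have ntau_ge0 : 0 <= (size vs)%:R * tau by rewrite mulr_ge0.
have [|X_gt0] := IHvs _ uniq_vs unpinned_vs' tau_ge0 _ k_large; first by lra.
rewrite (num_extensions_pin v_unpinned a_allowed) => X_ge X_le.
have P_ge := pin_marginal_ge v_unpinned a_allowed.
have P_gt0 := lt_le_trans marginal_lb_gt0 P_ge.
apply: (reciprocal_factor_bounds _ tau_ge0 tau_small P_gt0 _ X_gt0 _ X_ge X_le).
- exact: ler0n.
- by apply: ltW; exact: num_extensions_gt0.
rewrite mulrBr mulrDr mulr1 -ler_distl.
apply: le_trans (estimate_error k a v_unpinned) _; apply: le_trans k_large _.
exact: ler_wpM2r.
Qed.

Lemma count_estimate_approx k (eps : rat) vs p :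
  uniq vs -> unpinned p = [set v in vs] -> 0 < eps < 1 ->
  (2 * (size vs)%:R + 1) * (1 / 2) ^+ k <= marginal_lb * eps ->
  0 < count_estimate k vs p /\
  (1 - eps) * num_extensions p <= count_estimate k vs p <= (1 + eps) * num_extensions p.
Proof.
move=> uniq_vs unpinned_vs eps_range k_large; have /andP[eps_gt0 eps_lt1] := eps_range.
have n_ge0 : 0 <= (size vs)%:R :> rat by exact: ler0n.
have D_gt0 : 0 < 2 * (size vs)%:R + 1 :> rat by lra.
pose tau := eps / (2 * (size vs)%:R + 1).
have tauE : tau * (2 * (size vs)%:R + 1) = eps by rewrite mulfVK // gt_eqF.
have tau_ge0 : 0 <= tau by apply: divr_ge0; exact: ltW.
have ntau_le : (size vs)%:R * tau <= eps / 2 by lra.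
have [||X_gt0 X_ge X_le] := count_estimate_bounds (k := k) uniq_vs unpinned_vs tau_ge0.
- by lra.
- by rewrite mulrA ler_pdivlMr // mulrC.
split; first exact: X_gt0.
apply: (approximation_of_bounds eps_range ntau_le _ _ X_ge X_le); last exact: ltW.
by apply: ltW; exact: num_extensions_gt0.
Qed.

End Error.
End Estimate.
End Pinnings.

Lemma bernoulli (R : realFieldType) (h : R) m : 0 <= h -> 1 + m%:R * h <= (1 + h) ^+ m.
Proof.
move=> h_ge0; elim: m => [|m IHm]; first by rewrite mul0r addr0 expr0.
rewrite exprS -natr1; apply: le_trans (_ : (1 + h) * (1 + m%:R * h) <= _).
  have : 0 <= h * (m%:R * h) by rewrite !mulr_ge0 ?ler0n.
  by lra.
by apply: ler_wpM2l => //; lra.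
Qed.

Lemma exprn_decay (R : realFieldType) (h : R) m :
  0 <= h <= 1 -> (1 - h) ^+ m * (m%:R * h) <= 1.
Proof.
move=> /andP[h_ge0 h_le1].
apply: le_trans (_ : (1 - h) ^+ m * (1 + h) ^+ m <= _).
  apply: ler_wpM2l; first by apply: exprn_ge0; lra.
  by apply: le_trans (bernoulli m h_ge0); lra.
rewrite -exprMn; apply: exprn_ile1; first by apply: mulr_ge0; lra.
by have := mulr_ge0 h_ge0 h_ge0; lra.
Qed.

Lemma cubic_times_decay_le (R : realFieldType) (A h m y : R) :
  0 <= A -> 0 < h -> 0 < m -> 0 <= y -> y * (m * h) <= 1 ->
  4 * A * 13%:R ^+ 3 <= m * h ^+ 4 -> 2 * (13%:R * m) ^+ 3 * (A * y ^+ 4) <= 1 / 2.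
Proof.
move=> A_ge0 h_gt0 m_gt0 y_ge0 y_le m_large.
have y4_le : y ^+ 4 * (m * h) ^+ 4 <= 1.
  by rewrite -exprMn exprn_ile1 // !mulr_ge0 // ltW.
have m3y4_ge0 : 0 <= m ^+ 3 * y ^+ 4 by rewrite mulr_ge0 // exprn_ge0 // ltW.
have := ler_wpM2r m3y4_ge0 m_large.
rewrite (_ : m * h ^+ 4 * _ = y ^+ 4 * (m * h) ^+ 4); last by ring.
rewrite (_ : 2 * _ * _ = 4 * A * 13%:R ^+ 3 * (m ^+ 3 * y ^+ 4) / 2); last by field.
by lra.
Qed.

(* 2 (2 r + 5)^3 bounds the number of vertices of a sphere of radius r + 2. *)
Lemma exists_mixing_radius (A lam : rat) : 0 <= A -> 0 <= lam < 1 ->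
  exists r, (2 * (2 * r.+2 + 1) ^ 3)%:R * (A * lam ^+ r) <= 1 / 2.
Proof.
move=> A_ge0 /andP[lam_ge0 lam_lt1]; pose h := 1 - lam.
have h_gt0 : 0 < h by rewrite subr_gt0.
have h_le1 : h <= 1 by rewrite lerBlDr lerDl.
pose B := 4 * A * 13%:R ^+ 3 / h ^+ 4; pose m := (Num.bound B).+1.
have B_ge0 : 0 <= B by rewrite divr_ge0 ?exprn_ge0 ?(ltW h_gt0) // !mulr_ge0 ?exprn_ge0 ?ler0n.
have m_gt0 : 0 < m%:R :> rat by rewrite ltr0n.
have B_le : B <= m%:R by apply: ltW; apply: lt_le_trans (archi_boundP B_ge0) _; rewrite ler_nat.
have lamE : lam = 1 - h by rewrite opprB addrC subrK.
exists (m * 4)%N; rewrite exprM.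
have poly_le : (2 * (2 * (m * 4).+2 + 1) ^ 3)%:R <= 2 * (13%:R * m%:R) ^+ 3 :> rat.
  rewrite -natrM -natrX -natrM ler_nat leq_mul2l /= leq_exp2r //.
  by rewrite /m; clear; lia.
have decay_ge0 : 0 <= A * (lam ^+ m) ^+ 4 by rewrite mulr_ge0 ?exprn_ge0.
apply: le_trans (ler_wpM2r decay_ge0 poly_le) _.
apply: (cubic_times_decay_le A_ge0 h_gt0 m_gt0).
- exact: exprn_ge0.
- by rewrite lamE; apply: exprn_decay; apply/andP; split; [exact: ltW|exact: h_le1].
by rewrite -ler_pdivrMr // exprn_gt0.
Qed.
End Estimator.

Module PolyTime.
Import Defs.

(* The first argument is a unary clock. *)
Definition clocked_fun := nat -> tree -> tree.

Definition hd (t : tree) := if t is Node a _ then a else Leaf.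

Definition tl (t : tree) := if t is Node _ a then a else Leaf.

Fixpoint spine (t : tree) : seq tree := if t is Node x u then x :: spine u else [::].

Lemma spine_seq s : spine (tree_of_seq s) = s.
Proof. by elim: s => //= x s ->. Qed.

Definition clock (s : store) : nat := size (spine (s 1)).

(* The clock is read from register 1; registers below [b] are preserved. *)
Definition implements (c : cmd) (f : clocked_fun) (b : nat) (time : nat -> nat) :=
  forall s, exists k s',
  [/\ exec c s k s', k <= time (clock s), s' b = f (clock s) (s b)
    & forall i, i < b -> s' i = s i].

Definition poly_time (f : clocked_fun) : Prop :=
  exists K d, forall b, 1 < b -> exists c, implements c f b (fun N => K * N.+1 ^ d).

Lemma update_eq s x t : update s x t x = t.
Proof. by rewrite /update eqxx. Qed.

Lemma update_neq s x t y : y != x -> update s x t y = s y.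
Proof. by rewrite /update => /negbTE->. Qed.

Lemma clock_frame s s' : s' 1 = s 1 -> clock s' = clock s.
Proof. by rewrite /clock => ->. Qed.

Lemma leq_mul_powD K d d' N : K * N.+1 ^ d <= K * N.+1 ^ (d + d').
Proof. by rewrite leq_mul2l leq_pexp2l ?leq_addr ?orbT. Qed.

Lemma leq_mul_pow m d N : m <= m * N.+1 ^ d.
Proof. by rewrite leq_pmulr // expn_gt0. Qed.

Lemma poly_time_expr (f : clocked_fun) E :
  (forall s b N, eval s (E b) = f N (s b)) -> (forall b, cost (E b) <= 9) -> poly_time f.
Proof.
move=> evalE cost_le; exists 10, 0 => b b_gt1; exists (Assign b (E b)) => s.
exists (cost (E b)).+1, (update s b (eval s (E b))); split.
- exact: exec_assign.
- by rewrite expn0 muln1 ltnS.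
- by rewrite update_eq; exact: evalE.
by move=> i i_lt; rewrite update_neq // ltn_eqF.
Qed.

Lemma poly_time_id : poly_time (fun _ t => t).
Proof. exact: (@poly_time_expr _ EVar). Qed.

Lemma poly_time_leaf : poly_time (fun _ _ => Leaf).
Proof. exact: (@poly_time_expr _ (fun _ => ELeaf)). Qed.

Lemma poly_time_comp (g f : clocked_fun) :
  poly_time g -> poly_time f -> poly_time (fun N t => g N (f N t)).
Proof.
move=> [Kg [dg g_impl]] [Kf [df f_impl]]; exists (Kg + Kf + 1), (dg + df) => b b_gt1.
have [cg {}g_impl] := g_impl b b_gt1; have [cf {}f_impl] := f_impl b b_gt1.
exists (Seq cf cg) => s.
have [k1 [s1 [exec1 time1 value1 frame1]]] := f_impl s.
have [k2 [s2 [exec2 time2 value2 frame2]]] := g_impl s1.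
have clock1 := clock_frame (frame1 1 b_gt1); rewrite clock1 in time2 value2.
exists (k1 + k2).+1, s2; split; first exact: exec_seq exec1 exec2.
- have := leq_mul_powD Kg dg df (clock s).
  have := leq_mul_powD Kf df dg (clock s); rewrite [df + dg]addnC.
  have := leq_mul_pow 1 (dg + df) (clock s); rewrite !mulnDl.
  by move: time1 time2; clear; lia.
- by rewrite value2 value1.
by move=> i i_lt; rewrite frame2 // frame1.
Qed.

Lemma poly_time_hd f : poly_time f -> poly_time (fun N t => hd (f N t)).
Proof.
apply: (@poly_time_comp (fun _ => hd)).
exact: (@poly_time_expr _ (fun b => EFst (EVar b))).
Qed.

Lemma poly_time_tl f : poly_time f -> poly_time (fun N t => tl (f N t)).
Proof.
apply: (@poly_time_comp (fun _ => tl)).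
exact: (@poly_time_expr _ (fun b => ESnd (EVar b))).
Qed.

Lemma poly_time_node (f g : clocked_fun) :
  poly_time f -> poly_time g -> poly_time (fun N t => Node (f N t) (g N t)).
Proof.
move=> [Kf [df f_impl]] [Kg [dg g_impl]]; exists (Kg + Kf + 12), (dg + df) => b b_gt1.
have [cf {}f_impl] := f_impl b.+1 (ltnW b_gt1).
have [cg {}g_impl] := g_impl b.+2 (ltnW (ltnW b_gt1)).
exists (Seq (Assign b.+1 (EVar b)) (Seq cf (Seq (Assign b.+2 (EVar b))
  (Seq cg (Assign b (ENode (EVar b.+1) (EVar b.+2))))))) => s.
have [k1 [s1 [exec1 time1 value1 frame1]]] := f_impl (update s b.+1 (s b)).
have [k2 [s2 [exec2 time2 value2 frame2]]] := g_impl (update s1 b.+2 (s1 b)).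
have clock1 : clock (update s b.+1 (s b)) = clock s.
  by apply: clock_frame; rewrite update_neq //; lia.
have clock2 : clock (update s1 b.+2 (s1 b)) = clock s.
  by apply: clock_frame; rewrite update_neq ?frame1 ?update_neq //; lia.
have s1b : s1 b = s b by rewrite frame1 ?update_neq //; lia.
rewrite clock1 update_eq in time1 value1; rewrite clock2 update_eq s1b in time2 value2.
exists (2 + (k1 + (2 + (k2 + 4).+1).+1).+1).+1, (update s2 b (Node (s2 b.+1) (s2 b.+2))).
split.
- apply: exec_seq; first exact: exec_assign.
  apply: exec_seq exec1 _; apply: exec_seq; first exact: exec_assign.
  by apply: exec_seq exec2 _; exact: exec_assign.
- have := leq_mul_powD Kg dg df (clock s).
  have := leq_mul_powD Kf df dg (clock s); rewrite [df + dg]addnC.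
  have := leq_mul_pow 12 (dg + df) (clock s); rewrite !mulnDl.
  by move: time1 time2; clear; lia.
- rewrite update_eq value2 frame2 // update_neq ?value1 //; lia.
by move=> i i_lt; rewrite update_neq ?frame2 ?update_neq ?frame1 ?update_neq //; lia.
Qed.

Lemma poly_time_if (h f g : clocked_fun) : poly_time h -> poly_time f -> poly_time g ->
  poly_time (fun N t => if truthy (h N t) then f N t else g N t).
Proof.
move=> [Kh [dh h_impl]] [Kf [df f_impl]] [Kg [dg g_impl]].
exists (Kh + (Kf + Kg) + 12), (dh + (df + dg)) => b b_gt1.
have [ch {}h_impl] := h_impl b.+1 (ltnW b_gt1).
have [cf {}f_impl] := f_impl b b_gt1; have [cg {}g_impl] := g_impl b b_gt1.
exists (Seq (Assign b.+1 (EVar b)) (Seq ch (If (EVar b.+1) cf cg))) => s.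
have [k1 [s1 [exec1 time1 value1 frame1]]] := h_impl (update s b.+1 (s b)).
have clock0 : clock (update s b.+1 (s b)) = clock s.
  by apply: clock_frame; rewrite update_neq //; lia.
have clock1 : clock s1 = clock s by apply: clock_frame; rewrite frame1 ?update_neq //; lia.
have s1b : s1 b = s b by rewrite frame1 ?update_neq //; lia.
rewrite clock0 update_eq in time1 value1; set N := clock s in time1 value1 *.
have [k2 [s2 [exec2 time2 value2 frame2]]] : exists k s',
   [/\ exec (if truthy (eval s1 (EVar b.+1)) then cf else cg) s1 k s',
       k <= (Kf + Kg) * N.+1 ^ (df + dg),
       s' b = (if truthy (h N (s b)) then f N (s b) else g N (s b))
     & forall i, i < b -> s' i = s1 i].
  rewrite /= value1; case: ifP => _.
    have [k2 [s2 [exec2 time2 value2 frame2]]] := f_impl s1; exists k2, s2.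
    split=> //; last by rewrite value2 clock1 s1b.
    apply: leq_trans time2 _; rewrite clock1; apply: leq_trans (leq_mul_powD _ _ dg _) _.
    by rewrite leq_mul2r leq_addr orbT.
  have [k2 [s2 [exec2 time2 value2 frame2]]] := g_impl s1; exists k2, s2.
  split=> //; last by rewrite value2 clock1 s1b.
  apply: leq_trans time2 _; rewrite clock1; apply: leq_trans (leq_mul_powD _ _ df _) _.
  by rewrite addnC leq_mul2r leq_addl orbT.
exists (2 + (k1 + (1 + k2).+1).+1).+1, s2; split.
- apply: exec_seq; first exact: exec_assign.
  by apply: exec_seq exec1 _; exact: exec_if.
- have := leq_mul_powD Kh dh (df + dg) N.
  have := leq_mul_powD (Kf + Kg) (df + dg) dh N; rewrite [df + dg + dh]addnC.
  have := leq_mul_pow 12 (dh + (df + dg)) N; rewrite !mulnDl.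
  by move: time1 time2; rewrite mulnDl; clear; lia.
- exact: value2.
by move=> i i_lt; rewrite frame2 // frame1 ?update_neq //; lia.
Qed.

Lemma while_exec (time b : nat) (c : cmd) (f : tree -> tree) (s0 : store) :
  (forall s, (forall i, i < b -> s i = s0 i) -> exists k s',
     [/\ exec c s k s', k <= time, s' b = f (s b), s' b.+1 = tl (s b.+1)
       & forall i, i < b -> s' i = s i]) ->
  forall u s, s b.+1 = u -> (forall i, i < b -> s i = s0 i) -> exists k s',
    [/\ exec (While (EVar b.+1) c) s k s', k <= size (spine u) * (time + 2) + 2,
        s' b = iter (size (spine u)) f (s b) & forall i, i < b -> s' i = s i].
Proof.
move=> c_exec; elim=> [|x _ u IHu] s s_u s_frame.
  by exists 2, s; split=> //; apply: exec_while_done; rewrite /= s_u.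
have [k1 [s1 [exec1 time1 value1 s1_u frame1]]] := c_exec s s_frame.
rewrite s_u /= in s1_u.
have s1_frame i : i < b -> s1 i = s0 i by move=> i_lt; rewrite frame1 // s_frame.
have [k2 [s2 [exec2 time2 value2 frame2]]] := IHu s1 s1_u s1_frame.
exists (1 + k1 + k2).+1, s2; split.
- by apply: exec_while_step exec1 exec2; rewrite /= s_u.
- by move: time1 time2; rewrite /= mulSn; clear; lia.
- by rewrite value2 value1 -iterSr.
by move=> i i_lt; rewrite frame2 // frame1.
Qed.

Definition loop_body (c : cmd) (b : nat) :=
  Seq (Assign b.+2 (EVar b))
    (Seq c (Seq (Assign b (EVar b.+2)) (Assign b.+1 (ESnd (EVar b.+1))))).

Lemma loop_body_exec c (f : clocked_fun) b time s :
  1 < b -> implements c f b.+2 time -> exists k s',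
  [/\ exec (loop_body c b) s k s', k <= time (clock s) + 10, s' b = f (clock s) (s b),
      s' b.+1 = tl (s b.+1) & forall i, i < b -> s' i = s i].
Proof.
move=> b_gt1 c_impl.
have [k [s1 [exec1 time1 value1 frame1]]] := c_impl (update s b.+2 (s b)).
have clock1 : clock (update s b.+2 (s b)) = clock s.
  by apply: clock_frame; rewrite update_neq //; lia.
rewrite clock1 update_eq in time1 value1; set s2 := update s1 b (s1 b.+2).
exists (2 + (k + (2 + 3).+1).+1).+1, (update s2 b.+1 (eval s2 (ESnd (EVar b.+1)))); split.
- apply: exec_seq; first exact: exec_assign.
  by apply: exec_seq exec1 _; apply: exec_seq; exact: exec_assign.
- by move: time1; clear; lia.
- by rewrite update_neq ?/s2 ?update_eq //; lia.
- by rewrite update_eq /= /s2 update_neq ?frame1 ?update_neq //; lia.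
by move=> i i_lt; rewrite update_neq ?/s2 ?update_neq ?frame1 ?update_neq //; lia.
Qed.

Lemma poly_time_loop (f : clocked_fun) : poly_time f -> poly_time (fun N t => iter N (f N) t).
Proof.
move=> [K [d f_impl]]; exists (K + 20), d.+1 => b b_gt1.
have [c {}f_impl] := f_impl b.+2 (ltnW (ltnW b_gt1)).
exists (Seq (Assign b.+1 (EVar 1)) (While (EVar b.+1) (loop_body c b))) => s.
set N := clock s.
have body_exec s1 : (forall i, i < b -> s1 i = s i) -> exists k s',
   [/\ exec (loop_body c b) s1 k s', k <= K * N.+1 ^ d + 10, s' b = f N (s1 b),
       s' b.+1 = tl (s1 b.+1) & forall i, i < b -> s' i = s1 i].
  move=> /(_ 1 b_gt1)/clock_frame; rewrite -/N => clock1.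
  by have := loop_body_exec s1 b_gt1 f_impl; rewrite clock1.
have [||k [s' [exec1 time1 value1 frame1]]] :=
  while_exec body_exec (u := s 1) (s := update s b.+1 (s 1)).
- by rewrite update_eq.
- by move=> i i_lt; rewrite update_neq //; lia.
rewrite -/(clock s) -/N in time1 value1.
exists (2 + k).+1, s'; split.
- by apply: exec_seq exec1; exact: exec_assign.
- apply: leq_trans (_ : 3 + (N * (K * N.+1 ^ d + 10 + 2) + 2) <= _).
    by move: time1; clear; lia.
  have : 0 < N.+1 ^ d by rewrite expn_gt0.
  by rewrite expnS; set P := _ ^ d; clear; nia.
- by rewrite value1 update_neq //; lia.
by move=> i i_lt; rewrite frame1 ?update_neq //; lia.
Qed.

Definition fold_step (body : clocked_fun) : clocked_fun := fun N u =>
  if truthy (hd u) then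
    Node (tl (hd u)) (Node (body N (Node (hd (hd u)) (tl u))) (tl (tl u)))
  else u.

(* The argument is [Node list (Node accumulator context)]. *)
Definition fold_prog (body : clocked_fun) : clocked_fun := fun N u =>
  hd (tl (iter N (fold_step body N) u)).

Lemma poly_time_fold body : poly_time body -> poly_time (fold_prog body).
Proof.
move=> body_poly; apply/poly_time_hd/poly_time_tl/poly_time_loop.
apply/poly_time_if; [exact/poly_time_hd/poly_time_id| |exact: poly_time_id].
apply: poly_time_node; first exact/poly_time_tl/poly_time_hd/poly_time_id.
apply: poly_time_node; last exact/poly_time_tl/poly_time_tl/poly_time_id.
apply: (poly_time_comp body_poly); apply: poly_time_node.
  exact/poly_time_hd/poly_time_hd/poly_time_id.
exact/poly_time_tl/poly_time_id.
Qed.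

Lemma fold_progE body N l acc ctx : size (spine l) <= N ->
  fold_prog body N (Node l (Node acc ctx)) =
  foldl (fun a x => body N (Node x (Node a ctx))) acc (spine l).
Proof.
rewrite /fold_prog.
have stuck a m : iter m (fold_step body N) (Node Leaf (Node a ctx)) = Node Leaf (Node a ctx).
  by elim: m => //= m ->.
move: {1 2}N => m; elim: l acc m => [|x _ l IHl] acc m /= l_le; first by rewrite stuck.
by case: m l_le => // m l_le; rewrite iterSr /fold_step /=; exact: IHl.
Qed.

Create HintDb poly_time.

Ltac poly_time_step := match goal with
  | |- poly_time (fun _ t => t) => exact: poly_time_id
  | |- poly_time (fun _ _ => Leaf) => exact: poly_time_leaf
  | |- poly_time (fun N t => hd _) => apply: poly_time_hd
  | |- poly_time (fun N t => tl _) => apply: poly_time_tl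
  | |- poly_time (fun N t => Node _ _) => apply: poly_time_node
  | |- poly_time (fun N t => if truthy _ then _ else _) => apply: poly_time_if
  | |- poly_time (fold_prog _) => apply: poly_time_fold
  | |- poly_time (fun N t => fold_prog ?b N _) =>
      apply: (@poly_time_comp (fold_prog b)); [apply: poly_time_fold|]
  | |- poly_time ?g => solve [auto with poly_time]
  | |- poly_time (fun N t => ?g N _) =>
      apply: (@poly_time_comp g); [solve [auto with poly_time]|]
  end.
Ltac prove_poly_time := repeat poly_time_step.
End PolyTime.

Module TreeArithmetic.
Import Defs PolyTime.
Notation tree_of_bool := tree_of_bool.
Notation tree_true := (Node Leaf Leaf).

Fixpoint tree_catrev (t out : tree) : tree := if t is Node x u then tree_catrev u (Node x out) else out.
Lemma tree_catrevK t : tree_catrev (tree_catrev t Leaf) Leaf = t.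
Proof.
suff gen u o : tree_catrev (tree_catrev u o) Leaf = tree_catrev o u by exact: gen.
by elim: u o => [|x _ u IH] o //=; rewrite IH.
Qed.
Lemma tree_catrev_seq s o : tree_catrev (tree_of_seq s) o = tree_of_seq (catrev s (spine o)).
Proof.
elim: s o => [|x s IH] o /=; last by rewrite IH.
by elim: o => //= x _ o {1}->.
Qed.
Lemma foldl_tree_catrev t o : foldl (fun a x => Node x a) o (spine t) = tree_catrev t o.
Proof. by elim: t o => //= x _ u IH o; rewrite IH. Qed.
Lemma size_tree_catrev t o : size (spine (tree_catrev t o)) = size (spine t) + size (spine o).
Proof. by elim: t o => //= x _ u IH o; rewrite IH /= addnS. Qed.

Definition catrev_prog : clocked_fun := fun N t =>
  fold_prog (fun N u => Node (hd u) (hd (tl u))) N (Node (hd t) (Node (tl t) Leaf)).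
Lemma poly_time_catrev : poly_time catrev_prog. Proof. rewrite /catrev_prog; prove_poly_time. Qed.
#[global] Hint Resolve poly_time_catrev : poly_time.
Lemma catrev_progE N l o : size (spine l) <= N -> catrev_prog N (Node l o) = tree_catrev l o.
Proof. by move=> h; rewrite /catrev_prog fold_progE //= foldl_tree_catrev. Qed.

Definition rev_prog : clocked_fun := fun N t => catrev_prog N (Node t Leaf).
Lemma poly_time_rev : poly_time rev_prog. Proof. rewrite /rev_prog; prove_poly_time. Qed.
#[global] Hint Resolve poly_time_rev : poly_time.
Lemma rev_progE N l : size (spine l) <= N -> rev_prog N l = tree_catrev l Leaf.
Proof. exact: catrev_progE. Qed.

Lemma poly_time_const t : poly_time (fun _ _ => t).
Proof. by elim: t => [|x IHx y IHy]; [exact: poly_time_leaf|exact: poly_time_node]. Qed.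
#[global] Hint Resolve poly_time_const : poly_time.

Definition tree_nth (c : nat) (t : tree) := hd (iter c tl t).
Lemma tree_nthE c t : tree_nth c t = nth Leaf (spine t) c.
Proof.
rewrite /tree_nth; elim: c t => [|c IH] t; first by case: t.
by rewrite iterSr IH; case: t => //=; rewrite nth_nil.
Qed.
Lemma poly_time_nth c : poly_time (fun _ t => tree_nth c t).
Proof. by apply: poly_time_hd; elim: c => [|c IH]; [exact: poly_time_id|exact: poly_time_tl]. Qed.

Fixpoint binary (m a : nat) : tree := if m is m'.+1 then Node (tree_of_bool (odd a)) (binary m' a./2) else Leaf.
Lemma size_binary m a : size (spine (binary m a)) = m.
Proof. by elim: m a => //= m IH a; rewrite IH. Qed.

Lemma binary_mod m a b : binary m (a + 2 ^ m * b) = binary m a.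
Proof.
elim: m a b => //= m IH a b; rewrite expnS -mulnA oddD oddM addbF; congr Node.
by rewrite mul2n halfD odd_double andbF add0n doubleK IH.
Qed.

Definition tree_xor (a b : tree) := if truthy a then (if truthy b then Leaf else tree_true) else (if truthy b then tree_true else Leaf).
Definition tree_majority (a b c : tree) := if truthy a then (if truthy b then tree_true else if truthy c then tree_true else Leaf)
  else if truthy b then (if truthy c then tree_true else Leaf) else Leaf.

(* The state is [Node x (Node y (Node carry out))]. *)
Definition add_step : clocked_fun := fun _ s =>
  Node (tl (hd s)) (Node (tl (hd (tl s)))
   (Node (tree_majority (hd (hd s)) (hd (hd (tl s))) (hd (tl (tl s))))
     (Node (tree_xor (tree_xor (hd (hd s)) (hd (hd (tl s)))) (hd (tl (tl s)))) (tl (tl (tl s)))))).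
Definition add_prog : clocked_fun := fun N t =>
  rev_prog N (tl (tl (tl (iter N (add_step N) (Node (hd t) (Node (tl t) tree_true)))))).
Lemma poly_time_xor f g : poly_time f -> poly_time g -> poly_time (fun N t => tree_xor (f N t) (g N t)).
Proof. by move=> hf hg; rewrite /tree_xor; prove_poly_time. Qed.
Lemma poly_time_add : poly_time add_prog.
Proof.
rewrite /add_prog; apply: (poly_time_comp poly_time_rev); do 3!apply: poly_time_tl.
apply: (@poly_time_comp (fun N t => iter N (add_step N) t)); last by prove_poly_time.
apply: poly_time_loop; rewrite /add_step; apply: poly_time_node; first by prove_poly_time.
apply: poly_time_node; first by prove_poly_time.
apply: poly_time_node; first by rewrite /tree_majority; prove_poly_time.
apply: poly_time_node; last by prove_poly_time.
by apply: poly_time_xor; [apply: poly_time_xor|]; prove_poly_time.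
Qed.
#[global] Hint Resolve poly_time_add : poly_time.

Lemma add_iter N m a b (c : bool) o : tl (tl (tl (iter m (add_step N)
    (Node (binary m a) (Node (binary m b) (Node (tree_of_bool c) o)))))) = tree_catrev (binary m (a + b + c)) o.
Proof.
elim: m a b c o => [|m IH] a b c o //; rewrite iterSr.
have -> : add_step N (Node (binary m.+1 a) (Node (binary m.+1 b) (Node (tree_of_bool c) o))) =
  Node (binary m a./2) (Node (binary m b./2) (Node (tree_of_bool (1 < odd a + odd b + c)) (Node (tree_of_bool (odd (a + b + c))) o))).
  by rewrite /add_step /= !oddD; case: (odd a); case: (odd b); case: c.
rewrite IH /=; congr (tree_catrev (binary m _) _).
have := odd_double_half a; have := odd_double_half b; have := odd_double_half (a + b + c).
rewrite !oddD -!muln2; case: (odd a); case: (odd b); case: c => /=; clear; lia.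
Qed.

Lemma add_progE N a b : add_prog N (Node (binary N a) (binary N b)) = binary N (a + b).
Proof.
rewrite /add_prog /=; have := add_iter N N a b false Leaf; rewrite addn0 /= => ->.
by rewrite rev_progE ?tree_catrevK // size_tree_catrev size_binary addn0.
Qed.

(* The state is [Node x (Node y accumulator)]. *)
Definition mul_step : clocked_fun := fun N s =>
  Node (tl (hd s)) (Node (add_prog N (Node (hd (tl s)) (hd (tl s))))
    (if truthy (hd (hd s)) then add_prog N (Node (tl (tl s)) (hd (tl s))) else tl (tl s))).
Definition zero_prog : clocked_fun := fun N _ => iter N (fun t => Node Leaf t) Leaf.
Definition one_prog : clocked_fun := fun N t => Node tree_true (tl (zero_prog N t)).
Definition mul_prog : clocked_fun := fun N t =>
  tl (tl (iter N (mul_step N) (Node (hd t) (Node (tl t) (zero_prog N t))))).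
Lemma poly_time_zero : poly_time zero_prog.
Proof.
apply: (@poly_time_comp (fun N t => iter N (fun t => Node Leaf t) t) (fun _ _ => Leaf)); last exact: poly_time_leaf.
by apply: (@poly_time_loop (fun _ t => Node Leaf t)); prove_poly_time.
Qed.
#[global] Hint Resolve poly_time_zero : poly_time.
Lemma poly_time_one : poly_time one_prog. Proof. by rewrite /one_prog; prove_poly_time. Qed.
#[global] Hint Resolve poly_time_one : poly_time.
Lemma poly_time_mul : poly_time mul_prog.
Proof.
rewrite /mul_prog; do 2!apply: poly_time_tl.
apply: (@poly_time_comp (fun N t => iter N (mul_step N) t)); last by prove_poly_time.
by apply: poly_time_loop; rewrite /mul_step; prove_poly_time.
Qed.
#[global] Hint Resolve poly_time_mul : poly_time.

Lemma zero_progE N t : zero_prog N t = binary N 0.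
Proof. by rewrite /zero_prog; elim: N => //= N ->. Qed.
Lemma one_progE N t : 0 < N -> one_prog N t = binary N 1.
Proof. by case: N => // N _; rewrite /one_prog zero_progE. Qed.

Fixpoint low_bits (m a : nat) : nat := if m is m'.+1 then odd a + (low_bits m' a./2).*2 else 0.
Lemma low_bitsE m a : a = low_bits m a + 2 ^ m * (a %/ 2 ^ m).
Proof.
elim: m a => [|m IH] a; first by rewrite divn1 mul1n.
rewrite expnS divnMA divn2 -mulnA -addnA mul2n -doubleD -IH.
by rewrite odd_double_half.
Qed.

Lemma mul_iter N m a b c : tl (tl (iter m (mul_step N)
    (Node (binary m a) (Node (binary N b) (binary N c))))) = binary N (c + b * low_bits m a).
Proof.
elim: m a b c => [|m IH] a b c; first by rewrite /= muln0 addn0.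
rewrite iterSr.
have -> : mul_step N (Node (binary m.+1 a) (Node (binary N b) (binary N c))) =
  Node (binary m a./2) (Node (binary N (b + b)) (binary N (c + b * odd a))).
  by rewrite /mul_step /= !add_progE; case: (odd a); rewrite /= ?muln1 ?muln0 ?addn0.
by rewrite IH /= mulnDr addnA -mul2n mulnA [b * 2]mulnC addnn mul2n.
Qed.

Lemma mul_progE N a b : mul_prog N (Node (binary N a) (binary N b)) = binary N (a * b).
Proof.
rewrite /mul_prog zero_progE; have := mul_iter N N a b 0; rewrite add0n /= => ->.
by rewrite mulnC [in RHS](low_bitsE N a) mulnDl -mulnA binary_mod.
Qed.

(* A fraction is [Node numerator denominator]. *)
Definition frac_add_prog : clocked_fun := fun N t =>
  Node (add_prog N (Node (mul_prog N (Node (hd (hd t)) (tl (tl t)))) (mul_prog N (Node (hd (tl t)) (tl (hd t))))))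
       (mul_prog N (Node (tl (hd t)) (tl (tl t)))).
Definition frac_mul_prog : clocked_fun := fun N t =>
  Node (mul_prog N (Node (hd (hd t)) (hd (tl t)))) (mul_prog N (Node (tl (hd t)) (tl (tl t)))).
Lemma poly_time_frac_add : poly_time frac_add_prog. Proof. by rewrite /frac_add_prog; prove_poly_time. Qed.
Lemma poly_time_frac_mul : poly_time frac_mul_prog. Proof. by rewrite /frac_mul_prog; prove_poly_time. Qed.
#[global] Hint Resolve poly_time_frac_add poly_time_frac_mul : poly_time.

Definition frac_tree N (f : nat * nat) := Node (binary N f.1) (binary N f.2).
Definition frac_add (f g : nat * nat) := (f.1 * g.2 + g.1 * f.2, f.2 * g.2).
Definition frac_mul (f g : nat * nat) := (f.1 * g.1, f.2 * g.2).
Lemma frac_add_progE N f g : frac_add_prog N (Node (frac_tree N f) (frac_tree N g)) = frac_tree N (frac_add f g).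
Proof. by rewrite /frac_add_prog /= !mul_progE add_progE. Qed.
Lemma frac_mul_progE N f g : frac_mul_prog N (Node (frac_tree N f) (frac_tree N g)) = frac_tree N (frac_mul f g).
Proof. by rewrite /frac_mul_prog /= !mul_progE. Qed.

(* The argument is [Node A (Node B (Node accumulator context))]; B is read along A
   and padded with [Leaf]. *)
Definition zip_fold_prog (body : clocked_fun) : clocked_fun := fun N t =>
  tl (fold_prog (fun N u => Node (tl (hd (hd (tl u))))
         (body N (Node (hd u) (Node (hd (hd (hd (tl u)))) (Node (tl (hd (tl u))) (tl (tl u)))))))
    N (Node (hd t) (Node (Node (hd (tl t)) (hd (tl (tl t)))) (tl (tl (tl t)))))).
Lemma poly_time_zip_fold body : poly_time body -> poly_time (zip_fold_prog body).
Proof. by move=> h; rewrite /zip_fold_prog; prove_poly_time. Qed.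

Lemma foldl_map (I J R : Type) (f : R -> J -> R) (g : I -> J) a s :
  foldl f a (map g s) = foldl (fun a i => f a (g i)) a s.
Proof. by elim: s a => //= x s IH a. Qed.

Lemma zip_iotaS (I : Type) (s : seq I) i : zip s (iota i.+1 (size s)) =
  [seq (xi.1, xi.2.+1) | xi <- zip s (iota i (size s))].
Proof. by elim: s i => //= x s IH i; rewrite IH. Qed.

Lemma zip_fold_progE (I : Type) (s : seq I) (F : I -> tree) body N B acc ctx : size s <= N ->
  zip_fold_prog body N (Node (tree_of_seq (map F s)) (Node B (Node acc ctx))) =
  foldl (fun a xi => body N (Node (F xi.1) (Node (nth Leaf (spine B) xi.2) (Node a ctx)))) acc
    (zip s (iota 0 (size s))).
Proof.
move=> size_le; rewrite /zip_fold_prog fold_progE /= ?spine_seq ?size_map //.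
elim: s {size_le} B acc => //= x s IH B acc; rewrite IH zip_iotaS foldl_map /=.
have -> : hd B = nth Leaf (spine B) 0 by case: B.
elim: (zip _ _) (body _ _) => //= y z IHz a; rewrite IHz; congr (foldl _ (body _ (Node _ (Node _ _))) _).
by case: B {IHz} => //=; rewrite nth_nil.
Qed.

Lemma zip_fold_prog_ord n (F : 'I_n -> tree) body N B acc ctx : n <= N ->
  zip_fold_prog body N (Node (tree_of_seq [seq F v | v <- enum 'I_n]) (Node B (Node acc ctx))) =
  foldl (fun a v => body N (Node (F v) (Node (nth Leaf (spine B) (val v)) (Node a ctx)))) acc (enum 'I_n).
Proof.
move=> n_le; rewrite zip_fold_progE ?size_enum_ord //.
have -> : zip (enum 'I_n) (iota 0 n) = [seq (v, val v) | v <- enum 'I_n].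
  by rewrite -val_enum_ord; elim: (enum _) => //= x s ->.
by rewrite foldl_map.
Qed.

Lemma foldl_flag (I : Type) (s : seq I) (P : pred I) (a : tree) :
  foldl (fun a v => if P v then tree_true else a) a s = if has P s then tree_true else a.
Proof. by elim: s a => //= x s IH a; rewrite IH; case: (P x) => //; case: (has P s). Qed.

Lemma foldl_cons (I : Type) (s : seq I) (G : I -> tree) a :
  foldl (fun a v => Node (G v) a) a s = tree_catrev (tree_of_seq (map G s)) a.
Proof. by elim: s a => //= x s IH a. Qed.

Lemma truthy_tree_of_bool b : truthy (tree_of_bool b) = b. Proof. by case: b. Qed.

Lemma foldl_filter (I : Type) (s : seq I) (P : pred I) (G : I -> tree) a :
  foldl (fun a v => if P v then Node (G v) a else a) a s = tree_catrev (tree_of_seq [seq G v | v <- s & P v]) a.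
Proof. by elim: s a => //= x s IH a; rewrite IH; case: (P x). Qed.

Lemma eq_foldl (I R : Type) (f g : R -> I -> R) a s : (forall a x, f a x = g a x) -> foldl f a s = foldl g a s.
Proof. by move=> h; elim: s a => //= x s IH a; rewrite h IH. Qed.

Lemma up_log_bounds x : 0 < x ->
  [/\ 0 < up_log 2 x.+1, 2 ^ (up_log 2 x.+1).-1 <= x & x < 2 ^ up_log 2 x.+1].
Proof.
move=> x_gt0; have log_gt0 : 0 < up_log 2 x.+1 by rewrite up_log_gt0 /= ltnS.
split=> //; last exact: up_logP.
rewrite leqNgt; apply/negP=> lt_pow; have := @up_log_min 2 x.+1 _ isT lt_pow.
by move: log_gt0; clear; lia.
Qed.

Lemma binary_digit_top x l : 2 ^ l <= x < 2 ^ l.+1 -> binary_digit x l.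
Proof.
move=> /andP[x_ge x_lt]; rewrite /binary_digit (_ : x %/ 2 ^ l = 1) //.
by apply/eqP; rewrite eqn_leq divn_gt0 ?expn_gt0 // x_ge andbT -ltnS ltn_divLR ?expn_gt0 // -expnS.
Qed.
End TreeArithmetic.

Module TreeGraphs.
Import Defs Colourings SpatialMixing Estimator PolyTime TreeArithmetic.
Definition onehot (c : nat) : tree := tree_of_seq (rcons (nseq c Leaf) tree_true).
Lemma onehotE c i : truthy (nth Leaf (spine (onehot c)) i) = (i == c).
Proof.
rewrite spine_seq nth_rcons size_nseq nth_nseq; case: ltngtP => //= h; by rewrite ?h ?eqxx.
Qed.

Definition is_forbidden_prog (c : nat) : clocked_fun := fun N t =>
  zip_fold_prog (fun _ u => if truthy (hd (tl u)) then (if truthy (tree_nth c (hd u)) then tree_true else hd (tl (tl u)))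
                    else hd (tl (tl u))) N (Node (hd t) (Node (tl t) tree_true)).
Definition pin_prog (c : nat) : clocked_fun := fun N t =>
  rev_prog N (zip_fold_prog (fun _ u => Node (if truthy (hd (tl u)) then onehot c else hd u) (hd (tl (tl u)))) N
    (Node (hd t) (Node (tl t) tree_true))).
(* The entry of the list [tl t] at the position marked by [hd t]. *)
Definition lookup_prog : clocked_fun := fun N t =>
  zip_fold_prog (fun _ u => if truthy (hd u) then hd (tl u) else hd (tl (tl u))) N (Node (hd t) (Node (tl t) tree_true)).
Definition has_marked_neighbour_prog : clocked_fun := fun N t =>
  zip_fold_prog (fun _ u => if truthy (hd u) then (if truthy (hd (tl u)) then tree_true else hd (tl (tl u)))
                    else hd (tl (tl u))) N (Node (hd t) (Node (tl t) tree_true)).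

Lemma poly_time_nth_prog c f : poly_time f -> poly_time (fun N t => tree_nth c (f N t)).
Proof. by move=> h; apply: (@poly_time_comp (fun _ t => tree_nth c t)) => //; exact: poly_time_nth. Qed.

Ltac poly_time_zip_step := first [ poly_time_step | apply: poly_time_nth_prog | match goal with
  | |- poly_time (fun N t => zip_fold_prog ?b N _) => apply: (@poly_time_comp (zip_fold_prog b)); [apply: poly_time_zip_fold|] end ].
Ltac prove_poly_time_zip := repeat poly_time_zip_step.

Lemma poly_time_is_forbidden c : poly_time (is_forbidden_prog c). Proof. by rewrite /is_forbidden_prog; prove_poly_time_zip. Qed.
Lemma poly_time_pin c : poly_time (pin_prog c).
Proof. by rewrite /pin_prog; prove_poly_time_zip. Qed.
Lemma poly_time_lookup : poly_time lookup_prog. Proof. by rewrite /lookup_prog; prove_poly_time_zip. Qed.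
Lemma poly_time_has_marked_neighbour : poly_time has_marked_neighbour_prog. Proof. by rewrite /has_marked_neighbour_prog; prove_poly_time_zip. Qed.
#[global] Hint Resolve poly_time_is_forbidden poly_time_pin poly_time_lookup poly_time_has_marked_neighbour : poly_time.

(* Argument: Node p (Node x extra); the colours forbidden at x are skipped. *)
Definition map_allowed_prog (F : nat -> clocked_fun) (cs : seq nat) : clocked_fun :=
  foldr (fun c (g : clocked_fun) => fun N t =>
    if truthy (is_forbidden_prog c N (Node (hd t) (tl (hd (tl t))))) then g N t else Node (F c N t) (g N t))
  (fun _ _ => Leaf) cs.
Lemma poly_time_map_allowed F cs : (forall c, poly_time (F c)) -> poly_time (map_allowed_prog F cs).
Proof.
move=> hF; elim: cs => [|c cs IH]; first exact: poly_time_leaf.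
by rewrite /map_allowed_prog /= -/(map_allowed_prog F cs); apply: poly_time_if; [prove_poly_time|exact: IH|apply: poly_time_node; [exact: hF|exact: IH]].
Qed.

Section Colours.
Variable q : nat.

Definition extend_prog : clocked_fun := fun N t =>
  map_allowed_prog (fun c N t => pin_prog c N (Node (hd t) (hd (hd (tl t))))) (iota 0 q) N (Node (hd t) (Node (tl t) Leaf)).
Definition extend_weighted_prog : clocked_fun :=
  map_allowed_prog (fun c N t => Node (pin_prog c N (Node (hd t) (hd (hd (tl t)))))
                          (frac_mul_prog N (Node (hd (tl (tl t))) (tree_nth c (tl (tl (tl t))))))) (iota 0 q).
Lemma poly_time_extend : poly_time extend_prog.
Proof.
rewrite /extend_prog; apply: (@poly_time_comp (map_allowed_prog _ (iota 0 q))); last by prove_poly_time.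
by apply: poly_time_map_allowed => c; prove_poly_time.
Qed.
Lemma poly_time_extend_weighted : poly_time extend_weighted_prog. Proof. by apply: poly_time_map_allowed => c; prove_poly_time_zip. Qed.
#[local] Hint Resolve poly_time_extend poly_time_extend_weighted : poly_time.

Definition extend_all_prog : clocked_fun := fun N t =>
  fold_prog (fun N u => catrev_prog N (Node (extend_prog N (Node (hd u) (tl (tl u)))) (hd (tl u)))) N
    (Node (hd t) (Node Leaf (tl t))).
Lemma poly_time_extend_all : poly_time extend_all_prog. Proof. by rewrite /extend_all_prog; prove_poly_time. Qed.
#[local] Hint Resolve poly_time_extend_all : poly_time.

Definition grow_ball_prog : clocked_fun := fun N t =>
  rev_prog N (fold_prog (fun N u => Node (if truthy (lookup_prog N (Node (hd (hd u)) (tl (tl u)))) then tree_true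
     else if truthy (has_marked_neighbour_prog N (Node (tl (hd u)) (tl (tl u)))) then tree_true else Leaf) (hd (tl u))) N
    (Node (tl t) (Node Leaf (hd t)))).
Lemma poly_time_grow_ball : poly_time grow_ball_prog. Proof. by rewrite /grow_ball_prog; prove_poly_time. Qed.
#[local] Hint Resolve poly_time_grow_ball : poly_time.

Fixpoint ball_prog (k : nat) : clocked_fun := fun N t =>
  if k is k'.+1 then grow_ball_prog N (Node (ball_prog k' N t) (tl t)) else hd t.
Lemma poly_time_ball k : poly_time (ball_prog k).
Proof.
elim: k => [|k IH]; first exact/poly_time_hd/poly_time_id.
by apply: (poly_time_comp poly_time_grow_ball); apply: poly_time_node; prove_poly_time.
Qed.
#[local] Hint Resolve poly_time_ball : poly_time.

Variable r : nat.
(* Argument of both: Node p (Node x vs). *)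
Definition inner_list_prog : clocked_fun := fun N t =>
  rev_prog N (fold_prog (fun N u => if truthy (lookup_prog N (Node (hd (hd u)) (hd (tl (tl u))))) then hd (tl u)
     else if truthy (lookup_prog N (Node (hd (hd u)) (tl (tl (tl u))))) then Node (hd u) (hd (tl u)) else hd (tl u)) N
   (Node (tl (tl t)) (Node Leaf (Node (hd t) (ball_prog r.+1 N (Node (hd (hd (tl t))) (tl (tl t)))))))).
Definition sphere_prog : clocked_fun := fun N t =>
  rev_prog N (fold_prog (fun N u => if truthy (lookup_prog N (Node (hd (hd u)) (hd (tl (tl u))))) then hd (tl u)
     else if truthy (lookup_prog N (Node (hd (hd u)) (hd (tl (tl (tl u)))))) then hd (tl u)
     else if truthy (lookup_prog N (Node (hd (hd u)) (tl (tl (tl (tl u)))))) then Node (hd u) (hd (tl u)) else hd (tl u)) N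
   (Node (tl (tl t)) (Node Leaf (Node (hd t) (Node (ball_prog r.+1 N (Node (hd (hd (tl t))) (tl (tl t))))
     (ball_prog r.+2 N (Node (hd (hd (tl t))) (tl (tl t))))))))).
Lemma poly_time_inner_list : poly_time inner_list_prog. Proof. by rewrite /inner_list_prog; prove_poly_time. Qed.
Lemma poly_time_sphere : poly_time sphere_prog. Proof. by rewrite /sphere_prog; prove_poly_time. Qed.
#[local] Hint Resolve poly_time_inner_list poly_time_sphere : poly_time.

(* Argument: Node p (Node x vs). *)
Definition inner_extensions_prog : clocked_fun := fun N t =>
  fold_prog (fun N u => extend_all_prog N (Node (hd (tl u)) (hd u))) N (Node (inner_list_prog N t) (Node (Node (hd t) Leaf) Leaf)).
Lemma poly_time_inner_extensions : poly_time inner_extensions_prog. Proof. by rewrite /inner_extensions_prog; prove_poly_time. Qed.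
#[local] Hint Resolve poly_time_inner_extensions : poly_time.
Definition local_fraction_prog (c : nat) : clocked_fun := fun N t =>
  Node (fold_prog (fun N u => if truthy (tree_nth c (lookup_prog N (Node (tl (tl u)) (hd u)))) then add_prog N (Node (hd (tl u)) (one_prog N u))
           else hd (tl u)) N (Node (inner_extensions_prog N t) (Node (zero_prog N t) (hd (hd (tl t))))))
       (fold_prog (fun N u => add_prog N (Node (hd (tl u)) (one_prog N u))) N (Node (inner_extensions_prog N t) (Node (zero_prog N t) Leaf))).
Lemma poly_time_local_fraction c : poly_time (local_fraction_prog c). Proof. by rewrite /local_fraction_prog; prove_poly_time_zip. Qed.
#[local] Hint Resolve poly_time_local_fraction : poly_time.

(* Argument: Node (Node p x) vs. *)
Definition subtasks_prog : clocked_fun := fun N t =>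
  rev_prog N (tl (fold_prog (fun N u => Node (extend_all_prog N (Node (hd (hd (tl u))) (hd u)))
       (fold_prog (fun N u' => Node (Node (hd u') (tl (tl u'))) (hd (tl u'))) N
          (Node (hd (hd (tl u))) (Node (tl (hd (tl u))) (hd u)))))
    N (Node (sphere_prog N (Node (hd (hd t)) (Node (tl (hd t)) (tl t)))) (Node (Node (Node (hd (hd t)) Leaf) Leaf) Leaf)))).
Lemma poly_time_subtasks : poly_time subtasks_prog. Proof. by rewrite /subtasks_prog; prove_poly_time. Qed.

(* Argument: Node (Node p x) (Node vals vs). The result is the final list of
   weighted_reveal_prog pinnings and the remaining values. *)
Definition weighted_reveal_prog : clocked_fun := fun N t =>
  fold_prog (fun N u => fold_prog (fun N u' =>
      Node (catrev_prog N (Node (extend_weighted_prog N (Node (hd (hd u')) (Node (tl (tl u')) (Node (tl (hd u')) (hd (tl (hd (tl u')))))))) (hd (hd (tl u')))))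
           (tl (tl (hd (tl u'))))) N
     (Node (hd (hd (tl u))) (Node (Node Leaf (tl (hd (tl u)))) (hd u))))
  N (Node (sphere_prog N (Node (hd (hd t)) (Node (tl (hd t)) (tl (tl t)))))
    (Node (Node (Node (Node (hd (hd t)) (Node (one_prog N t) (one_prog N t))) Leaf) (hd (tl t))) Leaf)).
Lemma poly_time_weighted_reveal : poly_time weighted_reveal_prog. Proof. by rewrite /weighted_reveal_prog; prove_poly_time. Qed.
#[local] Hint Resolve poly_time_weighted_reveal : poly_time.

(* Argument: Node W (Node x vs). *)
Definition value_prog (c : nat) : clocked_fun := fun N t =>
  fold_prog (fun N u => frac_add_prog N (Node (hd (tl u)) (frac_mul_prog N (Node (tl (hd u)) (local_fraction_prog c N (Node (hd (hd u)) (tl (tl u)))))))) N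
    (Node (hd t) (Node (Node (zero_prog N t) (one_prog N t)) (tl t))).
Definition tabulate_prog (F : nat -> clocked_fun) (cs : seq nat) : clocked_fun :=
  foldr (fun c (g : clocked_fun) => fun N t => Node (F c N t) (g N t)) (fun _ _ => Leaf) cs.
Lemma poly_time_tabulate F cs : (forall c, poly_time (F c)) -> poly_time (tabulate_prog F cs).
Proof.
move=> hF; elim: cs => [|c cs IH]; first exact: poly_time_leaf.
by rewrite /tabulate_prog /= -/(tabulate_prog F cs); apply: poly_time_node; [exact: hF|exact: IH].
Qed.
Lemma poly_time_value c : poly_time (value_prog c). Proof. by rewrite /value_prog; prove_poly_time. Qed.
Definition combine_prog : clocked_fun := fun N t =>
  Node (tabulate_prog value_prog (iota 0 q) N (Node (hd (weighted_reveal_prog N t)) (Node (tl (hd t)) (tl (tl t))))) (tl (weighted_reveal_prog N t)).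
Lemma poly_time_combine : poly_time combine_prog.
Proof.
rewrite /combine_prog; apply: poly_time_node; last by prove_poly_time.
apply: (@poly_time_comp (tabulate_prog value_prog (iota 0 q))); last by prove_poly_time.
by apply: poly_time_tabulate; exact: poly_time_value.
Qed.

Fixpoint base_values_prog (cs : seq nat) : clocked_fun := fun N t =>
  if cs is c :: cs' then
    if truthy (is_forbidden_prog c N (Node (hd t) (tl (tl t)))) then Node (Node (zero_prog N t) (one_prog N t)) (base_values_prog cs' N t)
    else Node (Node (one_prog N t) (one_prog N t)) (tabulate_prog (fun _ N t => Node (zero_prog N t) (one_prog N t)) cs' N t)
  else Leaf.
Lemma poly_time_base_values cs : poly_time (base_values_prog cs).
Proof.
elim: cs => [|c cs IH]; first exact: poly_time_leaf.
rewrite /=; apply: poly_time_if; first by prove_poly_time.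
  by apply: poly_time_node; [prove_poly_time|exact: IH].
by apply: poly_time_node; [prove_poly_time|apply: poly_time_tabulate => d; prove_poly_time].
Qed.

Fixpoint pick_least_prog (cs : seq nat) : clocked_fun := fun N t =>
  if cs is c :: cs' then
    if truthy (is_forbidden_prog c N (Node (hd (hd t)) (tl (tl (hd t))))) then pick_least_prog cs' N t else tree_nth c (tl t)
  else Leaf.
Lemma poly_time_pick_least cs : poly_time (pick_least_prog cs).
Proof.
elim: cs => [|c cs IH]; first exact: poly_time_leaf.
by rewrite /=; apply: poly_time_if; [prove_poly_time|exact: IH|prove_poly_time_zip].
Qed.

End Colours.
End TreeGraphs.

Module TreeGraphsCorrect.
Import Defs Colourings SpatialMixing Estimator PolyTime TreeArithmetic TreeGraphs.
Lemma map_catrev (I J : Type) (f : I -> J) s t : map f (catrev s t) = catrev (map f s) (map f t).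
Proof. by elim: s t => //= x s IH t; rewrite IH. Qed.

#[local] Arguments ball : simpl never.
#[local] Arguments ball_prog : simpl never.
#[local] Arguments fold_prog : simpl never.
#[local] Arguments zip_fold_prog : simpl never.
#[local] Arguments catrev_prog : simpl never.
#[local] Arguments rev_prog : simpl never.
#[local] Arguments lookup_prog : simpl never.
#[local] Arguments has_marked_neighbour_prog : simpl never.
#[local] Arguments is_forbidden_prog : simpl never.
#[local] Arguments pin_prog : simpl never.
#[local] Arguments extend_prog : simpl never.
#[local] Arguments extend_weighted_prog : simpl never.
#[local] Arguments extend_all_prog : simpl never.
#[local] Arguments grow_ball_prog : simpl never.
#[local] Arguments inner_list_prog : simpl never.
#[local] Arguments sphere_prog : simpl never.
#[local] Arguments inner_extensions_prog : simpl never.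
#[local] Arguments local_fraction_prog : simpl never.
#[local] Arguments add_prog : simpl never.
#[local] Arguments mul_prog : simpl never.
#[local] Arguments frac_add_prog : simpl never.
#[local] Arguments frac_mul_prog : simpl never.
#[local] Arguments one_prog : simpl never.
#[local] Arguments zero_prog : simpl never.

Section Correct.
Variables (n q r N : nat) (e : rel 'I_n) (c0 : 'I_q).
Hypothesis e_sym : symmetric e.
Notation V := 'I_n.
Notation C := 'I_q.
Notation pinning := (pinning 'I_n 'I_q).
Implicit Types (p : pinning) (v w s : V) (c : C) (Q : seq pinning).
Hypotheses (n_le : n <= N) (q_le : q <= N) (N_gt0 : 0 < N).

Definition colour_tree (o : option C) := if o is Some c then onehot c else Leaf.
Definition pinning_tree p := tree_of_seq [seq colour_tree (p w) | w <- enum V].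
Definition row_tree v := tree_of_seq [seq tree_of_bool (e v w) | w <- enum V].
Definition vertex_tree v := Node (onehot v) (row_tree v).
Definition vertices_tree := tree_of_seq [seq vertex_tree v | v <- enum V].
Lemma spine_vertices_tree : spine vertices_tree = [seq vertex_tree v | v <- enum V]. Proof. exact: spine_seq. Qed.
Definition mask_tree (A : {set V}) := tree_of_seq [seq tree_of_bool (w \in A) | w <- enum V].

Lemma nth_tree_of_seq (F : V -> tree) w : nth Leaf (spine (tree_of_seq [seq F v | v <- enum V])) w = F w.
Proof. by rewrite spine_seq (nth_map w) ?size_enum_ord // nth_ord_enum. Qed.

Lemma colour_treeE o c : truthy (tree_nth c (colour_tree o)) = (o == Some c).
Proof.
rewrite tree_nthE; case: o => [d|] /=; last by rewrite nth_nil.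
by rewrite onehotE eq_sym.
Qed.

Lemma is_forbidden_progE p v c : truthy (is_forbidden_prog c N (Node (pinning_tree p) (row_tree v))) = (c \notin allowed e p v).
Proof.
rewrite /is_forbidden_prog /= /pinning_tree zip_fold_prog_ord //.
rewrite (@eq_foldl _ _ _ (fun a w => if e v w && (p w == Some c) then tree_true else a)); last first.
  by move=> a w /=; rewrite /row_tree nth_tree_of_seq truthy_tree_of_bool colour_treeE; case: (e v w).
rewrite foldl_flag inE negb_forall; set h := has _ _.
have -> : truthy (if h then tree_true else Leaf) = h by case: h.
apply/hasP/existsP => [[w _ h1]|[w h1]]; exists w; rewrite ?mem_enum //.
  by rewrite negb_imply negbK.
by move: h1; rewrite negb_imply negbK.
Qed.

Lemma rev_prog_map (I : Type) (G : I -> tree) (s : seq I) : size s <= N ->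
  rev_prog N (tree_catrev (tree_of_seq (map G s)) Leaf) = tree_of_seq (map G s).
Proof. by move=> h; rewrite rev_progE ?tree_catrevK // size_tree_catrev addn0 spine_seq size_map. Qed.

Lemma pin_progE p v c : pin_prog c N (Node (pinning_tree p) (onehot v)) = pinning_tree (pin p v c).
Proof.
rewrite /pin_prog /= {1}/pinning_tree zip_fold_prog_ord //.
rewrite (@eq_foldl _ _ _ (fun a w => Node (colour_tree (pin p v c w)) a)); last first.
  by move=> a w /=; rewrite onehotE ffunE -val_eqE; case: (_ == _).
by rewrite foldl_cons rev_prog_map // size_enum_ord.
Qed.

Lemma map_allowed_progE F p v X (cs : seq C) : map_allowed_prog F (map val cs) N (Node (pinning_tree p) (Node (vertex_tree v) X)) =
  tree_of_seq [seq F (val c) N (Node (pinning_tree p) (Node (vertex_tree v) X)) | c <- cs & c \in allowed e p v].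
Proof.
elim: cs => //= c cs IH; rewrite is_forbidden_progE IH; by case: (c \in _).
Qed.

Definition pin_extensions p v := [seq pin p v c | c <- enum C & c \in allowed e p v].
Lemma size_pin_extensions p v : size (pin_extensions p v) <= q.
Proof. by rewrite size_map size_filter (leq_trans (count_size _ _)) // size_enum_ord. Qed.

Lemma extend_progE p v : extend_prog q N (Node (pinning_tree p) (vertex_tree v)) = tree_of_seq [seq pinning_tree p' | p' <- pin_extensions p v].
Proof.
rewrite /extend_prog -val_enum_ord map_allowed_progE -map_comp; congr tree_of_seq.
by apply: eq_map => c /=; rewrite pin_progE.
Qed.

Definition extend_all v Q := catrev (flatten [seq pin_extensions p v | p <- Q]) [::].
Lemma size_flatten_le (I J : Type) (F : I -> seq J) (m : nat) (s : seq I) :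
  (forall x, size (F x) <= m) -> size (flatten (map F s)) <= m * size s.
Proof.
move=> h; elim: s => //= x s IH; rewrite size_cat mulnS; exact: leq_add.
Qed.
Lemma size_extend_all v Q : size (extend_all v Q) <= q * size Q.
Proof.
by rewrite /extend_all catrevE cats0 size_rev; apply: size_flatten_le => p; exact: size_pin_extensions.
Qed.

Lemma extend_all_progE Q v : size Q <= N ->
  extend_all_prog q N (Node (tree_of_seq (map pinning_tree Q)) (vertex_tree v)) = tree_of_seq (map pinning_tree (extend_all v Q)).
Proof.
move=> hQ; rewrite /extend_all_prog /= fold_progE ?spine_seq ?size_map //= foldl_map /extend_all.
rewrite -[Leaf]/(tree_of_seq (map pinning_tree [::])); move: [::] => A.
elim: Q {hQ} A => //= p Q IH A; rewrite extend_progE catrev_progE; last first.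
  by rewrite spine_seq size_map (leq_trans (size_pin_extensions _ _)).
by rewrite tree_catrev_seq spine_seq -map_catrev IH catrev_catl.
Qed.

Lemma lookup_progE B v : lookup_prog N (Node (onehot v) B) = nth Leaf (spine B) v.
Proof.
rewrite /lookup_prog /= /onehot -[rcons _ _]map_id zip_fold_progE; last first.
  by rewrite size_rcons size_nseq (leq_trans (ltn_ord v)).
rewrite size_rcons size_nseq -[iota 0 v.+1]/(iota 0 v.+1) -addn1 iotaD /= add0n -cats1 zip_cat; last first.
  by rewrite size_nseq size_iota.
by rewrite foldl_cat.
Qed.

Definition marks B (A : {set V}) := forall w : V, truthy (nth Leaf (spine B) w) = (w \in A).
Lemma marks_mask_tree A : marks (mask_tree A) A.
Proof. by move=> w; rewrite /mask_tree nth_tree_of_seq truthy_tree_of_bool. Qed.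

Lemma has_marked_neighbour_progE v B A : marks B A -> truthy (has_marked_neighbour_prog N (Node (row_tree v) B)) = [exists w in A, e v w].
Proof.
move=> hA; rewrite /has_marked_neighbour_prog /= /row_tree zip_fold_prog_ord //.
rewrite (@eq_foldl _ _ _ (fun a w => if (w \in A) && e v w then tree_true else a)); last first.
  by move=> a w /=; rewrite truthy_tree_of_bool hA; case: (e v w); rewrite ?andbF ?andbT.
rewrite foldl_flag; set h := has _ _.
have -> : truthy (if h then tree_true else Leaf) = h by case: h.
by apply/hasP/existsP => [[w _ h1]|[w h1]]; exists w; rewrite ?mem_enum.
Qed.

Lemma grow_ball_progE B A : marks B A ->
  grow_ball_prog N (Node B vertices_tree) = mask_tree (A :|: [set w | [exists x in A, e x w]]).
Proof.
move=> hA; rewrite /grow_ball_prog /= fold_progE; last by rewrite spine_vertices_tree size_map size_enum_ord.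
rewrite spine_vertices_tree foldl_map /=.
rewrite (@eq_foldl _ _ _ (fun a w => Node (tree_of_bool (w \in A :|: [set w | [exists x in A, e x w]])) a)); last first.
  move=> a w /=; rewrite lookup_progE hA (has_marked_neighbour_progE _ hA) !inE; case: (w \in A) => //=.
  have -> : [exists w0 in A, e w w0] = [exists x in A, e x w].
    by apply: eq_existsb => x; rewrite e_sym.
  by [].
by rewrite foldl_cons rev_prog_map // size_enum_ord.
Qed.

Lemma ball_progE k v : marks (ball_prog k N (Node (onehot v) vertices_tree)) (ball e v k).
Proof.
elim: k => [|k IH]; first by move=> w; rewrite /= onehotE val_eqE !inE.
rewrite -[ball_prog k.+1 N _]/(grow_ball_prog N (Node (ball_prog k N (Node (onehot v) vertices_tree)) vertices_tree)).
by rewrite (grow_ball_progE IH); exact: marks_mask_tree.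
Qed.

Definition inner_list p v := [seq s <- enum V | (p s == None) && (s \in ball e v r.+1)].
Lemma inner_list_progE p v : inner_list_prog r N (Node (pinning_tree p) (Node (vertex_tree v) vertices_tree)) = tree_of_seq [seq vertex_tree s | s <- inner_list p v].
Proof.
rewrite /inner_list_prog /= fold_progE; last by rewrite spine_vertices_tree size_map size_enum_ord.
rewrite spine_vertices_tree foldl_map /=.
rewrite (@eq_foldl _ _ _ (fun a w => if (p w == None) && (w \in ball e v r.+1) then Node (vertex_tree w) a else a)); last first.
  move=> a w /=; rewrite !lookup_progE (ball_progE r.+1 v) /pinning_tree nth_tree_of_seq.
  by case: (p w) => [c|] //=; rewrite /onehot; case: (nat_of_ord c).
rewrite foldl_filter rev_prog_map //.
by rewrite size_filter (leq_trans (count_size _ _)) // size_enum_ord.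
Qed.

Lemma sphere_progE p v : sphere_prog r N (Node (pinning_tree p) (Node (vertex_tree v) vertices_tree)) = tree_of_seq [seq vertex_tree s | s <- sphere e r p v].
Proof.
rewrite /sphere_prog /= fold_progE; last by rewrite spine_vertices_tree size_map size_enum_ord.
rewrite spine_vertices_tree foldl_map /=.
rewrite (@eq_foldl _ _ _ (fun a w => if (w \in ball e v r.+2) && (w \notin ball e v r.+1) && (p w == None) then Node (vertex_tree w) a else a)); last first.
  move=> a w /=; rewrite !lookup_progE (ball_progE r.+1 v) (ball_progE r.+2 v) /pinning_tree nth_tree_of_seq.
  case: (p w) => [c|]; first by rewrite /= andbF /onehot; case: (nat_of_ord c).
  by rewrite /= andbT; case: (w \in ball e v r.+1); rewrite ?andbF ?andbT.
rewrite foldl_filter rev_prog_map //.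
by rewrite size_filter (leq_trans (count_size _ _)) // size_enum_ord.
Qed.

Lemma size_inner_list p v : size (inner_list p v) <= n.
Proof. by rewrite size_filter (leq_trans (count_size _ _)) // size_enum_ord. Qed.
Lemma size_sphere p v : size (sphere e r p v) <= n.
Proof. by rewrite size_filter (leq_trans (count_size _ _)) // size_enum_ord. Qed.

Definition inner_extensions p v := foldl (fun Q s => extend_all s Q) [:: p] (inner_list p v).

Lemma size_extend_alls (S : seq V) Q : size (foldl (fun Q s => extend_all s Q) Q S) <= size Q * q ^ size S.
Proof.
elim: S Q => [|s S IH] Q /=; first by rewrite muln1.
apply: leq_trans (IH _) _; rewrite expnS mulnA leq_mul2r (mulnC (size Q) q) size_extend_all orbT //.
Qed.

Hypothesis inner_pow_leN : forall p v, q ^ size (inner_list p v) <= N.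
Hypothesis sphere_pow_leN : forall p v, q ^ size (sphere e r p v) <= N.
Hypothesis q_gt0 : 0 < q.

Lemma inner_extensions_progE p v : inner_extensions_prog q r N (Node (pinning_tree p) (Node (vertex_tree v) vertices_tree)) = tree_of_seq (map pinning_tree (inner_extensions p v)).
Proof.
rewrite /inner_extensions_prog inner_list_progE fold_progE /= ?spine_seq ?size_map ?(leq_trans (size_inner_list _ _)) // foldl_map /inner_extensions.
have : size [:: p] * q ^ size (inner_list p v) <= N by rewrite mul1n; exact: inner_pow_leN.
rewrite -[Node (pinning_tree p) Leaf]/(tree_of_seq (map pinning_tree [:: p])).
elim: (inner_list p v) [:: p] => //= s S IH Q hQ.
have hQ1 : size Q <= N by apply: leq_trans hQ; rewrite leq_pmulr // expn_gt0 q_gt0.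
rewrite extend_all_progE // IH //; apply: leq_trans hQ; rewrite expnS mulnA leq_mul2r (mulnC (size Q) q) size_extend_all orbT //.
Qed.

Lemma size_inner_extensions p v : size (inner_extensions p v) <= N.
Proof. by apply: leq_trans (size_extend_alls _ _) _; rewrite mul1n. Qed.

Definition local_fraction p v c : nat * nat := (seq.count (fun p' : pinning => p' v == Some c) (inner_extensions p v), size (inner_extensions p v)).

Lemma local_fraction_progE p v c : local_fraction_prog q r c N (Node (pinning_tree p) (Node (vertex_tree v) vertices_tree)) = frac_tree N (local_fraction p v c).
Proof.
have hf := size_inner_extensions p v.
rewrite /local_fraction_prog /frac_tree; congr Node.
  rewrite /= fold_progE ?inner_extensions_progE ?spine_seq ?size_map // foldl_map zero_progE /local_fraction /=.
  rewrite -[seq.count _ _]add0n; move: 0; elim: (inner_extensions p v) {hf} => [|p' Q IH] a /=; first by rewrite addn0.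
  rewrite lookup_progE /pinning_tree nth_tree_of_seq colour_treeE -/(pinning_tree p'); case: (p' v == Some c); last by rewrite add0n IH.
  by rewrite one_progE // add_progE IH addnA.
rewrite fold_progE ?inner_extensions_progE ?spine_seq ?size_map // foldl_map zero_progE /local_fraction /=.
rewrite -[size _]add0n; move: 0; elim: (inner_extensions p v) {hf} => [|p' Q IH] a /=; first by rewrite addn0.
by rewrite one_progE // add_progE IH -addnA add1n.
Qed.

Fixpoint subtasks (S : seq V) Q : seq (pinning * V) :=
  if S is s :: S' then [seq (p, s) | p <- Q] ++ subtasks S' (extend_all s Q) else [::].
Definition task_tree (t : pinning * V) := Node (pinning_tree t.1) (vertex_tree t.2).

Lemma size_subtasks S Q : size (subtasks S Q) <= size S * (size Q * q ^ size S).
Proof.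
elim: S Q => //= s S IH Q; rewrite size_cat size_map mulSn; apply: leq_add.
  by rewrite leq_pmulr // expn_gt0 q_gt0.
apply: leq_trans (IH _) _; rewrite leq_mul2l expnS mulnA leq_mul2r (mulnC (size Q) q) size_extend_all !orbT //.
Qed.

Hypothesis subtasks_le : forall p v, size (subtasks (sphere e r p v) [:: p]) <= N.

Lemma subtasks_progE p v : subtasks_prog q r N (Node (task_tree (p, v)) vertices_tree) =
  tree_of_seq (map task_tree (subtasks (sphere e r p v) [:: p])).
Proof.
rewrite /subtasks_prog [hd _]/= [tl _]/= sphere_progE fold_progE /= ?spine_seq ?size_map ?(leq_trans (size_sphere _ _)) // foldl_map.
have key S Q o : size Q * q ^ size S <= N ->
  tl (foldl (fun a s => Node (extend_all_prog q N (Node (hd a) (vertex_tree s)))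
       (fold_prog (fun _ u' => Node (Node (hd u') (tl (tl u'))) (hd (tl u'))) N (Node (hd a) (Node (tl a) (vertex_tree s)))))
     (Node (tree_of_seq (map pinning_tree Q)) o) S) = tree_catrev (tree_of_seq (map task_tree (subtasks S Q))) o.
  elim: S Q o => //= s S IH Q o hQ.
  have hQ1 : size Q <= N by apply: leq_trans hQ; rewrite leq_pmulr // expn_gt0 q_gt0.
  rewrite extend_all_progE // fold_progE ?spine_seq ?size_map // foldl_map IH; last first.
    apply: leq_trans hQ; rewrite expnS mulnA leq_mul2r (mulnC (size Q) q) size_extend_all orbT //.
  rewrite map_cat !tree_catrev_seq catrev_catl /= -map_comp; congr (tree_of_seq (catrev _ _)).
  by rewrite (foldl_cons Q (fun p => Node (pinning_tree p) (vertex_tree s))) tree_catrev_seq spine_seq.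
have := key (sphere e r p v) [:: p] Leaf; rewrite mul1n => -> //.
by rewrite rev_prog_map.
Qed.

Variable g : pinning -> V -> C -> nat * nat.
Implicit Type W : seq (pinning * (nat * nat)).
Definition weighted_tree (pw : pinning * (nat * nat)) := Node (pinning_tree pw.1) (frac_tree N pw.2).
Definition values_tree (h : C -> nat * nat) := tree_of_seq [seq frac_tree N (h c) | c <- enum C].
Definition weighted_pin_extensions s (pw : pinning * (nat * nat)) :=
  [seq (pin pw.1 s c, frac_mul pw.2 (g pw.1 s c)) | c <- enum C & c \in allowed e pw.1 s].
Definition weighted_extend_all s W := catrev (flatten (map (weighted_pin_extensions s) W)) [::].
Definition weighted_reveal (S : seq V) W := foldl (fun W s => weighted_extend_all s W) W S.

Lemma extend_weighted_progE s pw : extend_weighted_prog q N (Node (pinning_tree pw.1) (Node (vertex_tree s) (Node (frac_tree N pw.2) (values_tree (g pw.1 s))))) =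
  tree_of_seq (map weighted_tree (weighted_pin_extensions s pw)).
Proof.
rewrite /extend_weighted_prog -val_enum_ord map_allowed_progE /weighted_pin_extensions -map_comp; congr tree_of_seq; apply: eq_map => c /=.
rewrite pin_progE /weighted_tree /= tree_nthE /values_tree spine_seq (nth_map c) ?size_enum_ord // nth_ord_enum.
by rewrite frac_mul_progE.
Qed.

Lemma fst_weighted_extend_all s W : map fst (weighted_extend_all s W) = extend_all s (map fst W).
Proof.
rewrite /weighted_extend_all /extend_all map_catrev map_flatten -!map_comp; congr (catrev (flatten _) _).
by apply: eq_map => pw /=; rewrite /weighted_pin_extensions /pin_extensions -map_comp.
Qed.
Lemma size_weighted_extend_all s W : size (weighted_extend_all s W) = size (extend_all s (map fst W)).
Proof. by rewrite -fst_weighted_extend_all size_map. Qed.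

Lemma weighted_reveal_progE p v rest : weighted_reveal_prog q r N (Node (task_tree (p, v)) (Node (tree_of_seq
    ([seq values_tree (g t.1 t.2) | t <- subtasks (sphere e r p v) [:: p]] ++ rest)) vertices_tree)) =
  Node (tree_of_seq (map weighted_tree (weighted_reveal (sphere e r p v) [:: (p, (1, 1))]))) (tree_of_seq rest).
Proof.
have key S W rest' : size W * q ^ size S <= N ->
  foldl (fun a s => fold_prog (fun N u' =>
      Node (catrev_prog N (Node (extend_weighted_prog q N (Node (hd (hd u')) (Node (tl (tl u')) (Node (tl (hd u')) (hd (tl (hd (tl u')))))))) (hd (hd (tl u')))))
           (tl (tl (hd (tl u'))))) N (Node (hd a) (Node (Node Leaf (tl a)) (vertex_tree s))))
   (Node (tree_of_seq (map weighted_tree W)) (tree_of_seq ([seq values_tree (g t.1 t.2) | t <- subtasks S (map fst W)] ++ rest'))) S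
  = Node (tree_of_seq (map weighted_tree (weighted_reveal S W))) (tree_of_seq rest').
  elim: S W => //= s S IH W hW.
  have hW1 : size W <= N by apply: leq_trans hW; rewrite leq_pmulr // expn_gt0 q_gt0.
  rewrite fold_progE ?spine_seq ?size_map // foldl_map map_cat -catA.
  set rest2 := _ ++ rest'.
  have inner A : foldl (fun a (pw : pinning * (nat * nat)) => Node (catrev_prog N (Node (extend_weighted_prog q N (Node (pinning_tree pw.1) (Node (vertex_tree s)
       (Node (frac_tree N pw.2) (hd (tl a)))))) (hd a))) (tl (tl a)))
      (Node (tree_of_seq (map weighted_tree A)) (tree_of_seq ([seq values_tree (g t.1 t.2) | t <- [seq (p, s) | p <- map fst W]] ++ rest2))) W =
      Node (tree_of_seq (map weighted_tree (catrev (flatten (map (weighted_pin_extensions s) W)) A))) (tree_of_seq rest2).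
    elim: W {hW hW1 IH rest2} A (rest2) => //= pw W IHW A rest3.
    rewrite extend_weighted_progE catrev_progE; last first.
      by rewrite spine_seq size_map size_map size_filter (leq_trans (count_size _ _)) // size_enum_ord.
    by rewrite tree_catrev_seq spine_seq -map_catrev IHW catrev_catl.
  have := inner [::]; rewrite /= => ->.
  rewrite -/(weighted_extend_all s W) /rest2 -fst_weighted_extend_all IH //.
  rewrite size_weighted_extend_all; apply: leq_trans hW; rewrite expnS mulnA leq_mul2r (mulnC (size W) q).
  by rewrite (leq_trans (size_extend_all _ _)) ?orbT // size_map.
rewrite /weighted_reveal_prog [hd _]/= [tl _]/= sphere_progE fold_progE ?spine_seq ?size_map ?(leq_trans (size_sphere _ _)) // foldl_map.
have := key (sphere e r p v) [:: (p, (1, 1))] rest; rewrite mul1n => <- //.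
by rewrite /= one_progE.
Qed.

Definition value_fraction (W : seq (pinning * (nat * nat))) v c : nat * nat :=
  foldl (fun acc pw => frac_add acc (frac_mul pw.2 (local_fraction pw.1 v c))) (0, 1) W.

Lemma value_progE W v c : size W <= N ->
  value_prog q r c N (Node (tree_of_seq (map weighted_tree W)) (Node (vertex_tree v) vertices_tree)) = frac_tree N (value_fraction W v c).
Proof.
move=> hW; rewrite /value_prog fold_progE [hd _]/= ?spine_seq ?size_map // foldl_map zero_progE one_progE //.
rewrite -[Node (binary N 0) (binary N 1)]/(frac_tree N (0, 1)) /value_fraction; move: (0, 1).
elim: W {hW} => //= pw W IH f; by rewrite local_fraction_progE frac_mul_progE frac_add_progE IH.
Qed.

Lemma tabulate_progE (F : nat -> clocked_fun) (h : C -> nat * nat) t : (forall c : C, F c N t = frac_tree N (h c)) ->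
  tabulate_prog F (iota 0 q) N t = values_tree h.
Proof.
move=> hF; rewrite -val_enum_ord /values_tree; elim: (enum C) => //= c cs IH.
by rewrite hF IH.
Qed.

Lemma size_weighted_reveal S W : size (weighted_reveal S W) <= size W * q ^ size S.
Proof.
rewrite /weighted_reveal; elim: S W => [|s S IH] W /=; first by rewrite muln1.
apply: leq_trans (IH _) _; rewrite expnS mulnA leq_mul2r size_weighted_extend_all (mulnC (size W) q).
by rewrite (leq_trans (size_extend_all _ _)) ?orbT // size_map.
Qed.

Definition estimate_step p v c := value_fraction (weighted_reveal (sphere e r p v) [:: (p, (1, 1))]) v c.

Lemma combine_progE p v rest : combine_prog q r N (Node (task_tree (p, v)) (Node (tree_of_seq
    ([seq values_tree (g t.1 t.2) | t <- subtasks (sphere e r p v) [:: p]] ++ rest)) vertices_tree)) =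
  Node (values_tree (estimate_step p v)) (tree_of_seq rest).
Proof.
rewrite /combine_prog weighted_reveal_progE; congr Node; apply: tabulate_progE => c.
by apply: value_progE; apply: leq_trans (size_weighted_reveal _ _) _; rewrite mul1n.
Qed.

Definition estimate_base p v c : nat * nat := ((c == least_allowed c0 e p v) : nat, 1).

Lemma base_values_progE p v : v \in unpinned p -> (exists c, c \in allowed e p v) ->
  base_values_prog (iota 0 q) N (task_tree (p, v)) = values_tree (estimate_base p v).
Proof.
move=> vf [c1 c1a]; rewrite -val_enum_ord /values_tree /estimate_base /least_allowed.
have hz (cs : seq C) t : tabulate_prog (fun _ N t => Node (zero_prog N t) (one_prog N t)) (map val cs) N t =
    tree_of_seq [seq frac_tree N (0, 1) | c <- cs].
  by elim: cs => //= c cs ->; rewrite zero_progE one_progE.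
have : uniq (enum C) by exact: enum_uniq.
have : has (mem (allowed e p v)) (enum C) by apply/hasP; exists c1; rewrite ?mem_enum.
elim: (enum C) => //= c cs IH hh /andP[ccs ucs].
rewrite is_forbidden_progE; case ca: (c \in allowed e p v) => /=.
  rewrite eqxx hz one_progE //; congr (Node _ (tree_of_seq _)); apply/esym/eq_in_map => d dcs.
  by case: eqP => // E; rewrite -E dcs in ccs.
move: hh; rewrite ca /= => hh; rewrite IH // zero_progE one_progE //; congr (Node _ _).
rewrite (_ : (c == _) = false) //; apply/eqP=> E; move: ccs; rewrite E.
have : nth c0 [seq a <- cs | a \in allowed e p v] 0 \in [seq a <- cs | a \in allowed e p v].
  by apply: mem_nth; rewrite size_filter -has_count.
by rewrite mem_filter => /andP[_ ->].
Qed.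

Lemma pick_least_progE p v (h : C -> nat * nat) : (exists c, c \in allowed e p v) ->
  pick_least_prog (iota 0 q) N (Node (task_tree (p, v)) (values_tree h)) = frac_tree N (h (least_allowed c0 e p v)).
Proof.
move=> [c1 c1a]; rewrite -val_enum_ord /least_allowed.
have bE c : tree_nth c (values_tree h) = frac_tree N (h c).
  by rewrite tree_nthE /values_tree spine_seq (nth_map c) ?size_enum_ord // nth_ord_enum.
set X := values_tree h in bE *.
have : has (mem (allowed e p v)) (enum C) by apply/hasP; exists c1; rewrite ?mem_enum.
elim: (enum C) => //= c cs IH hh; rewrite is_forbidden_progE; case ca: (c \in allowed e p v) => /=.
  by rewrite bE.
by move: hh; rewrite ca /=; exact: IH.
Qed.

End Correct.
End TreeGraphsCorrect.

Module EstimatorProgram.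
Import Defs Colourings ListBounds SpatialMixing Estimator PolyTime TreeArithmetic TreeGraphs TreeGraphsCorrect.
Import Order.TTheory GRing.Theory Num.Theory.
Local Open Scope ring_scope.

Definition frac_value (f : nat * nat) : rat := f.1%:R / f.2%:R.
Definition frac_bounded (m : nat) (f : nat * nat) := ((f.1 <= 2 ^ m) && (f.2 <= 2 ^ m))%N.

Lemma frac_value_add f g : (0 < f.2)%N -> (0 < g.2)%N -> frac_value (frac_add f g) = frac_value f + frac_value g.
Proof.
move=> f0 g0; rewrite /frac_value /frac_add /= natrD !natrM.
have a : f.2%:R != 0 :> rat by rewrite pnatr_eq0 -lt0n.
have b : g.2%:R != 0 :> rat by rewrite pnatr_eq0 -lt0n.
by field; rewrite a b.
Qed.
Lemma frac_value_mul f g : frac_value (frac_mul f g) = frac_value f * frac_value g.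
Proof. by rewrite /frac_value /frac_mul /= !natrM invfM mulrACA. Qed.

Lemma frac_bounded_mul m m' f g : frac_bounded m f -> frac_bounded m' g -> frac_bounded (m + m') (frac_mul f g).
Proof.
by move=> /andP[a b] /andP[c d]; rewrite /frac_bounded /frac_mul /= expnD !leq_mul.
Qed.
Lemma frac_bounded_add m m' f g : frac_bounded m f -> frac_bounded m' g -> frac_bounded (m + m' + 1) (frac_add f g).
Proof.
move=> /andP[a b] /andP[c d]; rewrite /frac_bounded /frac_add /= addn1 expnS.
have h1 := leq_mul a d; have h2 := leq_mul c b; have h3 := leq_mul b d.
by rewrite expnD; move: h1 h2 h3; set x := (2 ^ m)%N; set y := (2 ^ m')%N; nia.
Qed.
Lemma frac_boundedW m m' f : (m <= m')%N -> frac_bounded m f -> frac_bounded m' f.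
Proof. by move=> h /andP[a b]; rewrite /frac_bounded !(leq_trans _ (leq_pexp2l _ h)) //. Qed.

Section Semantics.
Variables (n q r : nat) (e lat : rel 'I_n) (c0 : 'I_q) (Delta : nat).
Notation V := 'I_n.
Notation C := 'I_q.
Notation pinning := (pinning 'I_n 'I_q).
Hypotheses (e_sym : symmetric e) (e_irr : irreflexive e).
Hypothesis e_lat : subrel e lat.
Hypothesis Delta_lt : (Delta < #|C|)%N.
Hypothesis ldeg_le : forall v, (degree_in lat setT v <= Delta)%N.
Implicit Types (p : pinning) (v w s : V) (c : C) (Q : seq pinning) (W : seq (pinning * (nat * nat))).

Lemma eq_reveal (E E' : pinning -> V -> C -> rat) S (G G' : pinning -> rat) p : uniq S ->
  (forall s, s \in S -> s \in unpinned p) ->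
  (forall p' s c, s \in unpinned p' -> E p' s c = E' p' s c) ->
  (forall p', extends_on S p p' -> G p' = G' p') -> reveal e E S G p = reveal e E' S G' p.
Proof.
move=> + + hE; elim: S p => [|s S IH] p /= uS fS hG; first by apply: hG; split.
case/andP: uS => sS uS; apply: eq_bigr => b _; rewrite hE ?fS ?inE ?eqxx //; congr (_ * _).
apply: IH => //; first exact: unpinned_pin_tail sS fS.
by move=> p' /(extends_on_pin sS); exact: hG.
Qed.

Lemma sum_enum_allowed (F : C -> rat) p v :
  \sum_(c <- enum C | c \in allowed e p v) F c = \sum_(c in allowed e p v) F c.
Proof. by rewrite big_enum_cond; apply: eq_bigl => c. Qed.

Lemma sum_extend_all (h : pinning -> rat) s Q :
  \sum_(p <- extend_all e s Q) h p = \sum_(p <- Q) \sum_(c in allowed e p s) h (pin p s c).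
Proof.
rewrite /extend_all catrevE cats0 (perm_big _ (permEl (perm_rev _))) big_flatten /= big_map.
by apply: eq_bigr => p _; rewrite /pin_extensions big_map big_filter sum_enum_allowed.
Qed.

Lemma sum_extend_alls (h : pinning -> rat) S Q :
  \sum_(p <- foldl (fun Q s => extend_all e s Q) Q S) h p = \sum_(p <- Q) reveal e (fun _ _ _ => 1) S h p.
Proof.
elim: S Q => //= s S IH Q; rewrite IH sum_extend_all; apply: eq_bigr => p _; apply: eq_bigr => c _.
by rewrite mul1r.
Qed.

Lemma set_consD1 s (S : seq V) : s \notin S -> [set w in s :: S] :\ s = [set w in S].
Proof.
move=> sS; apply/setP=> w; rewrite !inE; case: (eqVneq w s) => [->|] //=.
by rewrite (negPf sS).
Qed.

Lemma reveal_ncol S p : uniq S -> (forall s, s \in S -> s \in unpinned p) ->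
  reveal e (fun _ _ _ => 1) S (fun=> 1) p = num_list_colourings c0 e [set s in S] (allowed e p).
Proof.
elim: S p => [|s S IH] p /= uS fS.
  by rewrite set_nil ncol_set0.
case/andP: uS => sS uS; have sf : s \in unpinned p by apply: fS; rewrite inE eqxx.
have sI : s \in [set w in s :: S] by rewrite !inE eqxx.
rewrite (ncolD1 c0 e_sym e_irr _ sI) set_consD1 //; apply: eq_bigr => b _.
rewrite mul1r IH //; last exact: unpinned_pin_tail sS fS.
by apply: eq_csum_lists => w _; rewrite allowed_pin.
Qed.

Lemma reveal_csum v a S p : uniq S -> (forall s, s \in S -> s \in unpinned p) ->
  reveal e (fun _ _ _ => 1) S (fun p' => (p' v == Some a)%:R) p =
  colouring_sum c0 e [set s in S] (allowed e p) (fun d => if v \in S then (d v == a)%:R else (p v == Some a)%:R).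
Proof.
elim: S p => [|s S IH] p /= uS fS.
  by rewrite set_nil csum_set0.
case/andP: uS => sS uS; have sf : s \in unpinned p by apply: fS; rewrite inE eqxx.
have sI : s \in [set w in s :: S] by rewrite !inE eqxx.
rewrite (csumD1 c0 e_sym e_irr _ _ sI) set_consD1 //; apply: eq_bigr => b _.
rewrite mul1r IH //; last exact: unpinned_pin_tail sS fS.
apply: eq_csum => [w _|d _]; first by rewrite allowed_pin.
rewrite inE !ffunE; case: (eqVneq v s) => [->|] //=.
by rewrite (negPf sS).
Qed.

Lemma inner_list_set p v : [set s in inner_list r e p v] = inner_ball e r p v.
Proof. by apply/setP=> s; rewrite [LHS]in_set mem_filter mem_enum andbT [RHS]in_set [s \in unpinned p]in_set. Qed.
Lemma uniq_inner_list p v : uniq (inner_list r e p v). Proof. exact: filter_uniq (enum_uniq _). Qed.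
Lemma inner_list_unpinned p v s : s \in inner_list r e p v -> s \in unpinned p.
Proof. by rewrite mem_filter => /andP[/andP[h _] _]; rewrite inE. Qed.

Lemma local_fractionE p v c : v \in unpinned p ->
  (0 < (local_fraction r e p v c).2)%N /\ frac_value (local_fraction r e p v c) = local_marginal c0 e r p v c.
Proof.
move=> vf; have vI : v \in inner_list r e p v by rewrite mem_filter ball_center mem_enum; move: vf; rewrite inE => ->.
have sz : (size (inner_extensions r e p v))%:R = num_list_colourings c0 e (inner_ball e r p v) (allowed e p).
  rewrite -inner_list_set -(reveal_ncol (uniq_inner_list p v) (@inner_list_unpinned p v)).
  have := sum_extend_alls (fun=> 1) (inner_list r e p v) [:: p]; rewrite big_seq1 => <-.
  by rewrite big_const_seq count_predT iter_addr_0.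
have ct : (seq.count (fun p' : pinning => p' v == Some c) (inner_extensions r e p v))%:R =
    colouring_sum c0 e (inner_ball e r p v) (allowed e p) (has_colour v c).
  have := reveal_csum v c (uniq_inner_list p v) (@inner_list_unpinned p v); rewrite vI inner_list_set => <-.
  have := sum_extend_alls (fun p' => (p' v == Some c)%:R) (inner_list r e p v) [:: p]; rewrite big_seq1 => <-.
  by rewrite -sum1_count natr_sum big_mkcond; apply: eq_bigr => p' _; case: (_ == _).
have pos : 0 < num_list_colourings c0 e (inner_ball e r p v) (allowed e p).
  by apply: (ample_ncol_gt0 c0 e_sym e_irr e_lat Delta_lt); exact: ample_inner_ball.
split; first by rewrite -(ltr_nat rat) sz.
by rewrite /frac_value /= ct sz.
Qed.

Section Step.
Variables (g : pinning -> V -> C -> nat * nat) (m : nat).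
Hypothesis g_valid : forall p v c, v \in unpinned p -> (0 < (g p v c).2)%N /\ frac_bounded m (g p v c).

Lemma mem_weighted_extend_all s W pw' : pw' \in weighted_extend_all e g s W -> exists pw c, [/\ pw \in W, c \in allowed e pw.1 s
  & pw' = (pin pw.1 s c, frac_mul pw.2 (g pw.1 s c))].
Proof.
rewrite /weighted_extend_all catrevE cats0 mem_rev => /flatten_mapP[pw pwW] /mapP[c]; rewrite mem_filter => /andP[ca _] ->.
by exists pw, c.
Qed.

Lemma weighted_reveal_extends S m0 W : uniq S ->
  (forall pw, pw \in W -> [/\ forall s, s \in S -> s \in unpinned pw.1, (0 < pw.2.2)%N & frac_bounded m0 pw.2]) ->
  forall pw', pw' \in weighted_reveal e g S W -> exists pw, [/\ pw \in W, extends_on S pw.1 pw'.1, (0 < pw'.2.2)%N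
    & frac_bounded (m0 + size S * m) pw'.2].
Proof.
elim: S m0 W => [|s S IH] m0 W /=.
  move=> _ hW pw' pW; have [_ a b] := hW pw' pW; exists pw'; rewrite mul0n addn0; split=> //.
case/andP=> sS uS hW pw' hp.
have [|pw1 [h1 h2 h3 h4]] := IH (m0 + m)%N (weighted_extend_all e g s W) uS _ pw' hp.
  move=> pw2 /mem_weighted_extend_all[pw [c [pW _ ->]]]; have [a1 a2 a3] := hW pw pW.
  have sf : s \in unpinned pw.1 by apply: a1; rewrite inE eqxx.
  have [b1 b2] := g_valid c sf; split=> /=; last exact: frac_bounded_mul.
    by apply: unpinned_pin_tail sS a1.
  by rewrite muln_gt0 a2.
have [pw [c [pW _ E]]] := mem_weighted_extend_all h1; exists pw; split=> //.
  by apply: (extends_on_pin (b := c) sS); move: h2; rewrite E.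
by rewrite mulSn addnA.
Qed.

Lemma sum_weighted_reveal (G : pinning -> rat) S W :
  \sum_(pw <- weighted_reveal e g S W) frac_value pw.2 * G pw.1 =
  \sum_(pw <- W) frac_value pw.2 * reveal e (fun p s c => frac_value (g p s c)) S G pw.1.
Proof.
elim: S W => //= s S IH W; rewrite IH /weighted_extend_all catrevE cats0 (perm_big _ (permEl (perm_rev _))) big_flatten /= big_map.
apply: eq_bigr => pw _; rewrite /weighted_pin_extensions big_map big_filter sum_enum_allowed mulr_sumr.
by apply: eq_bigr => c _; rewrite /= frac_value_mul mulrA.
Qed.

Lemma value_fraction_sum v c W : (forall pw, pw \in W -> (0 < pw.2.2)%N /\ (0 < (local_fraction r e pw.1 v c).2)%N) ->
  (0 < (value_fraction r e W v c).2)%N /\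
  frac_value (value_fraction r e W v c) = \sum_(pw <- W) frac_value pw.2 * frac_value (local_fraction r e pw.1 v c).
Proof.
rewrite /value_fraction => hW.
suff gen f : (0 < f.2)%N -> let F := foldl (fun acc pw => frac_add acc (frac_mul pw.2 (local_fraction r e pw.1 v c))) f W in
   (0 < F.2)%N /\ frac_value F = frac_value f + \sum_(pw <- W) frac_value pw.2 * frac_value (local_fraction r e pw.1 v c).
  by have [a ->] := gen (0%N, 1%N) isT; split=> //; rewrite {1}/frac_value /= mul0r add0r.
elim: W hW f => [|pw W IH] hW f f0 /=; first by rewrite big_nil addr0.
have [a b] := hW pw (mem_head _ _).
have ab : (0 < (frac_mul pw.2 (local_fraction r e pw.1 v c)).2)%N by rewrite /= muln_gt0 a.
have [||h1 h2] := IH _ (frac_add f (frac_mul pw.2 (local_fraction r e pw.1 v c))).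
- by move=> pw' h; apply: hW; rewrite inE h orbT.
- by rewrite /= muln_gt0 f0.
by split=> //; rewrite h2 frac_value_add // frac_value_mul big_cons addrA.
Qed.

Lemma value_fraction_bounded v c W mw Lb : (forall pw, pw \in W -> frac_bounded mw pw.2 /\ frac_bounded Lb (local_fraction r e pw.1 v c)) ->
  frac_bounded (size W * (mw + Lb + 1)) (value_fraction r e W v c).
Proof.
rewrite /value_fraction => hW.
suff gen f m1 : frac_bounded m1 f -> frac_bounded (m1 + size W * (mw + Lb + 1))
   (foldl (fun acc pw => frac_add acc (frac_mul pw.2 (local_fraction r e pw.1 v c))) f W) by exact: (gen (0%N, 1%N) 0%N).
elim: W hW f m1 => [|pw W IH] hW f m1 f0 /=; first by rewrite mul0n addn0.
have [a b] := hW pw (mem_head _ _).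
rewrite mulSn addnA; apply: IH; first by move=> pw' h; apply: hW; rewrite inE h orbT.
by rewrite addnA; apply: frac_bounded_add => //; exact: frac_bounded_mul.
Qed.

Variables (Smax Wmax Lb : nat).
Hypothesis sphere_le : forall p v, (size (sphere e r p v) <= Smax)%N.
Hypothesis sphere_pow_le : forall p v, (q ^ size (sphere e r p v) <= Wmax)%N.
Hypothesis inner_pow_le : forall p v, (q ^ size (inner_list r e p v) <= 2 ^ Lb)%N.
Variable E : pinning -> V -> C -> rat.
Hypothesis gE : forall p v c, v \in unpinned p -> frac_value (g p v c) = E p v c.

Lemma estimate_stepE p v c : v \in unpinned p ->
  [/\ (0 < (estimate_step r e g p v c).2)%N, frac_bounded (Wmax * (Smax * m + Lb + 1)) (estimate_step r e g p v c)
  & frac_value (estimate_step r e g p v c) = reveal e E (sphere e r p v) (fun p' => local_marginal c0 e r p' v c) p].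
Proof.
move=> vf; set S := sphere e r p v; rewrite /estimate_step -/S; set W := weighted_reveal _ _ _ _.
have uS : uniq S by exact: filter_uniq (enum_uniq _).
have fS s : s \in S -> s \in unpinned p by case/sphereP.
have hW pw : pw \in W -> [/\ extends_on S p pw.1, (0 < pw.2.2)%N & frac_bounded (Smax * m) pw.2].
  move=> pW; have [|pw1 [h1 h2 h3 h4]] := weighted_reveal_extends (m0 := 0%N) (W := [:: (p, (1%N, 1%N))]) uS _ pW.
    by move=> pw1 /[1!inE]/eqP ->; split.
  move: h1 h2; rewrite inE => /eqP -> h2; split=> //; apply: frac_boundedW h4.
  by rewrite add0n leq_mul2r sphere_le orbT.
have loc0 pw : pw \in W -> v \in unpinned pw.1.
  by move=> /hW[h _ _]; have [] := extends_on_sphere vf h.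
have [|a b] := @value_fraction_sum v c W.
  by move=> pw pW; have [_ h _] := hW pw pW; split=> //; have [] := local_fractionE c (loc0 _ pW).
split=> //.
  have := @value_fraction_bounded v c W (Smax * m) Lb => h; apply: frac_boundedW (h _); last first.
    move=> pw pW; have [_ _ h2] := hW pw pW; split=> //.
    have sz : (size (inner_extensions r e pw.1 v) <= 2 ^ Lb)%N.
      by apply: leq_trans (size_extend_alls _ _ _) _; rewrite mul1n; exact: inner_pow_le.
    by rewrite /frac_bounded /local_fraction /= sz (leq_trans (count_size _ _) sz).
  rewrite leq_mul2r; apply/orP; right; apply: leq_trans (size_weighted_reveal _ _ _ _) _.
  by rewrite mul1n; exact: sphere_pow_le.
rewrite b (eq_big_seq (fun pw => frac_value pw.2 * local_marginal c0 e r pw.1 v c)); last first.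
  by move=> pw pW; have [_ ->] := local_fractionE c (loc0 _ pW).
rewrite (sum_weighted_reveal (fun p' => local_marginal c0 e r p' v c)) big_seq1 /= {1}/frac_value divff // mul1r.
by apply: eq_reveal => // p' s d; exact: gE.
Qed.
End Step.

Variables (Smax Wmax Lb M : nat).
Hypothesis sphere_le : forall p v, (size (sphere e r p v) <= Smax)%N.
Hypothesis sphere_pow_le : forall p v, (q ^ size (sphere e r p v) <= Wmax)%N.
Hypothesis inner_pow_le : forall p v, (q ^ size (inner_list r e p v) <= 2 ^ Lb)%N.
Hypothesis M_ge : (Wmax * (Smax + Lb + 1) <= M)%N.
Hypothesis M_gt0 : (0 < M)%N.

Fixpoint estimate_fraction k : pinning -> V -> C -> nat * nat :=
  if k is k'.+1 then estimate_step r e (estimate_fraction k') else estimate_base e c0.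

Lemma estimate_fractionE k p v c : v \in unpinned p ->
  [/\ (0 < (estimate_fraction k p v c).2)%N, frac_bounded (M ^ k) (estimate_fraction k p v c) & frac_value (estimate_fraction k p v c) = estimate c0 e r k p v c].
Proof.
elim: k p v c => [|k IH] p v c vf.
  by rewrite /= /estimate_base /frac_value /frac_bounded /= divr1; split=> //; case: (_ == _).
have [||a b d] := @estimate_stepE (estimate_fraction k) (M ^ k) _ Smax Wmax Lb sphere_le sphere_pow_le inner_pow_le (estimate c0 e r k) _ p v c vf.
- by move=> p' v' c' /(IH p' v' c')[].
- by move=> p' v' c' /(IH p' v' c')[].
split=> //; apply: frac_boundedW b; rewrite expnS; apply: leq_trans (leq_mul M_ge (leqnn _)).
rewrite -mulnA leq_mul2l; apply/orP; right.
have : (0 < M ^ k)%N by rewrite expn_gt0 M_gt0.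
by set x := (M ^ k)%N; clear; nia.
Qed.

End Semantics.
End EstimatorProgram.

Module MainProgram.
Import Defs Colourings SpatialMixing Estimator PolyTime TreeArithmetic TreeGraphs TreeGraphsCorrect EstimatorProgram.
Import Order.TTheory GRing.Theory Num.Theory.

Section Programs.
Variables q r : nat.

(* Argument: Node tasks vs. *)
Definition next_layer_prog : clocked_fun := fun N t =>
  rev_prog N (fold_prog (fun N u => catrev_prog N (Node (subtasks_prog q r N (Node (hd u) (tl (tl u)))) (hd (tl u)))) N
    (Node (hd t) (Node Leaf (tl t)))).
(* Argument: Node klist (Node tasks vs); the result is the stack of all layers. *)
Definition layers_prog : clocked_fun := fun N t =>
  fold_prog (fun N u => Node (next_layer_prog N (Node (hd (hd (tl u))) (tl (tl u)))) (hd (tl u))) N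
    (Node (hd t) (Node (Node (hd (tl t)) Leaf) (tl (tl t)))).
(* Argument: Node layer (Node vals vs). *)
Definition evaluate_layer_prog : clocked_fun := fun N t =>
  rev_prog N (hd (fold_prog (fun N u =>
      (fun N w => Node (Node (hd (hd w)) (tl w)) (tl (hd w))) N
        (Node (combine_prog q r N (Node (hd u) (Node (tl (hd (tl u))) (tl (tl u))))) (hd (hd (tl u))))) N
    (Node (hd t) (Node (Node Leaf (hd (tl t))) (tl (tl t)))))).
Definition base_layer_prog : clocked_fun := fun N t =>
  rev_prog N (fold_prog (fun N u => Node (base_values_prog (iota 0 q) N (hd u)) (hd (tl u))) N (Node t tree_true)).
(* Argument: Node stack vs. *)
Definition evaluate_prog : clocked_fun := fun N t =>
  fold_prog (fun N u => evaluate_layer_prog N (Node (hd u) (tl u))) N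
    (Node (tl (hd t)) (Node (base_layer_prog N (hd (hd t))) (tl t))).
Definition vertices_prog : clocked_fun := fun N t =>
  rev_prog N (tl (fold_prog (fun N u => Node (Node Leaf (hd (hd (tl u)))) (Node (Node (hd (hd (tl u))) (hd u)) (tl (hd (tl u)))))
    N (Node t (Node (Node (Node tree_true Leaf) Leaf) Leaf)))).
Definition empty_pinning_prog : clocked_fun := fun N t => fold_prog (fun N u => Node Leaf (hd (tl u))) N (Node t tree_true).
(* Argument: Node p vs. *)
Definition top_tasks_prog : clocked_fun := fun N t =>
  rev_prog N (tl (fold_prog (fun N u => Node (hd (extend_prog q N (Node (hd (hd (tl u))) (hd u))))
      (Node (Node (hd (hd (tl u))) (hd u)) (tl (hd (tl u))))) N
    (Node (tl t) (Node (Node (hd t) Leaf) Leaf)))).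
(* Argument: Node tasks vals. *)
Definition product_prog : clocked_fun := fun N t =>
  zip_fold_prog (fun N u => frac_mul_prog N (Node (hd (tl (tl u)))
      ((fun N w => Node (tl w) (hd w)) N (pick_least_prog (iota 0 q) N (Node (hd u) (hd (tl u))))))) N
    (Node (hd t) (Node (tl t) (Node (Node (one_prog N t) (one_prog N t)) Leaf))).
Definition strip_prog : clocked_fun := fun N t =>
  iter N (fun t => if truthy (hd (hd t)) then t else if truthy (tl (hd t)) then t else tl t) t.
Definition output_prog : clocked_fun := fun N t =>
  strip_prog N (tl (tl (iter N (fun s => Node (tl (hd s)) (Node (tl (hd (tl s)))
     (Node (Node (hd (hd s)) (hd (hd (tl s)))) (tl (tl s))))) (Node (hd t) (Node (tl t) Leaf))))).
(* Argument: Node rows klist. *)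
Definition prepare_prog : clocked_fun := fun N t => (* Node (Node klist vs) tasks *)
  Node (Node (tl t) (vertices_prog N (hd t))) (top_tasks_prog N (Node (empty_pinning_prog N (hd t)) (vertices_prog N (hd t)))).
Definition solve_prog : clocked_fun := fun N t => (* from Node (Node klist vs) tasks *)
  output_prog N (product_prog N (Node (tl t) (evaluate_prog N (Node (layers_prog N (Node (hd (hd t)) (Node (tl t) (tl (hd t))))) (tl (hd t)))))).
Definition main_prog : clocked_fun := fun N t => solve_prog N (prepare_prog N t).

Lemma poly_time_swapw : poly_time (fun (_ : nat) w => Node (Node (hd (hd w)) (tl w)) (tl (hd w))). Proof. by prove_poly_time. Qed.
Lemma poly_time_swap : poly_time (fun (_ : nat) w => Node (tl w) (hd w)). Proof. by prove_poly_time. Qed.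
#[local] Hint Resolve poly_time_subtasks poly_time_combine poly_time_base_values poly_time_pick_least poly_time_extend : poly_time.
Lemma poly_time_next_layer : poly_time next_layer_prog. Proof. by rewrite /next_layer_prog; prove_poly_time. Qed.
#[local] Hint Resolve poly_time_next_layer : poly_time.
Lemma poly_time_layers : poly_time layers_prog. Proof. by rewrite /layers_prog; prove_poly_time. Qed.
Lemma poly_time_evaluate_layer : poly_time evaluate_layer_prog.
Proof.
rewrite /evaluate_layer_prog; apply: (poly_time_comp poly_time_rev); apply: poly_time_hd.
apply: (@poly_time_comp (fold_prog _)); last by prove_poly_time.
by apply: poly_time_fold; apply: (poly_time_comp poly_time_swapw); prove_poly_time.
Qed.
Lemma poly_time_base_layer : poly_time base_layer_prog. Proof. by rewrite /base_layer_prog; prove_poly_time. Qed.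
#[local] Hint Resolve poly_time_layers poly_time_evaluate_layer poly_time_base_layer : poly_time.
Lemma poly_time_evaluate : poly_time evaluate_prog. Proof. by rewrite /evaluate_prog; prove_poly_time. Qed.
Lemma poly_time_vertices : poly_time vertices_prog. Proof. by rewrite /vertices_prog; prove_poly_time. Qed.
Lemma poly_time_empty_pinning : poly_time empty_pinning_prog. Proof. by rewrite /empty_pinning_prog; prove_poly_time. Qed.
Lemma poly_time_top_tasks : poly_time top_tasks_prog. Proof. by rewrite /top_tasks_prog; prove_poly_time. Qed.
Lemma poly_time_product : poly_time product_prog.
Proof.
rewrite /product_prog; apply: (@poly_time_comp (zip_fold_prog _)); last by prove_poly_time.
apply: poly_time_zip_fold; apply: (poly_time_comp poly_time_frac_mul); apply: poly_time_node; first by prove_poly_time.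
by apply: (poly_time_comp poly_time_swap); prove_poly_time.
Qed.
Lemma poly_time_strip : poly_time strip_prog. Proof. by apply: poly_time_loop; prove_poly_time. Qed.
Lemma poly_time_output : poly_time output_prog.
Proof.
rewrite /output_prog; apply: (poly_time_comp poly_time_strip); do 2!apply: poly_time_tl.
pose st : clocked_fun := fun _ s => Node (tl (hd s)) (Node (tl (hd (tl s))) (Node (Node (hd (hd s)) (hd (hd (tl s)))) (tl (tl s)))).
apply: (@poly_time_comp (fun N t => iter N (st N) t)); last by prove_poly_time.
by apply: poly_time_loop; rewrite /st; prove_poly_time.
Qed.
#[local] Hint Resolve poly_time_evaluate poly_time_vertices poly_time_empty_pinning poly_time_top_tasks poly_time_product poly_time_output : poly_time.
Lemma poly_time_main : poly_time main_prog.
Proof. by apply: poly_time_comp; [rewrite /solve_prog|rewrite /prepare_prog]; prove_poly_time. Qed.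
End Programs.

#[local] Arguments ball : simpl never.
#[local] Arguments fold_prog : simpl never.
#[local] Arguments zip_fold_prog : simpl never.
#[local] Arguments catrev_prog : simpl never.
#[local] Arguments rev_prog : simpl never.
#[local] Arguments extend_prog : simpl never.
#[local] Arguments subtasks_prog : simpl never.
#[local] Arguments combine_prog : simpl never.
#[local] Arguments base_values_prog : simpl never.
#[local] Arguments pick_least_prog : simpl never.
#[local] Arguments frac_mul_prog : simpl never.
#[local] Arguments one_prog : simpl never.
#[local] Arguments zero_prog : simpl never.
#[local] Arguments subtasks : simpl never.

Lemma binary_digits N a : binary N a = tree_of_seq [seq tree_of_bool (binary_digit a i) | i <- iota 0 N].
Proof.
elim: N a => //= N IH a; rewrite /binary_digit expn0 divn1; congr Node.
rewrite IH (iotaDl 1 0 N) -map_comp; congr tree_of_seq; apply: eq_map => i /=.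
by rewrite /binary_digit -divn2 -divnMA -expnS.
Qed.

Lemma output_progE N a b : a < 2 ^ N -> b < 2 ^ N -> 0 < b -> output_prog N (frac_tree N (a, b)) = tree_of_fraction a b.
Proof.
move=> aN bN b0; rewrite /output_prog /=.
pose F i := Node (tree_of_bool (binary_digit a i)) (tree_of_bool (binary_digit b i)).
have zipE m i o : tl (tl (iter m (fun s => Node (tl (hd s)) (Node (tl (hd (tl s)))
     (Node (Node (hd (hd s)) (hd (hd (tl s)))) (tl (tl s)))))
     (Node (tree_of_seq [seq tree_of_bool (binary_digit a i) | i <- iota i m])
       (Node (tree_of_seq [seq tree_of_bool (binary_digit b i) | i <- iota i m]) o)))) =
   tree_catrev (tree_of_seq (map F (iota i m))) o.
  by elim: m i o => // m IH i o; rewrite iterSr /= IH.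
rewrite !binary_digits zipE tree_catrev_seq catrevE cats0 -map_rev.
rewrite /tree_of_fraction -/F; set L := up_log _ _.
have LN : L <= N.
  have : (maxn a b).+1 <= 2 ^ N by rewrite gtn_max aN.
  by move=> h; rewrite /L; have := @up_log_min 2 (maxn a b).+1 N isT h.
have mL : (maxn a b).+1 <= 2 ^ L by exact: up_logP.
have L0 : 0 < L by rewrite /L up_log_gt0 /= ltnS leq_max b0 orbT.
have top : truthy (hd (F L.-1)) || truthy (tl (F L.-1)).
  rewrite /F /= !truthy_tree_of_bool.
  have P : 0 < 2 ^ L.-1 by rewrite expn_gt0.
  have lo : 2 ^ L.-1 <= maxn a b.
    rewrite leqNgt; apply/negP=> h; have := @up_log_min 2 (maxn a b).+1 L.-1 isT h.
    by rewrite -/L; move: L0; clear; lia.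
  have dig x : x <= maxn a b -> 2 ^ L.-1 <= x -> binary_digit x L.-1.
    move=> xm xl; rewrite /binary_digit; have -> : x %/ 2 ^ L.-1 = 1 => //.
    apply/eqP; rewrite eqn_leq divn_gt0 // xl andbT -ltnS ltn_divLR // -expnS prednK //.
    exact: leq_ltn_trans xm mL.
  case/orP: (leq_total a b) => h; rewrite ?(maxn_idPr h) ?(maxn_idPl h) in lo *.
    by rewrite (dig b) ?orbT // leq_maxr.
  by rewrite (dig a) // leq_maxl.
have -> : iota 0 N = iota 0 L ++ iota L (N - L) by rewrite -iotaD subnKC.
rewrite rev_cat map_cat /strip_prog.
have zeros i : L <= i -> F i = tree_true.
  move=> Li; rewrite /F /binary_digit !divn_small //.
  - by apply: leq_trans (leq_pexp2l _ Li); rewrite // (leq_trans _ mL) // ltnS leq_maxr.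
  - by apply: leq_trans (leq_pexp2l _ Li); rewrite // (leq_trans _ mL) // ltnS leq_maxl.
have stop m : iter m (fun t => if truthy (hd (hd t)) then t else if truthy (tl (hd t)) then t else tl t)
    (tree_of_seq (map F (rev (iota 0 L)))) = tree_of_seq (map F (rev (iota 0 L))).
  have -> : rev (iota 0 L) = L.-1 :: rev (iota 0 L.-1).
    by rewrite -{1}(prednK L0) -addn1 iotaD /= rev_cat.
  elim: m => // m IH; rewrite iterS IH /=; move: top; rewrite /F /= !truthy_tree_of_bool.
  by case: (binary_digit a _); case: (binary_digit b _).
have al : all (fun i => L <= i) (rev (iota L (N - L))).
  by rewrite all_rev; apply/allP=> i; rewrite mem_iota => /andP[].
have sz : size (rev (iota L (N - L))) <= N by rewrite size_rev size_iota leq_subr.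
have fin s m : size s <= m -> all (fun i => L <= i) s -> iter m (fun t => if truthy (hd (hd t)) then t
    else if truthy (tl (hd t)) then t else tl t)
    (tree_of_seq (map F s ++ map F (rev (iota 0 L)))) = tree_of_seq (map F (rev (iota 0 L))).
  elim: s m => [|i s IH] m /= sm; first by rewrite stop.
  case/andP=> Li ls; case: m sm => // m sm; rewrite iterSr.
  rewrite [X in iter m _ X](_ : _ = tree_of_seq (map F s ++ map F (rev (iota 0 L)))); first exact: IH.
  by rewrite (zeros i Li).
exact: fin.
Qed.

Section CorrectMain.
Variables (n q r N : nat) (e lat : rel 'I_n) (c0 : 'I_q) (Delta : nat).
Notation V := 'I_n.
Notation C := 'I_q.
Notation pinning := (pinning 'I_n 'I_q).
Hypotheses (e_sym : symmetric e) (e_irr : irreflexive e).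
Hypothesis e_lat : subrel e lat.
Hypothesis Delta_lt : Delta < #|C|.
Hypothesis ldeg_le : forall v, degree_in lat setT v <= Delta.
Implicit Types (p : pinning) (v w s : V) (c : C) (Q : seq pinning) (ts : seq (pinning * V)).
Variables (Smax Wmax Lb M K : nat).
Hypothesis sphere_le : forall p v, size (sphere e r p v) <= Smax.
Hypothesis sphere_pow_le : forall p v, q ^ size (sphere e r p v) <= Wmax.
Hypothesis inner_pow_le : forall p v, q ^ size (inner_list r e p v) <= 2 ^ Lb.
Hypothesis M_ge : Wmax * (Smax + Lb + 1) <= M.
Hypothesis M_gt0 : 0 < M.
Hypotheses (n_le : n <= N) (q_le : q <= N) (N_gt0 : 0 < N) (q_gt0 : 0 < q).
Hypotheses (Wmax_le : Wmax <= N) (pow_Lb_le : 2 ^ Lb <= N) (SmaxWmax_le : Smax * Wmax <= N) (K_lt : K < N).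
Hypothesis bits_lt : n * M ^ K < N.

Notation task_tree := (task_tree e).
Notation vertices_tree := (vertices_tree e).
Notation values_tree := (values_tree N).
Notation estimate_fraction := (estimate_fraction r e c0).

Let inner_pow_leN p v : q ^ size (inner_list r e p v) <= N. Proof. exact: leq_trans (inner_pow_le p v) pow_Lb_le. Qed.
Let sphere_pow_leN p v : q ^ size (sphere e r p v) <= N. Proof. exact: leq_trans (sphere_pow_le p v) Wmax_le. Qed.
Definition task_subtasks (t : pinning * V) := subtasks e (sphere e r t.1 t.2) [:: t.1].
Lemma size_task_subtasks t : size (task_subtasks t) <= Smax * Wmax.
Proof.
apply: leq_trans (size_subtasks _ q_gt0 _ _) _; rewrite mul1n; apply: leq_mul => //; exact: sphere_le.
Qed.
Let subtasks_le p v : size (subtasks e (sphere e r p v) [:: p]) <= N.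
Proof. exact: leq_trans (size_task_subtasks (p, v)) SmaxWmax_le. Qed.
Let SmaxWmax_leM : Smax * Wmax <= M.
Proof. by apply: leq_trans M_ge; rewrite mulnC leq_mul2l -addnA leq_addr orbT. Qed.

Definition next_layer ts := flatten (map task_subtasks ts).
Lemma size_next_layer ts : size (next_layer ts) <= M * size ts.
Proof. by apply: size_flatten_le => t; exact: leq_trans (size_task_subtasks t) SmaxWmax_leM. Qed.

Lemma next_layer_progE ts : size ts <= N -> size (next_layer ts) <= N ->
  next_layer_prog q r N (Node (tree_of_seq (map task_tree ts)) vertices_tree) = tree_of_seq (map task_tree (next_layer ts)).
Proof.
move=> h1 h2; rewrite /next_layer_prog /= fold_progE ?spine_seq ?size_map // foldl_map /=.
have gen (A : seq (pinning * V)) ts' : foldl (fun a t => catrev_prog N (Node (subtasks_prog q r N (Node (task_tree t) vertices_tree)) a))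
    (tree_of_seq (map task_tree A)) ts' = tree_of_seq (map task_tree (catrev (flatten (map task_subtasks ts')) A)).
  elim: ts' A => //= -[p v] ts' IH A.
  rewrite subtasks_progE // catrev_progE; last by rewrite spine_seq size_map.
  by rewrite tree_catrev_seq spine_seq -map_catrev IH catrev_catl.
have := gen [::] ts; rewrite -/(next_layer ts) /= => ->.
rewrite catrevE cats0 rev_progE ?spine_seq ?size_map ?size_rev // tree_catrev_seq catrevE cats0.
by rewrite -map_rev revK.
Qed.

Fixpoint layer i ts := if i is i'.+1 then next_layer (layer i' ts) else ts.
Fixpoint stack i ts : seq (seq (pinning * V)) := if i is i'.+1 then layer i ts :: stack i' ts else [:: ts].

Lemma size_layer i ts : size (layer i ts) <= M ^ i * size ts.
Proof.
elim: i => [|i IH] /=; first by rewrite mul1n.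
by apply: leq_trans (size_next_layer _) _; rewrite expnS -mulnA leq_mul2l IH orbT.
Qed.
Lemma size_layerN i ts : i <= K -> size ts <= n -> size (layer i ts) <= N.
Proof.
move=> iK tn; apply: leq_trans (size_layer _ _) _; apply: leq_trans (ltnW bits_lt).
by rewrite mulnC; apply: leq_mul => //; apply: leq_pexp2l.
Qed.

Definition layer_tree ts := tree_of_seq (map task_tree ts).
Lemma layers_progE kl ts : size (spine kl) = K -> size ts <= n ->
  layers_prog q r N (Node kl (Node (layer_tree ts) vertices_tree)) = tree_of_seq (map layer_tree (stack K ts)).
Proof.
move=> sk tn; rewrite /layers_prog /= fold_progE ?sk ?(ltnW K_lt) //.
have gen m (s : seq tree) : size s = m -> m <= K ->
   foldl (fun a x => Node (next_layer_prog q r N (Node (hd a) vertices_tree)) a) (Node (layer_tree ts) Leaf) s =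
   tree_of_seq (map layer_tree (stack m ts)).
  elim: m s => [|m IH] s; first by case: s.
  case/lastP: s => // s x; rewrite size_rcons => -[sm] mK; rewrite -cats1 foldl_cat /= IH //; last exact: ltnW.
  congr Node.
  have -> : hd (tree_of_seq (map layer_tree (stack m ts))) = layer_tree (layer m ts) by case: m {IH sm mK} => //.
  rewrite next_layer_progE //; first by apply: size_layerN => //; exact: ltnW.
  by apply: (size_layerN mK).
exact: gen.
Qed.

Definition unpinned_tasks ts := forall t, t \in ts -> t.2 \in unpinned t.1.

Lemma subtasks_unpinned S Q : uniq S -> (forall p, p \in Q -> forall s, s \in S -> s \in unpinned p) ->
  forall t, t \in subtasks e S Q -> t.2 \in unpinned t.1.
Proof.
elim: S Q => //= s S IH Q /andP[sS uS] hQ t; rewrite mem_cat => /orP[/mapP[p pQ ->]|].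
  by apply: hQ pQ _ _; rewrite inE eqxx.
apply: IH => // p; rewrite /extend_all catrevE cats0 mem_rev => /flatten_mapP[p1 p1Q] /mapP[c _ ->] u uS'.
exact: (@unpinned_pin_tail 'I_n 'I_q p1 s c S sS (hQ p1 p1Q) u uS').
Qed.
Lemma unpinned_tasks_next_layer ts : unpinned_tasks ts -> unpinned_tasks (next_layer ts).
Proof.
move=> h t /flatten_mapP[[p v] pv]; apply: subtasks_unpinned; first exact: filter_uniq (enum_uniq _).
by move=> p1 /[1!inE]/eqP -> s /sphereP[].
Qed.
Lemma unpinned_tasks_layer i ts : unpinned_tasks ts -> unpinned_tasks (layer i ts).
Proof. by move=> h; elim: i => //= i; exact: unpinned_tasks_next_layer. Qed.

Lemma exists_allowed p v : v \in unpinned p -> exists c, c \in allowed e p v.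
Proof. by move=> vf; apply/card_gt0P; exact: (allowed_gt0 c0 e_lat Delta_lt ldeg_le vf). Qed.

Definition layer_values_tree k ts := tree_of_seq [seq values_tree (estimate_fraction k t.1 t.2) | t <- ts].

Lemma base_layer_progE ts : size ts <= N -> unpinned_tasks ts -> base_layer_prog q N (layer_tree ts) = layer_values_tree 0 ts.
Proof.
move=> h ok; rewrite /base_layer_prog fold_progE /= ?spine_seq ?size_map // foldl_map /=.
rewrite (_ : foldl _ _ _ = tree_catrev (layer_values_tree 0 ts) Leaf).
  by rewrite rev_progE ?tree_catrevK // size_tree_catrev addn0 spine_seq size_map.
rewrite /layer_values_tree; move: Leaf; elim: ts ok {h} => //= -[p v] ts IH ok o.
have vf : v \in unpinned p by apply: (ok (p, v)); rewrite inE eqxx.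
have ex := exists_allowed vf; rewrite (@base_values_progE n q N e c0) // IH // => t tt; apply: ok; by rewrite inE tt orbT.
Qed.

Lemma evaluate_layer_progE k ts : size ts <= N ->
  evaluate_layer_prog q r N (Node (layer_tree ts) (Node (layer_values_tree k (next_layer ts)) vertices_tree)) = layer_values_tree k.+1 ts.
Proof.
move=> h; have cE p v rest : combine_prog q r N (Node (task_tree (p, v)) (Node (tree_of_seq
    ([seq values_tree (estimate_fraction k t.1 t.2) | t <- task_subtasks (p, v)] ++ rest)) vertices_tree)) =
    Node (values_tree (estimate_fraction k.+1 p v)) (tree_of_seq rest) by apply: combine_progE.
rewrite /evaluate_layer_prog; move: (combine_prog q r) cE => cmb cE.
rewrite /= fold_progE ?spine_seq ?size_map // foldl_map /=.
have gen o rest ts' : foldl (fun a t => Node (Node (hd (cmb N (Node (task_tree t) (Node (tl a) vertices_tree)))) (hd a))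
       (tl (cmb N (Node (task_tree t) (Node (tl a) vertices_tree)))))
     (Node o (tree_of_seq ([seq values_tree (estimate_fraction k t.1 t.2) | t <- next_layer ts'] ++ rest))) ts' =
     Node (tree_catrev (layer_values_tree k.+1 ts') o) (tree_of_seq rest).
  elim: ts' o => // -[p v] ts' IH o.
  rewrite -[next_layer _]/(task_subtasks (p, v) ++ next_layer ts') map_cat -catA [foldl _ _ _]/= cE /= IH.
  by [].
have := gen Leaf [::] ts; rewrite cats0 => -> /=.
by rewrite rev_progE ?tree_catrevK // size_tree_catrev addn0 spine_seq size_map.
Qed.

Lemma evaluate_progE ts : size ts <= n -> unpinned_tasks ts ->
  evaluate_prog q r N (Node (tree_of_seq (map layer_tree (stack K ts))) vertices_tree) = layer_values_tree K ts.
Proof.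
move=> tn ok; rewrite /evaluate_prog /=.
have gen m j : m + j = K ->
  foldl (fun a x => evaluate_layer_prog q r N (Node x (Node a vertices_tree))) (layer_values_tree j (layer m ts)) (map layer_tree (behead (stack m ts))) = layer_values_tree K ts.
  elim: m j => [|m IH] j; first by rewrite add0n => ->.
  move=> mj /=; have -> : stack m ts = layer m ts :: behead (stack m ts) by case: (m).
  rewrite /= evaluate_layer_progE; last by apply: size_layerN => //; move: mj; clear; lia.
  by rewrite (IH j.+1) // addnS.
have E : tree_of_seq (map layer_tree (stack K ts)) = Node (layer_tree (layer K ts)) (tree_of_seq (map layer_tree (behead (stack K ts)))).
  by case: (K).
rewrite E /= fold_progE ?spine_seq ?size_map.
  rewrite base_layer_progE ?gen ?addn0 //; first exact: size_layerN.
  exact: unpinned_tasks_layer.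
suff -> : size (behead (stack K ts)) = K by exact: ltnW.
by rewrite size_behead; elim: (K) => //= m; case: (m) => //= m' ->.
Qed.

Lemma vertices_progE : vertices_prog N (tree_of_seq [seq row_tree e v | v <- enum V]) = vertices_tree.
Proof.
rewrite /vertices_prog fold_progE; last by rewrite spine_seq size_map size_enum_ord.
rewrite spine_seq foldl_map /=.
have gen (s : seq V) i o : map val s = iota i (size s) ->
  tl (foldl (fun a v => Node (Node Leaf (hd a)) (Node (Node (hd a) (row_tree e v)) (tl a))) (Node (onehot i) o) s) =
  tree_catrev (tree_of_seq [seq vertex_tree e v | v <- s]) o.
  elim: s i o => //= v s IH i o [vi si].
  have := IH i.+1 (Node (Node (onehot i) (row_tree e v)) o) si.
  by rewrite /onehot /= => ->; rewrite /vertex_tree /onehot vi.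
have := gen (enum V) 0 Leaf; rewrite size_enum_ord val_enum_ord => /(_ erefl) /= ->.
by rewrite rev_prog_map // size_enum_ord.
Qed.

Definition empty_pinning : pinning := [ffun=> None].
Lemma empty_pinning_progE : empty_pinning_prog N (tree_of_seq [seq row_tree e v | v <- enum V]) = pinning_tree empty_pinning.
Proof.
rewrite /empty_pinning_prog fold_progE; last by rewrite spine_seq size_map size_enum_ord.
rewrite spine_seq foldl_map /=.
rewrite /pinning_tree (eq_map (g := fun=> Leaf)) => [|w]; last by rewrite ffunE.
suff gen (s : seq V) o : foldl (fun a _ => Node Leaf a) o s = foldr Node o [seq Leaf | _ <- s] by exact: gen.
elim: s o => //= v s IH o; rewrite IH; elim: s {IH} => //= v' s ->.
by [].
Qed.

Fixpoint top_tasks (vs : seq V) p : seq (pinning * V) :=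
  if vs is v :: vs' then (p, v) :: top_tasks vs' (pin p v (least_allowed c0 e p v)) else [::].

Lemma free_step v vs p : uniq (v :: vs) -> unpinned p = [set w in v :: vs] ->
  v \in unpinned p /\ unpinned (pin p v (least_allowed c0 e p v)) = [set w in vs].
Proof.
case/andP=> vvs _ fp; split; first by rewrite fp !inE eqxx.
rewrite unpinned_pin fp; apply/setP=> w; rewrite !inE; case: (eqVneq w v) => [->|] //=.
by rewrite (negPf vvs).
Qed.

Lemma size_top_tasks vs p : size (top_tasks vs p) = size vs.
Proof. by elim: vs p => //= v vs IH p; rewrite IH. Qed.

Lemma unpinned_tasks_top_tasks vs p : uniq vs -> unpinned p = [set w in vs] -> unpinned_tasks (top_tasks vs p).
Proof.
elim: vs p => //= v vs IH p uvs fp; have [vf fp'] := free_step uvs fp.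
have uv : uniq vs by case/andP: uvs.
by move=> t; rewrite inE => /orP[/eqP -> //|h]; exact: (IH _ uv fp' t h).
Qed.

Lemma top_tasks_progE p vs o : uniq vs -> unpinned p = [set w in vs] ->
  tl (foldl (fun a x => Node (hd (extend_prog q N (Node (hd a) x))) (Node (Node (hd a) x) (tl a)))
    (Node (pinning_tree p) o) [seq vertex_tree e v | v <- vs]) = tree_catrev (layer_tree (top_tasks vs p)) o.
Proof.
elim: vs p o => //= v vs IH p o uvs fp; have [vf fp'] := free_step uvs fp.
have uv : uniq vs by case/andP: uvs.
rewrite extend_progE // -[tree_catrev _ _]/(tree_catrev (layer_tree (top_tasks vs (pin p v (least_allowed c0 e p v)))) (Node (task_tree (p, v)) o)) -IH //.
congr (tl (foldl _ (Node _ _) _)).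
have [c ca] := exists_allowed vf.
have : has (mem (allowed e p v)) (enum C) by apply/hasP; exists c; rewrite ?mem_enum.
rewrite /pin_extensions /least_allowed has_count -size_filter; by case: [seq _ <- _ | _].
Qed.

Definition frac_inv (f : nat * nat) := (f.2, f.1).
Definition product_fraction ts := foldl (fun acc t => frac_mul acc (frac_inv (estimate_fraction K t.1 t.2 (least_allowed c0 e t.1 t.2)))) (1, 1) ts.

Lemma product_progE ts : size ts <= N -> unpinned_tasks ts ->
  product_prog q N (Node (layer_tree ts) (layer_values_tree K ts)) = frac_tree N (product_fraction ts).
Proof.
move=> h ok; rewrite /product_prog /= /layer_tree zip_fold_progE // one_progE //.
rewrite -[Node (binary N 1) (binary N 1)]/(frac_tree N (1, 1)) /product_fraction /layer_values_tree spine_seq.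
have E : forall t0, zip ts (iota 0 (size ts)) = [seq (nth t0 ts i, i) | i <- iota 0 (size ts)].
  move=> t0; rewrite -[X in zip X _](mkseq_nth t0 ts) /mkseq.
  by elim: (iota _ _) => //= i s ->.
have [->|[t0 t0in]] : ts = [::] \/ exists t0, t0 \in ts.
  by case: (ts) => [|t l]; [left|right; exists t; rewrite inE eqxx].
  by [].
rewrite (E t0).
rewrite foldl_map -[in RHS](mkseq_nth t0 ts) /mkseq [in RHS]foldl_map.
have : all (fun i => i < size ts) (iota 0 (size ts)) by apply/allP=> i; rewrite mem_iota.
move: (1, 1); elim: (iota _ _) => //= i s IH f /andP[il al].
rewrite (nth_map t0) //; have tin : nth t0 ts i \in ts by exact: mem_nth.
have tf := ok _ tin; case: (nth t0 ts i) tf => p v vf.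
have ex := exists_allowed vf; rewrite (pick_least_progE c0) //=.
by rewrite -[Node (binary N _) (binary N _)]/(frac_tree N (frac_inv (estimate_fraction K p v (least_allowed c0 e p v)))) frac_mul_progE IH.
Qed.

Lemma frac_bounded_product_fraction ts : unpinned_tasks ts -> frac_bounded (size ts * M ^ K) (product_fraction ts).
Proof.
move=> ok; rewrite /product_fraction.
suff gen f m : frac_bounded m f -> frac_bounded (m + size ts * M ^ K)
  (foldl (fun acc t => frac_mul acc (frac_inv (estimate_fraction K t.1 t.2 (least_allowed c0 e t.1 t.2)))) f ts) by exact: (gen (1, 1) 0).
elim: ts ok f m => [|[p v] ts IH] ok f m hf /=; first by rewrite mul0n addn0.
rewrite mulSn addnA; apply: IH; first by move=> t tt; apply: ok; rewrite inE tt orbT.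
apply: frac_bounded_mul => //.
have vf : v \in unpinned p by apply: (ok (p, v)); rewrite inE eqxx.
have [_ + _] : [/\ 0 < (estimate_fraction K p v (least_allowed c0 e p v)).2, frac_bounded (M ^ K) (estimate_fraction K p v (least_allowed c0 e p v))
   & frac_value (estimate_fraction K p v (least_allowed c0 e p v)) = estimate c0 e r K p v (least_allowed c0 e p v)] by exact: (estimate_fractionE c0 e_sym e_irr e_lat Delta_lt ldeg_le sphere_le sphere_pow_le inner_pow_le M_ge M_gt0).
by rewrite /frac_bounded /frac_inv /= andbC.
Qed.

Lemma product_fractionE vs p f : uniq vs -> unpinned p = [set w in vs] -> (0 < count_estimate c0 e r K vs p)%R ->
  0 < f.2 ->
  let F := foldl (fun acc t => frac_mul acc (frac_inv (estimate_fraction K t.1 t.2 (least_allowed c0 e t.1 t.2)))) f (top_tasks vs p) in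
  0 < F.2 /\ frac_value F = (frac_value f * count_estimate c0 e r K vs p)%R.
Proof.
elim: vs p f => [|v vs IH] p f /= uvs fp pp f0; first by rewrite mulr1.
have [vf fp'] := free_step uvs fp; case/andP: uvs => _ uvs.
have [a _ b] : [/\ 0 < (estimate_fraction K p v (least_allowed c0 e p v)).2, frac_bounded (M ^ K) (estimate_fraction K p v (least_allowed c0 e p v))
   & frac_value (estimate_fraction K p v (least_allowed c0 e p v)) = estimate c0 e r K p v (least_allowed c0 e p v)] by exact: (estimate_fractionE c0 e_sym e_irr e_lat Delta_lt ldeg_le sphere_le sphere_pow_le inner_pow_le M_ge M_gt0).
have e0 : (0 <= estimate c0 e r K p v (least_allowed c0 e p v))%R by exact: estimate_ge0.
have en : (estimate c0 e r K p v (least_allowed c0 e p v) != 0)%R.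
  by apply: contraTneq pp => ->; rewrite invr0 mul0r ltxx.
have ep : (0 < estimate c0 e r K p v (least_allowed c0 e p v))%R by rewrite lt0r en.
have num : 0 < (estimate_fraction K p v (least_allowed c0 e p v)).1.
  rewrite lt0n; apply: contraNneq en => h; rewrite -b /frac_value h mul0r //.
have pp' : (0 < count_estimate c0 e r K vs (pin p v (least_allowed c0 e p v)))%R.
  by move: pp; rewrite pmulr_rgt0 // invr_gt0.
have [h1 h2] := IH _ (frac_mul f (frac_inv (estimate_fraction K p v (least_allowed c0 e p v)))) uvs fp' pp' ltac:(by rewrite /= muln_gt0 f0).
split=> //; rewrite h2 frac_value_mul -mulrA; congr (_ * (_ * _))%R.
by rewrite -b /frac_value /frac_inv /= invf_div.
Qed.

Lemma main_progE kl : size (spine kl) = K -> (0 < count_estimate c0 e r K (enum V) empty_pinning)%R ->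
  exists a b : nat, [/\ 0 < b, (count_estimate c0 e r K (enum V) empty_pinning = a%:R / b%:R)%R
   & main_prog q r N (Node (tree_of_seq [seq row_tree e v | v <- enum V]) kl) = tree_of_fraction a b].
Proof.
move=> sk pp; have uV : uniq (enum V) by exact: enum_uniq.
have fp : unpinned empty_pinning = [set w in enum V] by apply/setP=> w; rewrite !inE ffunE eqxx mem_enum.
set ts := top_tasks (enum V) empty_pinning.
have ok : unpinned_tasks ts by exact: unpinned_tasks_top_tasks.
have sz : size ts = n by rewrite size_top_tasks size_enum_ord.
have [h1 h2] := product_fractionE (f := (1, 1)) uV fp pp isT.
exists (product_fraction ts).1, (product_fraction ts).2; split=> //.
  by move: h2; rewrite /= {2}/frac_value divff // mul1r => <-.
rewrite /main_prog /prepare_prog /solve_prog /= vertices_progE empty_pinning_progE.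
have -> : top_tasks_prog q N (Node (pinning_tree empty_pinning) vertices_tree) = layer_tree ts.
  rewrite /top_tasks_prog /= fold_progE; last by rewrite spine_vertices_tree size_map size_enum_ord.
  rewrite spine_vertices_tree top_tasks_progE //.
  by rewrite rev_progE ?tree_catrevK // size_tree_catrev addn0 spine_seq size_map sz.
rewrite layers_progE ?sz // evaluate_progE ?sz // product_progE ?sz //.
have /andP[f1 f2] := frac_bounded_product_fraction ok; rewrite sz in f1 f2.
have lt : 2 ^ (n * M ^ K) < 2 ^ N by rewrite ltn_exp2l.
have h1' : 0 < (product_fraction ts).2 by exact: h1.
move: f1 f2 h1'; case: (product_fraction ts) => a b /= f1 f2 h1'.
by apply: output_progE => //; [exact: leq_ltn_trans f1 lt|exact: leq_ltn_trans f2 lt].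
Qed.

End CorrectMain.
End MainProgram.

Module Clock.
Import Defs PolyTime TreeArithmetic.

Fixpoint clock_power_prog (d : nat) : clocked_fun := fun N t =>
  if d is d'.+1 then iter N (clock_power_prog d' N) t else Node Leaf t.

Lemma poly_time_clock_power d : poly_time (clock_power_prog d).
Proof.
elim: d => [|d IHd]; last exact: poly_time_loop.
by rewrite /clock_power_prog; prove_poly_time.
Qed.

Lemma size_clock_power d N t :
  size (spine (clock_power_prog d N t)) = N ^ d + size (spine t).
Proof.
elim: d t => [|d IHd] t /=; first by rewrite expn0 add1n.
rewrite expnS; move: {1 3}N => m; elim: m => //= m IHm.
by rewrite IHd IHm mulSn addnA.
Qed.

Definition half_step (s : tree) :=
  if truthy (tl (hd s)) then Node (tl (tl (hd s))) (Node Leaf (tl s)) else s.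

Definition half_prog : clocked_fun := fun N t => tl (iter N half_step (Node t Leaf)).

Definition log_step : clocked_fun := fun N s =>
  if truthy (hd s) then Node (half_prog N (hd s)) (Node Leaf (tl s)) else s.

Definition log_prog : clocked_fun := fun N t =>
  tl (iter N (log_step N) (Node (zero_prog N t) Leaf)).

Lemma poly_time_half : poly_time half_prog.
Proof.
apply: poly_time_tl; apply: (@poly_time_comp (fun N t => iter N half_step t)).
  by apply: (@poly_time_loop (fun _ s => half_step s)); rewrite /half_step; prove_poly_time.
by prove_poly_time.
Qed.
#[global] Hint Resolve poly_time_half : poly_time.

Lemma poly_time_log : poly_time log_prog.
Proof.
apply: poly_time_tl; apply: (@poly_time_comp (fun N t => iter N (log_step N) t)).
  by apply: poly_time_loop; rewrite /log_step; prove_poly_time.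
by prove_poly_time.
Qed.
#[global] Hint Resolve poly_time_log : poly_time.

Lemma size_half_prog N t :
  size (spine t) <= N -> size (spine (half_prog N t)) = (size (spine t))./2.
Proof.
move=> size_le; rewrite /half_prog -[RHS](addn0 _) -[0]/(size (spine Leaf)).
elim: N t Leaf size_le => [|N IHN] t out; first by case: t.
case: t => [|x [|y t]] size_le; rewrite iterSr; [by rewrite iter_fix|by rewrite iter_fix|].
rewrite /half_step /= -/half_step IHN ?addnS //.
by move: size_le => /=; clear; lia.
Qed.

Lemma size_log_prog N t : 0 < N ->
  N < 2 ^ size (spine (log_prog N t)) /\ 2 ^ size (spine (log_prog N t)) <= 2 * N.
Proof.
move=> N_gt0; rewrite /log_prog.
have log_iter i l out : size (spine l) <= i -> size (spine l) <= N -> exists k,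
   [/\ size (spine (tl (iter i (log_step N) (Node l out)))) = k + size (spine out),
       size (spine l) < 2 ^ k, size (spine l) = 0 -> k = 0
     & 0 < size (spine l) -> 2 ^ k <= 2 * size (spine l)].
  elim: i l out => [|i IHi] l out; first by case: l => // _ _; exists 0.
  case: l => [|x l] le_i le_N; first by exists 0; rewrite iter_fix.
  rewrite iterSr [log_step N _]/= -[log_step N _]/(Node (half_prog N (Node x l)) (Node Leaf out)).
  have half_size := size_half_prog le_N.
  have [||k [sizeE lt_pow k_eq0 pow_le]] := IHi (half_prog N (Node x l)) (Node Leaf out).
  - by rewrite half_size; move: le_i => /=; clear; lia.
  - by rewrite half_size; move: le_N => /=; clear; lia.
  exists k.+1; rewrite half_size /= in sizeE lt_pow k_eq0 pow_le *; split=> //.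
  - by rewrite sizeE addnS.
  - by rewrite expnS; move: lt_pow; clear; lia.
  move=> _; rewrite expnS; case: (posnP (size (spine l)).+1./2) => [half_eq0|half_gt0].
    by rewrite (k_eq0 half_eq0); clear; lia.
  by have := pow_le half_gt0; clear; lia.
have zero_size : size (spine (zero_prog N t)) = N by rewrite zero_progE size_binary.
have [||k] := log_iter N (zero_prog N t) Leaf; rewrite ?zero_size //.
by rewrite addn0 => -[-> lt_pow _ pow_le]; split=> //; exact: pow_le.
Qed.

Definition add_leaves (c : nat) (t : tree) := iter c (Node Leaf) t.

Lemma poly_time_add_leaves c f : poly_time f -> poly_time (fun N t => add_leaves c (f N t)).
Proof.
move=> f_poly; rewrite /add_leaves; elim: c => //= c IHc.
by apply: poly_time_node; prove_poly_time.
Qed.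

Lemma size_add_leaves c t : size (spine (add_leaves c t)) = c + size (spine t).
Proof. by rewrite /add_leaves; elim: c => //= c ->. Qed.

(* A clock of length N ^ D and the recursion depth c + log N. *)
Definition setup_prog (D c : nat) : clocked_fun := fun N _ =>
  Node (clock_power_prog D N Leaf) (add_leaves c (log_prog N Leaf)).

Lemma poly_time_setup D c : poly_time (setup_prog D c).
Proof.
apply: poly_time_node; first by apply: (poly_time_comp (poly_time_clock_power D)); prove_poly_time.
by apply: poly_time_add_leaves; apply: (poly_time_comp poly_time_log); prove_poly_time.
Qed.

Definition double_body := Seq (Assign 1 (ENode ELeaf (EVar 1))) (Assign 5 (ESnd (EVar 5))).

Lemma double_exec u s : s 5 = u -> exists k s',
  [/\ exec (While (EVar 5) double_body) s k s', k <= 10 * size (spine u) + 2,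
      clock s' = clock s + size (spine u) & forall i, i != 1 -> i != 5 -> s' i = s i].
Proof.
elim: u s => [|x _ u IHu] s s5.
  by exists 2, s; split=> //; [apply: exec_while_done; rewrite /= s5|rewrite addn0].
set s1 := update s 1 (Node Leaf (s 1)); set s2 := update s1 5 u.
have exec1 : exec double_body s 8 s2.
  have -> : s2 = update s1 5 (eval s1 (ESnd (EVar 5))) by rewrite /= /s1 update_neq // s5.
  by apply: (@exec_seq _ _ _ _ _ 4 3); exact: exec_assign.
have [|k [s' [exec2 time2 clock2 frame2]]] := IHu s2; first by rewrite /s2 update_eq.
exists (1 + 8 + k).+1, s'; split.
- by apply: exec_while_step exec1 exec2; rewrite /= s5.
- by move: time2 => /=; clear; lia.
- by rewrite clock2 /clock /s2 update_neq // /s1 update_eq /= addnS.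
by move=> i i1 i5; rewrite frame2 // /s2 update_neq // /s1 update_neq.
Qed.

Definition leading_digit_at (j : nat) (t : tree) :=
  (forall i, i < j -> ~~ truthy (hd (nth Leaf (spine t) i))) /\
  truthy (hd (nth Leaf (spine t) j)).

Lemma leading_digit_at0 t : leading_digit_at 0 t -> truthy (hd (hd t)).
Proof. by case=> _; case: t. Qed.

Lemma leading_digit_atS j t :
  leading_digit_at j.+1 t -> ~~ truthy (hd (hd t)) /\ leading_digit_at j (tl t).
Proof.
have nth_tl i : nth Leaf (spine (tl t)) i = nth Leaf (spine t) i.+1.
  by case: t => //=; rewrite nth_nil.
move=> [zeros one]; split; first by have := zeros 0 isT; case: (t).
by split=> [i i_lt|]; rewrite nth_tl //; exact: zeros.
Qed.

(* Registers: 1 clock, 3 remaining digits, 4 flag, 5 counter. *)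
Definition scan_body := If (EFst (EFst (EVar 3))) (Assign 4 ELeaf)
  (Seq (Assign 3 (ESnd (EVar 3))) (Seq (Assign 5 (EVar 1)) (While (EVar 5) double_body))).

Lemma scan_body_exec s : ~~ truthy (hd (hd (s 3))) -> exists k s',
  [/\ exec scan_body s k s', k <= 10 * clock s + 20, clock s' = clock s + clock s,
      s' 3 = tl (s 3) & forall i, i \in [:: 0; 2; 4] -> s' i = s i].
Proof.
move=> digit0; set s1 := update s 3 (tl (s 3)); set s2 := update s1 5 (s1 1).
have [|k [s' [exec1 time1 clock1 frame1]]] := double_exec (s := s2) (u := s 1).
  by rewrite /s2 update_eq /s1 update_neq.
have clock2 : clock s2 = clock s by rewrite /clock /s2 update_neq // /s1 update_neq.
exists (3 + (3 + (2 + k).+1).+1).+1, s'; split.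
- apply: exec_if; rewrite (negPf digit0); apply: exec_seq; first exact: (exec_assign s 3 (ESnd (EVar 3))).
  by apply: exec_seq exec1; exact: (exec_assign s1 5 (EVar 1)).
- by move: time1; rewrite /= /clock; clear; lia.
- by rewrite clock1 clock2.
- by rewrite frame1 // /s2 update_neq // /s1 update_eq.
move=> i; rewrite !inE => i_in; have [i1 i3 i5] : [/\ i != 1, i != 3 & i != 5].
  by case/or3P: i_in => /eqP->.
by rewrite frame1 // /s2 update_neq // /s1 update_neq.
Qed.

Lemma scan_exec j s : truthy (s 4) -> leading_digit_at j (s 3) -> 0 < clock s ->
  exists k s', [/\ exec (While (EVar 4) scan_body) s k s',
    k <= 40 * (j.+1 * (clock s * 2 ^ j)), clock s' = clock s * 2 ^ j,
    s' 0 = s 0 & s' 2 = s 2].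
Proof.
elim: j s => [|j IHj] s flag digit clock_gt0.
  exists (1 + 6 + 2).+1, (update s 4 Leaf); split.
  - apply: (@exec_while_step _ (update s 4 Leaf)) => //.
      by apply: (@exec_if _ _ _ _ _ 2); rewrite (leading_digit_at0 digit); exact: exec_assign.
    by apply: exec_while_done.
  - by rewrite expn0; move: clock_gt0; clear; lia.
  - by rewrite /clock update_neq // muln1.
  - by rewrite update_neq.
  - by rewrite update_neq.
have [digit0 digit'] := leading_digit_atS digit.
have [k1 [s1 [exec1 time1 clock1 s1_3 frame1]]] := scan_body_exec digit0.
have [|||k2 [s2 [exec2 time2 clock2 s2_0 s2_2]]] := IHj s1.
- by rewrite frame1.
- by rewrite s1_3.
- by rewrite clock1; move: clock_gt0; clear; lia.
exists (1 + k1 + k2).+1, s2; split.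
- exact: exec_while_step exec1 exec2.
- rewrite clock1 in time2; move: time1 time2 clock_gt0; rewrite expnS.
  have : 0 < 2 ^ j by rewrite expn_gt0.
  by move: (clock s) (2 ^ j) => L P; clear; nia.
- by rewrite clock2 clock1 expnS addnn -mul2n mulnA [_ * 2]mulnC.
- by rewrite s2_0 frame1.
by rewrite s2_2 frame1.
Qed.

Definition clocked_program (setup main : cmd) : cmd :=
  Seq (Assign 2 (EFst (EVar 0))) (Seq (Assign 3 (ESnd (EVar 0)))
  (Seq (Assign 1 (ENode ELeaf (ENode ELeaf (EVar 2)))) (Seq (Assign 4 (ENode ELeaf ELeaf))
  (Seq (While (EVar 4) scan_body) (Seq setup (Seq (Assign 1 (EFst (EVar 3)))
  (Seq (Assign 3 (ENode (EVar 2) (ESnd (EVar 3)))) (Seq main (Assign 0 (EVar 3)))))))))).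

Section ClockedProgram.
Variables (setup main : clocked_fun).
Hypothesis setup_const : forall N t, setup N t = setup N Leaf.
Variables (rows t : tree) (j : nat).
Let N0 := (size (spine rows)).+2 * 2 ^ j.
Let N1 := size (spine (hd (setup N0 Leaf))).

Lemma clocked_program_exec c1 c2 time1 time2 :
  implements c1 setup 3 time1 -> implements c2 main 3 time2 -> leading_digit_at j t ->
  exists2 k,
    computes (clocked_program c1 c2) (Node rows t) k (main N1 (Node rows (tl (setup N0 Leaf))))
  & k <= 40 * (j.+1 * N0) + time1 N0 + time2 N1 + 40.
Proof.
move=> c1_impl c2_impl digit.
set i0 := update (fun=> Leaf) 0 (Node rows t); set i1 := update i0 2 rows.
set i2 := update i1 3 t; set i3 := update i2 1 (Node Leaf (Node Leaf rows)).
set i4 := update i3 4 tree_true.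
have [|||ka [s1 [exec_a time_a clock_a _ s1_2]]] := @scan_exec j i4 => //.
rewrite -[clock i4]/((size (spine rows)).+2) -/N0 in time_a clock_a.
have [kb [s2 [exec_b time_b s2_3 frame_b]]] := c1_impl s1.
rewrite clock_a setup_const in time_b s2_3.
set s3 := update s2 1 (hd (s2 3)); set s4 := update s3 3 (Node (s3 2) (tl (s3 3))).
have [kc [s5 [exec_c time_c s5_3 _]]] := c2_impl s4.
have clock4 : clock s4 = N1 by rewrite /clock /s4 /s3 /update /= s2_3.
have s4_3 : s4 3 = Node rows (tl (setup N0 Leaf)).
  by rewrite /s4 /s3 /update /= s2_3 frame_b // s1_2.
rewrite clock4 s4_3 in time_c s5_3.
exists (3 + (3 + (6 + (4 + (ka + (kb + (3 + (5 + (kc + 2).+1).+1).+1).+1).+1).+1).+1).+1).+1.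
  exists (update s5 0 (s5 3)); last by rewrite update_eq s5_3.
  apply: exec_seq; first exact: (exec_assign i0 2 (EFst (EVar 0))).
  apply: exec_seq; first exact: (exec_assign i1 3 (ESnd (EVar 0))).
  apply: exec_seq; first exact: (exec_assign i2 1 (ENode ELeaf (ENode ELeaf (EVar 2)))).
  apply: exec_seq; first exact: (exec_assign i3 4 (ENode ELeaf ELeaf)).
  apply: exec_seq exec_a _; apply: exec_seq exec_b _.
  apply: exec_seq; first exact: (exec_assign s2 1 (EFst (EVar 3))).
  apply: exec_seq; first exact: (exec_assign s3 3 (ENode (EVar 2) (ESnd (EVar 3)))).
  by apply: exec_seq exec_c _; exact: (exec_assign s5 0 (EVar 3)).
by move: time_a time_b time_c; clear; lia.
Qed.

Lemma clocked_program_time_le K1 d1 K2 d2 :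
  40 * (j.+1 * N0) + K1 * N0.+1 ^ d1 + K2 * N1.+1 ^ d2 + 40 <=
  (K1 + K2 + 100) * (N0.+1 * N1.+1) ^ (d1 + d2 + 2).
Proof.
set X := N0.+1 * N1.+1; set d := d1 + d2 + 2.
have X_gt0 : 0 < X by rewrite muln_gt0.
have pow_le d' x : x <= X -> d' <= d -> x ^ d' <= X ^ d.
  move=> xX d'd; apply: leq_trans (leq_pexp2l X_gt0 d'd).
  by case: d' {d'd} => [|d']; rewrite ?expn0 // leq_exp2r.
have le1 : N0.+1 ^ d1 <= X ^ d by apply: pow_le; [rewrite leq_pmulr|rewrite /d; lia].
have le2 : N1.+1 ^ d2 <= X ^ d by apply: pow_le; [rewrite leq_pmull|rewrite /d; lia].
have le0 : N0.+1 ^ 2 <= X ^ d by apply: pow_le; [rewrite leq_pmulr|rewrite /d; lia].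
have jN : j.+1 <= N0 by apply: leq_trans (ltn_expl j (isT : 1 < 2)) _; rewrite leq_pmull.
have scan_le : j.+1 * N0 <= X ^ d.
  by apply: leq_trans le0; rewrite -mulnn; apply: leq_mul; [exact: leqW|exact: leqnSn].
have pow_gt0 : 0 < X ^ d by rewrite expn_gt0 X_gt0.
rewrite !mulnDl; have := leq_mul (leqnn K1) le1; have := leq_mul (leqnn K2) le2.
by move: scan_le pow_gt0; clear; lia.
Qed.

End ClockedProgram.

Lemma poly_time_program (setup main : clocked_fun) :
  poly_time setup -> poly_time main -> (forall N t, setup N t = setup N Leaf) ->
  exists (p : cmd) (K d : nat), forall rows t j, leading_digit_at j t ->
   let N0 := (size (spine rows)).+2 * 2 ^ j in
   let N1 := size (spine (hd (setup N0 Leaf))) in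
   exists2 k, computes p (Node rows t) k (main N1 (Node rows (tl (setup N0 Leaf))))
     & k <= K * (N0.+1 * N1.+1) ^ d.
Proof.
move=> [K1 [d1 setup_impl]] [K2 [d2 main_impl]] setup_const.
have [c1 {}setup_impl] := setup_impl 3 isT; have [c2 {}main_impl] := main_impl 3 isT.
exists (clocked_program c1 c2), (K1 + K2 + 100), (d1 + d2 + 2) => rows t j digit.
have [k comp time] := clocked_program_exec setup_const rows setup_impl main_impl digit.
by exists k; last exact: leq_trans time (clocked_program_time_le _ _ _ _ _ _ _).
Qed.
End Clock.

Module Reduction.
Import Defs Colourings SpatialMixing Lattices Estimator PolyTime TreeArithmetic.
Import TreeGraphs TreeGraphsCorrect EstimatorProgram MainProgram Clock.
Import Order.TTheory GRing.Theory Num.Theory.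

Lemma leading_digit a b : 0 < a -> a < b -> exists j,
  [/\ leading_digit_at j (tree_of_fraction a b), b < 2 ^ j.+1 * a & 2 ^ j * a < 2 * b].
Proof.
move=> a_gt0 ab; rewrite /tree_of_fraction (maxn_idPr (ltnW ab)).
have [L_gt0 b_ge b_lt] := up_log_bounds (ltn_trans a_gt0 ab).
have [l_gt0 a_ge a_lt] := up_log_bounds a_gt0.
have l_le : up_log 2 a.+1 <= up_log 2 b.+1 by apply: up_log_min => //; exact: ltn_trans ab b_lt.
move: L_gt0 b_ge b_lt l_gt0 a_ge a_lt l_le.
set L := up_log 2 b.+1; set l := up_log 2 a.+1 => L_gt0 b_ge b_lt l_gt0 a_ge a_lt l_le.
have digitE i : i < L -> truthy (hd (nth Leaf (spine (tree_of_seq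
    [seq Node (tree_of_bool (binary_digit a i)) (tree_of_bool (binary_digit b i))
    | i <- rev (iota 0 L)])) i)) = binary_digit a (L - i.+1).
  move=> i_lt; rewrite spine_seq (nth_map 0) ?size_rev ?size_iota //.
  rewrite nth_rev ?size_iota // nth_iota ?add0n ?truthy_tree_of_bool //.
  by move: i_lt; clear; lia.
exists (L - l); split; first split.
- move=> i i_lt; rewrite digitE; last by move: i_lt; clear; lia.
  rewrite /binary_digit divn_small //; apply: leq_trans a_lt _; apply: leq_pexp2l => //.
  by move: i_lt; clear; lia.
- rewrite digitE; last by move: l_gt0 l_le; clear; lia.
  rewrite (_ : L - (L - l).+1 = l.-1); last by move: l_gt0 l_le; clear; lia.
  by apply: binary_digit_top; rewrite a_ge prednK.
- apply: leq_trans b_lt _; apply: leq_trans (_ : 2 ^ (L - l).+1 * 2 ^ l.-1 <= _).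
    by rewrite -expnD; apply: leq_pexp2l => //; move: l_gt0 l_le; clear; lia.
  by rewrite leq_mul2l a_ge orbT.
apply: leq_trans (_ : 2 ^ (L - l) * 2 ^ l <= _); first by rewrite ltn_mul2l expn_gt0.
by rewrite -expnD subnK // -(prednK L_gt0) expnS leq_mul2l.
Qed.

Lemma leading_digit_fraction (eps : rat) a b : (0 < eps < 1)%R -> 0 < b ->
  eps = (a%:R / b%:R)%R -> exists j,
  [/\ leading_digit_at j (tree_of_fraction a b), (1 < 2 * (2 ^ j)%:R * eps)%R
    & ((2 ^ j)%:R * eps < 2)%R].
Proof.
move=> /andP[eps_gt0 eps_lt1] b_gt0 epsE; have bR_gt0 : (0 < b%:R :> rat)%R by rewrite ltr0n.
have a_gt0 : 0 < a by rewrite lt0n; apply: contraTneq eps_gt0 => a0; rewrite epsE a0 mul0r ltxx.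
have ab : a < b by move: eps_lt1; rewrite epsE ltr_pdivrMr // mul1r ltr_nat.
have [j [digit j_ge j_le]] := leading_digit a_gt0 ab; exists j; split; first exact: digit.
  by rewrite epsE mulrA ltr_pdivlMr // mul1r -!natrM ltr_nat -expnS.
by rewrite epsE mulrA ltr_pdivrMr // -!natrM ltr_nat.
Qed.

Definition sphere_bound (r : nat) := 2 * (2 * r.+2 + 1) ^ 3.

Definition inner_bits (q r : nat) := q * sphere_bound r.

Definition fraction_bits (q r : nat) :=
  q ^ sphere_bound r * (sphere_bound r + inner_bits q r + 1).

Definition constant_bound (q r : nat) :=
  q + q ^ sphere_bound r + inner_bits q r + sphere_bound r * q ^ sphere_bound r.

(* The fractions at depth c + k, where 2 ^ k <= 2 * base, have numerators and
   denominators of at most base ^ ((2 + c) * fraction_bits q r) digits. *)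
Definition clock_degree (q r c : nat) :=
  1 + (2 + c) * fraction_bits q r + (2 + c) + constant_bound q r.

Section ClockBounds.
Variables (q r c n j k : nat).
Local Notation base := (n.+2 * 2 ^ j).
Local Notation degree := (clock_degree q r c).
Hypothesis k_le : 2 ^ k <= 2 * base.

Lemma base_gt1 : 1 < base.
Proof. by apply: (@leq_trans n.+2) => //; rewrite leq_pmulr // expn_gt0. Qed.

Lemma le_clock x i : x <= base ^ i -> i <= degree -> x <= base ^ degree.
Proof.
move=> x_le i_le; apply: leq_trans x_le _; apply: leq_pexp2l => //.
exact: ltnW base_gt1.
Qed.

Lemma expn2_le_base m : 2 ^ m <= base ^ m.
Proof. by case: m => // m; rewrite leq_exp2r // base_gt1. Qed.

Lemma expn_constant_le_clock x : x <= constant_bound q r -> 2 ^ x <= base ^ degree.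
Proof.
move=> x_le; apply: le_clock (expn2_le_base x) _.
by rewrite /clock_degree; move: x_le; clear; lia.
Qed.

Lemma constant_le_clock x : x <= constant_bound q r -> x <= base ^ degree.
Proof.
by move=> x_le; apply: leq_trans (expn_constant_le_clock x_le); apply/ltnW/ltn_expl.
Qed.

Lemma order_lt_base : n < base.
Proof. by apply: leq_trans (leqnSn _) _; rewrite leq_pmulr // expn_gt0. Qed.

Lemma order_le_clock : n <= base ^ degree.
Proof.
apply: (@le_clock _ 1); first by rewrite expn1 ltnW // order_lt_base.
by rewrite /clock_degree; clear; lia.
Qed.

Lemma expn_depth_le : 2 ^ (c + k) <= base ^ (2 + c).
Proof.
rewrite expnD; apply: leq_trans (leq_mul (expn2_le_base c) k_le) _.
rewrite expnD mulnC leq_mul2r; apply/orP; right.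
by rewrite -mulnn leq_mul2r base_gt1 orbT.
Qed.

Lemma depth_lt_clock : c + k < base ^ degree.
Proof.
apply: leq_trans (ltn_expl (c + k) (isT : 1 < 2)) _.
by apply: le_clock expn_depth_le _; rewrite /clock_degree; clear; lia.
Qed.

Lemma total_bits_lt_clock : n * (2 ^ fraction_bits q r) ^ (c + k) < base ^ degree.
Proof.
apply: leq_trans (_ : base ^ (1 + (2 + c) * fraction_bits q r) <= _); last first.
  by apply: leq_pexp2l; [exact: ltnW base_gt1|rewrite /clock_degree; clear; lia].
rewrite [in leqRHS]expnD expn1; apply: leq_trans (_ : n.+1 * (2 ^ fraction_bits q r) ^ (c + k) <= _).
  by rewrite ltn_mul2r !expn_gt0 /= ltnSn.
apply: leq_mul; first exact: order_lt_base.
rewrite -expnM mulnC expnM [in leqRHS]expnM.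
by case: (fraction_bits q r) => // m; rewrite leq_exp2r // expn_depth_le.
Qed.

End ClockBounds.

Local Open Scope ring_scope.

Lemma num_colourings_extensions q (G : graph) (c0 : 'I_q) :
  (num_colourings q G)%:R = num_extensions c0 (@adj G) (empty_pinning (order G) q).
Proof.
rewrite /num_colourings /num_extensions /num_list_colourings /colouring_sum -sum1_card natr_sum.
have all_unpinned : unpinned (empty_pinning (order G) q) = setT.
  by apply/setP=> v; rewrite !inE ffunE.
have all_allowed v : allowed (@adj G) (empty_pinning (order G) q) v = setT.
  by apply/setP=> c; rewrite !inE; apply/forallP=> w; rewrite ffunE implybT.
apply: eq_bigl => c; rewrite inE /list_colouring all_unpinned /proper_colouring.
rewrite [X in _ = X && _](_ : _ = true); last by apply/forallP=> v; rewrite inE all_allowed inE.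
by apply: eq_forallb => v; rewrite inE /=; apply: eq_forallb => w; rewrite inE.
Qed.

Lemma depth_accuracy_bound (R : realFieldType) (n P Q c rho eps : R) :
  0 <= n -> 0 < rho -> 0 < eps -> 4 <= c * rho -> 1 < 2 * P * eps ->
  (n + 2) * P * c <= Q -> 2 * n + 1 <= rho * eps * Q.
Proof.
move=> n_ge0 rho_gt0 eps_gt0 c_large P_large Q_large.
apply: le_trans (_ : rho * eps * ((n + 2) * P * c) <= _); last first.
  by apply: ler_wpM2l => //; rewrite mulr_ge0 // ltW.
rewrite (_ : rho * eps * _ = (c * rho) * ((n + 2) * (P * eps))); last by ring.
apply: le_trans (_ : 4 * ((n + 2) * (1 / 2)) <= _); first by lra.
apply: ler_pM => //; first by apply: mulr_ge0; lra.
by apply: ler_wpM2l; lra.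
Qed.

Lemma depth_accuracy (n j c k : nat) (rho eps : rat) :
  0 < rho -> 0 < eps -> 4 <= (2 ^ c)%:R * rho -> 1 < 2 * (2 ^ j)%:R * eps ->
  (n.+2 * 2 ^ j < 2 ^ k)%N -> (2 * n%:R + 1) * (1 / 2) ^+ (c + k) <= rho * eps.
Proof.
move=> rho_gt0 eps_gt0 c_large j_large k_large.
have pow_gt0 : 0 < (2 ^ (c + k))%:R :> rat by rewrite ltr0n expn_gt0.
rewrite div1r exprVn -natrX ler_pdivrMr //.
apply: (depth_accuracy_bound (ler0n _ n) rho_gt0 eps_gt0 c_large j_large).
by rewrite -(natrD _ n 2) addn2 -!natrM ler_nat expnD mulnC leq_mul2l (ltnW k_large) orbT.
Qed.

Lemma clock_base_bound (R : realFieldType) (n P eps : R) :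
  0 <= n -> 0 <= P -> 0 < eps -> eps < 1 -> P * eps < 2 ->
  (n + 2) * P + 1 <= 5 * (n + eps^-1) ^+ 2.
Proof.
move=> n_ge0 P_ge0 eps_gt0 eps_lt1 Peps_lt.
have inv_gt1 : 1 < eps^-1 by rewrite invf_gt1.
have P_le : P <= 2 * eps^-1 by rewrite -ler_pdivrMr ?invr_gt0 // invrK; exact: ltW.
move: {eps_gt0 eps_lt1 Peps_lt} eps^-1 inv_gt1 P_le => y y_gt1 P_le; set x := n + y.
have x_ge1 : 1 <= x by rewrite /x; lra.
have x_le_sqr : x <= x * x by rewrite ler_peMr //; lra.
have n2_le : n + 2 <= 2 * x by rewrite /x; lra.
have P_le_x : P <= 2 * x by rewrite /x; lra.
have : (n + 2) * P <= (2 * x) * (2 * x) by apply: ler_pM => //; lra.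
by rewrite expr2; lra.
Qed.

Lemma running_time_le (n j k K D d : nat) (eps : rat) :
  0 < eps < 1 -> (2 ^ j)%:R * eps < 2 ->
  (k <= K * ((n.+2 * 2 ^ j).+1 * ((n.+2 * 2 ^ j) ^ D).+1) ^ d)%N ->
  k%:R <= (K * 5 ^ (D.+2 * d))%:R * (n%:R + eps^-1) ^+ (2 * (D.+2 * d)).
Proof.
move=> /andP[eps_gt0 eps_lt1] j_le k_le; set b := (n.+2 * 2 ^ j)%N in k_le.
have b_gt1 : (1 < b)%N by exact: base_gt1.
have {}k_le : (k <= K * b.+1 ^ (D.+2 * d))%N.
  apply: leq_trans k_le _; rewrite leq_mul2l; apply/orP; right; rewrite expnM.
  case: d => // d; rewrite leq_exp2r // expnS leq_mul2l; apply/orP; right.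
  rewrite expnS; apply: leq_trans (_ : b.+1 ^ D + b.+1 ^ D <= _)%N.
    rewrite -addn1; apply: leq_add; last by rewrite expn_gt0.
    by case: D => // D; rewrite leq_exp2r.
  by rewrite addnn -mul2n leq_mul2r ltnS (ltnW b_gt1) orbT.
have := clock_base_bound (ler0n _ n) (ler0n _ (2 ^ j)) eps_gt0 eps_lt1 j_le.
rewrite -(natrD _ n 2) addn2 -natrM natr1 -/b => b_le.
apply: le_trans (_ : (K * b.+1 ^ (D.+2 * d))%:R <= _); first by rewrite ler_nat.
rewrite !natrM -mulrA; apply: ler_wpM2l; first exact: ler0n.
rewrite !natrX [_ ^+ (2 * _)]exprM -exprMn; apply: lerXn2r; rewrite ?nnegrE ?ler0n //.
exact: le_trans (ler0n _ _) b_le.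
Qed.

Lemma exists_depth_offset (C : finType) (Delta : nat) : (Delta < #|C|)%N ->
  exists c : nat, 4 <= (2 ^ c)%:R * marginal_lb C Delta.
Proof.
move=> /marginal_lb_gt0 lb_gt0; have x_ge0 : 0 <= 4 / marginal_lb C Delta.
  by apply: divr_ge0; [exact: ler0n|exact: ltW].
exists (Num.bound (4 / marginal_lb C Delta)); rewrite -ler_pdivrMr //; apply: ltW.
by apply: lt_le_trans (archi_boundP x_ge0) _; rewrite ler_nat; apply/ltnW/ltn_expl.
Qed.

Section Approximation.
Variables (q Delta r c : nat) (K lam eps : rat) (G : graph) (j : nat).
Hypothesis Delta_lt : (Delta < q)%N.
Hypotheses (K_ge0 : 0 <= K) (lam_range : 0 <= lam < 1).
Hypothesis radius_large : (sphere_bound r)%:R * (q%:R * K * lam ^+ r) <= 1 / 2.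
Hypothesis offset_large : 4 <= (2 ^ c)%:R * marginal_lb 'I_q Delta.
Hypotheses (eps_range : 0 < eps < 1) (j_large : 1 < 2 * (2 ^ j)%:R * eps).
Hypothesis G_mixing : has_mixing_supergraph q Delta K lam G.
Local Notation n := (order G).
Local Notation base := (n.+2 * 2 ^ j)%N.
Local Notation N := (base ^ clock_degree q r c)%N.
Local Notation log := (log_prog base Leaf).
Local Notation depth := (c + size (spine log))%N.
Let c0 : 'I_q := Ordinal (leq_ltn_trans (leq0n Delta) Delta_lt).
Let estimated_count := count_estimate c0 (@adj G) r depth (enum 'I_n) (empty_pinning n q).

Lemma size_sphere_le (p : pinning 'I_n 'I_q) v : (size (sphere (@adj G) r p v) <= sphere_bound r)%N.
Proof.
case: G_mixing p v => lat [_ _ _ _ ball_le] p v; apply: leq_trans (ball_le v r.+2).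
rewrite -(card_uniqP (uniq_sphere _ _ _ _)).
by apply: subset_leq_card; apply/subsetP=> s /sphereP[].
Qed.

Lemma size_inner_list_le (p : pinning 'I_n 'I_q) v :
  (size (inner_list r (@adj G) p v) <= sphere_bound r)%N.
Proof.
case: G_mixing p v => lat [_ _ _ _ ball_le] p v; apply: leq_trans (ball_le v r.+2).
rewrite -(card_uniqP (uniq_inner_list _ _ _ _)); apply: subset_leq_card.
apply/subsetP=> s; rewrite mem_filter => /andP[/andP[_ s_ball] _].
exact: subsetP (ballS _ _ _) _ s_ball.
Qed.

Lemma estimated_count_approx : 0 < estimated_count /\
  (1 - eps) * (num_colourings q G)%:R <= estimated_count <=
  (1 + eps) * (num_colourings q G)%:R.
Proof.
rewrite (num_colourings_extensions G c0).
have [lat [lat_sym adj_lat ldeg_le mixing _]] := G_mixing.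
have Delta_lt' : (Delta < #|'I_q|)%N by rewrite card_ord.
have eta_ge0 : 0 <= K * lam ^+ r by rewrite mulr_ge0 ?exprn_ge0 //; case/andP: lam_range.
have [eps_gt0 _] := andP eps_range.
have [log_gt _] := size_log_prog Leaf (ltnW (base_gt1 n j)).
apply: (count_estimate_approx (@adj_sym G) (@adj_irr G) lat_sym adj_lat Delta_lt' ldeg_le
  (mixing c0) eta_ge0 size_sphere_le _ (enum_uniq _) _ eps_range).
- by rewrite card_ord [q%:R * _]mulrA; exact: radius_large.
- by apply/setP=> w; rewrite !inE ffunE eqxx mem_enum.
rewrite size_enum_ord.
exact: (depth_accuracy (marginal_lb_gt0 Delta_lt') eps_gt0 offset_large j_large log_gt).
Qed.

Lemma main_prog_approximates : exists a b : nat,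
  [/\ (0 < b)%N,
      main_prog q r N (Node (tree_of_graph G) (add_leaves c log)) = tree_of_fraction a b
    & (1 - eps) * (num_colourings q G)%:R <= a%:R / b%:R <=
      (1 + eps) * (num_colourings q G)%:R].
Proof.
have [count_gt0 count_approx] := estimated_count_approx.
have [lat [lat_sym adj_lat ldeg_le mixing _]] := G_mixing.
have Delta_lt' : (Delta < #|'I_q|)%N by rewrite card_ord.
have q_gt0 : (0 < q)%N by exact: leq_ltn_trans Delta_lt.
have [_ log_le] := size_log_prog Leaf (ltnW (base_gt1 n j)).
have size_pow_le (s : nat) : (s <= sphere_bound r -> q ^ s <= q ^ sphere_bound r)%N.
  exact: leq_pexp2l.
suff [a [b [b_gt0 countE outE]]] : exists a b : nat,
    [/\ (0 < b)%N, estimated_count = a%:R / b%:R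
      & main_prog q r N (Node (tree_of_graph G) (add_leaves c log)) = tree_of_fraction a b].
  by exists a, b; rewrite -countE.
apply: (main_progE (@adj_sym G) (@adj_irr G) adj_lat Delta_lt' ldeg_le
  (Smax := sphere_bound r) (Wmax := q ^ sphere_bound r) (Lb := inner_bits q r)
  (M := 2 ^ fraction_bits q r)) => //.
- exact: size_sphere_le.
- by move=> p v; exact/size_pow_le/size_sphere_le.
- move=> p v; apply: leq_trans (size_pow_le _ (size_inner_list_le p v)) _.
  rewrite /inner_bits expnM; case: (sphere_bound r) => // s; rewrite leq_exp2r //.
  exact/ltnW/ltn_expl.
- exact/ltnW/ltn_expl.
- by rewrite expn_gt0.
- exact: order_le_clock.
- by apply: constant_le_clock; rewrite /constant_bound; clear; lia.
- by rewrite expn_gt0 (ltnW (base_gt1 n j)).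
- by apply: constant_le_clock; rewrite /constant_bound; clear; lia.
- by apply: expn_constant_le_clock; rewrite /constant_bound; clear; lia.
- by apply: constant_le_clock; rewrite /constant_bound; clear; lia.
- exact: depth_lt_clock.
- exact: total_bits_lt_clock.
- by rewrite size_add_leaves.
Qed.

End Approximation.

Theorem FPTAS_of_mixing (q Delta : nat) (K lam : rat) (Cl : graph -> Prop) :
  (Delta < q)%N -> 0 <= K -> 0 <= lam < 1 ->
  (forall G, Cl G -> has_mixing_supergraph q Delta K lam G) ->
  has_FPTAS Cl (num_colourings q).
Proof.
move=> Delta_lt K_ge0 lam_range mixing.
have [r radius_large] := exists_mixing_radius (mulr_ge0 (ler0n rat q) K_ge0) lam_range.
have [|c offset_large] := @exists_depth_offset 'I_q Delta; first by rewrite card_ord.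
pose D := clock_degree q r c.
have [p [Kp [d p_spec]]] :=
  poly_time_program (poly_time_setup D c) (poly_time_main q r) (fun _ _ => erefl).
exists p, (Kp * 5 ^ (D.+2 * d))%N, (2 * (D.+2 * d))%N => G eps t GCl eps_range.
move=> [a [b [b_gt0 epsE ->]]].
have [j [digit j_ge j_le]] := leading_digit_fraction eps_range b_gt0 epsE.
have clockE N : size (spine (hd (setup_prog D c N Leaf))) = (N ^ D)%N.
  by rewrite size_clock_power addn0.
have [k] := p_spec (tree_of_graph G) _ j digit.
rewrite clockE spine_seq size_map size_enum_ord => comp time.
have [A [B [B_gt0 outE approx]]] := main_prog_approximates Delta_lt K_ge0 lam_range
  radius_large offset_large eps_range j_ge (mixing G GCl).
exists k, (tree_of_fraction A B), (A%:R / B%:R); split.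
- by rewrite -outE; exact: comp.
- exact: running_time_le eps_range j_le time.
- by exists A, B.
exact: approx.
Qed.
End Reduction.

Theorem theoremB7 :
  [/\ forall q : nat, 6 <= q ->
        has_FPTAS (subgraph_of Z2_lattice) (num_colourings q),
      forall q : nat, 10 <= q ->
        has_FPTAS (subgraph_of Z3_lattice) (num_colourings q),
      forall q : nat, 10 <= q ->
        has_FPTAS (subgraph_of triangular_lattice) (num_colourings q),
      forall q : nat, 5 <= q ->
        has_FPTAS (subgraph_of honeycomb_lattice) (num_colourings q)
    & forall q : nat, 5 <= q ->
        has_FPTAS (subgraph_of kagome_lattice) (num_colourings q)].
Proof.
split=> q q_ge.
- apply: (Reduction.FPTAS_of_mixing _ _ _ (fun G => Lattices.Z2_mixing q_ge)).
  + exact: leq_trans q_ge.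
  + lra.
  + by apply/andP; split; lra.
- apply: (Reduction.FPTAS_of_mixing _ _ _ (fun G => Lattices.Z3_mixing q_ge)).
  + exact: leq_trans q_ge.
  + lra.
  + by apply/andP; split; lra.
- apply: (Reduction.FPTAS_of_mixing _ _ _ (fun G => Lattices.triangular_mixing q_ge)).
  + exact: leq_trans q_ge.
  + lra.
  + by apply/andP; split; lra.
- apply: (Reduction.FPTAS_of_mixing _ _ _ (fun G => Lattices.honeycomb_mixing q_ge)).
  + exact: leq_trans q_ge.
  + lra.
  + by apply/andP; split; lra.
- apply: (Reduction.FPTAS_of_mixing _ _ _ (fun G => Lattices.kagome_mixing q_ge)).
  + exact: leq_trans q_ge.
  + lra.
  + by apply/andP; split; lra.
Qed.
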